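(* Let $S$ be a parabolic surface germ $z=f(x,y)$ in Monge form with $$f(x,y)=\frac{a_{02}}{2}y^2+\sum_{i+j\ge 3}\frac{a_{ij}}{i!\,j!}x^iy^j\quad(a_{02}\neq 0)$$ (as a Taylor expansion at $0$), and let $\phi:\mathbb R^2,0\to\mathbb R^2,0$, $\phi(x,y)=(y,f(x,y))$, be the orthogonal projection of $S$ along the asymptotic direction $(1,0,0)$. Then each of the following equivalences holds. (i) $a_{30}\ne0$ and $Q_{D_4}>0$ if and only if $\phi$ is a beaks at $0$. (ii) $a_{30}\ne0$ and $Q_{D_4}<0$ if and only if $\phi$ is a lips at $0$. (iii) $a_{30}\ne0$, $Q_{D_4}=0$ and $Q_{E_7}\ne0$ if and only if $\phi$ is a goose at $0$. (iv) $a_{30}=0$, $a_{21}a_{40}\ne0$ and $R_{A_4}\ne0$ if and only if $\phi$ is a gulls at $0$. (v) $a_{30}\ne0$, $Q_{D_4}=0$, $Q_{E_7}=0$ and $Q_{E_*}\ne0$ if and only if $\phi$ is an ugly goose (positive or negative) at $0$. (vi) $a_{30}=0$, $a_{21}a_{40}\ne0$, $R_{A_4}=0$ and $R_{A_6}\ne0$ if and only if $\phi$ is an ugly gulls at $0$.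
   Context: All germs are $C^\infty$ germs at the origin. A parabolic surface germ is a surface germ in $\mathbb R^3$ at a non-umbilical parabolic point (a point where the Gaussian curvature vanishes); without loss of generality it is the graph $z=f(x,y)$ in the Monge form displayed in the claim, and $(1,0,0)$ is its unique asymptotic direction at the origin. Map germs $g_1,g_2:\mathbb R^2,0\to\mathbb R^2,0$ are $\mathcal A$-equivalent if there are diffeomorphism germs $\phi_1,\phi_2:\mathbb R^2,0\to\mathbb R^2,0$ with $\phi_2\circ g_1=g_2\circ\phi_1$. A map germ is called by one of the following names if it is $\mathcal A$-equivalent to the normal form: beaks: $(x,y^3-x^2y)$; lips: $(x,y^3+x^2y)$; goose: $(x,y^3+x^3y)$; positive (resp. negative) ugly goose: $(x,y^3+x^4y)$ (resp. $(x,y^3-x^4y)$); gulls: $(x,xy^2+y^4+y^5)$; ugly gulls: $(x,xy^2+y^4+y^7)$. Constants: $$Q_{D_4}=a_{21}^2-a_{12}a_{30},$$ $$Q_{E_7}=-a_{40}a_{21}^3+3a_{31}a_{30}a_{21}^2-3a_{22}a_{30}^2a_{21}+a_{13}a_{30}^3,$$ $$\begin{aligned}Q_{E_*}=&-3a_{21}^4a_{40}^2+a_{21}^3(12a_{31}a_{40}+a_{21}a_{50})a_{30}-2a_{21}^2(6a_{31}^2+3a_{22}a_{40}+2a_{21}a_{41})a_{30}^2\\&+6a_{21}(2a_{22}a_{31}+a_{21}a_{32})a_{30}^3+(-3a_{22}^2-4a_{21}a_{23})a_{30}^4+a_{14}a_{30}^5,\end{aligned}$$ $$R_{A_4}=-10a_{21}a_{31}a_{40}+5a_{12}a_{40}^2+3a_{21}^2a_{50},$$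 $$\begin{aligned}R_{A_6}=&\,756a_{21}^3a_{50}^3-315a_{21}^2a_{50}(10a_{31}a_{50}+3a_{21}a_{60})a_{40}\\&+75a_{21}\bigl(56a_{31}^2a_{50}+21a_{21}a_{31}a_{60}+3a_{21}(14a_{41}a_{50}+a_{21}a_{70})\bigr)a_{40}^2\\&-175\bigl(10a_{31}^3+30a_{21}a_{31}a_{41}+9a_{21}(a_{22}a_{50}+a_{21}a_{51})\bigr)a_{40}^3\\&+2625(a_{22}a_{31}+a_{21}a_{32})a_{40}^4-875a_{13}a_{40}^5.\end{aligned}$$ *)

(* Defs.v *)
From Stdlib Require Import Reals Factorial.
From Coquelicot Require Import Coquelicot.
Open Scope R_scope.

(** A germ at the origin is represented by a total function; only its values
    near the origin are ever used. *)

(** The neighbourhood does not depend on the order of differentiation [n]. *)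
Definition smooth_germ (h : R -> R -> R) : Prop :=
  locally_2d (fun x y => forall n : nat, ex_diff_n h n x y) 0 0.

Definition smooth_map_germ (g : R * R -> R * R) : Prop :=
  g (0, 0) = (0, 0) /\
  smooth_germ (fun x y => fst (g (x, y))) /\
  smooth_germ (fun x y => snd (g (x, y))).

Definition diffeo_germ (phi : R * R -> R * R) : Prop :=
  smooth_map_germ phi /\
  exists psi : R * R -> R * R,
    smooth_map_germ psi /\
    locally_2d (fun x y => psi (phi (x, y)) = (x, y)) 0 0 /\
    locally_2d (fun x y => phi (psi (x, y)) = (x, y)) 0 0.

Definition A_equivalent (g1 g2 : R * R -> R * R) : Prop :=
  exists phi1 phi2 : R * R -> R * R,
    diffeo_germ phi1 /\ diffeo_germ phi2 /\
    locally_2d (fun x y => phi2 (g1 (x, y)) = g2 (phi1 (x, y))) 0 0.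

Definition is_beaks (g : R * R -> R * R) : Prop :=
  A_equivalent g (fun '(x, y) => (x, y ^ 3 - x ^ 2 * y)).
Definition is_lips (g : R * R -> R * R) : Prop :=
  A_equivalent g (fun '(x, y) => (x, y ^ 3 + x ^ 2 * y)).
Definition is_goose (g : R * R -> R * R) : Prop :=
  A_equivalent g (fun '(x, y) => (x, y ^ 3 + x ^ 3 * y)).
Definition is_positive_ugly_goose (g : R * R -> R * R) : Prop :=
  A_equivalent g (fun '(x, y) => (x, y ^ 3 + x ^ 4 * y)).
Definition is_negative_ugly_goose (g : R * R -> R * R) : Prop :=
  A_equivalent g (fun '(x, y) => (x, y ^ 3 - x ^ 4 * y)).
Definition is_gulls (g : R * R -> R * R) : Prop :=
  A_equivalent g (fun '(x, y) => (x, x * y ^ 2 + y ^ 4 + y ^ 5)).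
Definition is_ugly_gulls (g : R * R -> R * R) : Prop :=
  A_equivalent g (fun '(x, y) => (x, x * y ^ 2 + y ^ 4 + y ^ 7)).

(** Coefficient of [x ^ i * y ^ j] in the Taylor expansion of [f] at 0. *)
Definition taylor_coeff (f : R -> R -> R) (i j : nat) : R :=
  partial_derive i j f 0 0 / (INR (fact i) * INR (fact j)).

(** The same coefficient in the series
    [a02 / 2 * y ^ 2 + sum_(i + j >= 3) a i j / (i! j!) * x ^ i * y ^ j]. *)
Definition monge_coeff (a : nat -> nat -> R) (i j : nat) : R :=
  if Nat.leb 3 (i + j) then a i j / (INR (fact i) * INR (fact j))
  else match i, j with
       | 0%nat, 2%nat => a 0%nat 2%nat / 2
       | _, _ => 0
       end.

Definition parabolic_monge_form (a : nat -> nat -> R) (f : R -> R -> R) : Prop :=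
  smooth_germ f /\
  a 0%nat 2%nat <> 0 /\
  forall i j : nat, taylor_coeff f i j = monge_coeff a i j.

(** Orthogonal projection of the graph [z = f x y] along [(1, 0, 0)], in the
    parametrisation of the graph by [(x, y)]. *)
Definition asymptotic_projection (f : R -> R -> R) : R * R -> R * R :=
  fun '(x, y) => (y, f x y).

Definition Q_D4 (a : nat -> nat -> R) : R :=
  let a30 := a 3%nat 0%nat in
  let a21 := a 2%nat 1%nat in
  let a12 := a 1%nat 2%nat in
  a21 ^ 2 - a12 * a30.

Definition Q_E7 (a : nat -> nat -> R) : R :=
  let a30 := a 3%nat 0%nat in
  let a21 := a 2%nat 1%nat in
  let a40 := a 4%nat 0%nat in
  let a31 := a 3%nat 1%nat in
  let a22 := a 2%nat 2%nat in
  let a13 := a 1%nat 3%nat in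
  - a40 * a21 ^ 3 + 3 * a31 * a30 * a21 ^ 2 - 3 * a22 * a30 ^ 2 * a21
  + a13 * a30 ^ 3.

Definition Q_Estar (a : nat -> nat -> R) : R :=
  let a30 := a 3%nat 0%nat in
  let a21 := a 2%nat 1%nat in
  let a40 := a 4%nat 0%nat in
  let a31 := a 3%nat 1%nat in
  let a22 := a 2%nat 2%nat in
  let a50 := a 5%nat 0%nat in
  let a41 := a 4%nat 1%nat in
  let a32 := a 3%nat 2%nat in
  let a23 := a 2%nat 3%nat in
  let a14 := a 1%nat 4%nat in
  -3 * a21 ^ 4 * a40 ^ 2
  + a21 ^ 3 * (12 * a31 * a40 + a21 * a50) * a30
  - 2 * a21 ^ 2 * (6 * a31 ^ 2 + 3 * a22 * a40 + 2 * a21 * a41) * a30 ^ 2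
  + 6 * a21 * (2 * a22 * a31 + a21 * a32) * a30 ^ 3
  + (-3 * a22 ^ 2 - 4 * a21 * a23) * a30 ^ 4
  + a14 * a30 ^ 5.

Definition R_A4 (a : nat -> nat -> R) : R :=
  let a21 := a 2%nat 1%nat in
  let a12 := a 1%nat 2%nat in
  let a40 := a 4%nat 0%nat in
  let a31 := a 3%nat 1%nat in
  let a50 := a 5%nat 0%nat in
  -10 * a21 * a31 * a40 + 5 * a12 * a40 ^ 2 + 3 * a21 ^ 2 * a50.

Definition R_A6 (a : nat -> nat -> R) : R :=
  let a21 := a 2%nat 1%nat in
  let a40 := a 4%nat 0%nat in
  let a31 := a 3%nat 1%nat in
  let a22 := a 2%nat 2%nat in
  let a13 := a 1%nat 3%nat in
  let a50 := a 5%nat 0%nat in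
  let a41 := a 4%nat 1%nat in
  let a32 := a 3%nat 2%nat in
  let a60 := a 6%nat 0%nat in
  let a51 := a 5%nat 1%nat in
  let a70 := a 7%nat 0%nat in
  756 * a21 ^ 3 * a50 ^ 3
  - 315 * a21 ^ 2 * a50 * (10 * a31 * a50 + 3 * a21 * a60) * a40
  + 75 * a21 * (56 * a31 ^ 2 * a50 + 21 * a21 * a31 * a60
                + 3 * a21 * (14 * a41 * a50 + a21 * a70)) * a40 ^ 2
  - 175 * (10 * a31 ^ 3 + 30 * a21 * a31 * a41
           + 9 * a21 * (a22 * a50 + a21 * a51)) * a40 ^ 3
  + 2625 * (a22 * a31 + a21 * a32) * a40 ^ 4
  - 875 * a13 * a40 ^ 5.

(* Main.v *)
Require Import Defs.
From Stdlib Require Import Reals Lra Lia Factorial ClassicalEpsilon.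
From Coquelicot Require Import Coquelicot.
Open Scope R_scope.

(** With (u, v) = (y, x) the projection is the map germ (u, F u v), where F u v = f v u, and its singular set is the zero set of
the Jacobian F_v.  The derivatives of F in v at the origin are those of f in x, so that a30 = F_vvv(0) and a40 = F_vvvv(0).

If a30 <> 0, the equation F_vv = 0 has a solution v = m(u), and F is an unfolding of a cubic.  Changes of coordinates that
respect the first coordinate bring F to v^3 + al(u) v, where al(u) is the value F_v(u, m(u)) up to a constant of the sign of a30
([cubic_unfolding]).  This is a division by v^2 + P(u); the roots of that polynomial need not be real, and the division is
done on the even and on the odd part in v, which are smooth functions of v^2 by Whitney's theorem ([whitney]), itself a
consequence of Borel's theorem with a parameter ([borel]).  Then only the order of al and, for even order, its sign matter
([cubic_monomial]).  Evaluating F_v along an approximate critical point gives the 4-jet of F_v(u, m(u)), namely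
- Q_D4 / (2 a30) u^2 + Q_E7 / (6 a30^3) u^3 + Q_E* / (24 a30^5) u^4 modulo u^5
([critical_value_expansion]).  Conversely the order k of al is an invariant of A-equivalence: the Jacobian and
its first derivatives vanish to order k - 1 along an immersed curve, and such curves are carried to each other
([jacobian_order_transfer]).  The lips and the beaks differ by their singular sets, a point and a pair of lines.

If a30 = 0 and a21 a40 <> 0, the singular set has two smooth branches.  Coordinates can be chosen such that the first one is
s = 0, where F vanishes, and the second one is the parabola u = s^2: then F_s = s (u - s^2) e with e(0) <> 0 ([gull_reduction]).
Two such germs with the same critical values F(s^2, s) are equivalent, because their difference is divisible by the square
of the Jacobian and can be absorbed by moving s ([equivalent_same_critical_values]).  After a normalisation the critical
values are s^4 (1 + s b(s^2)), and a rescaling of s turns them into s^4 (1 + s) if b(0) <> 0, into s^4 (1 + s^3) if b has a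
simple zero; these are the gulls and the ugly gulls.  The order of b is an invariant, because it measures
how far the curve of critical values is from being traversed twice ([gull_invariant]).  The numbers b(0) and, if it vanishes,
b'(0) are computed along a test curve that is close enough to the second branch ([approximate_critical_value]); for the
projection they are R_A4 and R_A6 up to nonzero factors, and the same computation places the two normal forms.
Finally, a map equivalent to a gulls or an ugly gulls has the same multiplicity, which gives a30 = 0 and a40 <> 0,
and a Jacobian with a nondegenerate 2-jet, which gives a21 <> 0 ([gull_necessary_conditions]).

Smoothness is handled through germs of functions of three variables: two variables and a parameter that is integrated
over or solved for.  All coordinate changes come from the implicit function theorem and from Hadamard's lemma. *)

(** * Differentiable functions of three variables *)

(** Neighbourhoods are boxes and differentiability is measured in the sum norm, so that one, two and three variables
    are treated by the same estimates on coordinates. *)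
Definition near (P : R -> R -> R -> Prop) (x y z : R) : Prop :=
  exists r, 0 < r /\ forall x' y' z',
    Rabs (x' - x) < r -> Rabs (y' - y) < r -> Rabs (z' - z) < r -> P x' y' z'.

Definition cont3 (f : R -> R -> R -> R) (x y z : R) : Prop :=
  forall eps, 0 < eps -> near (fun x' y' z' => Rabs (f x' y' z' - f x y z) < eps) x y z.

(** Total differentiability, with differential (a, b, c). Partial derivatives alone would not give the chain rule. *)
Definition diff3 (f : R -> R -> R -> R) (a b c x y z : R) : Prop :=
  forall eps, 0 < eps -> near (fun x' y' z' =>
    Rabs (f x' y' z' - f x y z - (a * (x' - x) + b * (y' - y) + c * (z' - z)))
    <= eps * (Rabs (x' - x) + Rabs (y' - y) + Rabs (z' - z))) x y z.

Lemma near_and P Q x y z : near P x y z -> near Q x y z ->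
  near (fun x y z => P x y z /\ Q x y z) x y z.
Proof.
  intros [r [Hr H]] [s [Hs K]]. exists (Rmin r s). split. { now apply Rmin_pos. }
  intros. pose proof (Rmin_l r s); pose proof (Rmin_r r s).
  split; [apply H | apply K]; lra.
Qed.

Lemma near_imp (P Q : R -> R -> R -> Prop) x y z :
  (forall x y z, P x y z -> Q x y z) -> near P x y z -> near Q x y z.
Proof. intros HI [r [Hr H]]. exists r. split; auto. Qed.

Lemma near_here P x y z : near P x y z -> P x y z.
Proof. intros [r [Hr H]]. apply H; rewrite Rminus_diag, Rabs_R0; lra. Qed.

Lemma near_all (P : R -> R -> R -> Prop) x y z : (forall x y z, P x y z) -> near P x y z.
Proof. intros H. exists 1. split; [lra | auto]. Qed.

Lemma near_near P x y z : near P x y z -> near (near P) x y z.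
Proof.
  intros [r [Hr H]]. exists (r/2). split; [lra|]. intros. exists (r/2). split; [lra|].
  intros. apply H; [replace (x'0 - x) with ((x'0 - x') + (x' - x)) by ring
    | replace (y'0 - y) with ((y'0 - y') + (y' - y)) by ring
    | replace (z'0 - z) with ((z'0 - z') + (z' - z)) by ring];
  eapply Rle_lt_trans; try apply Rabs_triang; lra.
Qed.

(** Every statement about a composite is reduced to a statement about the outer function by this pull-back of
    neighbourhoods. *)
Lemma near_pull P f g h x y z :
  cont3 f x y z -> cont3 g x y z -> cont3 h x y z ->
  near P (f x y z) (g x y z) (h x y z) ->
  near (fun x y z => P (f x y z) (g x y z) (h x y z)) x y z.
Proof.
  intros Cf Cg Ch [r [Hr H]].
  generalize (near_and _ _ _ _ _ (Cf r Hr) (near_and _ _ _ _ _ (Cg r Hr) (Ch r Hr))).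
  apply near_imp. intros u v w (A & B & C). now apply H.
Qed.

Lemma diff3_cont f a b c x y z : diff3 f a b c x y z -> cont3 f x y z.
Proof.
  intros H eps He. destruct (H 1 Rlt_0_1) as [r [Hr K]].
  set (L := Rabs a + Rabs b + Rabs c + 3).
  assert (HL : 0 < L) by (unfold L; pose proof (Rabs_pos a); pose proof (Rabs_pos b); pose proof (Rabs_pos c); lra).
  exists (Rmin r (eps / (2*L))). split. { apply Rmin_pos; auto. apply Rdiv_lt_0_compat; lra. }
  intros x' y' z' Hx Hy Hz.
  pose proof (Rmin_l r (eps / (2*L))) as M1. pose proof (Rmin_r r (eps / (2*L))) as M2.
  specialize (K x' y' z' ltac:(lra) ltac:(lra) ltac:(lra)).
  set (d := Rmin r (eps / (2*L))) in *.
  assert (Hd : d * L <= eps / 2).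
  { replace (eps/2) with (eps/(2*L)*L) by (field; lra). apply Rmult_le_compat_r; lra. }
  pose proof (Rabs_pos (x'-x)); pose proof (Rabs_pos (y'-y)); pose proof (Rabs_pos (z'-z)).
  assert (Rabs (a * (x' - x) + b * (y' - y) + c * (z' - z)) <= (Rabs a + Rabs b + Rabs c) * d).
  { eapply Rle_trans; [apply Rabs_triang|]. eapply Rle_trans; [apply Rplus_le_compat_r, Rabs_triang|].
    rewrite !Rabs_mult. pose proof (Rabs_pos a); pose proof (Rabs_pos b); pose proof (Rabs_pos c). nra. }
  replace (f x' y' z' - f x y z) with ((f x' y' z' - f x y z - (a * (x' - x) + b * (y' - y) + c * (z' - z))) + (a * (x' - x) + b * (y' - y) + c * (z' - z))) by ring.
  eapply Rle_lt_trans; [apply Rabs_triang|]. unfold L in *. lra.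
Qed.

Lemma diff3_comp f g h k A B C a1 b1 c1 a2 b2 c2 a3 b3 c3 x y z :
  diff3 f A B C (g x y z) (h x y z) (k x y z) ->
  diff3 g a1 b1 c1 x y z -> diff3 h a2 b2 c2 x y z -> diff3 k a3 b3 c3 x y z ->
  diff3 (fun x y z => f (g x y z) (h x y z) (k x y z))
    (A*a1 + B*a2 + C*a3) (A*b1 + B*b2 + C*b3) (A*c1 + B*c2 + C*c3) x y z.
Proof.
  intros Hf Hg Hh Hk eps He.
  set (S := Rabs A + Rabs B + Rabs C).
  set (K := Rabs a1 + Rabs b1 + Rabs c1 + Rabs a2 + Rabs b2 + Rabs c2 + Rabs a3 + Rabs b3 + Rabs c3 + 3).
  assert (HS : 0 <= S) by (unfold S; pose proof (Rabs_pos A); pose proof (Rabs_pos B); pose proof (Rabs_pos C); lra).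
  assert (HK : 0 < K) by (unfold K; pose proof (Rabs_pos a1); pose proof (Rabs_pos b1); pose proof (Rabs_pos c1); pose proof (Rabs_pos a2); pose proof (Rabs_pos b2); pose proof (Rabs_pos c2);pose proof (Rabs_pos a3); pose proof (Rabs_pos b3); pose proof (Rabs_pos c3);  lra).
  set (e1 := Rmin 1 (eps / (2 * (S+1)))).
  assert (He1 : 0 < e1) by (apply Rmin_pos; [lra|apply Rdiv_lt_0_compat; lra]).
  assert (He1' : e1 <= 1) by apply Rmin_l.
  assert (Ke1 : S * e1 <= eps/2).
  { assert (e1 <= eps / (2 * (S+1))) by apply Rmin_r.
    apply Rle_trans with ((S+1) * (eps / (2*(S+1)))). 2:{ right; field; lra. } nra. }
  assert (He2 : 0 < eps / (2*K)) by (apply Rdiv_lt_0_compat; lra).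
  generalize (near_and _ _ _ _ _ (Hg e1 He1) (near_and _ _ _ _ _ (Hh e1 He1) (near_and _ _ _ _ _ (Hk e1 He1)
   (near_pull _ g h k x y z (diff3_cont _ _ _ _ _ _ _ Hg) (diff3_cont _ _ _ _ _ _ _ Hh) (diff3_cont _ _ _ _ _ _ _ Hk) (Hf _ He2))))).
  apply near_imp. intros x' y' z' (Eg & Eh & Ek & Ef).
  set (dx := x' - x) in *. set (dy := y' - y) in *. set (dz := z' - z) in *.
  set (N := Rabs dx + Rabs dy + Rabs dz) in *.
  set (dg := g x' y' z' - g x y z) in *. set (dh := h x' y' z' - h x y z) in *. set (dk := k x' y' z' - k x y z) in *.
  assert (Nx : 0 <= Rabs dx) by apply Rabs_pos. assert (Ny : 0 <= Rabs dy) by apply Rabs_pos. assert (Nz : 0 <= Rabs dz) by apply Rabs_pos.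
  assert (HN : 0 <= N) by (unfold N; lra).
  assert (bnd : forall p q r d, Rabs (d - (p * dx + q * dy + r * dz)) <= e1 * N -> Rabs d <= (Rabs p + Rabs q + Rabs r + 1) * N).
  { intros p q r d Hd. replace d with ((d - (p * dx + q * dy + r * dz)) + (p * dx + q * dy + r * dz)) by ring.
    eapply Rle_trans; [apply Rabs_triang|].
    assert (Rabs (p*dx+q*dy+r*dz) <= (Rabs p + Rabs q + Rabs r) * N).
    { eapply Rle_trans; [apply Rabs_triang|]. eapply Rle_trans; [apply Rplus_le_compat_r, Rabs_triang|].
      rewrite !Rabs_mult. pose proof (Rabs_pos p); pose proof (Rabs_pos q); pose proof (Rabs_pos r). unfold N. nra. }
    nra. }
  pose proof (bnd _ _ _ _ Eg). pose proof (bnd _ _ _ _ Eh). pose proof (bnd _ _ _ _ Ek).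
  assert (tot : Rabs dg + Rabs dh + Rabs dk <= K * N) by (unfold K; lra).
  replace (f (g x' y' z') (h x' y' z') (k x' y' z') - f (g x y z) (h x y z) (k x y z) -
   ((A * a1 + B * a2 + C * a3) * dx + (A * b1 + B * b2 + C * b3) * dy + (A * c1 + B * c2 + C * c3) * dz))
  with ((f (g x' y' z') (h x' y' z') (k x' y' z') - f (g x y z) (h x y z) (k x y z) - (A * dg + B * dh + C * dk))
    + A * (dg - (a1 * dx + b1 * dy + c1 * dz)) + B * (dh - (a2 * dx + b2 * dy + c2 * dz)) + C * (dk - (a3 * dx + b3 * dy + c3 * dz))) by ring.
  eapply Rle_trans; [apply Rabs_triang|]. eapply Rle_trans; [apply Rplus_le_compat_r, Rabs_triang|].
  eapply Rle_trans; [apply Rplus_le_compat_r, Rplus_le_compat_r, Rabs_triang|].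
  rewrite !Rabs_mult.
  assert (Rabs A * Rabs (dg - (a1 * dx + b1 * dy + c1 * dz)) <= Rabs A * (e1 * N)) by (apply Rmult_le_compat_l; auto; apply Rabs_pos).
  assert (Rabs B * Rabs (dh - (a2 * dx + b2 * dy + c2 * dz)) <= Rabs B * (e1 * N)) by (apply Rmult_le_compat_l; auto; apply Rabs_pos).
  assert (Rabs C * Rabs (dk - (a3 * dx + b3 * dy + c3 * dz)) <= Rabs C * (e1 * N)) by (apply Rmult_le_compat_l; auto; apply Rabs_pos).
  assert (eps / (2*K) * (Rabs dg + Rabs dh + Rabs dk) <= eps/2 * N).
  { apply Rle_trans with (eps / (2*K) * (K * N)). apply Rmult_le_compat_l; lra. right; field; lra. }
  assert (S * e1 * N <= eps/2 * N) by (apply Rmult_le_compat_r; lra).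
  unfold S in *. lra.
Qed.

Lemma diff3_ext f g a b c x y z : near (fun x y z => f x y z = g x y z) x y z ->
  diff3 f a b c x y z -> diff3 g a b c x y z.
Proof.
  intros E H eps He. generalize (near_and _ _ _ _ _ E (H eps He)). apply near_imp.
  intros x' y' z' [E' K]. rewrite <- E', <- (near_here _ _ _ _ E). exact K.
Qed.

Lemma cont3_ext f g x y z : near (fun x y z => f x y z = g x y z) x y z ->
  cont3 f x y z -> cont3 g x y z.
Proof.
  intros E H eps He. generalize (near_and _ _ _ _ _ E (H eps He)). apply near_imp.
  intros x' y' z' [E' K]. rewrite <- E', <- (near_here _ _ _ _ E). exact K.
Qed.

Lemma diff3_const k x y z : diff3 (fun _ _ _ => k) 0 0 0 x y z.
Proof.
  intros eps He. apply near_all. intros.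
  replace (k - k - (0 * (x0 - x) + 0 * (y0 - y) + 0 * (z0 - z))) with 0 by ring. rewrite Rabs_R0.
  pose proof (Rabs_pos (x0-x)); pose proof (Rabs_pos (y0-y)); pose proof (Rabs_pos (z0-z)). nra.
Qed.

Lemma diff3_linear a b c x y z : diff3 (fun x y z => a * x + b * y + c * z) a b c x y z.
Proof.
  intros eps He. apply near_all. intros.
  match goal with |- Rabs ?e <= _ => replace e with 0 by ring end. rewrite Rabs_R0.
  pose proof (Rabs_pos (x0-x)); pose proof (Rabs_pos (y0-y)); pose proof (Rabs_pos (z0-z)). nra.
Qed.

Lemma diff3_eq f a b c a' b' c' x y z : diff3 f a b c x y z -> a = a' -> b = b' -> c = c' -> diff3 f a' b' c' x y z.
Proof. now intros H <- <- <-. Qed.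

Lemma diff3_fst x y z : diff3 (fun x _ _ => x) 1 0 0 x y z.
Proof. eapply diff3_ext; [|apply (diff3_linear 1 0 0)]. apply near_all; intros; simpl; ring. Qed.
Lemma diff3_snd x y z : diff3 (fun _ y _ => y) 0 1 0 x y z.
Proof. eapply diff3_ext; [|apply (diff3_linear 0 1 0)]. apply near_all; intros; simpl; ring. Qed.
Lemma diff3_thd x y z : diff3 (fun _ _ z => z) 0 0 1 x y z.
Proof. eapply diff3_ext; [|apply (diff3_linear 0 0 1)]. apply near_all; intros; simpl; ring. Qed.

Lemma diff3_mul0 x y z : diff3 (fun x y _ => x * y) y x 0 x y z.
Proof.
  intros eps He. exists eps. split; auto. intros x' y' z' Hx Hy Hz.
  replace (x' * y' - x * y - (y * (x' - x) + x * (y' - y) + 0 * (z' - z))) with ((x'-x)*(y'-y)) by ring.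
  rewrite Rabs_mult.
  pose proof (Rabs_pos (x'-x)); pose proof (Rabs_pos (y'-y)); pose proof (Rabs_pos (z'-z)). nra.
Qed.

Lemma diff3_add f g a b c a' b' c' x y z : diff3 f a b c x y z -> diff3 g a' b' c' x y z ->
  diff3 (fun x y z => f x y z + g x y z) (a + a') (b + b') (c + c') x y z.
Proof.
  intros Hf Hg.
  eapply diff3_eq. eapply diff3_ext.
  2:{ eapply (diff3_comp (fun x y z => 1 * x + 1 * y + 0 * z)); [apply diff3_linear| exact Hf | exact Hg | apply (diff3_const 0)]. }
  apply near_all; intros; simpl; ring. all: ring.
Qed.

Lemma diff3_mul f g a b c a' b' c' x y z : diff3 f a b c x y z -> diff3 g a' b' c' x y z ->
  diff3 (fun x y z => f x y z * g x y z) (a * g x y z + f x y z * a')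
    (b * g x y z + f x y z * b') (c * g x y z + f x y z * c') x y z.
Proof.
  intros Hf Hg.
  eapply diff3_eq.
  { eapply (diff3_comp (fun x y _ => x * y)); [apply diff3_mul0| exact Hf | exact Hg | apply (diff3_const 0)]. }
  all: ring.
Qed.

Lemma diff3_of_derive h l x y z : is_derive h x l -> diff3 (fun x _ _ => h x) l 0 0 x y z.
Proof.
  intros H eps He. apply is_derive_Reals in H. destruct (H eps He) as [d K].
  exists d. split; [apply cond_pos|]. intros x' y' z' Hx _ _.
  pose proof (Rabs_pos (y'-y)); pose proof (Rabs_pos (z'-z)).
  destruct (Req_dec x' x) as [->|Hne].
  - replace (h x - h x - (l * (x - x) + 0 * (y' - y) + 0 * (z' - z))) with 0 by ring.
    rewrite Rabs_R0. pose proof (Rabs_pos (x-x)). nra.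
  - specialize (K (x'-x) ltac:(lra) Hx). replace (x + (x' - x)) with x' in K by ring.
    replace (h x' - h x - (l * (x' - x) + 0 * (y' - y) + 0 * (z' - z)))
      with (((h x' - h x) / (x' - x) - l) * (x' - x)) by (field; lra).
    rewrite Rabs_mult. pose proof (Rabs_pos (x'-x)). nra.
Qed.

(** Back to one variable: derivatives along a curve, on which all later computations of partial derivatives rest. *)
Lemma diff3_derive_along f a b c x y z g1 g2 g3 l1 l2 l3 t :
  diff3 f a b c x y z -> g1 t = x -> g2 t = y -> g3 t = z ->
  is_derive g1 t l1 -> is_derive g2 t l2 -> is_derive g3 t l3 ->
  is_derive (fun s => f (g1 s) (g2 s) (g3 s)) t (a * l1 + b * l2 + c * l3).
Proof.
  intros Hf <- <- <- H1 H2 H3.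
  assert (K : diff3 (fun s _ _ => f (g1 s) (g2 s) (g3 s)) (a * l1 + b * l2 + c * l3) (a*0+b*0+c*0) (a*0+b*0+c*0) t 0 0).
  { apply (diff3_comp f (fun s _ _ => g1 s) (fun s _ _ => g2 s) (fun s _ _ => g3 s)); auto; now apply diff3_of_derive. }
  apply is_derive_Reals. intros eps He. destruct (K (eps/2) ltac:(lra)) as [r [Hr E]].
  exists (mkposreal r Hr). intros h Hh0 Hh. simpl in Hh.
  specialize (E (t+h) 0 0). rewrite !Rminus_diag, Rabs_R0 in E. replace (t + h - t) with h in E by ring.
  specialize (E Hh Hr Hr). rewrite !Rmult_0_r, !Rplus_0_r in E.
  set (q := f (g1 (t + h)) (g2 (t + h)) (g3 (t + h)) - f (g1 t) (g2 t) (g3 t)) in *.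
  replace (q / h - (a * l1 + b * l2 + c * l3)) with ((q - (a * l1 + b * l2 + c * l3) * h) / h) by (field; auto).
  unfold Rdiv. rewrite Rabs_mult, Rabs_inv. pose proof (Rabs_pos_lt h Hh0).
  apply Rmult_lt_reg_r with (Rabs h); auto. rewrite Rmult_assoc, Rinv_l, Rmult_1_r by lra. nra.
Qed.

Definition D1 (f : R -> R -> R -> R) x y z := Derive (fun t => f t y z) x.
Definition D2 (f : R -> R -> R -> R) x y z := Derive (fun t => f x t z) y.
Definition D3 (f : R -> R -> R -> R) x y z := Derive (fun t => f x y t) z.

Lemma diff3_is_D f a b c x y z : diff3 f a b c x y z ->
  is_derive (fun t => f t y z) x a /\ is_derive (fun t => f x t z) y b /\ is_derive (fun t => f x y t) z c.
Proof.
  intros H. split; [|split].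
  - evar_last. apply (diff3_derive_along f a b c x y z (fun t => t) (fun _ => y) (fun _ => z) 1 0 0); auto; auto_derive; auto.
    simpl; ring.
  - evar_last. apply (diff3_derive_along f a b c x y z (fun _ => x) (fun t => t) (fun _ => z) 0 1 0); auto; auto_derive; auto.
    simpl; ring.
  - evar_last. apply (diff3_derive_along f a b c x y z (fun _ => x) (fun _ => y) (fun t => t) 0 0 1); auto; auto_derive; auto.
    simpl; ring.
Qed.

Lemma diff3_D f a b c x y z : diff3 f a b c x y z -> D1 f x y z = a /\ D2 f x y z = b /\ D3 f x y z = c.
Proof. intros H. apply diff3_is_D in H. repeat split; apply is_derive_unique; tauto. Qed.

(** * Functions of class C^n on open sets, and smooth germs *)

Definition open3 (U : R -> R -> R -> Prop) := forall x y z, U x y z -> near U x y z.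

(** The derivatives of f are the total functions D1 f, D2 f, D3 f, so that no witness for the derivatives has to be
    carried along; that they are the differential is part of the definition. *)
Fixpoint Cn (n : nat) (U : R -> R -> R -> Prop) (f : R -> R -> R -> R) : Prop :=
  match n with
  | O => forall x y z, U x y z -> cont3 f x y z
  | S m => (forall x y z, U x y z -> diff3 f (D1 f x y z) (D2 f x y z) (D3 f x y z) x y z)
           /\ Cn m U (D1 f) /\ Cn m U (D2 f) /\ Cn m U (D3 f)
  end.

Lemma D_ext f g x y z : near (fun x y z => f x y z = g x y z) x y z ->
  D1 f x y z = D1 g x y z /\ D2 f x y z = D2 g x y z /\ D3 f x y z = D3 g x y z.
Proof.
  intros [r [Hr H]]. repeat split; apply Derive_ext_loc; exists (mkposreal r Hr); intros t Ht;
  apply H; try (rewrite Rminus_diag, Rabs_R0; auto); exact Ht.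
Qed.

Lemma Cn_ext n U f g : open3 U -> (forall x y z, U x y z -> f x y z = g x y z) -> Cn n U f -> Cn n U g.
Proof.
  intros HU. revert f g. induction n as [|n IH]; intros f g E.
  - intros H x y z Hp. eapply cont3_ext; [|now apply H]. eapply near_imp; [|now apply HU]. auto.
  - assert (E' : forall x y z, U x y z -> near (fun x y z => f x y z = g x y z) x y z).
    { intros x y z Hp. eapply near_imp; [|now apply HU]. auto. }
    intros (H & H1 & H2 & H3). split; [|repeat split].
    + intros x y z Hp. destruct (D_ext _ _ _ _ _ (E' _ _ _ Hp)) as (<- & <- & <-).
      eapply diff3_ext; eauto.
    + eapply IH; [|exact H1]. intros x y z Hp. apply (D_ext _ _ _ _ _ (E' _ _ _ Hp)).
    + eapply IH; [|exact H2]. intros x y z Hp. apply (D_ext _ _ _ _ _ (E' _ _ _ Hp)).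
    + eapply IH; [|exact H3]. intros x y z Hp. apply (D_ext _ _ _ _ _ (E' _ _ _ Hp)).
Qed.

(** A differential given by any formula will do, because it agrees with D1 f, D2 f, D3 f on the open set. *)
Lemma Cn_intro n U f f1 f2 f3 : open3 U ->
  (forall x y z, U x y z -> diff3 f (f1 x y z) (f2 x y z) (f3 x y z) x y z) ->
  Cn n U f1 -> Cn n U f2 -> Cn n U f3 -> Cn (S n) U f.
Proof.
  intros HU H H1 H2 H3. split; [|repeat split].
  - intros x y z Hp. pose proof (H _ _ _ Hp) as K. destruct (diff3_D _ _ _ _ _ _ _ K) as (-> & -> & ->). exact K.
  - eapply Cn_ext; [exact HU| |exact H1]. intros x y z Hp. symmetry. apply (diff3_D _ _ _ _ _ _ _ (H _ _ _ Hp)).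
  - eapply Cn_ext; [exact HU| |exact H2]. intros x y z Hp. symmetry. apply (diff3_D _ _ _ _ _ _ _ (H _ _ _ Hp)).
  - eapply Cn_ext; [exact HU| |exact H3]. intros x y z Hp. symmetry. apply (diff3_D _ _ _ _ _ _ _ (H _ _ _ Hp)).
Qed.

Lemma Cn_cont n U f : Cn n U f -> forall x y z, U x y z -> cont3 f x y z.
Proof.
  destruct n; auto. intros (H & _) x y z Hp. eapply diff3_cont. now apply H.
Qed.

Lemma Cn_pred n U f : Cn (S n) U f -> Cn n U f.
Proof.
  revert f; induction n as [|n IH]; intros f H.
  - exact (Cn_cont _ _ _ H).
  - destruct H as (H & H1 & H2 & H3). split; auto.
Qed.

Lemma Cn_mono n (U V : R -> R -> R -> Prop) f : (forall x y z, V x y z -> U x y z) -> Cn n U f -> Cn n V f.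
Proof.
  intros HV; revert f; induction n as [|n IH]; intros f.
  - intros H x y z Hp. apply H; auto.
  - intros (H & H1 & H2 & H3). split; auto.
Qed.

Lemma Cn_add n U f g : open3 U -> Cn n U f -> Cn n U g -> Cn n U (fun x y z => f x y z + g x y z).
Proof.
  intros HU; revert f g; induction n as [|n IH]; intros f g Hf Hg.
  - intros x y z Hp eps He. generalize (near_and _ _ _ _ _ (Hf x y z Hp (eps/2) ltac:(lra)) (Hg x y z Hp (eps/2) ltac:(lra))).
    apply near_imp. intros x' y' z' [A B].
    replace (f x' y' z' + g x' y' z' - (f x y z + g x y z)) with ((f x' y' z' - f x y z) + (g x' y' z' - g x y z)) by ring.
    eapply Rle_lt_trans; [apply Rabs_triang|]. lra.
  - destruct Hf as (Hf & F1 & F2 & F3). destruct Hg as (Hg & G1 & G2 & G3).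
    eapply Cn_intro; auto. intros; apply diff3_add; auto. all: cbv beta; apply IH; auto.
Qed.

Lemma Cn_mul n U f g : open3 U -> Cn n U f -> Cn n U g -> Cn n U (fun x y z => f x y z * g x y z).
Proof.
  intros HU; revert f g; induction n as [|n IH]; intros f g Hf Hg.
  - intros x y z Hp.
    assert (C : cont3 (fun x y _ => x * y) (f x y z) (g x y z) 0) by (eapply diff3_cont, diff3_mul0).
    intros eps He. apply (near_pull (fun u v _ => Rabs (u * v - f x y z * g x y z) < eps) f g (fun _ _ _ => 0)).
    now apply Hf. now apply Hg. eapply diff3_cont, diff3_const. apply C; auto.
  - pose proof (Cn_pred _ _ _ Hf). pose proof (Cn_pred _ _ _ Hg).
    destruct Hf as (Hf & F1 & F2 & F3). destruct Hg as (Hg & G1 & G2 & G3).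
    eapply Cn_intro; auto. intros; apply diff3_mul; auto. all: cbv beta; apply Cn_add; auto; apply IH; auto.
Qed.

Lemma Cn_const n U k : open3 U -> Cn n U (fun _ _ _ => k).
Proof.
  intros HU; revert k; induction n as [|n IH]; intros k.
  - intros x y z _. eapply diff3_cont, diff3_const.
  - eapply Cn_intro with (f1 := fun _ _ _ => 0) (f2 := fun _ _ _ => 0) (f3 := fun _ _ _ => 0); auto.
    intros; apply diff3_const.
Qed.

(** For functions that are defined piecewise or by series, where the derivatives are known in closed form as members
    of the same family: differentiability of all members gives smoothness of each. *)
Lemma Cn_family (I : Type) (S : I -> R -> R -> R -> R) (d1 d2 : I -> I) U : open3 U ->
  (forall i x y z, U x y z -> diff3 (S i) (S (d1 i) x y z) (S (d2 i) x y z) 0 x y z) ->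
  forall n i, Cn n U (S i).
Proof.
  intros HU H n. induction n as [|n IH]; intros i.
  - intros x y z Hp. eapply diff3_cont; eauto.
  - apply Cn_intro with (S (d1 i)) (S (d2 i)) (fun _ _ _ => 0); auto. now apply Cn_const.
Qed.

Definition Box x y z r : R -> R -> R -> Prop :=
  fun x' y' z' => Rabs (x' - x) < r /\ Rabs (y' - y) < r /\ Rabs (z' - z) < r.

Lemma abs_open a r x : Rabs (x - a) < r -> exists d, 0 < d /\ forall x', Rabs (x' - x) < d -> Rabs (x' - a) < r.
Proof.
  intros H. exists (r - Rabs (x - a)). split; [lra|]. intros x' K.
  replace (x' - a) with ((x' - x) + (x - a)) by ring. eapply Rle_lt_trans; [apply Rabs_triang|]. lra.
Qed.

Lemma Box_open x y z r : open3 (Box x y z r).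
Proof.
  intros u v w (A & B & C).
  destruct (abs_open _ _ _ A) as (d1 & P1 & Q1). destruct (abs_open _ _ _ B) as (d2 & P2 & Q2). destruct (abs_open _ _ _ C) as (d3 & P3 & Q3).
  exists (Rmin d1 (Rmin d2 d3)). split. { repeat apply Rmin_pos; auto. }
  intros. pose proof (Rmin_l d1 (Rmin d2 d3)). pose proof (Rmin_r d1 (Rmin d2 d3)). pose proof (Rmin_l d2 d3). pose proof (Rmin_r d2 d3).
  repeat split; [apply Q1|apply Q2|apply Q3]; lra.
Qed.

Lemma Box_center x y z r : 0 < r -> Box x y z r x y z.
Proof. intros; repeat split; rewrite Rminus_diag, Rabs_R0; auto. Qed.

(** One neighbourhood serves for all orders of differentiation. *)
Definition sm (f : R -> R -> R -> R) (x y z : R) : Prop :=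
  exists r, 0 < r /\ forall n, Cn n (Box x y z r) f.

Lemma near_box P x y z : near P x y z <-> exists r, 0 < r /\ forall x' y' z', Box x y z r x' y' z' -> P x' y' z'.
Proof.
  split; intros [r [Hr H]]; exists r; split; auto.
  - intros x' y' z' (A & B & C); auto.
  - intros x' y' z' A B C; apply H; repeat split; auto.
Qed.

Lemma open_box U x y z : open3 U -> U x y z -> exists r, 0 < r /\ forall x' y' z', Box x y z r x' y' z' -> U x' y' z'.
Proof. intros HU Hp. apply near_box. now apply HU. Qed.

Lemma sm_of_Cn U f x y z : open3 U -> U x y z -> (forall n, Cn n U f) -> sm f x y z.
Proof.
  intros HU Hp H. destruct (open_box _ _ _ _ HU Hp) as [r [Hr K]]. exists r. split; auto.
  intros n. eapply Cn_mono; eauto.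
Qed.

Lemma Cn_of_sm U f : (forall x y z, U x y z -> sm f x y z) -> forall n, Cn n U f.
Proof.
  intros H n. revert f H. induction n as [|n IH]; intros f H.
  - intros x y z Hp. destruct (H _ _ _ Hp) as [r [Hr K]]. apply (K O). now apply Box_center.
  - split; [|repeat split].
    + intros x y z Hp. destruct (H _ _ _ Hp) as [r [Hr K]]. apply (K 1%nat). now apply Box_center.
    + apply IH. intros x y z Hp. destruct (H _ _ _ Hp) as [r [Hr K]]. exists r; split; auto. intros m. apply (K (S m)).
    + apply IH. intros x y z Hp. destruct (H _ _ _ Hp) as [r [Hr K]]. exists r; split; auto. intros m. apply (K (S m)).
    + apply IH. intros x y z Hp. destruct (H _ _ _ Hp) as [r [Hr K]]. exists r; split; auto. intros m. apply (K (S m)).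
Qed.

Lemma sm_near f x y z : sm f x y z -> near (sm f) x y z.
Proof.
  intros [r [Hr H]]. apply near_box. exists r. split; auto. intros x' y' z' Hb.
  eapply sm_of_Cn; [apply Box_open|exact Hb|exact H].
Qed.

Lemma sm_diff f x y z : sm f x y z -> diff3 f (D1 f x y z) (D2 f x y z) (D3 f x y z) x y z.
Proof. intros [r [Hr H]]. apply (H 1%nat). now apply Box_center. Qed.

Lemma sm_cont f x y z : sm f x y z -> cont3 f x y z.
Proof. intros H. eapply diff3_cont, sm_diff, H. Qed.

Lemma sm_D f x y z : sm f x y z -> sm (D1 f) x y z /\ sm (D2 f) x y z /\ sm (D3 f) x y z.
Proof. intros [r [Hr H]]. repeat split; exists r; split; auto; intros n; apply (H (S n)). Qed.

Lemma sm_ext f g x y z : near (fun x y z => f x y z = g x y z) x y z -> sm f x y z -> sm g x y z.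
Proof.
  intros E H. pose proof (near_and _ _ _ _ _ E (sm_near _ _ _ _ H)) as K. apply near_box in K.
  destruct K as [r [Hr K]]. exists r. split; auto. intros n.
  apply Cn_ext with f; [apply Box_open|intros; apply K; auto|]. apply Cn_of_sm. intros; apply K; auto.
Qed.

Lemma sm_intro_near (P : R -> R -> R -> Prop) f x y z :
  near P x y z -> (forall U, open3 U -> (forall x y z, U x y z -> P x y z) -> forall n, Cn n U f) -> sm f x y z.
Proof.
  intros HP H. apply near_box in HP. destruct HP as [r [Hr K]]. exists r. split; auto.
  apply H; auto. apply Box_open.
Qed.

(** By induction on n, since the derivatives of the composite are sums of products of derivatives of f, composed with
    the same inner functions, and of derivatives of those. *)
Lemma Cn_comp n U f g h k : open3 U ->
  (forall x y z, U x y z -> sm f (g x y z) (h x y z) (k x y z)) ->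
  Cn n U g -> Cn n U h -> Cn n U k -> Cn n U (fun x y z => f (g x y z) (h x y z) (k x y z)).
Proof.
  intros HU. revert f. induction n as [|n IH]; intros f Hf Hg Hh Hk.
  - intros x y z Hp eps He.
    apply (near_pull (fun u v w => Rabs (f u v w - f (g x y z) (h x y z) (k x y z)) < eps) g h k); auto.
    apply sm_cont; auto.
  - pose proof (Cn_pred _ _ _ Hg). pose proof (Cn_pred _ _ _ Hh). pose proof (Cn_pred _ _ _ Hk).
    destruct Hg as (Hg & G1 & G2 & G3). destruct Hh as (Hh & I1 & I2 & I3). destruct Hk as (Hk & K1 & K2 & K3).
    assert (C1 : Cn n U (fun x y z => D1 f (g x y z) (h x y z) (k x y z))) by (apply IH; auto; intros; apply sm_D; auto).
    assert (C2 : Cn n U (fun x y z => D2 f (g x y z) (h x y z) (k x y z))) by (apply IH; auto; intros; apply sm_D; auto).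
    assert (C3 : Cn n U (fun x y z => D3 f (g x y z) (h x y z) (k x y z))) by (apply IH; auto; intros; apply sm_D; auto).
    eapply Cn_intro; [exact HU| | | |].
    + intros x y z Hp. apply (diff3_comp f g h k); auto. now apply sm_diff, Hf.
    + cbv beta. repeat apply Cn_add; auto; apply Cn_mul; auto.
    + cbv beta. repeat apply Cn_add; auto; apply Cn_mul; auto.
    + cbv beta. repeat apply Cn_add; auto; apply Cn_mul; auto.
Qed.

Lemma sm_comp f g h k x y z :
  sm f (g x y z) (h x y z) (k x y z) -> sm g x y z -> sm h x y z -> sm k x y z ->
  sm (fun x y z => f (g x y z) (h x y z) (k x y z)) x y z.
Proof.
  intros Hf Hg Hh Hk.
  assert (N : near (fun x y z => sm g x y z /\ sm h x y z /\ sm k x y z /\ sm f (g x y z) (h x y z) (k x y z)) x y z).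
  { repeat apply near_and; try apply sm_near; auto.
    apply (near_pull (sm f) g h k); try apply sm_cont; auto. apply sm_near; auto. }
  eapply sm_intro_near; [exact N|]. intros U HU K n.
  apply Cn_comp; auto; [|apply Cn_of_sm|apply Cn_of_sm|apply Cn_of_sm]; intros; apply K; auto.
Qed.

Lemma sm_add f g x y z : sm f x y z -> sm g x y z -> sm (fun x y z => f x y z + g x y z) x y z.
Proof.
  intros Hf Hg. eapply sm_intro_near; [apply near_and; apply sm_near; [exact Hf|exact Hg]|].
  intros U HU K n. apply Cn_add; auto; apply Cn_of_sm; intros; apply K; auto.
Qed.

Lemma sm_mul f g x y z : sm f x y z -> sm g x y z -> sm (fun x y z => f x y z * g x y z) x y z.
Proof.
  intros Hf Hg. eapply sm_intro_near; [apply near_and; apply sm_near; [exact Hf|exact Hg]|].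
  intros U HU K n. apply Cn_mul; auto; apply Cn_of_sm; intros; apply K; auto.
Qed.

Lemma sm_const k x y z : sm (fun _ _ _ => k) x y z.
Proof. exists 1. split; [lra|]. intros n. apply Cn_const, Box_open. Qed.

Lemma sm_proj x y z : sm (fun x _ _ => x) x y z /\ sm (fun _ y _ => y) x y z /\ sm (fun _ _ z => z) x y z.
Proof.
  repeat split; exists 1; (split; [lra|]); intros [|n].
  - intros ? ? ? _; eapply diff3_cont, diff3_fst.
  - eapply Cn_intro; [apply Box_open|intros; apply diff3_fst| | | ]; cbv beta; apply Cn_const, Box_open.
  - intros ? ? ? _; eapply diff3_cont, diff3_snd.
  - eapply Cn_intro; [apply Box_open|intros; apply diff3_snd| | | ]; cbv beta; apply Cn_const, Box_open.
  - intros ? ? ? _; eapply diff3_cont, diff3_thd.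
  - eapply Cn_intro; [apply Box_open|intros; apply diff3_thd| | | ]; cbv beta; apply Cn_const, Box_open.
Qed.

Lemma sm_opp f x y z : sm f x y z -> sm (fun x y z => - f x y z) x y z.
Proof.
  intros H. apply sm_ext with (fun x y z => (-1) * f x y z). apply near_all; intros; ring.
  apply sm_mul; auto. apply sm_const.
Qed.

Lemma sm_sub f g x y z : sm f x y z -> sm g x y z -> sm (fun x y z => f x y z - g x y z) x y z.
Proof. intros Hf Hg. apply (sm_add f (fun x y z => - g x y z)); auto. now apply sm_opp. Qed.

Lemma sm_pow f n x y z : sm f x y z -> sm (fun x y z => f x y z ^ n) x y z.
Proof.
  intros H. induction n as [|n IH]; simpl. apply sm_const.
  apply (sm_mul f (fun x y z => f x y z ^ n)); auto.
Qed.

(** The derivative of 1/x is a polynomial in 1/x, so that the induction on the class of differentiability closes on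
    itself. *)
Lemma sm_inv_id x y z : x <> 0 -> sm (fun x _ _ => / x) x y z.
Proof.
  intros Hx.
  assert (N : near (fun x _ _ => x <> 0) x y z).
  { exists (Rabs x). split. now apply Rabs_pos_lt. intros x' _ _ K _ _ ->.
    rewrite Rminus_0_l, Rabs_Ropp in K. lra. }
  eapply sm_intro_near; [exact N|]. intros U HU K n.
  assert (D : forall x y z, U x y z -> diff3 (fun x _ _ => / x) (- 1 * (/ x * / x)) 0 0 x y z).
  { intros x' y' z' Hp. apply (diff3_of_derive Rinv). pose proof (K _ _ _ Hp). simpl in H. auto_derive; auto. field; auto. }
  induction n as [|n IH].
  - intros x' y' z' Hp. eapply diff3_cont; eauto.
  - eapply Cn_intro; [auto|exact D| | | ]; try (apply Cn_const; auto).
    apply Cn_mul; auto. apply Cn_const; auto. apply Cn_mul; auto.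
Qed.

Lemma sm_inv f x y z : sm f x y z -> f x y z <> 0 -> sm (fun x y z => / f x y z) x y z.
Proof.
  intros Hf H0. apply (sm_comp (fun x _ _ => / x) f (fun _ _ _ => 0) (fun _ _ _ => 0)); auto; try apply sm_const.
  now apply sm_inv_id.
Qed.

Lemma sm_div f g x y z : sm f x y z -> sm g x y z -> g x y z <> 0 -> sm (fun x y z => f x y z / g x y z) x y z.
Proof. intros Hf Hg H0. apply (sm_mul f (fun x y z => / g x y z)); auto. now apply sm_inv. Qed.

(** Same principle: the derivative of the square root is the inverse of a multiple of it. *)
Lemma sm_sqrt_id x y z : 0 < x -> sm (fun x _ _ => sqrt x) x y z.
Proof.
  intros Hx.
  assert (N : near (fun x _ _ => 0 < x) x y z).
  { exists x. split; auto. intros x' _ _ K _ _. apply Rabs_lt_between in K. lra. }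
  eapply sm_intro_near; [exact N|]. intros U HU K n.
  assert (D : forall x y z, U x y z -> diff3 (fun x _ _ => sqrt x) (/2 * / sqrt x) 0 0 x y z).
  { intros x' y' z' Hp. apply (diff3_of_derive sqrt). pose proof (K _ _ _ Hp). simpl in H. auto_derive; auto.
    field. pose proof (sqrt_lt_R0 _ H). lra. }
  assert (S : forall x y z, U x y z -> sm (fun x _ _ => / x) (sqrt x) 0 0).
  { intros. apply sm_inv_id. pose proof (sqrt_lt_R0 _ (K _ _ _ H)). lra. }
  induction n as [|n IH].
  - intros x' y' z' Hp. eapply diff3_cont; eauto.
  - eapply Cn_intro; [auto|exact D| | | ]; try (apply Cn_const; auto).
    apply Cn_mul; auto. apply Cn_const; auto.
    apply (Cn_comp n U (fun x _ _ => / x) (fun x _ _ => sqrt x) (fun _ _ _ => 0) (fun _ _ _ => 0)); auto; try apply Cn_const; auto.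
Qed.

(** * Smooth germs in one and two variables *)

(** Germs in fewer variables are germs in three variables that do not depend on the others; in this way the closure
    properties are proved once. *)
Definition sm2 (F : R -> R -> R) x y := sm (fun x y _ => F x y) x y 0.
Definition sm1 (h : R -> R) x := sm (fun x _ _ => h x) x 0 0.
Definition d1 (F : R -> R -> R) x y := Derive (fun t => F t y) x.
Definition d2 (F : R -> R -> R) x y := Derive (fun t => F x t) y.

Lemma sm_comp2 F g h x y z : sm2 F (g x y z) (h x y z) -> sm g x y z -> sm h x y z ->
  sm (fun x y z => F (g x y z) (h x y z)) x y z.
Proof. intros. apply (sm_comp (fun x y _ => F x y) g h (fun _ _ _ => 0)); auto. apply sm_const. Qed.

Lemma sm_comp1 F g x y z : sm1 F (g x y z) -> sm g x y z -> sm (fun x y z => F (g x y z)) x y z.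
Proof. intros. apply (sm_comp (fun x _ _ => F x) g (fun _ _ _ => 0) (fun _ _ _ => 0)); auto; apply sm_const. Qed.

Lemma sm2_d F x y : sm2 F x y -> sm2 (d1 F) x y /\ sm2 (d2 F) x y.
Proof. intros H. apply sm_D in H. split; apply H. Qed.
Lemma sm1_d h x : sm1 h x -> sm1 (Derive h) x.
Proof. intros H. apply sm_D in H. apply H. Qed.

Lemma sm2_diff F x y z : sm2 F x y -> diff3 (fun x y _ => F x y) (d1 F x y) (d2 F x y) 0 x y z.
Proof.
  intros H. pose proof (sm_diff _ _ _ _ H) as K.
  change (D1 (fun x y _ => F x y) x y 0) with (d1 F x y) in K. change (D2 (fun x y _ => F x y) x y 0) with (d2 F x y) in K.
  assert (E : D3 (fun x y _ => F x y) x y 0 = 0) by (unfold D3; apply (Derive_const (F x y))). rewrite E in K.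
  eapply diff3_eq; [apply (diff3_comp (fun x y _ => F x y) (fun x _ _ => x) (fun _ y _ => y) (fun _ _ _ => 0) _ _ _ _ _ _ _ _ _ _ _ _ _ _ _ K (diff3_fst _ _ _) (diff3_snd _ _ _) (diff3_const _ _ _ _))| | |]; ring.
Qed.

Lemma sm1_derive h x : sm1 h x -> is_derive h x (Derive h x).
Proof. intros H. pose proof (sm_diff _ _ _ _ H) as K. apply diff3_is_D in K. apply K. Qed.

Lemma sm2_chain F g h x y l m t : sm2 F x y -> g t = x -> h t = y -> is_derive g t l -> is_derive h t m ->
  is_derive (fun s => F (g s) (h s)) t (d1 F x y * l + d2 F x y * m).
Proof.
  intros H Hg Hh Dg Dh. replace (d1 F x y * l + d2 F x y * m) with (d1 F x y * l + d2 F x y * m + 0 * 0) by ring.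
  apply (diff3_derive_along (fun x y _ => F x y) _ _ _ x y 0 g h (fun _ => 0)); auto. now apply sm2_diff.
  auto_derive; auto.
Qed.

Lemma sm2_derive1 F x y : sm2 F x y -> is_derive (fun t => F t y) x (d1 F x y).
Proof. intros H. pose proof (sm2_diff _ _ _ 0 H) as K. apply diff3_is_D in K. apply K. Qed.
Lemma sm2_derive2 F x y : sm2 F x y -> is_derive (fun t => F x t) y (d2 F x y).
Proof. intros H. pose proof (sm2_diff _ _ _ 0 H) as K. apply diff3_is_D in K. apply K. Qed.

(** Combining finitely many local statements. The lemmas replace the intersection of neighbourhoods in all later
    arguments. *)
Lemma locally_2d_mp P Q x y : locally_2d P x y -> (forall u v, P u v -> Q u v) -> locally_2d Q x y.
Proof. intros [d H] K. exists d. auto. Qed.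
Lemma locally_2d_mp2 (P1 P2 Q : R -> R -> Prop) x y : locally_2d P1 x y -> locally_2d P2 x y ->
  (forall u v, P1 u v -> P2 u v -> Q u v) -> locally_2d Q x y.
Proof. intros H1 H2 K. apply (locally_2d_mp _ _ _ _ (locally_2d_and _ _ _ _ H1 H2)). intros u v []; auto. Qed.
Lemma locally_2d_mp3 (P1 P2 P3 Q : R -> R -> Prop) x y : locally_2d P1 x y -> locally_2d P2 x y -> locally_2d P3 x y ->
  (forall u v, P1 u v -> P2 u v -> P3 u v -> Q u v) -> locally_2d Q x y.
Proof. intros H1 H2 H3 K. apply (locally_2d_mp2 _ _ _ _ _ (locally_2d_and _ _ _ _ H1 H2) H3). intros u v []; auto. Qed.
Lemma locally_2d_mp4 (P1 P2 P3 P4 Q : R -> R -> Prop) x y : locally_2d P1 x y -> locally_2d P2 x y -> locally_2d P3 x y -> locally_2d P4 x y ->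
  (forall u v, P1 u v -> P2 u v -> P3 u v -> P4 u v -> Q u v) -> locally_2d Q x y.
Proof. intros H1 H2 H3 H4 K. apply (locally_2d_mp3 _ _ _ _ _ _ (locally_2d_and _ _ _ _ H1 H2) H3 H4). intros u v []; auto. Qed.

Lemma locally_mp (P Q : R -> Prop) x : locally x P -> (forall u, P u -> Q u) -> locally x Q.
Proof. intros [d H] K. exists d. auto. Qed.
Lemma locally_mp2 (P1 P2 Q : R -> Prop) x : locally x P1 -> locally x P2 -> (forall u, P1 u -> P2 u -> Q u) -> locally x Q.
Proof. intros H1 H2 K. apply (locally_mp _ _ _ (filter_and _ _ H1 H2)). intros u []; auto. Qed.
Lemma locally_mp3 (P1 P2 P3 Q : R -> Prop) x : locally x P1 -> locally x P2 -> locally x P3 -> (forall u, P1 u -> P2 u -> P3 u -> Q u) -> locally x Q.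
Proof. intros H1 H2 H3 K. apply (locally_mp2 _ _ _ _ (filter_and _ _ H1 H2) H3). intros u []; auto. Qed.

Lemma locally_2d_fst (P : R -> Prop) x y : locally x P -> locally_2d (fun u _ => P u) x y.
Proof. intros [d H]. exists d. intros; now apply H. Qed.
Lemma locally_2d_snd (P : R -> Prop) x y : locally y P -> locally_2d (fun _ v => P v) x y.
Proof. intros [d H]. exists d. intros; now apply H. Qed.

Lemma near_locally_2d P x y z : locally_2d P x y <-> near (fun x y _ => P x y) x y z.
Proof.
  split.
  - intros [d H]. exists d. split; [apply cond_pos|]. auto.
  - intros [r [Hr H]]. exists (mkposreal r Hr). intros u v A B. apply (H u v z); auto. rewrite Rminus_diag, Rabs_R0; auto.
Qed.
Lemma near_locally (P : R -> Prop) x y z : locally x P <-> near (fun x _ _ => P x) x y z.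
Proof.
  split.
  - intros [d H]. exists d. split; [apply cond_pos|]. intros; apply H; auto.
  - intros [r [Hr H]]. exists (mkposreal r Hr). intros u A. apply (H u y z); auto; rewrite Rminus_diag, Rabs_R0; auto.
Qed.

Lemma sm2_near F x y : sm2 F x y -> locally_2d (sm2 F) x y.
Proof.
  intros H. apply sm_near in H. destruct H as [r [Hr H]]. exists (mkposreal r Hr).
  intros u v A B. apply H; auto. rewrite Rminus_diag, Rabs_R0; auto.
Qed.
Lemma sm1_near h x : sm1 h x -> locally x (sm1 h).
Proof.
  intros H. apply sm_near in H. destruct H as [r [Hr H]]. exists (mkposreal r Hr).
  intros u A. apply H; auto; rewrite Rminus_diag, Rabs_R0; auto.
Qed.

(** Local statements are transported along smooth substitutions. *)
Lemma locally_2d_pull P g h x y : sm2 g x y -> sm2 h x y -> locally_2d P (g x y) (h x y) ->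
  locally_2d (fun x y => P (g x y) (h x y)) x y.
Proof.
  intros Hg Hh HP. apply (near_locally_2d _ _ _ 0).
  apply (near_pull (fun u v _ => P u v) (fun x y _ => g x y) (fun x y _ => h x y) (fun _ _ _ => 0)).
  now apply sm_cont. now apply sm_cont. apply sm_cont, sm_const. now apply near_locally_2d.
Qed.
Lemma locally_pull2 (P : R -> Prop) g x y : sm2 g x y -> locally (g x y) P ->
  locally_2d (fun x y => P (g x y)) x y.
Proof.
  intros Hg HP. apply (near_locally_2d _ _ _ 0).
  apply (near_pull (fun u _ _ => P u) (fun x y _ => g x y) (fun x y _ => 0) (fun _ _ _ => 0)).
  now apply sm_cont. apply sm_cont, sm_const. apply sm_cont, sm_const. now apply near_locally.
Qed.
Lemma locally_2d_pull1 P g h x : sm1 g x -> sm1 h x -> locally_2d P (g x) (h x) ->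
  locally x (fun x => P (g x) (h x)).
Proof.
  intros Hg Hh HP. apply (near_locally _ _ 0 0).
  apply (near_pull (fun u v _ => P u v) (fun x _ _ => g x) (fun x _ _ => h x) (fun _ _ _ => 0)).
  now apply sm_cont. now apply sm_cont. apply sm_cont, sm_const. now apply near_locally_2d.
Qed.
Lemma locally_pull1 (P : R -> Prop) g x : sm1 g x -> locally (g x) P -> locally x (fun x => P (g x)).
Proof.
  intros Hg HP. apply (near_locally _ _ 0 0).
  apply (near_pull (fun u _ _ => P u) (fun x _ _ => g x) (fun x _ _ => 0) (fun _ _ _ => 0)).
  now apply sm_cont. apply sm_cont, sm_const. apply sm_cont, sm_const. now apply near_locally.
Qed.

Lemma sm2_ext F G x y : locally_2d (fun x y => F x y = G x y) x y -> sm2 F x y -> sm2 G x y.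
Proof. intros E H. eapply sm_ext; [|exact H]. apply (proj1 (near_locally_2d _ x y 0) E). Qed.

Lemma d_ext F G x y : locally_2d (fun x y => F x y = G x y) x y -> d1 F x y = d1 G x y /\ d2 F x y = d2 G x y.
Proof.
  intros H. split; apply Derive_ext_loc.
  - apply (locally_2d_1d_const_y _ _ _ H).
  - apply (locally_2d_1d_const_x _ _ _ H).
Qed.

Lemma sm2_continuity F x y : sm2 F x y -> continuity_2d_pt F x y.
Proof.
  intros H eps. apply (near_locally_2d _ _ _ 0).
  generalize (sm_cont _ _ _ _ H eps (cond_pos eps)). auto.
Qed.

Lemma neq0_near g x y : sm2 g x y -> g x y <> 0 -> locally_2d (fun u v => g u v <> 0) x y.
Proof. intros S H. apply continuity_2d_pt_neq_0; auto. now apply sm2_continuity. Qed.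

Lemma neq0_germ g : sm1 g 0 -> g 0 <> 0 -> locally 0 (fun t => g t <> 0).
Proof.
  intros S H. exact (locally_2d_1d_const_y _ 0 0 (neq0_near (fun u _ => g u) 0 0 S H)).
Qed.

Lemma germ_lower_bound g : sm1 g 0 -> g 0 <> 0 -> exists c, 0 < c /\ locally 0 (fun t => c <= Rabs (g t)).
Proof.
  intros S g0. pose proof (Rabs_pos_lt _ g0) as H. exists (Rabs (g 0) / 2). split; [lra|].
  pose proof (sm_cont _ _ _ _ S (Rabs (g 0) / 2) ltac:(lra)) as N. apply (near_locally (fun x => Rabs (g x - g 0) < Rabs (g 0) / 2) 0 0 0) in N.
  apply (locally_mp _ _ _ N). intros t K. pose proof (Rabs_triang (g t) (- (g t - g 0))) as T. rewrite Rabs_Ropp in T.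
  replace (g t + - (g t - g 0)) with (g 0) in T by ring. lra.
Qed.

Lemma sm2_Schwarz F x y : sm2 F x y -> d1 (d2 F) x y = d2 (d1 F) x y.
Proof.
  intros H. apply (Schwarz F x y).
  - apply (locally_2d_mp _ _ _ _ (sm2_near _ _ _ H)). intros u v K.
    pose proof (sm2_d _ _ _ K) as [K1 K2]. repeat split.
    + eexists. now apply sm2_derive1.
    + eexists. now apply sm2_derive2.
    + eexists. now apply (sm2_derive1 (d2 F)).
    + eexists. now apply (sm2_derive2 (d1 F)).
  - apply (sm2_continuity (d1 (d2 F))). now apply sm2_d, sm2_d.
  - apply (sm2_continuity (d2 (d1 F))). now apply sm2_d, sm2_d.
Qed.

(** * The two notions of smooth germ agree *)

Lemma sm2_ex_diff_n n F x y : sm2 F x y -> ex_diff_n F n x y.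
Proof.
  revert F. induction n as [|n IH]; intros F H.
  - split; auto. now apply sm2_continuity.
  - pose proof (sm2_d _ _ _ H) as [K1 K2]. split; [now apply sm2_continuity|]. split; [|split; [|split]].
    + eexists; now apply sm2_derive1.
    + eexists; now apply sm2_derive2.
    + apply (IH (d1 F)); auto.
    + apply (IH (d2 F)); auto.
Qed.

Lemma sm2_smooth_germ F : sm2 F 0 0 -> smooth_germ F.
Proof.
  intros H. apply (locally_2d_mp _ _ _ _ (sm2_near _ _ _ H)). intros u v K n. now apply sm2_ex_diff_n.
Qed.

Lemma mvt f f' a b : (forall t, Rmin a b <= t <= Rmax a b -> is_derive f t (f' t)) ->
  exists c, Rmin a b <= c <= Rmax a b /\ f b - f a = f' c * (b - a).
Proof.
  intros H. apply MVT_gen.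
  - intros t Ht. apply H; lra.
  - intros t Ht. apply derivable_continuous_pt. exists (f' t). apply is_derive_Reals. auto.
Qed.

Lemma between_abs x a t d : Rmin x a <= t <= Rmax x a -> Rabs (a - x) < d -> Rabs (t - x) < d.
Proof.
  intros H K. apply Rabs_lt_between in K. apply Rabs_lt_between.
  unfold Rmin, Rmax in H. destruct (Rle_dec x a); lra.
Qed.

Lemma between_ball x0 a b t d : Rmin a b <= t <= Rmax a b -> Rabs (a - x0) < d -> Rabs (b - x0) < d -> Rabs (t - x0) < d.
Proof.
  intros H K L. apply Rabs_lt_between in K. apply Rabs_lt_between in L. apply Rabs_lt_between.
  unfold Rmin, Rmax in H. destruct (Rle_dec a b); lra.
Qed.

(** The classical argument: go from (x, y) to (x', y') along the two coordinate directions and apply the mean value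
    theorem to each. *)
Lemma diff3_of_partials F x y z : locally_2d (ex_diff_n F 1) x y ->
  diff3 (fun x y _ => F x y) (d1 F x y) (d2 F x y) 0 x y z.
Proof.
  intros H.
  assert (C1 : continuity_2d_pt (d1 F) x y) by (pose proof (locally_2d_singleton _ _ _ H) as (_ & _ & _ & K & _); apply K).
  assert (C2 : continuity_2d_pt (d2 F) x y) by (pose proof (locally_2d_singleton _ _ _ H) as (_ & _ & _ & _ & K); apply K).
  intros eps He.
  destruct (locally_2d_and _ _ _ _ H (locally_2d_and _ _ _ _ (C1 (mkposreal _ He)) (C2 (mkposreal _ He)))) as [d K].
  simpl in K. exists d. split; [apply cond_pos|]. intros x' y' z' Hx Hy _.
  destruct (mvt (fun t => F t y') (fun t => d1 F t y') x x') as [c [Hc Ec]].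
  { intros t Ht. destruct (K t y' (between_abs _ _ _ _ Ht Hx) Hy) as [(_ & L & _) _]. now apply Derive_correct. }
  destruct (mvt (fun t => F x t) (fun t => d2 F x t) y y') as [e [Hee Ee]].
  { intros t Ht. destruct (K x t ltac:(rewrite Rminus_diag, Rabs_R0; apply cond_pos) (between_abs _ _ _ _ Ht Hy)) as [(_ & _ & L & _) _]. now apply Derive_correct. }
  replace (F x' y' - F x y) with (F x' y' - F x y' + (F x y' - F x y)) by ring. rewrite Ec, Ee.
  destruct (K c y' (between_abs _ _ _ _ Hc Hx) Hy) as (_ & A & _).
  destruct (K x e ltac:(rewrite Rminus_diag, Rabs_R0; apply cond_pos) (between_abs _ _ _ _ Hee Hy)) as (_ & _ & B).
  replace (d1 F c y' * (x' - x) + d2 F x e * (y' - y) - (d1 F x y * (x' - x) + d2 F x y * (y' - y) + 0 * (z' - z)))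
    with ((d1 F c y' - d1 F x y) * (x' - x) + (d2 F x e - d2 F x y) * (y' - y)) by ring.
  eapply Rle_trans; [apply Rabs_triang|]. rewrite !Rabs_mult.
  pose proof (Rabs_pos (x' - x)). pose proof (Rabs_pos (y' - y)). pose proof (Rabs_pos (z' - z)).
  pose proof (Rabs_pos (d1 F c y' - d1 F x y)). pose proof (Rabs_pos (d2 F x e - d2 F x y)). nra.
Qed.

(** Here the neighbourhood in the definition of a smooth germ has to be independent of the order. Continuous partial
    derivatives give the total differentials that the class C^n requires. *)
Lemma smooth_germ_sm2 F : smooth_germ F -> sm2 F 0 0.
Proof.
  intros [r H]. exists r. split; [apply cond_pos|]. intros n.
  assert (K : forall x y z, Box 0 0 0 r x y z -> forall n, ex_diff_n F n x y) by (intros x y z (A & B & _); now apply H).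
  clear H. revert F K. induction n as [|n IH]; intros F K.
  - intros x y z Hp eps He. apply near_locally_2d with (P := fun x' y' => Rabs (F x' y' - F x y) < eps).
    destruct (K _ _ _ Hp O) as [L _]. apply (L (mkposreal _ He)).
  - apply Cn_intro with (fun x y _ => d1 F x y) (fun x y _ => d2 F x y) (fun _ _ _ => 0); [apply Box_open| | | |].
    + intros x y z Hp. apply diff3_of_partials. apply (near_locally_2d _ _ _ z).
      eapply near_imp; [|apply (Box_open _ _ _ _ _ _ _ Hp)]. intros; simpl. eapply (K _ _ _ H 1%nat).
    + apply (IH (d1 F)). intros x y z Hp m. apply (K _ _ _ Hp (S m)).
    + apply (IH (d2 F)). intros x y z Hp m. apply (K _ _ _ Hp (S m)).
    + apply Cn_const, Box_open.
Qed.

(** * Integrals depending on parameters *)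

(** Compactness of [0, 1]: neighbourhoods of all points of a segment contain a uniform one. *)
Lemma near_segment (P : R -> R -> R -> Prop) x y : (forall t, 0 <= t <= 1 -> near P x y t) ->
  exists r, 0 < r /\ forall x' y' t, Rabs (x' - x) < r -> Rabs (y' - y) < r -> 0 <= t <= 1 -> P x' y' t.
Proof.
  intros H.
  assert (K : forall t, { r : posreal | 0 <= t <= 1 -> forall x' y' z', Rabs (x' - x) < r -> Rabs (y' - y) < r -> Rabs (z' - t) < r -> P x' y' z' }).
  { intros t. apply constructive_indefinite_description.
    destruct (excluded_middle_informative (0 <= t <= 1)) as [Ht|Ht].
    - destruct (H t Ht) as [r [Hr L]]. exists (mkposreal r Hr). auto.
    - exists (mkposreal 1 Rlt_0_1). tauto. }
  destruct (compactness_value_1d 0 1 (fun t => proj1_sig (K t))) as [d Hd].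
  exists d. split; [apply cond_pos|]. intros x' y' t Hx Hy Ht.
  apply NNPP. intros N. apply (Hd t Ht). intros (s & Hs & Hts & Hds). apply N.
  destruct (K s) as [rs Ls]. simpl in *. apply Ls; auto; lra.
Qed.

Lemma cont3_cont_3 g x y t : cont3 g x y t -> continuous (fun s => g x y s) t.
Proof.
  intros H. apply continuity_pt_filterlim. intros eps He. destruct (H eps He) as [r [Hr K]].
  exists r. split; auto. intros s [_ Hs]. apply K; try (rewrite Rminus_diag, Rabs_R0; auto). exact Hs.
Qed.

Lemma ex_RInt_cont g x y : (forall t, 0 <= t <= 1 -> cont3 g x y t) -> ex_RInt (fun t => g x y t) 0 1.
Proof.
  intros H. apply (ex_RInt_continuous (V := R_CompleteNormedModule)). intros t Ht.
  rewrite Rmin_left, Rmax_right in Ht by lra. apply cont3_cont_3; auto.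
Qed.

Lemma uniform_segment g x y eps : 0 < eps -> (forall t, 0 <= t <= 1 -> cont3 g x y t) ->
  exists r, 0 < r /\ forall x' y' t, Rabs (x' - x) < r -> Rabs (y' - y) < r -> 0 <= t <= 1 -> Rabs (g x' y' t - g x y t) < eps.
Proof.
  intros He H. apply (near_segment (fun x' y' t => Rabs (g x' y' t - g x y t) < eps)). intros t Ht.
  destruct (H t Ht (eps/2) ltac:(lra)) as [r [Hr K]]. exists r; split; auto. intros x' y' s A B C.
  pose proof (K x' y' s A B C). pose proof (K x y s ltac:(rewrite Rminus_diag, Rabs_R0; auto) ltac:(rewrite Rminus_diag, Rabs_R0; auto) C).
  replace (g x' y' s - g x y s) with ((g x' y' s - g x y t) - (g x y s - g x y t)) by ring.
  eapply Rle_lt_trans; [apply Rabs_triang|]. rewrite Rabs_Ropp. lra.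
Qed.

Lemma RInt_abs_le (f : R -> R) M : ex_RInt f 0 1 -> (forall t, 0 <= t <= 1 -> Rabs (f t) <= M) -> Rabs (RInt f 0 1) <= M.
Proof.
  intros Hf HM. eapply Rle_trans. apply (abs_RInt_le_const f 0 1 M); auto; lra. lra.
Qed.

(** Differentiation under the integral sign. The partial derivatives of the integrand are uniformly continuous near
    the segment, so that the error is small uniformly in t. *)
Lemma diff3_RInt g x y z : (forall t, 0 <= t <= 1 -> sm g x y t) ->
  diff3 (fun x y _ => RInt (fun t => g x y t) 0 1)
    (RInt (fun t => D1 g x y t) 0 1) (RInt (fun t => D2 g x y t) 0 1) 0 x y z.
Proof.
  intros H eps He.
  destruct (near_segment (sm g) x y) as [r0 [Hr0 S]]. { intros t Ht. now apply sm_near, H. }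
  destruct (uniform_segment (D1 g) x y eps He) as [r1 [Hr1 S1]]. { intros t Ht. now apply sm_cont, sm_D, H. }
  destruct (uniform_segment (D2 g) x y eps He) as [r2 [Hr2 S2]]. { intros t Ht. now apply sm_cont, sm_D, H. }
  set (r := Rmin r0 (Rmin r1 r2)).
  assert (Rr : 0 < r /\ r <= r0 /\ r <= r1 /\ r <= r2).
  { unfold r. pose proof (Rmin_l r0 (Rmin r1 r2)); pose proof (Rmin_r r0 (Rmin r1 r2)); pose proof (Rmin_l r1 r2); pose proof (Rmin_r r1 r2).
    split; [repeat apply Rmin_pos; auto|lra]. }
  exists r. split; [tauto|]. intros x' y' z' Hx Hy _.
  assert (Z : forall u, Rabs (u - u) < r) by (intros; rewrite Rminus_diag, Rabs_R0; tauto).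
  assert (I0 : ex_RInt (fun t => g x y t) 0 1) by (apply ex_RInt_cont; intros; now apply sm_cont, H).
  assert (I1 : ex_RInt (fun t => D1 g x y t) 0 1) by (apply ex_RInt_cont; intros; now apply sm_cont, sm_D, H).
  assert (I2 : ex_RInt (fun t => D2 g x y t) 0 1) by (apply ex_RInt_cont; intros; now apply sm_cont, sm_D, H).
  assert (I' : ex_RInt (fun t => g x' y' t) 0 1) by (apply ex_RInt_cont; intros; apply sm_cont, S; lra).
  set (q := fun t => g x' y' t - g x y t - (D1 g x y t * (x' - x) + D2 g x y t * (y' - y))).
  assert (Iq : is_RInt q 0 1 (RInt (fun t => g x' y' t) 0 1 - RInt (fun t => g x y t) 0 1 -
     ((RInt (fun t => D1 g x y t) 0 1) * (x' - x) + (RInt (fun t => D2 g x y t) 0 1) * (y' - y)))).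
  { unfold q. apply (is_RInt_minus (V := R_NormedModule)).
    - apply (is_RInt_minus (V := R_NormedModule)); now apply (RInt_correct (V := R_CompleteNormedModule)).
    - apply (is_RInt_plus (V := R_NormedModule)).
      + rewrite (Rmult_comm _ (x'-x)). apply is_RInt_ext with (fun t => scal (x'-x) (D1 g x y t)).
        { intros; apply Rmult_comm. }
        apply (is_RInt_scal (V := R_NormedModule)). now apply (RInt_correct (V := R_CompleteNormedModule)).
      + rewrite (Rmult_comm _ (y'-y)). apply is_RInt_ext with (fun t => scal (y'-y) (D2 g x y t)).
        { intros; apply Rmult_comm. }
        apply (is_RInt_scal (V := R_NormedModule)). now apply (RInt_correct (V := R_CompleteNormedModule)). }
  replace (RInt (fun t => D1 g x y t) 0 1 * (x' - x) + RInt (fun t => D2 g x y t) 0 1 * (y' - y) + 0 * (z' - z))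
   with (RInt (fun t => D1 g x y t) 0 1 * (x' - x) + RInt (fun t => D2 g x y t) 0 1 * (y' - y)) by ring.
  rewrite <- (is_RInt_unique _ _ _ _ Iq). apply RInt_abs_le; [eexists; exact Iq|].
  intros t Ht. unfold q.
  destruct (mvt (fun s => g s y' t) (fun s => D1 g s y' t) x x') as [c [Hc Ec]].
  { intros s Hs. apply (diff3_is_D _ _ _ _ _ _ _ (sm_diff _ _ _ _ (S s y' t ltac:(pose proof (between_abs _ _ _ _ Hs Hx); lra) ltac:(lra) Ht))). }
  destruct (mvt (fun s => g x s t) (fun s => D2 g x s t) y y') as [e [Hee Ee]].
  { intros s Hs. apply (diff3_is_D _ _ _ _ _ _ _ (sm_diff _ _ _ _ (S x s t ltac:(specialize (Z x); lra) ltac:(pose proof (between_abs _ _ _ _ Hs Hy); lra) Ht))). }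
  cbv beta in Ec, Ee. replace (g x' y' t - g x y t) with (g x' y' t - g x y' t + (g x y' t - g x y t)) by ring. rewrite Ec, Ee.
  pose proof (S1 c y' t ltac:(pose proof (between_abs _ _ _ _ Hc Hx); lra) ltac:(lra) Ht) as A.
  pose proof (S2 x e t ltac:(specialize (Z x); lra) ltac:(pose proof (between_abs _ _ _ _ Hee Hy); lra) Ht) as B.
  match goal with |- Rabs ?E <= _ => replace E with
    ((D1 g c y' t - D1 g x y t) * (x' - x) + (D2 g x e t - D2 g x y t) * (y' - y)) by ring end.
  eapply Rle_trans; [apply Rabs_triang|]. rewrite !Rabs_mult.
  pose proof (Rabs_pos (x' - x)). pose proof (Rabs_pos (y' - y)). pose proof (Rabs_pos (z' - z)).
  pose proof (Rabs_pos (D1 g c y' t - D1 g x y t)). pose proof (Rabs_pos (D2 g x e t - D2 g x y t)). nra.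
Qed.

Lemma sm2_RInt g x y : (forall t, 0 <= t <= 1 -> sm g x y t) ->
  sm2 (fun x y => RInt (fun t => g x y t) 0 1) x y.
Proof.
  intros H. destruct (near_segment (sm g) x y) as [r [Hr S]]. { intros t Ht. now apply sm_near, H. }
  exists r. split; auto. intros n.
  assert (S' : forall u v w t, Box x y 0 r u v w -> 0 <= t <= 1 -> sm g u v t) by (intros u v w t (A & B & _) Ht; auto).
  clear H S. revert g S'. induction n as [|n IH]; intros g S.
  - intros u v w Hp. eapply diff3_cont, diff3_RInt. intros; eapply S; eauto.
  - apply Cn_intro with (fun x y _ => RInt (fun t => D1 g x y t) 0 1) (fun x y _ => RInt (fun t => D2 g x y t) 0 1) (fun _ _ _ => 0).
    + apply Box_open.
    + intros u v w Hp. apply diff3_RInt. intros; eapply S; eauto.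
    + apply IH. intros; eapply sm_D, S; eauto.
    + apply IH. intros; eapply sm_D, S; eauto.
    + apply Cn_const, Box_open.
Qed.

Lemma d_RInt g x y : (forall t, 0 <= t <= 1 -> sm g x y t) ->
  d1 (fun x y => RInt (fun t => g x y t) 0 1) x y = RInt (fun t => D1 g x y t) 0 1 /\
  d2 (fun x y => RInt (fun t => g x y t) 0 1) x y = RInt (fun t => D2 g x y t) 0 1.
Proof. intros H. destruct (diff3_D _ _ _ _ _ _ _ (diff3_RInt g x y 0 H)) as (A & B & _). auto. Qed.

Lemma RInt_FTC (f f' : R -> R) : (forall t, 0 <= t <= 1 -> is_derive f t (f' t)) -> (forall t, 0 <= t <= 1 -> continuous f' t) ->
  RInt f' 0 1 = f 1 - f 0.
Proof.
  intros H C. apply is_RInt_unique. apply (is_RInt_derive (V := R_CompleteNormedModule) f f'); intros t Ht;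
  rewrite Rmin_left, Rmax_right in Ht by lra; auto.
Qed.

(** * Derivatives of one variable, and a decision procedure for smoothness *)

Lemma sm_fst x y z : sm (fun x _ _ => x) x y z. Proof. apply sm_proj. Qed.
Lemma sm_snd x y z : sm (fun _ y _ => y) x y z. Proof. apply sm_proj. Qed.
Lemma sm_thd x y z : sm (fun _ _ z => z) x y z. Proof. apply sm_proj. Qed.
Lemma sm2_d1 F x y : sm2 F x y -> sm2 (d1 F) x y. Proof. apply sm2_d. Qed.
Lemma sm2_d2 F x y : sm2 F x y -> sm2 (d2 F) x y. Proof. apply sm2_d. Qed.

(** Equations between derivatives or integrals are stated in carriers of structures that unfold to the reals; the cast
    makes them accessible to [ring] and [field]. *)
Ltac req := match goal with |- @eq _ ?a ?b => change (@eq R a b) end.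

Lemma derive_mul (f g : R -> R) x a b : is_derive f x a -> is_derive g x b -> is_derive (fun t => f t * g t) x (a * g x + f x * b).
Proof. intros Hf Hg. evar_last. apply (is_derive_mult f g x a b); auto. intros; apply Rmult_comm. reflexivity. Qed.
Lemma derive_add (f g : R -> R) x a b : is_derive f x a -> is_derive g x b -> is_derive (fun t => f t + g t) x (a + b).
Proof. intros Hf Hg. apply (is_derive_plus (V := R_NormedModule) f g x a b); auto. Qed.
Lemma derive_sub (f g : R -> R) x a b : is_derive f x a -> is_derive g x b -> is_derive (fun t => f t - g t) x (a - b).
Proof. intros Hf Hg. apply (is_derive_minus (V := R_NormedModule) f g x a b); auto. Qed.
Lemma derive_cst (c x : R) : is_derive (K := R_AbsRing) (V := R_NormedModule) (fun _ => c) x 0.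
Proof. apply (is_derive_const (V := R_NormedModule)). Qed.
Lemma derive_id (x : R) : is_derive (K := R_AbsRing) (V := R_NormedModule) (fun t => t) x 1.
Proof. exact (is_derive_id (K := R_AbsRing) x). Qed.
Lemma derive_eq (f : R -> R) x (a b : R) : is_derive f x a -> a = b -> is_derive f x b.
Proof. now intros H <-. Qed.

Lemma sm2_at F x y a b : sm2 F x y -> x = a -> y = b -> sm2 F a b.
Proof. now intros H <- <-. Qed.
Lemma sm1_at F x a : sm1 F x -> x = a -> sm1 F a.
Proof. now intros H <-. Qed.

(** Simplification of values at the origin, where most base points are computed. *)
Ltac evals := cbv beta; repeat match goal with
  | H : ?f 0 = _ |- context [?f 0] => rewrite H
  | H : ?f 0 0 = _ |- context [?f 0 0] => rewrite H
  | |- context [0 * ?a] => rewrite (Rmult_0_l a)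
  | |- context [?a * 0] => rewrite (Rmult_0_r a)
  | |- context [0 + ?a] => rewrite (Rplus_0_l a)
  | |- context [?a + 0] => rewrite (Rplus_0_r a)
  | |- context [?a - 0] => rewrite (Rminus_0_r a)
  | |- context [0 ^ S ?n] => rewrite (pow_i (S n)) by lia
  end; try reflexivity; try (simpl; ring); auto; try lra.

(** One step of the recursion on the shape of the expression; the smoothness of its atoms is looked up in the context. *)
Ltac sms_step := lazymatch goal with
  | |- sm (fun x y z => @?f x y z + @?g x y z) _ _ _ => apply (sm_add f g)
  | |- sm (fun x y z => @?f x y z - @?g x y z) _ _ _ => apply (sm_sub f g)
  | |- sm (fun x y z => - @?f x y z) _ _ _ => apply (sm_opp f)
  | |- sm (fun x y z => @?f x y z * @?g x y z) _ _ _ => apply (sm_mul f g)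
  | |- sm (fun x y z => @?f x y z / @?g x y z) _ _ _ => apply (sm_div f g)
  | |- sm (fun x y z => / @?f x y z) _ _ _ => apply (sm_inv f)
  | |- sm (fun x y z => @?f x y z ^ ?n) _ _ _ => apply (sm_pow f n)
  | |- sm (fun _ _ _ => ?k) _ _ _ => apply (sm_const k)
  | |- sm (fun x y z => x) _ _ _ => apply sm_fst
  | |- sm (fun x y z => y) _ _ _ => apply sm_snd
  | |- sm (fun x y z => z) _ _ _ => apply sm_thd
  | |- sm (fun x y z => Derive ?F (@?g x y z)) _ _ _ => apply (sm_comp1 (Derive F) g)
  | |- sm (fun x y z => ?F (@?g x y z) (@?h x y z)) _ _ _ => apply (sm_comp2 F g h)
  | |- sm (fun x y z => ?F (@?g x y z)) _ _ _ => apply (sm_comp1 F g)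
  | H : sm2 ?F _ _ |- sm2 ?F _ _ => eapply sm2_at; [exact H| |]
  | H : sm1 ?F _ |- sm1 ?F _ => eapply sm1_at; [exact H|]
  | |- sm2 (d1 ?F) _ _ => apply sm2_d1
  | |- sm2 (d2 ?F) _ _ => apply sm2_d2
  | |- sm1 (Derive ?F) _ => apply sm1_d
  | |- sm2 ?F _ _ => tryif is_var F then fail else unfold sm2
  | |- sm1 ?F _ => tryif is_var F then fail else unfold sm1
  end; cbv beta.
Ltac sms := cbv beta; repeat sms_step; evals.

(** The mean value of the derivative between c x and y. It is the difference quotient of f, extended smoothly to the
    diagonal y = c x. *)
(** * Hadamard's lemma *)

Definition hquot (c : R -> R) (f : R -> R -> R) x y := RInt (fun t => d2 f x (c x + t * (y - c x))) 0 1.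

Lemma hquot_sm c f x y : sm1 c x -> (forall t, 0 <= t <= 1 -> sm2 f x (c x + t * (y - c x))) -> sm2 (hquot c f) x y.
Proof.
  intros Hc Hf. apply (sm2_RInt (fun x y t => d2 f x (c x + t * (y - c x)))).
  intros t Ht. specialize (Hf t Ht). sms.
Qed.

Lemma hquot_eq c f x y : (forall t, 0 <= t <= 1 -> sm2 f x (c x + t * (y - c x))) ->
  f x y = f x (c x) + (y - c x) * hquot c f x y.
Proof.
  intros Hf. unfold hquot.
  pose proof (RInt_FTC (fun t => f x (c x + t * (y - c x))) (fun t => (y - c x) * d2 f x (c x + t * (y - c x)))) as K.
  assert (C : forall t, 0 <= t <= 1 -> cont3 (fun _ _ t => d2 f x (c x + t * (y - c x))) 0 0 t).
  { intros t Ht. apply sm_cont. specialize (Hf t Ht). sms. }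
  assert (E : RInt (fun t => (y - c x) * d2 f x (c x + t * (y - c x))) 0 1 = (y - c x) * RInt (fun t => d2 f x (c x + t * (y - c x))) 0 1).
  { apply (RInt_scal (V := R_CompleteNormedModule)). apply (ex_RInt_cont (fun _ _ t => d2 f x (c x + t * (y - c x))) 0 0); auto. }
  rewrite E in K. rewrite K.
  - rewrite Rmult_1_l, Rmult_0_l. replace (c x + (y - c x)) with y by ring. rewrite Rplus_0_r. ring.
  - intros t Ht. evar_last. apply (sm2_chain f (fun _ => x) (fun t => c x + t * (y - c x)) x (c x + t * (y - c x)) 0 (y - c x) t); auto.
    auto_derive; auto. auto_derive; auto. ring. simpl. ring.
  - intros t Ht. apply (cont3_cont_3 (fun _ _ t => (y - c x) * d2 f x (c x + t * (y - c x))) 0 0).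
    apply sm_cont. specialize (Hf t Ht). sms.
Qed.

Lemma hquot_diag c f x : hquot c f x (c x) = d2 f x (c x).
Proof.
  unfold hquot. rewrite (RInt_ext _ (fun _ => d2 f x (c x))).
  rewrite RInt_const. unfold scal; simpl; unfold mult; simpl; ring.
  intros. f_equal. ring.
Qed.

(** Small neighbourhoods are convex, so that they contain the segments over which the difference quotient is an
    average. *)
Lemma segment_near f c x0 y0 : sm2 f x0 y0 -> sm1 c x0 -> c x0 = y0 ->
  locally_2d (fun x y => forall t, 0 <= t <= 1 -> sm2 f x (c x + t * (y - c x))) x0 y0.
Proof.
  intros Hf Hc E. destruct (sm2_near _ _ _ Hf) as [r H].
  assert (L : locally_2d (fun x y => Rabs (c x - y0) < r) x0 y0).
  { apply (locally_pull2 (fun u => Rabs (u - y0) < r) (fun x y => c x)). sms. rewrite E. exists r; auto. }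
  destruct L as [s L]. exists (mkposreal (Rmin r s) (Rmin_pos _ _ (cond_pos r) (cond_pos s))). simpl.
  intros x y Hx Hy t Ht. pose proof (Rmin_l r s). pose proof (Rmin_r r s). apply H; [lra|].
  specialize (L x y ltac:(lra) ltac:(lra)).
  replace (c x + t * (y - c x) - y0) with ((1-t) * (c x - y0) + t * (y - y0)) by ring.
  eapply Rle_lt_trans; [apply Rabs_triang|]. rewrite !Rabs_mult. rewrite (Rabs_pos_eq t), (Rabs_pos_eq (1-t)) by lra.
  assert (Rabs (y-y0) < r) by lra. set (p := Rabs (c x - y0)) in *. set (q := Rabs (y - y0)) in *.
  apply Rle_lt_trans with (Rmax p q); [|now apply Rmax_lub_lt].
  pose proof (Rmax_l p q). pose proof (Rmax_r p q).
  assert ((1-t) * p <= (1-t) * Rmax p q) by (apply Rmult_le_compat_l; lra).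
  assert (t * q <= t * Rmax p q) by (apply Rmult_le_compat_l; lra). lra.
Qed.

(** Fundamental theorem of calculus on the segment from c x to y, followed by smoothness of the parameter integral. *)
Lemma hadamard f c x0 y0 : sm2 f x0 y0 -> sm1 c x0 -> c x0 = y0 ->
  exists g, sm2 g x0 y0 /\ locally_2d (fun x y => f x y = f x (c x) + (y - c x) * g x y) x0 y0
    /\ (forall x, g x (c x) = d2 f x (c x)).
Proof.
  intros Hf Hc E. pose proof (segment_near _ _ _ _ Hf Hc E) as S. exists (hquot c f). split; [|split].
  - apply hquot_sm; auto. apply (locally_2d_singleton _ _ _ S).
  - apply (locally_2d_mp _ _ _ _ S). intros; now apply hquot_eq.
  - intros x. apply hquot_diag.
Qed.

Lemma hadamard_2 f c x0 y0 : sm2 f x0 y0 -> sm1 c x0 -> c x0 = y0 ->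
  exists g, sm2 g x0 y0 /\ locally_2d (fun x y => f x y = f x (c x) + (y - c x) * d2 f x (c x) + (y - c x) ^ 2 * g x y) x0 y0
   /\ g x0 y0 = / 2 * d2 (d2 f) x0 y0.
Proof.
  intros Hf Hc E. destruct (hadamard f c x0 y0 Hf Hc E) as (g & Hg & Eg & Dg).
  destruct (hadamard g c x0 y0 Hg Hc E) as (h & Hh & Eh & Dh).
  exists h. split; auto.
  assert (EE : locally_2d (fun x y => f x y = f x (c x) + (y - c x) * d2 f x (c x) + (y - c x) ^ 2 * h x y) x0 y0).
  { apply (locally_2d_mp2 _ _ _ _ _ Eg Eh). intros u v -> ->. rewrite Dg. ring. }
  split; auto.
  subst y0. pose proof (Dh x0) as D0. rewrite D0.
  (* two expressions for the second derivative of f at the point *)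
  assert (K : locally_2d (fun x y => d2 f x y = g x y + (y - c x) * d2 g x y) x0 (c x0)).
  { assert (N : locally_2d (fun x y => locally_2d (fun x y => f x y = f x (c x) + (y - c x) * g x y) x y) x0 (c x0)).
    { apply (near_locally_2d _ _ _ 0). apply (near_locally_2d _ _ _ 0) in Eg. apply near_near in Eg. eapply near_imp; [|exact Eg].
      intros x y z Hn. now apply near_locally_2d in Hn. }
    apply (locally_2d_mp2 _ _ _ _ _ N (sm2_near _ _ _ Hg)). intros x y Hn Sg.
    destruct (d_ext _ _ _ _ Hn) as [_ ->]. apply is_derive_unique.
    pose proof (sm2_derive2 _ _ _ Sg) as Dy.
    evar_last. apply (is_derive_plus (V := R_NormedModule) (fun _ => f x (c x))). apply (is_derive_const (V := R_NormedModule)).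
    apply (is_derive_mult (fun t => t - c x)); [|exact Dy|intros; apply Rmult_comm]. apply (is_derive_minus (V:=R_NormedModule)). apply is_derive_id. apply (is_derive_const (V := R_NormedModule)).
    unfold plus, minus, opp, zero, one, mult; simpl. unfold plus, opp; simpl. ring. }
  assert (Sg' : sm2 (d2 g) x0 (c x0)) by (now apply sm2_d).
  destruct (d_ext _ _ _ _ K) as [_ ->].
  assert (Q : d2 (fun x y => g x y + (y - c x) * d2 g x y) x0 (c x0) = 2 * d2 g x0 (c x0)).
  { apply is_derive_unique. pose proof (sm2_derive2 _ _ _ Hg) as Dy. pose proof (sm2_derive2 _ _ _ Sg') as Dyy.
    evar_last. apply (is_derive_plus (V := R_NormedModule)). exact Dy.
    apply (is_derive_mult (fun t => t - c x0)); [|exact Dyy|intros; apply Rmult_comm]. apply (is_derive_minus (V:=R_NormedModule)). apply is_derive_id. apply (is_derive_const (V := R_NormedModule)).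
    unfold plus, minus, opp, zero, one, mult; simpl. unfold plus, opp; simpl. ring. }
  rewrite Q. field.
Qed.

Lemma sm2_swap f x y : sm2 f x y -> sm2 (fun y x => f x y) y x.
Proof. intros H. sms. Qed.

Lemma locally_2d_swap P x y : locally_2d P x y -> locally_2d (fun y x => P x y) y x.
Proof. intros [d H]. exists d. auto. Qed.

Lemma hadamard_fst f c x0 y0 : sm2 f x0 y0 -> sm1 c y0 -> c y0 = x0 ->
  exists g, sm2 g x0 y0 /\ locally_2d (fun x y => f x y = f (c y) y + (x - c y) * g x y) x0 y0
    /\ (forall y, g (c y) y = d1 f (c y) y).
Proof.
  intros Hf Hc E. destruct (hadamard (fun y x => f x y) c y0 x0 (sm2_swap _ _ _ Hf) Hc E) as (g & Hg & Eg & Dg).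
  exists (fun x y => g y x). split; [now apply sm2_swap|]. split; [apply (locally_2d_swap _ _ _ Eg)|exact Dg].
Qed.

Lemma hadamard_1 h a : sm1 h a -> exists g, sm1 g a /\ locally a (fun t => h t = h a + (t - a) * g t) /\ g a = Derive h a.
Proof.
  intros Hh. destruct (hadamard (fun _ y => h y) (fun _ => a) 0 a) as (g & Hg & Eg & Dg); [sms|sms|auto|].
  exists (g 0). split; [sms|]. split; [|apply (Dg 0)].
  apply (locally_2d_1d_const_x _ 0 a Eg).
Qed.

(** * The implicit function theorem *)

Lemma sm_pos_near f x y z : sm f x y z -> 0 < f x y z -> near (fun u v w => f x y z / 2 < f u v w) x y z.
Proof.
  intros Hf H0. generalize (sm_cont _ _ _ _ Hf (f x y z / 2) ltac:(lra)). apply near_imp.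
  intros u v w K. apply Rabs_lt_between in K. lra.
Qed.

(** F is strictly increasing in z near the point, with slope at least m. The intermediate value theorem gives the
    solution, the slope gives its uniqueness and the Lipschitz bound M / m, and with it the differentiability; the
    formula for the derivatives then propagates smoothness. *)
Lemma implicit_pos F x0 y0 z0 : sm F x0 y0 z0 -> F x0 y0 z0 = 0 -> 0 < D3 F x0 y0 z0 ->
  exists phi, sm2 phi x0 y0 /\ phi x0 y0 = z0 /\ locally_2d (fun x y => F x y (phi x y) = 0) x0 y0
    /\ near (fun x y z => F x y z = 0 -> z = phi x y) x0 y0 z0.
Proof.
  intros HF F0 HD. set (m := D3 F x0 y0 z0 / 2). assert (Hm : 0 < m) by (unfold m; lra).
  pose proof (near_and _ _ _ _ _ (sm_near _ _ _ _ HF) (sm_pos_near _ _ _ _ (proj2 (proj2 (sm_D _ _ _ _ HF))) HD)) as N.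
  fold m in N. destruct N as [r [Hr N]].
  assert (Z : forall u : R, Rabs (u - u) < r) by (intros; rewrite Rminus_diag, Rabs_R0; auto).
  (* the slope in z is at least m, by the mean value theorem *)
  assert (incr : forall x y z z', Rabs (x - x0) < r -> Rabs (y - y0) < r -> Rabs (z - z0) < r -> Rabs (z' - z0) < r ->
     exists c, m < c /\ F x y z' - F x y z = c * (z' - z)).
  { intros x y z z' Hx Hy Hz Hz'. destruct (mvt (fun t => F x y t) (fun t => D3 F x y t) z z') as [c [Hc Ec]].
    - intros t Ht. pose proof (between_ball _ _ _ _ _ Ht Hz Hz') as Bt.
      apply (diff3_is_D _ _ _ _ _ _ _ (sm_diff _ _ _ _ (proj1 (N x y t Hx Hy Bt)))).
    - exists (D3 F x y c). split; auto. apply N; auto. eapply between_ball; eauto. }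
  set (e := r / 2).
  assert (Bp : Rabs (z0 + e - z0) < r) by (unfold e; replace (z0 + r/2 - z0) with (r/2) by ring; rewrite Rabs_pos_eq; lra).
  assert (Bm : Rabs (z0 - e - z0) < r) by (unfold e; replace (z0 - r/2 - z0) with (-(r/2)) by ring; rewrite Rabs_Ropp, Rabs_pos_eq; lra).
  assert (Fp : 0 < F x0 y0 (z0 + e)).
  { destruct (incr x0 y0 z0 (z0 + e) (Z _) (Z _) (Z _) Bp) as [c [Hc Ec]]. rewrite F0 in Ec. unfold e in *. clear - Ec Hc Hm Hr. nra. }
  assert (Fm : F x0 y0 (z0 - e) < 0).
  { destruct (incr x0 y0 z0 (z0 - e) (Z _) (Z _) (Z _) Bm) as [c [Hc Ec]]. rewrite F0 in Ec. unfold e in *. clear - Ec Hc Hm Hr. nra. }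
  assert (L : locally_2d (fun x y => Rabs (x - x0) < r /\ Rabs (y - y0) < r /\ 0 < F x y (z0 + e) /\ F x y (z0 - e) < 0) x0 y0).
  { destruct (sm_cont _ _ _ _ (proj1 (N x0 y0 (z0+e) (Z _) (Z _) Bp)) _ Fp) as [ra [Ha Ka]].
    destruct (sm_cont _ _ _ _ (proj1 (N x0 y0 (z0-e) (Z _) (Z _) Bm)) (- F x0 y0 (z0 - e)) ltac:(lra)) as [rb [Hb Kb]].
    exists (mkposreal (Rmin r (Rmin ra rb)) ltac:(repeat apply Rmin_pos; auto)). simpl. intros x y Hx Hy.
    pose proof (Rmin_l r (Rmin ra rb)); pose proof (Rmin_r r (Rmin ra rb)); pose proof (Rmin_l ra rb); pose proof (Rmin_r ra rb).
    specialize (Ka x y (z0+e) ltac:(lra) ltac:(lra) ltac:(rewrite Rminus_diag, Rabs_R0; lra)).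
    specialize (Kb x y (z0-e) ltac:(lra) ltac:(lra) ltac:(rewrite Rminus_diag, Rabs_R0; lra)).
    apply Rabs_lt_between in Ka. apply Rabs_lt_between in Kb. repeat split; lra. }
  destruct L as [s L].
  assert (ex : forall x y, { z : R | Rabs (x - x0) < s -> Rabs (y - y0) < s -> Rabs (z - z0) < r /\ F x y z = 0 }).
  { intros x y. apply constructive_indefinite_description.
    destruct (excluded_middle_informative (Rabs (x - x0) < s /\ Rabs (y - y0) < s)) as [[Hx Hy]|Hn].
    2:{ exists 0. tauto. }
    destruct (L x y Hx Hy) as (Ax & Ay & Ap & Am).
    destruct (Ranalysis5.IVT_interv (fun z => F x y z) (z0 - e) (z0 + e)) as [z [Hz Ez]]; auto.
    - intros t Ht. assert (Bt : Rabs (t - z0) < r) by (apply Rabs_lt_between; unfold e in *; lra).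
      apply continuity_pt_filterlim. apply (cont3_cont_3 F). apply sm_cont. apply N; auto.
    - unfold e; lra.
    - exists z. intros _ _. split; auto. apply Rabs_lt_between. unfold e in *; lra. }
  set (phi := fun x y => proj1_sig (ex x y)).
  assert (P : forall x y, Rabs (x - x0) < s -> Rabs (y - y0) < s -> Rabs (x - x0) < r /\ Rabs (y - y0) < r /\ Rabs (phi x y - z0) < r /\ F x y (phi x y) = 0).
  { intros x y Hx Hy. destruct (L x y Hx Hy) as (Ax & Ay & _). unfold phi. destruct (ex x y) as [z K]. simpl. tauto. }
  assert (uniq : forall x y z, Rabs (x - x0) < s -> Rabs (y - y0) < s -> Rabs (z - z0) < r -> F x y z = 0 -> z = phi x y).
  { intros x y z Hx Hy Hz Ez. destruct (P x y Hx Hy) as (Ax & Ay & Az & E).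
    destruct (incr x y z (phi x y) Ax Ay Hz Az) as [c [Hc Ec]]. rewrite E, Ez in Ec. nra. }
  assert (Zs : forall u, Rabs (u - u) < s) by (intros; rewrite Rminus_diag, Rabs_R0; apply cond_pos).
  assert (phi0 : phi x0 y0 = z0) by (symmetry; apply uniq; auto).
  assert (Dphi : forall x y z, Rabs (x - x0) < s -> Rabs (y - y0) < s ->
     diff3 (fun x y _ => phi x y) (- D1 F x y (phi x y) * / D3 F x y (phi x y)) (- D2 F x y (phi x y) * / D3 F x y (phi x y)) 0 x y z).
  { intros x y z Hx Hy. destruct (P x y Hx Hy) as (Ax & Ay & Az & E).
    destruct (N _ _ _ Ax Ay Az) as [SF HD'].
    set (a := D1 F x y (phi x y)) in *. set (b := D2 F x y (phi x y)) in *. set (c := D3 F x y (phi x y)) in *.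
    pose proof (sm_diff _ _ _ _ SF) as dF. fold a b c in dF.
    assert (Hin : locally_2d (fun x' y' => Rabs (x' - x0) < s /\ Rabs (y' - y0) < s) x y).
    { destruct (abs_open _ _ _ Hx) as (da & Pa & Qa). destruct (abs_open _ _ _ Hy) as (db & Pb & Qb).
      exists (mkposreal (Rmin da db) ltac:(apply Rmin_pos; auto)). simpl. intros x' y' Hx' Hy'.
      pose proof (Rmin_l da db). pose proof (Rmin_r da db). split; [apply Qa|apply Qb]; lra. }
    destruct (dF 1 Rlt_0_1) as [r1 [Hr1 K1]].
    set (M := Rabs a + Rabs b + 1).
    assert (HM : 0 < M) by (unfold M; pose proof (Rabs_pos a); pose proof (Rabs_pos b); lra).
    assert (Lip : locally_2d (fun x' y' => Rabs (phi x' y' - phi x y) <= M / m * (Rabs (x' - x) + Rabs (y' - y))) x y).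
    { assert (Hin1 : locally_2d (fun x' y' => Rabs (x' - x) < r1 /\ Rabs (y' - y) < r1) x y) by (exists (mkposreal r1 Hr1); auto).
      apply (locally_2d_mp2 _ _ _ _ _ Hin Hin1). intros x' y' [Hx' Hy'] [Hx1 Hy1].
      destruct (P x' y' Hx' Hy') as (Ax' & Ay' & Az' & E').
      destruct (incr x' y' (phi x y) (phi x' y') Ax' Ay' Az Az') as [q [Hq Eq]]. rewrite E' in Eq.
      specialize (K1 x' y' (phi x y) Hx1 Hy1 ltac:(rewrite Rminus_diag, Rabs_R0; auto)).
      rewrite E, (Rminus_diag (phi x y)), Rabs_R0, Rmult_0_r, !Rplus_0_r, Rminus_0_r in K1.
      assert (B : Rabs (F x' y' (phi x y)) <= M * (Rabs (x' - x) + Rabs (y' - y))).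
      { replace (F x' y' (phi x y)) with ((F x' y' (phi x y) - (a * (x' - x) + b * (y' - y))) + a * (x' - x) + b * (y' - y)) by ring.
        eapply Rle_trans; [apply Rabs_triang|]. eapply Rle_trans; [apply Rplus_le_compat_r, Rabs_triang|]. rewrite !Rabs_mult. unfold M.
        pose proof (Rabs_pos a); pose proof (Rabs_pos b); pose proof (Rabs_pos (x'-x)); pose proof (Rabs_pos (y'-y)). nra. }
      assert (C : m * Rabs (phi x' y' - phi x y) <= Rabs (F x' y' (phi x y))).
      { replace (F x' y' (phi x y)) with (- (q * (phi x' y' - phi x y))) by lra. rewrite Rabs_Ropp, Rabs_mult, (Rabs_pos_eq q) by lra.
        pose proof (Rabs_pos (phi x' y' - phi x y)). nra. }
      apply Rmult_le_reg_l with m; auto. replace (m * (M / m * (Rabs (x' - x) + Rabs (y' - y)))) with (M * (Rabs (x' - x) + Rabs (y' - y))) by (field; lra). lra. }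
    intros eps He.
    (* the increment of phi is at most M / m times that of (x, y), and the linearised equation is divided by c *)
    set (e1 := eps * c / (1 + M / m)).
    assert (HMm : 0 < M / m) by (apply Rdiv_lt_0_compat; auto).
    assert (He1 : 0 < e1) by (unfold e1; apply Rdiv_lt_0_compat; [nra|lra]).
    destruct (dF e1 He1) as [r2 [Hr2 K2]].
    assert (Hc2 : locally_2d (fun x' y' => Rabs (x' - x) < r2 /\ Rabs (y' - y) < r2 /\ Rabs (phi x' y' - phi x y) < r2) x y).
    { destruct Lip as [dl Lip].
      set (d0 := r2 / (2 * (M/m) + 1)). assert (Hd0 : 0 < d0) by (unfold d0; apply Rdiv_lt_0_compat; lra).
      assert (Ed0 : d0 * (2 * (M/m) + 1) = r2) by (unfold d0; field; split; [lra|nra]).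
      assert (Hdle : d0 <= r2) by nra.
      exists (mkposreal (Rmin dl d0) ltac:(apply Rmin_pos; auto; apply cond_pos)). simpl. intros x' y' Hx' Hy'.
      pose proof (Rmin_l dl d0). pose proof (Rmin_r dl d0). specialize (Lip x' y' ltac:(lra) ltac:(lra)).
      repeat split; try lra. eapply Rle_lt_trans; [exact Lip|].
      apply Rlt_le_trans with (M/m * (2*d0)). apply Rmult_lt_compat_l; lra. nra. }
    refine (near_imp _ _ _ _ _ _ (proj1 (near_locally_2d (fun x' y' => forall z',
      Rabs (phi x' y' - phi x y - (- a * / c * (x' - x) + - b * / c * (y' - y) + 0 * (z' - z))) <= eps * (Rabs (x' - x) + Rabs (y' - y) + Rabs (z' - z))) x y z) _)).
    - intros x' y' z' K. apply K.
    - apply (locally_2d_mp3 _ _ _ _ _ _ Hin Lip Hc2). intros x' y' [Hx' Hy'] Lp (A & B & C) z'.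
      destruct (P x' y' Hx' Hy') as (_ & _ & _ & E'). specialize (K2 x' y' (phi x' y') A B C). rewrite E, E' in K2.
      replace (phi x' y' - phi x y - (- a * / c * (x' - x) + - b * / c * (y' - y) + 0 * (z' - z)))
       with (- / c * (0 - 0 - (a * (x' - x) + b * (y' - y) + c * (phi x' y' - phi x y)))) by (field; lra).
      rewrite Rabs_mult, Rabs_Ropp, (Rabs_pos_eq (/ c)) by (left; apply Rinv_0_lt_compat; lra).
      apply Rmult_le_reg_l with c; [lra|]. rewrite <- Rmult_assoc, Rinv_r, Rmult_1_l by lra.
      eapply Rle_trans; [exact K2|].
      pose proof (Rabs_pos (x'-x)); pose proof (Rabs_pos (y'-y)); pose proof (Rabs_pos (z'-z)).
      apply Rle_trans with (e1 * ((1 + M/m) * (Rabs (x'-x) + Rabs (y'-y)))). apply Rmult_le_compat_l; lra.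
      replace (e1 * ((1 + M/m) * (Rabs (x'-x) + Rabs (y'-y)))) with (c * (eps * (Rabs (x' - x) + Rabs (y' - y)))) by (unfold e1; field; split; [lra|nra]).
      apply Rmult_le_compat_l; [lra|]. apply Rmult_le_compat_l; lra. }
  exists phi. split; [|split; [exact phi0|split]].
  - exists s. split; [apply cond_pos|]. intros n. induction n as [|n IH].
    + intros x y z (Hx & Hy & _). eapply diff3_cont. apply Dphi; auto.
    + assert (C0 : Cn n (Box x0 y0 0 s) (fun x _ _ => x) /\ Cn n (Box x0 y0 0 s) (fun _ y _ => y)) by (split; apply Cn_of_sm; intros; apply sm_proj).
      assert (SF : forall x y z, Box x0 y0 0 s x y z -> sm F x y (phi x y) /\ D3 F x y (phi x y) <> 0).
      { intros x y z (Hx & Hy & _). destruct (P x y Hx Hy) as (Ax & Ay & Az & E). destruct (N _ _ _ Ax Ay Az). split; auto. lra. }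
      apply Cn_intro with (fun x y _ => - D1 F x y (phi x y) * / D3 F x y (phi x y)) (fun x y _ => - D2 F x y (phi x y) * / D3 F x y (phi x y)) (fun _ _ _ => 0).
      * apply Box_open.
      * intros x y z (Hx & Hy & _). apply Dphi; auto.
      * apply (Cn_comp n _ (fun x y z => - D1 F x y z * / D3 F x y z) (fun x _ _ => x) (fun _ y _ => y) (fun x y _ => phi x y)); try tauto; [apply Box_open|].
        intros x y z Hb. destruct (SF x y z Hb) as [S1 S2]. apply sm_D in S1. apply (sm_mul (fun x y z => - D1 F x y z) (fun x y z => / D3 F x y z)). apply sm_opp; tauto. apply sm_inv; tauto.
      * apply (Cn_comp n _ (fun x y z => - D2 F x y z * / D3 F x y z) (fun x _ _ => x) (fun _ y _ => y) (fun x y _ => phi x y)); try tauto; [apply Box_open|].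
        intros x y z Hb. destruct (SF x y z Hb) as [S1 S2]. apply sm_D in S1. apply (sm_mul (fun x y z => - D2 F x y z) (fun x y z => / D3 F x y z)). apply sm_opp; tauto. apply sm_inv; tauto.
      * apply Cn_const, Box_open.
  - exists s. intros x y Hx Hy. apply P; auto.
  - exists (Rmin r s). split; [apply Rmin_pos; auto; apply cond_pos|]. intros x y z Hx Hy Hz Ez.
    pose proof (Rmin_l r s); pose proof (Rmin_r r s). apply uniq; auto; lra.
Qed.

Lemma implicit_function F x0 y0 z0 : sm F x0 y0 z0 -> F x0 y0 z0 = 0 -> D3 F x0 y0 z0 <> 0 ->
  exists phi, sm2 phi x0 y0 /\ phi x0 y0 = z0 /\ locally_2d (fun x y => F x y (phi x y) = 0) x0 y0
    /\ near (fun x y z => F x y z = 0 -> z = phi x y) x0 y0 z0.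
Proof.
  intros HF F0 HD. destruct (Rtotal_order (D3 F x0 y0 z0) 0) as [H|[H|H]]; [|contradiction|now apply implicit_pos].
  destruct (implicit_pos (fun x y z => - F x y z) x0 y0 z0) as (phi & A & B & C & D).
  - now apply sm_opp.
  - rewrite F0; ring.
  - unfold D3 in *. rewrite Derive_opp. apply Ropp_0_gt_lt_contravar. exact H.
  - exists phi. repeat split; auto.
    + apply (locally_2d_mp _ _ _ _ C). intros; lra.
    + eapply near_imp; [|exact D]. intros x y z K E. apply K. rewrite E; ring.
Qed.

(** * A bump function *)

(** The flat functions e^(-1/x) x^(-m), extended by 0. The family is closed under differentiation up to linear
    combinations. *)
Definition etam (m : nat) (x : R) : R := if Rlt_dec 0 x then exp (- / x) * (/ x) ^ m else 0.

(** The exponential series gives e^(1/x) at least its term of degree m + 2. The factor x^2 makes the derivative at 0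
    vanish. *)
Lemma etam_small m x : 0 <= etam m x <= INR (fact (m + 2)) * x ^ 2.
Proof.
  unfold etam. pose proof (INR_fact_lt_0 (m+2)). destruct (Rlt_dec 0 x) as [Hx|Hx]; [|nra].
  assert (Hi : 0 < / x) by (now apply Rinv_0_lt_compat).
  pose proof (exp_pos (- / x)). pose proof (pow_lt (/ x) m Hi). split; [nra|].
  assert (E : (/ x) ^ (m+2) / INR (fact (m+2)) <= exp (/ x)).
  { eapply Rle_trans; [|apply (exp_ge_taylor (/ x) (m+2)); lra].
    rewrite <- (sum_n_Reals (fun k => (/ x) ^ k / INR (fact k))).
    destruct (m+2)%nat as [|k] eqn:Ek; [lia|]. rewrite sum_Sn. unfold plus; simpl.
    assert (0 <= sum_n (fun k => (/ x) ^ k / INR (fact k)) k); [|simpl in *; lra].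
    rewrite sum_n_Reals. apply cond_pos_sum. intros j. apply Rlt_le, Rdiv_lt_0_compat; [now apply pow_lt|apply INR_fact_lt_0]. }
  rewrite exp_Ropp. pose proof (exp_pos (/ x)).
  apply Rmult_le_reg_l with (exp (/ x)); auto.
  replace (exp (/ x) * (/ exp (/ x) * (/ x) ^ m)) with ((/ x) ^ m) by (rewrite <- Rmult_assoc, Rinv_r, Rmult_1_l by lra; reflexivity).
  apply Rle_trans with ((/ x) ^ (m+2) / INR (fact (m+2)) * (INR (fact (m+2)) * x^2)).
  - right. rewrite pow_add. set (p := (/ x)^m).
    replace (p * (/ x)^2 / INR (fact (m+2)) * (INR (fact (m+2)) * x^2)) with (p * ((/ x) * x)^2) by (field; split; lra).
    rewrite Rinv_l by lra. ring.
  - apply Rmult_le_compat_r; auto. nra.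
Qed.

Lemma etam_derive m x : is_derive (etam m) x (etam (m+2) x - INR m * etam (m+1) x).
Proof.
  destruct (Rtotal_order x 0) as [Hx|[->|Hx]].
  - apply is_derive_ext_loc with (fun _ => 0).
    { exists (mkposreal (-x) ltac:(lra)). intros y Hy. unfold ball in Hy; simpl in Hy; unfold AbsRing_ball, abs, minus, plus, opp in Hy; simpl in Hy.
      apply Rabs_lt_between in Hy. unfold etam. destruct (Rlt_dec 0 y); auto; lra. }
    unfold etam. destruct (Rlt_dec 0 x); [lra|]. evar_last; [apply (is_derive_const (V := R_NormedModule))|]. unfold zero; simpl; ring.
  - replace (etam (m+2) 0 - INR m * etam (m+1) 0) with 0.
    2:{ unfold etam. destruct (Rlt_dec 0 0); [lra|ring]. }
    apply is_derive_Reals. intros eps He. set (C := INR (fact (m+2))).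
    assert (HC : 0 < C) by apply INR_fact_lt_0.
    exists (mkposreal (eps / C) ltac:(apply Rdiv_lt_0_compat; auto)). simpl. intros h Hh0 Hh.
    assert (E : etam m 0 = 0) by (unfold etam; destruct (Rlt_dec 0 0); [lra|auto]). rewrite E, Rplus_0_l, !Rminus_0_r.
    pose proof (etam_small m h) as [P1 P2]. fold C in P2.
    unfold Rdiv. rewrite Rabs_mult, (Rabs_pos_eq (etam m h)), Rabs_inv by auto.
    pose proof (Rabs_pos_lt h Hh0) as Hp. apply Rmult_lt_reg_r with (Rabs h); auto.
    rewrite Rmult_assoc, Rinv_l, Rmult_1_r by lra. eapply Rle_lt_trans; [exact P2|].
    replace (h^2) with (Rabs h * Rabs h) by (rewrite <- Rabs_mult; rewrite Rabs_pos_eq; [ring|nra]).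
    rewrite <- Rmult_assoc. apply Rmult_lt_compat_r; auto.
    apply Rmult_lt_reg_r with (/ C); [now apply Rinv_0_lt_compat|]. replace (C * Rabs h * / C) with (Rabs h) by (field; lra). exact Hh.
  - apply is_derive_ext_loc with (fun x => exp (- / x) * (/ x) ^ m).
    { exists (mkposreal x Hx). intros y Hy. unfold ball in Hy; simpl in Hy; unfold AbsRing_ball, abs, minus, plus, opp in Hy; simpl in Hy.
      apply Rabs_lt_between in Hy. unfold etam. destruct (Rlt_dec 0 y); auto; lra. }
    unfold etam. destruct (Rlt_dec 0 x); [|lra]. auto_derive; [lra|].
    rewrite !pow_add. destruct m as [|m]; [simpl; field; lra|]. rewrite Nat.pred_succ. simpl pow. field. lra.
Qed.

Lemma etam_sm m x y z : sm (fun x _ _ => etam m x) x y z.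
Proof.
  exists 1. split; [lra|]. intros n. revert m. induction n as [|n IH]; intros m.
  - intros u v w _. eapply diff3_cont, (diff3_of_derive (etam m)), etam_derive.
  - apply Cn_intro with (fun x _ _ => etam (m+2) x + (- INR m) * etam (m+1) x) (fun _ _ _ => 0) (fun _ _ _ => 0); [apply Box_open| | | |].
    + intros u v w _. apply (diff3_of_derive (etam m)). evar_last; [apply etam_derive|ring].
    + apply Cn_add; [apply Box_open|apply IH|]. apply (Cn_mul n _ (fun _ _ _ => - INR m)); [apply Box_open|apply Cn_const, Box_open|apply IH].
    + apply Cn_const, Box_open.
    + apply Cn_const, Box_open.
Qed.

(** Equal to 1 for |q| at most 1/2 and to 0 for |q| at least 1: the two summands of the denominator never vanish
    together. *)
Definition bump (q : R) : R := etam 0 (1 - q^2) / (etam 0 (1 - q^2) + etam 0 (q^2 - /4)).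

Lemma etam0_pos x : 0 < x -> 0 < etam 0 x.
Proof. intros H. unfold etam. destruct (Rlt_dec 0 x); [|lra]. simpl. pose proof (exp_pos (- / x)). lra. Qed.
Lemma etam0_neg x : x <= 0 -> etam 0 x = 0.
Proof. intros H. unfold etam. destruct (Rlt_dec 0 x); lra. Qed.

Lemma bump_sm q : sm1 bump q.
Proof.
  assert (H1 : sm1 (etam 0) (1 - q^2)) by apply etam_sm.
  assert (H2 : sm1 (etam 0) (q^2 - /4)) by apply etam_sm.
  apply (sm_div (fun q _ _ => etam 0 (1 - q^2)) (fun q _ _ => etam 0 (1 - q^2) + etam 0 (q^2 - /4))).
  - apply (sm_comp1 (etam 0) (fun q _ _ => 1 - q^2)); auto. sms.
  - apply (sm_add (fun q _ _ => etam 0 (1 - q^2)) (fun q _ _ => etam 0 (q^2 - /4))).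
    apply (sm_comp1 (etam 0) (fun q _ _ => 1 - q^2)); auto. sms. apply (sm_comp1 (etam 0) (fun q _ _ => q^2 - /4)); auto. sms.
  - pose proof (etam_small 0 (1 - q^2)). pose proof (etam_small 0 (q^2 - /4)).
    destruct (Rlt_dec 0 (1 - q^2)) as [H3|H3]. pose proof (etam0_pos _ H3); lra.
    pose proof (etam0_pos (q^2 - /4) ltac:(lra)). lra.
Qed.

Lemma bump_out q : 1 < Rabs q -> bump q = 0.
Proof.
  intros H. unfold bump. rewrite etam0_neg. unfold Rdiv; ring. rewrite <- (pow2_abs q). nra.
Qed.

Lemma bump_in q : Rabs q < /2 -> bump q = 1.
Proof.
  intros H. assert (q^2 < /4) by (rewrite <- (pow2_abs q); pose proof (Rabs_pos q); nra).
  unfold bump. rewrite (etam0_neg (q^2 - /4)) by lra. pose proof (etam0_pos (1 - q^2) ltac:(lra)). field. lra.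
Qed.

(** The derivatives of the monomial q^n, cut off; the summands of the series in Borel's theorem are rescalings of
    these. *)
Definition cutpow (n j : nat) (q : R) : R := Derive_n (fun q => q ^ n * bump q) j q.

Lemma sm1_Derive_n h j x : sm1 h x -> sm1 (Derive_n h j) x.
Proof. intros H. induction j as [|j IH]; [exact H|]. exact (sm1_d _ _ IH). Qed.

Lemma cutpow_sm n j q : sm1 (cutpow n j) q.
Proof. apply (sm1_Derive_n (fun q => q ^ n * bump q)). pose proof (bump_sm q). sms. Qed.

Lemma cutpow_derive n j q : is_derive (cutpow n j) q (cutpow n (S j) q).
Proof. apply (sm1_derive (cutpow n j)). apply cutpow_sm. Qed.

Lemma sm1_continuity h x : sm1 h x -> continuity_pt h x.
Proof. intros H. apply derivable_continuous_pt. exists (Derive h x). apply is_derive_Reals. now apply sm1_derive. Qed.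

Lemma bounded_on f a b : a <= b -> (forall t, a <= t <= b -> continuity_pt f t) -> exists M, 0 <= M /\ forall t, a <= t <= b -> Rabs (f t) <= M.
Proof.
  intros Hab H. destruct (continuity_ab_maj (fun t => Rabs (f t)) a b Hab) as [m [Hm _]].
  - intros t Ht. apply (continuity_pt_comp f Rabs). auto. apply Rcontinuity_abs.
  - exists (Rabs (f m)). split; auto. apply Rabs_pos.
Qed.

Lemma cutpow_bounded n j : exists M, 0 <= M /\ forall q, Rabs (cutpow n j q) <= M.
Proof.
  destruct (bounded_on (cutpow n j) (-1) 1 ltac:(lra)) as (M & HM & K).
  - intros. now apply sm1_continuity, cutpow_sm.
  - exists M. split; auto. intros q. destruct (Rle_dec (Rabs q) 1) as [H|H].
    + apply K. apply Rabs_le_between. exact H.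
    + replace (cutpow n j q) with 0; [rewrite Rabs_R0; auto|].
      unfold cutpow. rewrite (Derive_n_ext_loc _ (fun _ => 0)).
      * destruct j; [reflexivity|]. rewrite Derive_n_const. reflexivity.
      * assert (Hp : 0 < Rabs q - 1) by lra.
        assert (T : forall t, Rabs (t - q) < Rabs q - 1 -> 1 < Rabs t).
        { intros t Ht. pose proof (Rabs_triang_inv q (q - t)) as T. replace (q - (q - t)) with t in T by ring. rewrite (Rabs_minus_sym q t) in T. lra. }
        exists (mkposreal _ Hp). intros t Ht. rewrite bump_out; [apply Rmult_0_r|]. apply T, Ht.
Qed.

Lemma cutpow_0 n j : cutpow n j 0 = if Nat.eq_dec n j then INR (fact j) else 0.
Proof.
  unfold cutpow. rewrite (Derive_n_ext_loc _ (fun q => q ^ n)).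
  - rewrite Derive_n_pow. destruct (Compare_dec.le_dec j n) as [L|L]; destruct (Nat.eq_dec n j) as [E|E]; try lia.
    + subst. rewrite Nat.sub_diag. simpl. field.
    + rewrite pow_i by lia. ring.
    + reflexivity.
  - exists (mkposreal (/2) ltac:(lra)). intros t Ht. change (Rabs (t - 0) < /2) in Ht. rewrite Rminus_0_r in Ht. rewrite bump_in; auto. apply Rmult_1_r.
Qed.

(** * Borel's theorem, with a parameter *)

Lemma series_geom_bound u c : 0 <= c -> (forall k, Rabs (u k) <= c * (/2)^k) -> ex_series u /\ Rabs (Series u) <= 2 * c.
Proof.
  intros Hc H.
  assert (G : is_series (fun k => c * (/2)^k) (2 * c)).
  { replace (2 * c) with (c * (/ (1 - /2))) by field. apply (is_series_scal (K := R_AbsRing) (V := R_NormedModule) c (fun k => (/2)^k) (/ (1 - /2))). apply is_series_geom. rewrite Rabs_pos_eq; lra. }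
  assert (E : ex_series (fun k => Rabs (u k))).
  { apply (ex_series_le (K := R_AbsRing) (V := R_CompleteNormedModule) _ (fun k => c * (/2)^k)).
    - intros k. change (Rabs (Rabs (u k)) <= c * (/2)^k). rewrite Rabs_Rabsolu. auto.
    - eexists; exact G. }
  split. now apply ex_series_Rabs.
  eapply Rle_trans; [now apply Series_Rabs|]. rewrite <- (is_series_unique _ _ G). apply Series_le.
  - intros k. split; [apply Rabs_pos|auto].
  - eexists; exact G.
Qed.

Lemma ex_series_ev u N : (forall n, (N <= n)%nat -> Rabs (u n) <= (/2)^n) -> ex_series u.
Proof.
  intros H. apply (ex_series_incr_n u N). apply (series_geom_bound _ 1); [lra|]. intros k. eapply Rle_trans; [apply H; lia|].
  rewrite Rmult_1_l, pow_add. pose proof (pow_lt (/2) k ltac:(lra)). pose proof (pow_le (/2) N ltac:(lra)).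
  assert ((/2)^N <= 1). { rewrite <- (pow1 N). apply pow_incr; lra. } nra.
Qed.

Lemma diff3_sum (T : nat -> R -> R -> R) a b K x y z : (forall n, diff3 (fun x y _ => T n x y) (a n) (b n) 0 x y z) ->
  diff3 (fun x y _ => sum_f_R0 (fun n => T n x y) K) (sum_f_R0 a K) (sum_f_R0 b K) 0 x y z.
Proof.
  intros H. induction K as [|K IH]; simpl; auto.
  eapply diff3_eq; [apply (diff3_add (fun x y _ => sum_f_R0 (fun n => T n x y) K) (fun x y _ => T (S K) x y)); [exact IH|apply H]| | |]; ring.
Qed.

(** Termwise differentiation: the tails of the series and of the difference quotients are bounded by a geometric
    series, and finitely many terms are differentiable. *)
Lemma diff3_Series (T : nat -> R -> R -> R) a b N r x y z : 0 < r ->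
  (forall n, diff3 (fun x y _ => T n x y) (a n) (b n) 0 x y z) ->
  (forall n, (N <= n)%nat -> Rabs (a n) <= (/2)^n /\ Rabs (b n) <= (/2)^n) ->
  (forall n x' y', (N <= n)%nat -> Rabs (x' - x) < r -> Rabs (T n x' y') <= (/2)^n /\
     Rabs (T n x' y' - T n x y) <= (/2)^n * (Rabs (x' - x) + Rabs (y' - y))) ->
  diff3 (fun x y _ => Series (fun n => T n x y)) (Series a) (Series b) 0 x y z.
Proof.
  intros Hr HD Hab HT eps He.
  assert (Ea : ex_series a) by (apply (ex_series_ev _ N); intros; now apply Hab).
  assert (Eb : ex_series b) by (apply (ex_series_ev _ N); intros; now apply Hab).
  assert (ET : forall x' y', Rabs (x' - x) < r -> ex_series (fun n => T n x' y')) by (intros; apply (ex_series_ev _ N); intros; now apply HT).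
  destruct (pow_lt_1_zero (/2) ltac:(rewrite Rabs_pos_eq; lra) (eps/8) ltac:(lra)) as [K0 HK0].
  set (K := S (max N K0)).
  assert (HK : (/2)^K < eps/8). { specialize (HK0 K ltac:(lia)). rewrite Rabs_pos_eq in HK0; auto. apply pow_le; lra. }
  generalize (near_and _ _ _ _ _ (diff3_sum T a b (pred K) x y z HD (eps/2) ltac:(lra)) (proj1 (near_locally _ x y z) (locally_ball x (mkposreal r Hr)))).
  apply near_imp. intros x' y' z' [F Hx]. change (Rabs (x' - x) < r) in Hx.
  set (w := fun n => T n x' y' - T n x y - (a n * (x' - x) + b n * (y' - y))).
  assert (Ex : Rabs (x - x) < r) by (rewrite Rminus_diag, Rabs_R0; auto).
  assert (Ew1 : ex_series (fun n => a n * (x' - x))) by now apply (ex_series_scal_r (x'-x) a).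
  assert (Ew2 : ex_series (fun n => b n * (y' - y))) by now apply (ex_series_scal_r (y'-y) b).
  assert (Ew3 : ex_series (fun n => a n * (x' - x) + b n * (y' - y))) by now apply (ex_series_plus (fun n => a n * (x'-x))).
  assert (Ew4 : ex_series (fun n => T n x' y' - T n x y)) by (apply (ex_series_minus (fun n => T n x' y')); auto).
  assert (Ew : ex_series w) by (apply (ex_series_minus (fun n => T n x' y' - T n x y)); auto).
  assert (Sw : Series w = Series (fun n => T n x' y') - Series (fun n => T n x y) - (Series a * (x' - x) + Series b * (y' - y))).
  { unfold w. rewrite Series_minus by auto. rewrite Series_minus by auto. rewrite Series_plus by auto. rewrite !Series_scal_r. ring. }
  replace (Series (fun n => T n x' y') - Series (fun n => T n x y) - (Series a * (x' - x) + Series b * (y' - y) + 0 * (z' - z))) with (Series w) by (rewrite Sw; ring).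
  rewrite (Series_incr_n w K) by (auto; unfold K; lia).
  set (D := Rabs (x' - x) + Rabs (y' - y)).
  assert (HD0 : 0 <= D) by (unfold D; pose proof (Rabs_pos (x'-x)); pose proof (Rabs_pos (y'-y)); lra).
  assert (tail : Rabs (Series (fun k => w (K + k)%nat)) <= 2 * (2 * (/2)^K * D)).
  { apply series_geom_bound. pose proof (pow_lt (/2) K ltac:(lra)). nra.
    intros k. unfold w. destruct (Hab (K+k)%nat ltac:(lia)) as [A B]. destruct (HT (K+k)%nat x' y' ltac:(lia) Hx) as [_ C].
    eapply Rle_trans; [apply Rabs_triang|]. rewrite Rabs_Ropp. fold D in C.
    assert (Rabs (a (K+k)%nat * (x'-x) + b (K+k)%nat * (y' - y)) <= (/2)^(K+k) * D).
    { eapply Rle_trans; [apply Rabs_triang|]. rewrite !Rabs_mult. unfold D. pose proof (Rabs_pos (x'-x)); pose proof (Rabs_pos (y'-y)). nra. }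
    rewrite pow_add in *. lra. }
  assert (head : Rabs (sum_f_R0 w (pred K)) <= eps/2 * (D + Rabs (z' - z))).
  { unfold w. replace (sum_f_R0 (fun n => T n x' y' - T n x y - (a n * (x' - x) + b n * (y' - y))) (pred K)) with
     (sum_f_R0 (fun n => T n x' y') (pred K) - sum_f_R0 (fun n => T n x y) (pred K) - (sum_f_R0 a (pred K) * (x' - x) + sum_f_R0 b (pred K) * (y' - y) + 0 * (z' - z))).
    exact F. clear. induction (pred K) as [|k IH]; simpl; [ring|]. rewrite <- IH. ring. }
  eapply Rle_trans; [apply Rabs_triang|]. fold D. pose proof (Rabs_pos (z' - z)).
  assert (2 * (2 * (/2)^K * D) <= eps/2 * D) by nra. nra.
Qed.

Lemma sum_f_R0_ge (A : nat -> R) n i : (forall k, 0 <= A k) -> (i <= n)%nat -> A i <= sum_f_R0 A n.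
Proof.
  intros H Hi. induction n as [|n IH]; simpl.
  - replace i with O by lia. lra.
  - destruct (Nat.eq_dec i (S n)) as [->|Hne]. pose proof (cond_pos_sum A n H). lra.
    specialize (IH ltac:(lia)). pose proof (H (S n)). lra.
Qed.

(** The n-th term c_n(u) q^n is cut off at distance 1 / lam n from q = 0. Its derivatives of order less than n in q
    and at most n in u are then smaller by a factor 1 / lam n, and lam n is taken large enough to make them at most
    2^-n. Rather than one function, the whole family of its partial derivatives is produced, which is what the gluing
    in Whitney's theorem needs. *)
Lemma borel (c : nat -> nat -> R -> R) r : 0 < r ->
  (forall n i u, Rabs u < r -> is_derive (c n i) u (c n (S i) u)) ->
  exists S : nat -> nat -> R -> R -> R,
    (forall i j x y z, Rabs x < r / 2 ->
       diff3 (fun x y _ => S i j x y) (S (Datatypes.S i) j x y) (S i (Datatypes.S j) x y) 0 x y z) /\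
    (forall i j x, Rabs x < r / 2 -> S i j x 0 = INR (fact j) * c j i x).
Proof.
  intros Hr Hc.
  assert (bA : forall n i, { M | 0 <= M /\ forall u, - (r/2) <= u <= r/2 -> Rabs (c n i u) <= M }).
  { intros n i. apply constructive_indefinite_description. apply bounded_on. lra. intros t Ht.
    apply derivable_continuous_pt. exists (c n (S i) t). apply is_derive_Reals, Hc. apply Rabs_lt_between; lra. }
  assert (bK : forall n j, { M | 0 <= M /\ forall q, Rabs (cutpow n j q) <= M }).
  { intros n j. apply constructive_indefinite_description, cutpow_bounded. }
  set (A := fun n i => proj1_sig (bA n i)). set (K := fun n j => proj1_sig (bK n j)).
  assert (HA : forall n i, 0 <= A n i /\ forall u, Rabs u < r/2 -> Rabs (c n i u) <= A n i).
  { intros n i. unfold A. destruct (bA n i) as [M [HM H]]. simpl. split; auto. intros u Hu. apply H. apply Rabs_lt_between in Hu. lra. }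
  assert (HK : forall n j, 0 <= K n j /\ forall q, Rabs (cutpow n j q) <= K n j).
  { intros n j. unfold K. destruct (bK n j) as [M [HM H]]. simpl. split; auto. }
  (* the sums bound all the constants for derivatives of order at most n at once *)
  set (lam := fun n => 1 + 2^n * (sum_f_R0 (A n) n * sum_f_R0 (K n) n)).
  assert (SA : forall n, 0 <= sum_f_R0 (A n) n) by (intros; apply cond_pos_sum; intros; apply HA).
  assert (SK : forall n, 0 <= sum_f_R0 (K n) n) by (intros; apply cond_pos_sum; intros; apply HK).
  assert (Hlam : forall n, 1 <= lam n).
  { intros n. unfold lam. pose proof (pow_lt 2 n ltac:(lra)). specialize (SA n). specialize (SK n). assert (0 <= sum_f_R0 (A n) n * sum_f_R0 (K n) n) by nra. nra. }
  set (T := fun i j n u q => c n i u * (cutpow n j (lam n * q) * lam n ^ j / lam n ^ n)).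
  assert (TB : forall i j n u q, (i <= n)%nat -> (j < n)%nat -> Rabs u < r/2 -> Rabs (T i j n u q) <= (/2)^n).
  { intros i j n u q Hi Hj Hu. unfold T. pose proof (Hlam n) as L. set (l := lam n) in *.
    assert (Pj : 0 < l ^ j) by (apply pow_lt; lra). assert (Pn : 0 < l ^ n) by (apply pow_lt; lra).
    unfold Rdiv. rewrite !Rabs_mult, Rabs_inv, (Rabs_pos_eq (l^j)), (Rabs_pos_eq (l^n)) by lra.
    assert (Q : l ^ j * / l ^ n <= / l).
    { apply Rmult_le_reg_r with (l ^ n); auto. rewrite Rmult_assoc, Rinv_l, Rmult_1_r by lra.
      apply Rmult_le_reg_l with l; [lra|]. rewrite <- Rmult_assoc, Rinv_r, Rmult_1_l by lra.
      change (l ^ (S j) <= l ^ n). apply Rle_pow; auto. }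
    destruct (HA n i) as [A0 A1]. destruct (HK n j) as [K0 K1].
    assert (B : A n i * K n j <= sum_f_R0 (A n) n * sum_f_R0 (K n) n).
    { apply Rmult_le_compat; auto; apply sum_f_R0_ge; try lia; intros; [apply HA|apply HK]. }
    assert (LB : 2^n * (A n i * K n j) <= l). { unfold l, lam. pose proof (pow_lt 2 n ltac:(lra)). nra. }
    apply Rle_trans with (A n i * (K n j * / l)).
    - rewrite !Rmult_assoc. apply Rmult_le_compat; auto; try apply Rabs_pos.
      { repeat apply Rmult_le_pos; try apply Rabs_pos; try lra. left; now apply Rinv_0_lt_compat. }
      apply Rmult_le_compat; auto; try apply Rabs_pos. apply Rmult_le_pos; try lra. left; now apply Rinv_0_lt_compat.
    - rewrite pow_inv. pose proof (pow_lt 2 n ltac:(lra)) as P2.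
      apply Rmult_le_reg_l with (2^n * l); [nra|].
      replace (2^n * l * (A n i * (K n j * / l))) with (2^n * (A n i * K n j)) by (field; lra).
      replace (2^n * l * / 2^n) with l by (field; lra). exact LB. }
  assert (TD : forall i j n x y z, Rabs x < r/2 -> diff3 (fun x y _ => T i j n x y) (T (S i) j n x y) (T i (S j) n x y) 0 x y z).
  { intros i j n x y z Hx. pose proof (Hlam n) as L. assert (Pn : 0 < lam n ^ n) by (apply pow_lt; lra).
    assert (E2 : diff3 (fun _ y _ => cutpow n j (lam n * y) * lam n ^ j / lam n ^ n) 0 (cutpow n (S j) (lam n * y) * lam n ^ (S j) / lam n ^ n) 0 x y z).
    { eapply diff3_eq. apply (diff3_comp (fun q _ _ => cutpow n j (lam n * q) * lam n ^ j / lam n ^ n) (fun _ y _ => y) (fun _ _ _ => 0) (fun _ _ _ => 0)).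
      apply (diff3_of_derive (fun q => cutpow n j (lam n * q) * lam n ^ j / lam n ^ n) (cutpow n (S j) (lam n * y) * lam n ^ (S j) / lam n ^ n)).
      2: apply diff3_snd. 2: apply (diff3_const 0). 2: apply (diff3_const 0). 2,3,4: ring.
      pose proof (cutpow_derive n j (lam n * y)) as C.
      apply is_derive_ext with (fun q => (lam n ^ j / lam n ^ n) * cutpow n j (lam n * q)). intros; simpl; field; lra.
      evar_last. apply is_derive_scal. apply (is_derive_comp (cutpow n j) (fun q => lam n * q)). exact C. auto_derive; auto.
      unfold scal; simpl; unfold mult; simpl. field. lra. }
    eapply diff3_eq. unfold T. apply (diff3_mul (fun x _ _ => c n i x) (fun _ y _ => cutpow n j (lam n * y) * lam n ^ j / lam n ^ n)).
    apply (diff3_of_derive (c n i)). apply Hc; lra. exact E2. all: unfold T; ring. }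
  exists (fun i j x y => Series (fun n => T i j n x y)). split.
  - intros i j x y z Hx. apply diff3_Series with (N := S (S (i + j))) (r := r/2 - Rabs x); [lra| | |].
    + intros n. now apply TD.
    + intros n Hn. split; apply TB; auto; lia.
    + intros n x' y' Hn Hx'.
      assert (Hb : Rabs x' < r/2). { replace x' with ((x' - x) + x) by ring. eapply Rle_lt_trans; [apply Rabs_triang|]. lra. }
      assert (Hb' : forall t, Rmin x x' <= t <= Rmax x x' -> Rabs t < r/2).
      { intros t Ht. apply Rabs_lt_between in Hx. apply Rabs_lt_between in Hb. apply Rabs_lt_between.
        unfold Rmin, Rmax in Ht. destruct (Rle_dec x x'); lra. }
      split. apply TB; auto; lia.
      destruct (mvt (fun s => T i j n s y') (fun s => T (S i) j n s y') x x') as [e [He Ee]].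
      { intros t Ht. apply (diff3_is_D _ _ _ _ _ _ _ (TD i j n t y' 0 (Hb' t Ht))). }
      destruct (mvt (fun s => T i j n x s) (fun s => T i (S j) n x s) y y') as [f [Hf Ef]].
      { intros t Ht. apply (diff3_is_D _ _ _ _ _ _ _ (TD i j n x t 0 Hx)). }
      cbv beta in Ee, Ef. replace (T i j n x' y' - T i j n x y) with ((T i j n x' y' - T i j n x y') + (T i j n x y' - T i j n x y)) by ring.
      rewrite Ee, Ef. eapply Rle_trans; [apply Rabs_triang|]. rewrite !Rabs_mult.
      pose proof (TB (S i) j n e y' ltac:(lia) ltac:(lia) (Hb' e He)). pose proof (TB i (S j) n x f ltac:(lia) ltac:(lia) Hx).
      pose proof (Rabs_pos (x'-x)); pose proof (Rabs_pos (y'-y)). nra.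
  - intros i j x Hx.
    assert (E : forall n, T i j n x 0 = if Nat.eq_dec n j then INR (fact j) * c j i x else 0).
    { intros n. unfold T. rewrite Rmult_0_r, cutpow_0. destruct (Nat.eq_dec n j) as [->|]; [|unfold Rdiv; ring].
      field. pose proof (Hlam j). apply pow_nonzero; lra. }
    rewrite (Series_ext _ _ E).
    assert (Z : forall k, (j < k)%nat -> (if Nat.eq_dec k j then INR (fact j) * c j i x else 0) = 0) by (intros k Hk; destruct (Nat.eq_dec k j); [lia|auto]).
    rewrite (Series_incr_n _ (S j)).
    + rewrite (Series_ext _ (fun _ => 0)). 2:{ intros k. apply Z. lia. }
      replace (Series (fun _ => 0)) with 0 by (rewrite (Series_ext _ (fun n => 0 * 0)) by (intros; ring); rewrite Series_scal_l; ring). rewrite Rplus_0_r. simpl pred.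
      assert (P : forall m, (m < j)%nat -> sum_f_R0 (fun k => if Nat.eq_dec k j then INR (fact j) * c j i x else 0) m = 0).
      { induction m as [|m IH]; intros Hm; cbn [sum_f_R0].
        - destruct (Nat.eq_dec 0 j); [lia|auto].
        - rewrite IH by lia. destruct (Nat.eq_dec (S m) j); [lia|ring]. }
      destruct j as [|j]; cbn [sum_f_R0]. reflexivity. rewrite P by lia. destruct (Nat.eq_dec (S j) (S j)); [ring|lia].
    + lia.
    + apply (ex_series_ev _ (S j)). intros n Hn. rewrite Z by lia. rewrite Rabs_R0. apply pow_le; lra.
Qed.

(** * Whitney's theorem on even functions, with a parameter *)

(** Parity s = 1 or -1 is kept on a fixed square, because the operators below are iterated infinitely often. *)
Definition parity_on (r s : R) (f : R -> R -> R) : Prop :=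
  forall u w, Rabs u < r -> Rabs w < r -> sm2 f u w /\ f u (- w) = s * f u w.

Lemma parity_d2 r s f : parity_on r s f -> parity_on r (- s) (d2 f).
Proof.
  intros H u w Hu Hw. destruct (H u w Hu Hw) as [S _]. split. now apply sm2_d.
  destruct (H u (-w) Hu ltac:(now rewrite Rabs_Ropp)) as [S' _].
  assert (D1 : is_derive (fun t => f u (- t)) w (- d2 f u (- w))).
  { evar_last. apply (sm2_chain f (fun _ => u) (fun t => - t) u (- w) 0 (-1) w); auto; auto_derive; auto. simpl; ring. }
  assert (D2' : is_derive (fun t => s * f u t) w (s * d2 f u w)) by (apply is_derive_scal, sm2_derive2; auto).
  assert (E : - d2 f u (- w) = s * d2 f u w).
  { rewrite <- (is_derive_unique _ _ _ D1), <- (is_derive_unique _ _ _ D2').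
    apply Derive_ext_loc. destruct (abs_open 0 r w ltac:(now rewrite Rminus_0_r)) as (d & Hd & K).
    exists (mkposreal d Hd). intros t Ht. apply H; auto. specialize (K t Ht). now rewrite Rminus_0_r in K. }
  lra.
Qed.

(** The operator f |-> f_w / (2 w) on functions that are even in w: it is differentiation with respect to q = w^2, and
    it is smooth because f_w is odd. *)
Definition evenT (f : R -> R -> R) u w := / 2 * hquot (fun _ => 0) (d2 f) u w.

Lemma abs_scale t w r : 0 <= t <= 1 -> Rabs w < r -> Rabs (0 + t * (w - 0)) < r.
Proof.
  intros Ht Hw. replace (0 + t * (w - 0)) with (t * w) by ring. rewrite Rabs_mult, (Rabs_pos_eq t) by lra. pose proof (Rabs_pos w). nra.
Qed.

Lemma evenT_parity r f : parity_on r 1 f -> parity_on r 1 (evenT f).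
Proof.
  intros H. pose proof (parity_d2 _ _ _ H) as H1. pose proof (parity_d2 _ _ _ H1) as H2.
  intros u w Hu Hw. split.
  - assert (S : sm2 (hquot (fun _ => 0) (d2 f)) u w).
    { apply hquot_sm. sms. intros t Ht. apply H1; auto. now apply abs_scale. }
    unfold evenT. sms.
  - unfold evenT, hquot. rewrite Rmult_1_l. f_equal. apply RInt_ext. intros t Ht.
    rewrite Rmin_left, Rmax_right in Ht by lra.
    replace (0 + t * (- w - 0)) with (- (0 + t * (w - 0))) by ring.
    destruct (H2 u (0 + t * (w - 0)) Hu ltac:(apply abs_scale; auto; lra)) as [_ E].
    rewrite !Ropp_involutive, Rmult_1_l in E. exact E.
Qed.

Lemma evenT_eq r f u w : parity_on r 1 f -> Rabs u < r -> Rabs w < r -> d2 f u w = 2 * w * evenT f u w.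
Proof.
  intros H Hu Hw. pose proof (parity_d2 _ _ _ H) as H1. unfold evenT.
  rewrite (hquot_eq (fun _ => 0) (d2 f) u w).
  - assert (Z : d2 f u 0 = 0).
    { assert (H0 : Rabs 0 < r) by (rewrite Rabs_R0; pose proof (Rabs_pos u); lra). destruct (H1 u 0 Hu H0) as [_ E]. rewrite Ropp_0 in E. lra. }
    rewrite Z. field.
  - intros t Ht. apply H1; auto. now apply abs_scale.
Qed.

Fixpoint Di (i : nat) (f : R -> R -> R) := match i with O => f | S i => d1 (Di i f) end.
Fixpoint Tn (n : nat) (f : R -> R -> R) := match n with O => f | S n => evenT (Tn n f) end.

Lemma Tn_parity r f n : parity_on r 1 f -> parity_on r 1 (Tn n f).
Proof. intros H. induction n as [|n IH]; simpl; auto. now apply evenT_parity. Qed.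

Lemma Di_sm r f i : (forall u w, Rabs u < r -> Rabs w < r -> sm2 f u w) -> forall u w, Rabs u < r -> Rabs w < r -> sm2 (Di i f) u w.
Proof. intros H. induction i as [|i IH]; simpl; auto. intros. now apply sm2_d1, IH. Qed.

Lemma square_near r u w : Rabs u < r -> Rabs w < r -> locally_2d (fun u w => Rabs u < r /\ Rabs w < r) u w.
Proof.
  intros Hu Hw. destruct (abs_open 0 r u ltac:(now rewrite Rminus_0_r)) as (d & Hd & K).
  destruct (abs_open 0 r w ltac:(now rewrite Rminus_0_r)) as (e & He & L).
  exists (mkposreal (Rmin d e) ltac:(now apply Rmin_pos)). simpl. intros a b A B.
  pose proof (Rmin_l d e). pose proof (Rmin_r d e). specialize (K a ltac:(lra)). specialize (L b ltac:(lra)).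
  rewrite Rminus_0_r in K, L. auto.
Qed.

(** The operators d/du and d/dq commute, since mixed partial derivatives do. *)
Lemma Di_Tn_d2 r f i n u w : parity_on r 1 f -> Rabs u < r -> Rabs w < r ->
  d2 (Di i (Tn n f)) u w = 2 * w * Di i (Tn (S n) f) u w.
Proof.
  intros H. pose proof (Tn_parity r f n H) as P. pose proof (Tn_parity r f (S n) H) as P'.
  revert u w. induction i as [|i IH]; intros u w Hu Hw.
  - simpl. now apply (evenT_eq r).
  - cbn [Di]. rewrite <- sm2_Schwarz by (apply (Di_sm r); auto; apply P).
    assert (E : locally_2d (fun u w => d2 (Di i (Tn n f)) u w = 2 * w * Di i (Tn (S n) f) u w) u w).
    { apply (locally_2d_mp _ _ _ _ (square_near r u w Hu Hw)). intros a b [A B]. now apply IH. }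
    destruct (d_ext _ _ _ _ E) as [-> _]. unfold d1 at 1. apply is_derive_unique.
    apply is_derive_ext with (fun t => (2 * w) * Di i (Tn (S n) f) t w). auto.
    apply is_derive_scal. apply sm2_derive1. apply (Di_sm r); auto. apply P'.
Qed.

Lemma sqrt_lt_of_sq q d : 0 <= q -> 0 < d -> q < d * d -> sqrt q < d.
Proof. intros Hq Hd H. rewrite <- (sqrt_square d) by lra. apply sqrt_lt_1; nra. Qed.

(** On q >= 0 the function G(u, q) = E(u, sqrt q) has the derivatives EF i n(u, sqrt q), whose limits at q = 0 are EF
    i n(u, 0). On q < 0 a function with these derivatives at q = 0 is supplied by Borel's theorem. The glued families
    are differentiable across q = 0 and are the partial derivatives of each other. *)
Theorem whitney_even E : sm2 E 0 0 -> locally_2d (fun u w => E u (- w) = E u w) 0 0 ->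
  exists G, sm2 G 0 0 /\ locally_2d (fun u w => E u w = G u (w ^ 2)) 0 0.
Proof.
  intros SE EE. destruct (locally_2d_and _ _ _ _ (sm2_near _ _ _ SE) EE) as [r H].
  assert (P : parity_on r 1 E).
  { intros u w Hu Hw. destruct (H u w) as [A B]; rewrite ?Rminus_0_r; auto. split; auto. rewrite B; ring. }
  clear H SE EE. pose proof (cond_pos r) as Hr.
  set (EF := fun i n => Di i (Tn n E)).
  assert (SF : forall i n u w, Rabs u < r -> Rabs w < r -> sm2 (EF i n) u w).
  { intros i n. apply Di_sm. intros. apply (Tn_parity r E n P); auto. }
  assert (DF : forall i n u w, Rabs u < r -> Rabs w < r -> d2 (EF i n) u w = 2 * w * EF i (S n) u w) by (intros; now apply (Di_Tn_d2 r)).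
  assert (R0 : Rabs 0 < r) by (rewrite Rabs_R0; auto).
  destruct (borel (fun n i u => EF i n u 0 / INR (fact n)) r Hr) as (S & DS & S0).
  { intros n i u Hu. apply is_derive_ext with (fun t => / INR (fact n) * EF i n t 0). intros; apply Rmult_comm.
    replace (EF (S i) n u 0 / INR (fact n)) with (/ INR (fact n) * EF (S i) n u 0) by apply Rmult_comm.
    apply is_derive_scal. apply (sm2_derive1 (EF i n)). now apply SF. }
  assert (S0' : forall i j x, Rabs x < r / 2 -> S i j x 0 = EF i j x 0).
  { intros. rewrite S0 by auto. field. apply INR_fact_neq_0. }
  set (G := fun i n u q => if Rle_dec 0 q then EF i n u (sqrt q) else S i n u q).
  (* r/2 is the range of Borel's theorem, and q < r^2 means sqrt q < r *)
  set (rho := Rmin (r/2) (r*r)).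
  assert (Hrho : 0 < rho /\ rho <= r/2 /\ rho <= r*r) by (unfold rho; split; [apply Rmin_pos; nra|split; [apply Rmin_l|apply Rmin_r]]).
  assert (DG : forall i n u q z, Rabs u < rho -> Rabs q < rho -> diff3 (fun u q _ => G i n u q) (G (Datatypes.S i) n u q) (G i (Datatypes.S n) u q) 0 u q z).
  { intros i n u q z Hu Hq. assert (Hu' : Rabs u < r) by lra.
    destruct (Rtotal_order q 0) as [Hq0|[->|Hq0]].
    - apply diff3_ext with (fun u q _ => S i n u q).
      { exists (- q). split; [lra|]. intros u' q' _ _ Hq' _. apply Rabs_lt_between in Hq'. unfold G. destruct (Rle_dec 0 q'); auto; lra. }
      unfold G. destruct (Rle_dec 0 q); [lra|]. apply DS; lra.
    - unfold G at 2 3. destruct (Rle_dec 0 0) as [_|]; [|lra]. rewrite sqrt_0.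
      intros eps He. pose proof (DS i n u 0 z ltac:(lra) eps He) as N1. rewrite !S0' in N1 by lra.
      pose proof (sm2_diff _ _ _ z (SF i n u 0 Hu' R0) eps He) as N2.
      pose proof (sm_cont _ _ _ _ (SF i (Datatypes.S n) u 0 Hu' R0) eps He) as N3.
      destruct N2 as [a2 [A2 N2]]. destruct N3 as [a3 [A3 N3]].
      assert (N4 : near (fun u' q' _ => Rabs (u' - u) < Rmin a2 a3 /\ Rabs u' < r /\ Rabs q' < r * r /\ Rabs q' < a3 * a3) u 0 z).
      { destruct (abs_open 0 r u ltac:(now rewrite Rminus_0_r)) as (d & Hd & K).
        exists (Rmin (Rmin a2 a3) (Rmin d (Rmin (r*r) (a3*a3)))). split. { repeat apply Rmin_pos; nra. }
        intros u' q' z' U Q _. rewrite Rminus_0_r in Q.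
        pose proof (Rmin_l (Rmin a2 a3) (Rmin d (Rmin (r*r) (a3*a3)))). pose proof (Rmin_r (Rmin a2 a3) (Rmin d (Rmin (r*r) (a3*a3)))).
        pose proof (Rmin_l d (Rmin (r*r) (a3*a3))). pose proof (Rmin_r d (Rmin (r*r) (a3*a3))). pose proof (Rmin_l (r*r) (a3*a3)). pose proof (Rmin_r (r*r) (a3*a3)).
        specialize (K u' ltac:(lra)). rewrite Rminus_0_r in K. repeat split; lra. }
      generalize (near_and _ _ _ _ _ N1 N4). apply near_imp. intros u' q' z' [B1 (B2 & B3 & B4 & B5)].
      pose proof (Rmin_l a2 a3). pose proof (Rmin_r a2 a3).
      unfold G. destruct (Rle_dec 0 q') as [Hq'|Hq'].
      2:{ destruct (Rle_dec 0 0); [|lra]. rewrite sqrt_0. exact B1. }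
      destruct (Rle_dec 0 0); [|lra]. rewrite sqrt_0, Rminus_0_r.
      rewrite (Rabs_pos_eq q') in * by auto.
      (* the mean value theorem in q avoids the singularity of the square root at 0 *)
      assert (MV : exists c, 0 <= c <= q' /\ EF i n u' (sqrt q') - EF i n u' 0 = EF i (Datatypes.S n) u' (sqrt c) * q').
      { destruct (MVT_gen (fun q => EF i n u' (sqrt q)) 0 q' (fun q => EF i (Datatypes.S n) u' (sqrt q))) as [c [Hc Ec]].
        - rewrite Rmin_left, Rmax_right by lra. intros t Ht.
          assert (Q : Rabs (sqrt t) < r) by (rewrite Rabs_pos_eq by apply sqrt_pos; apply sqrt_lt_of_sq; lra).
          pose proof (sqrt_lt_R0 t ltac:(lra)).
          evar_last. apply (sm2_chain (EF i n) (fun _ => u') sqrt u' (sqrt t) 0 (/ (2 * sqrt t)) t); auto.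
          auto_derive; auto. auto_derive. lra. field; lra. simpl. rewrite DF by auto. field. lra.
        - rewrite Rmin_left, Rmax_right by lra. intros t Ht.
          assert (Q : Rabs (sqrt t) < r) by (rewrite Rabs_pos_eq by apply sqrt_pos; apply sqrt_lt_of_sq; lra).
          apply (continuity_pt_comp sqrt (EF i n u')). apply continuity_pt_sqrt; lra.
          apply derivable_continuous_pt. exists (d2 (EF i n) u' (sqrt t)). apply is_derive_Reals. now apply sm2_derive2, SF.
        - rewrite Rmin_left, Rmax_right in Hc by lra. exists c. split; auto. rewrite sqrt_0, Rminus_0_r in Ec. exact Ec. }
      destruct MV as [c [Hc Ec]].
      assert (Qc : Rabs (sqrt c - 0) < a3) by (rewrite Rminus_0_r, Rabs_pos_eq by apply sqrt_pos; apply sqrt_lt_of_sq; lra).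
      specialize (N3 u' (sqrt c) 0 ltac:(lra) Qc ltac:(rewrite Rminus_diag, Rabs_R0; auto)).
      specialize (N2 u' 0 z ltac:(lra) ltac:(rewrite Rminus_diag, Rabs_R0; auto) ltac:(rewrite Rminus_diag, Rabs_R0; auto)).
      rewrite !Rminus_diag, Rabs_R0 in N2. change (d1 (EF i n) u 0) with (EF (Datatypes.S i) n u 0) in N2.
      replace (EF i n u' (sqrt q') - EF i n u 0 - (EF (Datatypes.S i) n u 0 * (u' - u) + EF i (Datatypes.S n) u 0 * q' + 0 * (z' - z)))
       with ((EF i n u' 0 - EF i n u 0 - (EF (Datatypes.S i) n u 0 * (u' - u) + d2 (EF i n) u 0 * 0 + 0 * 0))
         + (EF i (Datatypes.S n) u' (sqrt c) - EF i (Datatypes.S n) u 0) * q') by (rewrite Rmult_minus_distr_r, <- Ec; ring).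
      eapply Rle_trans; [apply Rabs_triang|]. rewrite Rabs_mult, (Rabs_pos_eq q') by auto.
      pose proof (Rabs_pos (z'-z)). nra.
    - assert (Q : Rabs (sqrt q) < r) by (rewrite Rabs_pos_eq by apply sqrt_pos; apply sqrt_lt_of_sq; try lra; rewrite Rabs_pos_eq in Hq; lra).
      pose proof (sqrt_lt_R0 q Hq0).
      apply diff3_ext with (fun u q _ => EF i n u (sqrt q)).
      { exists q. split; [lra|]. intros u' q' _ _ Hq' _. apply Rabs_lt_between in Hq'. unfold G. destruct (Rle_dec 0 q'); auto; lra. }
      unfold G. destruct (Rle_dec 0 q); [|lra].
      eapply diff3_eq. apply (diff3_comp (fun u w _ => EF i n u w) (fun u _ _ => u) (fun _ q _ => sqrt q) (fun _ _ _ => 0)).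
      apply sm2_diff. now apply SF. apply diff3_fst.
      apply (diff3_comp (fun q _ _ => sqrt q) (fun _ q _ => q) (fun _ _ _ => 0) (fun _ _ _ => 0)).
      apply (diff3_of_derive sqrt (/ (2 * sqrt q))). auto_derive. lra. field; lra. apply diff3_snd. apply (diff3_const 0). apply (diff3_const 0). apply (diff3_const 0).
      change (d1 (EF i n) u (sqrt q)) with (EF (Datatypes.S i) n u (sqrt q)). ring. rewrite DF by auto. field. lra. ring. }
  exists (G 0%nat 0%nat). split.
  - exists rho. split; [tauto|]. intros n.
    apply (Cn_family (nat * nat) (fun p u q _ => G (fst p) (snd p) u q) (fun p => (Datatypes.S (fst p), snd p)) (fun p => (fst p, Datatypes.S (snd p))) (Box 0 0 0 rho) (Box_open _ _ _ _)) with (i := (0%nat, 0%nat)).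
    intros [i j] x y z (Hx & Hy & _). simpl. rewrite Rminus_0_r in Hx, Hy. now apply DG.
  - exists r. intros u w Hu Hw. rewrite Rminus_0_r in Hu, Hw. unfold G.
    destruct (Rle_dec 0 (w^2)) as [_|N]; [|pose proof (pow2_ge_0 w); lra].
    replace (w^2) with (Rsqr w) by (unfold Rsqr; ring). rewrite sqrt_Rsqr_abs.
    change (E u w = E u (Rabs w)). destruct (Rle_dec 0 w).
    + now rewrite Rabs_pos_eq.
    + rewrite Rabs_left by lra. destruct (P u w Hu Hw) as [_ ->]. ring.
Qed.

(** The even part is covered directly; the odd part vanishes for w = 0, and its quotient by w is even. *)
Theorem whitney f : sm2 f 0 0 -> exists A B, sm2 A 0 0 /\ sm2 B 0 0 /\
  locally_2d (fun u w => f u w = A u (w ^ 2) + w * B u (w ^ 2)) 0 0.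
Proof.
  intros Sf.
  assert (Sm : sm2 (fun u w => f u (- w)) 0 0) by sms.
  destruct (whitney_even (fun u w => (f u w + f u (- w)) / 2)) as (A & SA & EA).
  { sms. }
  { apply locally_2d_forall. intros u w. rewrite Ropp_involutive. field. }
  destruct (hadamard (fun u w => (f u w - f u (- w)) / 2) (fun _ => 0) 0 0) as (h & Sh & Eh & _); auto.
  { sms. } { sms. }
  assert (Eh' : locally_2d (fun u w => (f u (- w) - f u (- - w)) / 2 = (f u 0 - f u (- 0)) / 2 + (- w - 0) * h u (- w)) 0 0).
  { apply (locally_2d_pull (fun x y => (f x y - f x (- y)) / 2 = (f x 0 - f x (- 0)) / 2 + (y - 0) * h x y) (fun u _ => u) (fun _ w => - w) 0 0 ltac:(sms) ltac:(sms)). rewrite Ropp_0 in *. exact Eh. }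
  destruct (whitney_even h Sh) as (B & SB & EB).
  { apply (locally_2d_mp2 _ _ _ _ _ Eh Eh'). intros u w E1 E2. cbv beta in *. rewrite Ropp_involutive in E2. rewrite ?Ropp_0 in *.
    destruct (Req_dec w 0) as [->|Hw]. now rewrite Ropp_0. apply Rmult_eq_reg_l with w; auto. lra. }
  exists A, B. split; [|split]; auto. apply (locally_2d_mp3 _ _ _ _ _ _ EA EB Eh). intros u w E1 E2 E3. cbv beta in *.
  rewrite <- E1, <- E2. rewrite ?Ropp_0 in E3. lra.
Qed.

Corollary whitney_1 f : sm1 f 0 -> exists A B, sm1 A 0 /\ sm1 B 0 /\
  locally 0 (fun w => f w = A (w ^ 2) + w * B (w ^ 2)).
Proof.
  intros Sf. destruct (whitney (fun _ w => f w)) as (A & B & SA & SB & E). sms.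
  exists (A 0), (B 0). split; [sms|split; [sms|]]. apply (locally_2d_1d_const_x _ 0 0 E).
Qed.

(** * Diffeomorphism germs and A-equivalence *)

Definition at0 (P : R * R -> Prop) : Prop := locally_2d (fun x y => P (x, y)) 0 0.
Definition c1 (phi : R * R -> R * R) x y := fst (phi (x, y)).
Definition c2 (phi : R * R -> R * R) x y := snd (phi (x, y)).

Lemma smooth_map_germ_iff phi : smooth_map_germ phi <-> phi (0,0) = (0,0) /\ sm2 (c1 phi) 0 0 /\ sm2 (c2 phi) 0 0.
Proof.
  split; intros (A & B & C); split; auto; split; first [now apply smooth_germ_sm2 | now apply sm2_smooth_germ].
Qed.

Lemma at0_pull phi P : smooth_map_germ phi -> at0 P -> at0 (fun p => P (phi p)).
Proof.
  intros H HP. apply smooth_map_germ_iff in H. destruct H as (E & S1 & S2).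
  assert (L : locally_2d (fun x y => P (c1 phi x y, c2 phi x y)) 0 0).
  { apply (locally_2d_pull (fun x y => P (x, y)) (c1 phi) (c2 phi)); auto. unfold c1, c2. rewrite E. exact HP. }
  apply (locally_2d_mp _ _ _ _ L). intros x y K. unfold c1, c2 in K. now rewrite <- surjective_pairing in K.
Qed.

Lemma smooth_map_germ_comp phi psi : smooth_map_germ phi -> smooth_map_germ psi -> smooth_map_germ (fun p => psi (phi p)).
Proof.
  rewrite !smooth_map_germ_iff. intros (E & S1 & S2) (E' & S1' & S2').
  assert (A1 : c1 phi 0 0 = 0) by (unfold c1; rewrite E; auto). assert (A2 : c2 phi 0 0 = 0) by (unfold c2; rewrite E; auto).
  split; [congruence|]. split.
  - apply sm2_ext with (fun x y => c1 psi (c1 phi x y) (c2 phi x y)).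
    + apply locally_2d_forall. intros. unfold c1, c2. now rewrite <- surjective_pairing.
    + sms.
  - apply sm2_ext with (fun x y => c2 psi (c1 phi x y) (c2 phi x y)).
    + apply locally_2d_forall. intros. unfold c1, c2. now rewrite <- surjective_pairing.
    + sms.
Qed.

Lemma diffeo_germ_comp phi psi : diffeo_germ phi -> diffeo_germ psi -> diffeo_germ (fun p => psi (phi p)).
Proof.
  intros (S & phi' & S' & L & K) (T & psi' & T' & M & N). split. now apply smooth_map_germ_comp.
  exists (fun p => phi' (psi' p)). split. now apply smooth_map_germ_comp. split.
  - pose proof (at0_pull phi (fun p => psi' (psi p) = p) S M) as M'.
    apply (locally_2d_mp2 _ _ _ _ _ L M'). intros u v E1 E2. simpl in *. now rewrite E2.
  - pose proof (at0_pull psi' (fun p => phi (phi' p) = p) T' K) as K'.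
    apply (locally_2d_mp2 _ _ _ _ _ N K'). intros u v E1 E2. simpl in *. now rewrite E2.
Qed.

Lemma A_equivalent_trans f g h : A_equivalent f g -> A_equivalent g h -> A_equivalent f h.
Proof.
  intros (p1 & p2 & D1 & D2 & E) (q1 & q2 & D1' & D2' & E').
  exists (fun p => q1 (p1 p)), (fun p => q2 (p2 p)). split; [now apply diffeo_germ_comp|]. split; [now apply diffeo_germ_comp|].
  pose proof (at0_pull p1 (fun p => q2 (g p) = h (q1 p)) (proj1 D1) E') as L.
  apply (locally_2d_mp2 _ _ _ _ _ E L). intros u v A B. simpl in *. now rewrite A.
Qed.

(** That f fixes the origin is needed to pull the inverse of the target diffeomorphism back to the source. *)
Lemma A_equivalent_sym f g : smooth_map_germ f -> A_equivalent f g -> A_equivalent g f.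
Proof.
  intros Sf (p1 & p2 & (S1 & q1 & T1 & L1 & K1) & (S2 & q2 & T2 & L2 & K2) & E).
  exists q1, q2. split. { split; auto. exists p1; auto. } split. { split; auto. exists p2; auto. }
  pose proof (at0_pull q1 (fun p => p2 (f p) = g (p1 p)) T1 E) as E'.
  pose proof (at0_pull q1 (fun p => q2 (p2 (f p)) = f p) T1 (at0_pull f (fun p => q2 (p2 p) = p) Sf L2)) as M.
  apply (locally_2d_mp3 _ _ _ _ _ _ K1 E' M). intros u v A B C. simpl in *. now rewrite <- C, B, A.
Qed.

(** The form to which every map germ of corank at most 1 can be brought; here the germs have it from the beginning.
    Its Jacobian is d2 F. *)
Definition corank1 (F : R -> R -> R) : R * R -> R * R := fun '(u, v) => (u, F u v).

Lemma corank1_smooth F : sm2 F 0 0 -> F 0 0 = 0 -> smooth_map_germ (corank1 F).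
Proof. intros S E. apply smooth_map_germ_iff. split; [simpl; now rewrite E|]. split; [unfold c1; simpl; sms|exact S]. Qed.

(** The implicit function theorem for h(z) = x; uniqueness of the solution makes the inverse two-sided. *)
Lemma inverse_germ h : sm1 h 0 -> h 0 = 0 -> Derive h 0 <> 0 ->
  exists k, sm1 k 0 /\ k 0 = 0 /\ locally 0 (fun x => h (k x) = x) /\ locally 0 (fun x => k (h x) = x).
Proof.
  intros S E D. destruct (implicit_function (fun x _ z => h z - x) 0 0 0) as (phi & S' & P0 & L & U).
  - sms.
  - rewrite E. ring.
  - unfold D3. rewrite (is_derive_unique _ _ (Derive h 0)); auto. pose proof (sm1_derive h 0 S).
    evar_last. apply (is_derive_minus (V := R_NormedModule)). exact H. apply (is_derive_const (V := R_NormedModule)). unfold minus, plus, opp, zero; simpl; ring.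
  - exists (fun x => phi x 0). split; [sms|]. split; [auto|]. split.
    + apply (locally_mp _ _ _ (locally_2d_1d_const_y _ 0 0 L)). intros x K. lra.
    + pose proof (near_pull (fun x y z => h z - x = 0 -> z = phi x y) (fun x _ _ => h x) (fun _ _ _ => 0) (fun x _ _ => x) 0 0 0 (sm_cont _ _ _ _ S) (sm_cont _ _ _ _ (sm_const _ _ _ _)) (sm_cont _ _ _ _ (sm_fst _ _ _))) as N.
      cbv beta in N. rewrite E in N. specialize (N U). cbv beta in N.
      apply (near_locally (fun x => h x - h x = 0 -> x = phi (h x) 0) 0 0 0) in N.
      apply (locally_mp _ _ _ N). intros x K. symmetry. apply K. ring.
Qed.

(** Coordinate changes of this kind suffice for all reductions, and they are inverted one variable at a time. *)
Lemma triangular_diffeo h Y : sm1 h 0 -> h 0 = 0 -> Derive h 0 <> 0 -> sm2 Y 0 0 -> Y 0 0 = 0 -> d2 Y 0 0 <> 0 ->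
  diffeo_germ (fun '(u, v) => (h u, Y u v)).
Proof.
  intros Sh h0 Dh SY Y0 DY. destruct (inverse_germ h Sh h0 Dh) as (k & Sk & k0 & L & K).
  destruct (implicit_function (fun x y w => Y (k x) w - y) 0 0 0) as (W & SW & W0 & LW & UW).
  - sms.
  - rewrite k0, Y0. ring.
  - unfold D3. rewrite k0. rewrite (is_derive_unique _ _ (d2 Y 0 0)); auto. pose proof (sm2_derive2 Y 0 0 SY).
    evar_last. apply (is_derive_minus (V := R_NormedModule)). exact H. apply (is_derive_const (V := R_NormedModule)). unfold minus, plus, opp, zero; simpl; ring.
  - split. { apply smooth_map_germ_iff. split; [simpl; now rewrite h0, Y0|]. split; unfold c1, c2; simpl; sms. }
    exists (fun '(x, y) => (k x, W x y)). split. { apply smooth_map_germ_iff. split; [simpl; now rewrite k0, W0|]. split; unfold c1, c2; simpl; sms. }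
    split.
    + pose proof (near_pull (fun x y w => Y (k x) w - y = 0 -> w = W x y) (fun u _ _ => h u) (fun u v _ => Y u v) (fun _ v _ => v) 0 0 0
        ltac:(apply sm_cont; sms) ltac:(apply sm_cont; sms) ltac:(apply sm_cont; sms)) as N.
      cbv beta in N. rewrite h0, Y0 in N. specialize (N UW).
      apply (near_locally_2d (fun u v => Y (k (h u)) v - Y u v = 0 -> v = W (h u) (Y u v)) 0 0 0) in N.
      assert (K' : locally_2d (fun u v => k (h u) = u) 0 0) by (now apply locally_2d_fst).
      apply (locally_2d_mp2 _ _ _ _ _ N K'). intros u v A B. rewrite <- A; rewrite B; auto. ring.
    + assert (L' : locally_2d (fun u v => h (k u) = u) 0 0) by (now apply locally_2d_fst).
      apply (locally_2d_mp2 _ _ _ _ _ L' LW). intros u v A B. rewrite A. f_equal. lra.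
Qed.

(** The equation Z(u, F) = F0(h, Y) is the second component of the equivalence; the first one is h = h. *)
Lemma A_equivalent_fibred F F0 h Z Y :
  sm1 h 0 -> h 0 = 0 -> Derive h 0 <> 0 -> sm2 Y 0 0 -> Y 0 0 = 0 -> d2 Y 0 0 <> 0 ->
  sm2 Z 0 0 -> Z 0 0 = 0 -> d2 Z 0 0 <> 0 ->
  locally_2d (fun u v => Z u (F u v) = F0 (h u) (Y u v)) 0 0 -> A_equivalent (corank1 F) (corank1 F0).
Proof.
  intros. exists (fun '(u, v) => (h u, Y u v)), (fun '(u, v) => (h u, Z u v)).
  split; [now apply triangular_diffeo|]. split; [now apply triangular_diffeo|].
  apply (locally_2d_mp _ _ _ _ H8). intros u v E. simpl. now rewrite E.
Qed.

Lemma A_equivalent_eq F F0 : locally_2d (fun u v => F u v = F0 u v) 0 0 -> A_equivalent (corank1 F) (corank1 F0).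
Proof.
  intros H. assert (D : d2 (fun _ v => v) 0 0 <> 0) by (unfold d2; rewrite Derive_id; lra).
  apply (A_equivalent_fibred F F0 (fun u => u) (fun _ v => v) (fun _ v => v)); auto; try sms; try (rewrite Derive_id; lra).
Qed.

Lemma A_equivalent_source F F0 Y : sm2 Y 0 0 -> Y 0 0 = 0 -> d2 Y 0 0 <> 0 ->
  locally_2d (fun u v => F u v = F0 u (Y u v)) 0 0 -> A_equivalent (corank1 F) (corank1 F0).
Proof.
  intros. assert (D : d2 (fun _ v => v) 0 0 <> 0) by (unfold d2; rewrite Derive_id; lra).
  apply (A_equivalent_fibred F F0 (fun u => u) (fun _ v => v) Y); auto; try sms; try (rewrite Derive_id; lra).
Qed.

Lemma d_comp F g h x y a b : sm2 F a b -> g x y = a -> h x y = b -> sm2 g x y -> sm2 h x y ->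
  d1 (fun x y => F (g x y) (h x y)) x y = d1 F a b * d1 g x y + d2 F a b * d1 h x y /\
  d2 (fun x y => F (g x y) (h x y)) x y = d1 F a b * d2 g x y + d2 F a b * d2 h x y.
Proof.
  intros SF <- <- Sg Sh. split; apply is_derive_unique.
  - apply (sm2_chain F (fun t => g t y) (fun t => h t y)); auto; now apply sm2_derive1.
  - apply (sm2_chain F (fun t => g x t) (fun t => h x t)); auto; now apply sm2_derive2.
Qed.

Lemma d_fst x y : d1 (fun x _ => x) x y = 1 /\ d2 (fun x _ => x) x y = 0.
Proof. unfold d1, d2. rewrite Derive_id, Derive_const. auto. Qed.
Lemma d_snd x y : d1 (fun _ y => y) x y = 0 /\ d2 (fun _ y => y) x y = 1.
Proof. unfold d1, d2. rewrite Derive_id, Derive_const. auto. Qed.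

(** All that is used of a diffeomorphism in the necessity proofs: nonzero Jacobian determinant, by the chain rule for
    the inverse, and injectivity over the origin. *)
Lemma diffeo_germ_data phi : diffeo_germ phi -> exists a b,
  (forall u v, phi (u, v) = (a u v, b u v)) /\ sm2 a 0 0 /\ sm2 b 0 0 /\ a 0 0 = 0 /\ b 0 0 = 0 /\
  d1 a 0 0 * d2 b 0 0 - d2 a 0 0 * d1 b 0 0 <> 0 /\
  locally_2d (fun u v => a u v = 0 -> b u v = 0 -> u = 0 /\ v = 0) 0 0.
Proof.
  intros (S & psi & T & L & _). exists (c1 phi), (c2 phi).
  apply smooth_map_germ_iff in S. apply smooth_map_germ_iff in T. destruct S as (E & S1 & S2). destruct T as (E' & T1 & T2).
  assert (A1 : c1 phi 0 0 = 0) by (unfold c1; rewrite E; auto). assert (A2 : c2 phi 0 0 = 0) by (unfold c2; rewrite E; auto).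
  split. { intros. unfold c1, c2. apply surjective_pairing. }
  repeat (split; [assumption|]).
  assert (L1 : locally_2d (fun u v => c1 psi (c1 phi u v) (c2 phi u v) = u) 0 0).
  { apply (locally_2d_mp _ _ _ _ L). intros u v K. unfold c1, c2. rewrite <- surjective_pairing, K. auto. }
  assert (L2 : locally_2d (fun u v => c2 psi (c1 phi u v) (c2 phi u v) = v) 0 0).
  { apply (locally_2d_mp _ _ _ _ L). intros u v K. unfold c1, c2. rewrite <- surjective_pairing, K. auto. }
  split.
  - destruct (d_ext _ _ _ _ L1) as [X1 X2]. destruct (d_ext _ _ _ _ L2) as [X3 X4].
    destruct (d_comp (c1 psi) (c1 phi) (c2 phi) 0 0 0 0 T1 A1 A2 S1 S2) as [Y1 Y2].
    destruct (d_comp (c2 psi) (c1 phi) (c2 phi) 0 0 0 0 T2 A1 A2 S1 S2) as [Y3 Y4].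
    rewrite Y1, (proj1 (d_fst 0 0)) in X1. rewrite Y2, (proj2 (d_fst 0 0)) in X2. rewrite Y3, (proj1 (d_snd 0 0)) in X3. rewrite Y4, (proj2 (d_snd 0 0)) in X4.
    set (p := d1 (c1 psi) 0 0) in *. set (q := d2 (c1 psi) 0 0) in *. set (p' := d1 (c2 psi) 0 0) in *. set (q' := d2 (c2 psi) 0 0) in *.
    set (a := d1 (c1 phi) 0 0) in *. set (b := d2 (c1 phi) 0 0) in *. set (a' := d1 (c2 phi) 0 0) in *. set (b' := d2 (c2 phi) 0 0) in *.
    intros Z. assert ((p * q' - q * p') * (a * b' - b * a') = (p * a + q * a') * (p' * b + q' * b') - (p * b + q * b') * (p' * a + q' * a')) by ring.
    rewrite X1, X2, X3, X4, Z in H. lra.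
  - apply (locally_2d_mp2 _ _ _ _ _ L1 L2). intros u v B1 B2 H1 H2. rewrite H1, H2 in B1, B2.
    unfold c1, c2 in B1, B2. rewrite E' in B1, B2. simpl in *. auto.
Qed.

Lemma A_equivalent_data F F0 : A_equivalent (corank1 F) (corank1 F0) -> exists a b c d,
  sm2 a 0 0 /\ sm2 b 0 0 /\ a 0 0 = 0 /\ b 0 0 = 0 /\ d1 a 0 0 * d2 b 0 0 - d2 a 0 0 * d1 b 0 0 <> 0 /\
  locally_2d (fun u v => a u v = 0 -> b u v = 0 -> u = 0 /\ v = 0) 0 0 /\
  sm2 c 0 0 /\ sm2 d 0 0 /\ c 0 0 = 0 /\ d 0 0 = 0 /\ d1 c 0 0 * d2 d 0 0 - d2 c 0 0 * d1 d 0 0 <> 0 /\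
  locally_2d (fun u v => c u (F u v) = a u v /\ d u (F u v) = F0 (a u v) (b u v)) 0 0.
Proof.
  intros (p1 & p2 & D1 & D2 & L).
  destruct (diffeo_germ_data p1 D1) as (a & b & E1 & A1 & A2 & A3 & A4 & A5 & A6).
  destruct (diffeo_germ_data p2 D2) as (c & d & E2 & B1 & B2 & B3 & B4 & B5 & _).
  exists a, b, c, d. do 11 (split; [assumption|]).
  apply (locally_2d_mp _ _ _ _ L). intros u v K. simpl in K. rewrite E1, E2 in K. simpl in K. now inversion K.
Qed.

Lemma swap_diffeo : diffeo_germ (fun '(x, y) => (y, x)).
Proof.
  assert (S : smooth_map_germ (fun '(x, y) => (y, x))).
  { apply smooth_map_germ_iff. split; auto. split; unfold c1, c2; simpl; sms. }
  split; auto. exists (fun '(x, y) => (y, x)). split; auto. split; now apply locally_2d_forall.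
Qed.

(** Exchange of the source coordinates. *)
Lemma asymptotic_projection_corank1 f : A_equivalent (asymptotic_projection f) (corank1 (fun u v => f v u)).
Proof.
  exists (fun '(x, y) => (y, x)), (fun '(u, v) => (u, v)). split; [apply swap_diffeo|]. split.
  - assert (S : smooth_map_germ (fun '(x, y) => (x, y))).
    { apply smooth_map_germ_iff. split; auto. split; unfold c1, c2; simpl; sms. }
    split; auto. exists (fun '(x, y) => (x, y)). split; auto. split; now apply locally_2d_forall.
  - apply locally_2d_forall. auto.
Qed.

(** * Normal form of unfoldings of a cubic *)

(** Integrals of w^a k(u, w^2) in w, after the substitution that turns them into smooth functions of q = w^2. *)
Definition wint (a : nat) (k : R -> R -> R) u q := RInt (fun t => t ^ a * k u (q * t ^ 2)) 0 1.

Lemma sq_scale q r t : Rabs q < r -> 0 <= t <= 1 -> Rabs (q * t ^ 2) < r.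
Proof. intros Hq Ht. rewrite Rabs_mult, (Rabs_pos_eq (t^2)) by nra. pose proof (Rabs_pos q). assert (t^2 <= 1) by nra. apply Rle_lt_trans with (Rabs q * 1); [apply Rmult_le_compat_l; lra|lra]. Qed.

(** The differential equation expresses that w^(a+1) wint(u, w^2) is a primitive of w^a k(u, w^2). *)
Lemma wint_facts a k r u q : (forall u q, Rabs u < r -> Rabs q < r -> sm2 k u q) -> Rabs u < r -> Rabs q < r ->
  sm2 (wint a k) u q /\ d2 (wint a k) u q = wint (a + 2) (d2 k) u q /\
  (INR a + 1) * wint a k u q + 2 * q * d2 (wint a k) u q = k u q.
Proof.
  intros Hk Hu Hq.
  assert (Sg : forall t, 0 <= t <= 1 -> sm (fun u q t => t ^ a * k u (q * t ^ 2)) u q t).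
  { intros t Ht. pose proof (Hk u (q * t^2) Hu (sq_scale _ _ _ Hq Ht)). sms. }
  assert (Sg' : forall t, 0 <= t <= 1 -> sm (fun u q t => t ^ (a+2) * d2 k u (q * t ^ 2)) u q t).
  { intros t Ht. pose proof (Hk u (q * t^2) Hu (sq_scale _ _ _ Hq Ht)). sms. }
  assert (D : d2 (wint a k) u q = wint (a + 2) (d2 k) u q).
  { unfold wint. destruct (d_RInt (fun u q t => t ^ a * k u (q * t ^ 2)) u q Sg) as [_ ->]. apply RInt_ext. intros t Ht.
    rewrite Rmin_left, Rmax_right in Ht by lra. unfold D2. apply is_derive_unique.
    pose proof (Hk u (q * t^2) Hu (sq_scale q r t Hq ltac:(lra))) as S.
    assert (X : is_derive (fun q => k u (q * t^2)) q (d2 k u (q * t^2) * t^2)).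
    { evar_last. apply (sm2_chain k (fun _ => u) (fun q => q * t^2) u (q * t^2) 0 (t^2) q); auto; auto_derive; auto; simpl; ring. simpl; ring. }
    evar_last. apply is_derive_scal. exact X. rewrite pow_add. simpl. ring. }
  split; [now apply (sm2_RInt (fun u q t => t ^ a * k u (q * t ^ 2)))|]. split; [exact D|]. rewrite D.
  assert (I1 : ex_RInt (fun t => t ^ a * k u (q * t ^ 2)) 0 1) by (apply (ex_RInt_cont (fun u q t => t ^ a * k u (q * t ^ 2)) u q); intros; apply sm_cont; auto).
  assert (I2 : ex_RInt (fun t => t ^ (a+2) * d2 k u (q * t ^ 2)) 0 1) by (apply (ex_RInt_cont (fun u q t => t ^ (a+2) * d2 k u (q * t ^ 2)) u q); intros; apply sm_cont; auto).
  pose proof (RInt_FTC (fun t => t ^ (S a) * k u (q * t ^ 2)) (fun t => (INR a + 1) * (t ^ a * k u (q * t ^ 2)) + 2 * q * (t ^ (a+2) * d2 k u (q * t ^ 2)))) as F.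
  cbv beta in F. replace (1 ^ S a * k u (q * 1^2) - 0 ^ S a * k u (q * 0^2)) with (k u q) in F by (rewrite !pow1, (pow_i (S a)), Rmult_1_r by lia; ring).
  rewrite <- F.
  - unfold wint. rewrite (RInt_plus (V := R_CompleteNormedModule) (fun t => (INR a + 1) * (t ^ a * k u (q * t ^ 2))) (fun t => 2 * q * (t ^ (a+2) * d2 k u (q * t ^ 2)))).
    + rewrite (RInt_scal (V := R_CompleteNormedModule) (fun t => t ^ a * k u (q * t ^ 2))) by auto. rewrite (RInt_scal (V := R_CompleteNormedModule) (fun t => t ^ (a+2) * d2 k u (q * t ^ 2))) by auto. reflexivity.
    + apply (ex_RInt_scal (V := R_CompleteNormedModule) (fun t => t ^ a * k u (q * t ^ 2))). auto.
    + apply (ex_RInt_scal (V := R_CompleteNormedModule) (fun t => t ^ (a+2) * d2 k u (q * t ^ 2))). auto.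
  - intros t Ht. pose proof (Hk u (q * t^2) Hu (sq_scale _ _ _ Hq Ht)) as S.
    assert (X : is_derive (fun t => k u (q * t^2)) t (d2 k u (q * t^2) * (q * (2 * t)))).
    { evar_last. apply (sm2_chain k (fun _ => u) (fun t => q * t^2) u (q * t^2) 0 (q * (2*t)) t); auto; auto_derive; auto; simpl; ring. simpl; ring. }
    evar_last. apply (is_derive_mult (fun t => t ^ Datatypes.S a)); [|exact X|intros; apply Rmult_comm]. auto_derive; auto.
    unfold plus, mult; simpl. rewrite pow_add. destruct a as [|a]; [simpl; ring|]. rewrite S_INR. simpl. ring.
  - intros t Ht. apply (cont3_cont_3 (fun u q t => (INR a + 1) * (t ^ a * k u (q * t ^ 2)) + 2 * q * (t ^ (a+2) * d2 k u (q * t ^ 2))) u q).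
    apply sm_cont. pose proof (Hk u (q * t^2) Hu (sq_scale _ _ _ Hq Ht)). sms.
Qed.

Lemma locally_2d_square P : locally_2d P 0 0 -> exists r, 0 < r /\ forall u w, Rabs u < r -> Rabs w < r -> P u w.
Proof. intros [d H]. exists d. split; [apply cond_pos|]. intros. apply H; now rewrite Rminus_0_r. Qed.
Lemma square_locally_2d (P : R -> R -> Prop) r : 0 < r -> (forall u w, Rabs u < r -> Rabs w < r -> P u w) -> locally_2d P 0 0.
Proof. intros Hr H. exists (mkposreal r Hr). intros u v. rewrite !Rminus_0_r. simpl. auto. Qed.

(** Writing F(u, w) = F(u, 0) + K(u, w^2) + w H(u, w^2), the hypothesis on F_w says that K_q and H + 2 q H_q are
    divisible by q + P. Expanding K and H at q = - P to second order gives F = r0 + r3 (w^3 + 3 P w) + (w^2 + P)^2 g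
    with r3(0) <> 0. As (w^2 + P) divides the derivative of w^3 + 3 P w, the last term is produced by a displacement w
    + (w^2 + P) W, with W given by the implicit function theorem. *)
Lemma cubic_unfolding_prenormal F P E : sm2 F 0 0 -> F 0 0 = 0 -> sm1 P 0 -> P 0 = 0 -> sm2 E 0 0 -> E 0 0 <> 0 ->
  locally_2d (fun u w => d2 F u w = (w ^ 2 + P u) * E u w) 0 0 ->
  A_equivalent (corank1 F) (corank1 (fun u v => v ^ 3 + 3 * P u * v)).
Proof.
  intros SF F0 SP P0 SE E0 HD.
  destruct (whitney E SE) as (e0 & e1 & S0 & S1 & EE).
  assert (e00 : e0 0 0 <> 0).
  { pose proof (locally_2d_singleton _ _ _ EE) as X. cbv beta in X. rewrite Rmult_0_l, Rplus_0_r, pow_i in X by lia. congruence. }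
  set (k0 := fun u q => (q + P u) * e0 u q). set (k1 := fun u q => /2 * (q + P u) * e1 u q).
  assert (Sk0 : sm2 k0 0 0) by (unfold k0; sms). assert (Sk1 : sm2 k1 0 0) by (unfold k1; sms).
  destruct (locally_2d_square _ (locally_2d_and _ _ _ _ (sm2_near _ _ _ SF) (locally_2d_and _ _ _ _ (sm2_near _ _ _ Sk0) (locally_2d_and _ _ _ _ (sm2_near _ _ _ Sk1) (locally_2d_and _ _ _ _ HD EE))))) as (r & Hr & B).
  assert (Bk0 : forall u q, Rabs u < r -> Rabs q < r -> sm2 k0 u q) by (intros; now apply B).
  assert (Bk1 : forall u q, Rabs u < r -> Rabs q < r -> sm2 k1 u q) by (intros; now apply B).
  set (H := wint 0 k0). set (K := fun u q => 2 * q * wint 1 k1 u q).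
  assert (R0 : Rabs 0 < r) by (rewrite Rabs_R0; auto).
  assert (SH : sm2 H 0 0) by (now apply (wint_facts 0 k0 r)).
  assert (SI : sm2 (wint 1 k1) 0 0) by (now apply (wint_facts 1 k1 r)).
  assert (SK : sm2 K 0 0) by (unfold K; sms).
  (* the decomposition of F into even and odd part *)
  assert (FE : locally_2d (fun u w => F u w = F u 0 + K u (w^2) + w * H u (w^2)) 0 0).
  { apply (square_locally_2d _ (Rmin r 1) ltac:(apply Rmin_pos; lra)). intros u w Hu Hw.
    pose proof (Rmin_l r 1). pose proof (Rmin_r r 1).
    assert (Hu' : Rabs u < r) by lra. assert (Hw' : Rabs w < r) by lra.
    assert (Hw2 : Rabs (w^2) < r). { rewrite <- RPow_abs. pose proof (Rabs_pos w). simpl. nra. }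
    assert (St : forall t, 0 <= t <= 1 -> Rabs (0 + t * (w - 0)) < r) by (intros; now apply abs_scale).
    rewrite (hquot_eq (fun _ => 0) F u w) by (intros; apply B; auto).
    unfold hquot. rewrite (RInt_ext _ (fun t => t^0 * k0 u (w^2 * t^2) + (2 * w) * (t^1 * k1 u (w^2 * t^2)))).
    - assert (I0 : ex_RInt (fun t => t^0 * k0 u (w^2*t^2)) 0 1).
      { apply (ex_RInt_cont (fun _ _ t => t^0 * k0 u (w^2*t^2)) 0 0). intros t Ht. apply sm_cont. pose proof (Bk0 u (w^2*t^2) Hu' (sq_scale _ _ _ Hw2 Ht)). sms. }
      assert (I1 : ex_RInt (fun t => t^1 * k1 u (w^2*t^2)) 0 1).
      { apply (ex_RInt_cont (fun _ _ t => t^1 * k1 u (w^2*t^2)) 0 0). intros t Ht. apply sm_cont. pose proof (Bk1 u (w^2*t^2) Hu' (sq_scale _ _ _ Hw2 Ht)). sms. }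
      rewrite (RInt_plus (V := R_CompleteNormedModule) (fun t => t^0 * k0 u (w^2*t^2)) (fun t => (2 * w) * (t^1 * k1 u (w^2*t^2)))); auto.
      + rewrite (RInt_scal (V := R_CompleteNormedModule) (fun t => t^1 * k1 u (w^2*t^2))) by auto.
        unfold K, H, wint, plus, scal; simpl; unfold mult; simpl. ring.
      + apply (ex_RInt_scal (V := R_CompleteNormedModule) (fun t => t^1 * k1 u (w^2*t^2))); auto.
    - intros t Ht. rewrite Rmin_left, Rmax_right in Ht by lra.
      destruct (B u (0 + t * (w - 0)) Hu' (St t ltac:(lra))) as (_ & _ & _ & X & Y). rewrite X, Y. unfold k0, k1.
      replace ((0 + t * (w - 0))^2) with (w^2*t^2) by ring. change (t^0) with 1. req. field. }
  (* division at q = - P u *)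
  assert (SmP : sm1 (fun u => - P u) 0) by sms.
  assert (mP0 : - P 0 = 0) by (rewrite P0; ring).
  destruct (hadamard_2 K (fun u => - P u) 0 0 SK SmP mP0) as (ka & Ska & EK & _).
  destruct (hadamard_2 H (fun u => - P u) 0 0 SH SmP mP0) as (et & Set' & EH & _).
  set (r3 := fun u => d2 H u (- P u)). set (r0 := fun u => F u 0 + K u (- P u)).
  assert (Sr3 : sm1 r3 0) by (unfold r3; sms). assert (Sr0 : sm1 r0 0) by (unfold r0; sms).
  assert (LP : locally 0 (fun u => Rabs u < r /\ Rabs (- P u) < r)).
  { apply (locally_2d_pull1 (fun u w => Rabs u < r /\ Rabs w < r) (fun u => u) (fun u => - P u)); [sms|auto|]. rewrite mP0. now apply square_near. }
  assert (DK : locally 0 (fun u => d2 K u (- P u) = 0)).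
  { apply (locally_mp _ _ _ LP). intros u [Hu HPu]. destruct (wint_facts 1 k1 r u (- P u) Bk1 Hu HPu) as (SI' & _ & X).
    assert (Y : d2 K u (- P u) = 2 * wint 1 k1 u (- P u) + 2 * (- P u) * d2 (wint 1 k1) u (- P u)).
    { unfold K. apply is_derive_unique. evar_last. apply (is_derive_mult (fun t => 2 * t)); [|apply sm2_derive2; exact SI'|intros; apply Rmult_comm]. auto_derive; auto. unfold plus, mult; simpl. ring. }
    rewrite Y. simpl INR in X. unfold k1 in X at 3. replace (- P u + P u) with 0 in X by ring. rewrite Rmult_0_r, Rmult_0_l in X. lra. }
  assert (HH : locally 0 (fun u => H u (- P u) = 2 * P u * r3 u)).
  { apply (locally_mp _ _ _ LP). intros u [Hu HPu]. destruct (wint_facts 0 k0 r u (- P u) Bk0 Hu HPu) as (_ & _ & X).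
    simpl INR in X. unfold k0 in X at 3. replace (- P u + P u) with 0 in X by ring. rewrite Rmult_0_l in X. unfold r3. fold H in X. lra. }
  assert (r30 : r3 0 <> 0).
  { unfold r3. rewrite mP0. unfold H. destruct (wint_facts 0 k0 r 0 0 Bk0 R0 R0) as (_ & -> & _). change (0 + 2)%nat with 2%nat.
    destruct (wint_facts 2 (d2 k0) r 0 0) as (_ & _ & X); auto. { intros; apply sm2_d; auto. }
    assert (Y : d2 k0 0 0 = e0 0 0).
    { unfold k0. apply is_derive_unique. evar_last. apply (is_derive_mult (fun t => t + P 0)); [|apply sm2_derive2; exact S0|intros; apply Rmult_comm]. auto_derive; auto. unfold plus, mult; simpl. rewrite P0. ring. }
    rewrite Y in X. simpl INR in X. intros Z. rewrite Z in X. lra. }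
  set (g := fun u w => ka u (w^2) + w * et u (w^2)).
  assert (Sg : sm2 g 0 0) by (unfold g; sms).
  assert (FF : locally_2d (fun u w => F u w = r0 u + r3 u * (w^3 + 3 * P u * w) + (w^2 + P u)^2 * g u w) 0 0).
  { assert (EK' : locally_2d (fun u w => K u (w^2) = K u (- P u) + (w^2 - - P u) * d2 K u (- P u) + (w^2 - - P u)^2 * ka u (w^2)) 0 0).
    { apply (locally_2d_pull (fun u q => K u q = K u (- P u) + (q - - P u) * d2 K u (- P u) + (q - - P u)^2 * ka u q) (fun u _ => u) (fun _ w => w^2)); [sms|sms|]. rewrite pow_i by lia. exact EK. }
    assert (EH' : locally_2d (fun u w => H u (w^2) = H u (- P u) + (w^2 - - P u) * d2 H u (- P u) + (w^2 - - P u)^2 * et u (w^2)) 0 0).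
    { apply (locally_2d_pull (fun u q => H u q = H u (- P u) + (q - - P u) * d2 H u (- P u) + (q - - P u)^2 * et u q) (fun u _ => u) (fun _ w => w^2)); [sms|sms|]. rewrite pow_i by lia. exact EH. }
    assert (X : locally_2d (fun u w => d2 K u (- P u) = 0 /\ H u (- P u) = 2 * P u * r3 u) 0 0).
    { apply (locally_2d_fst (fun u => d2 K u (- P u) = 0 /\ H u (- P u) = 2 * P u * r3 u)). now apply filter_and. }
    apply (locally_2d_mp4 _ _ _ _ _ _ _ FE EK' EH' X). intros u w Y1 Y2 Y3 [Y4 Y5]. rewrite Y1, Y2, Y3, Y4, Y5. unfold r0, g. fold (r3 u). ring. }
  (* absorb the multiple of (w^2 + P)^2 by a change of w *)
  (* the cubic at w + (w^2 + P) W exceeds its value at w by (w^2 + P)^2 (3 W + 3 w W^2 + (w^2 + P) W^3) *)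
  set (W0 := g 0 0 / (3 * r3 0)).
  destruct (implicit_function (fun u w W => r3 u * (3 * W + 3 * w * W^2 + (w^2 + P u) * W^3) - g u w) 0 0 W0) as (W & SW & EW0 & EW & _).
  { sms. }
  { rewrite P0. unfold W0. field. auto. }
  { unfold D3. rewrite (is_derive_unique _ _ (3 * r3 0)). lra. auto_derive; auto. rewrite P0. ring. }
  set (V := fun u w => w + (w^2 + P u) * W u w).
  assert (SV : sm2 V 0 0) by (unfold V; sms).
  assert (V0 : V 0 0 = 0) by (unfold V; rewrite P0; ring).
  apply (A_equivalent_fibred F (fun u v => v ^ 3 + 3 * P u * v) (fun u => u) (fun u z => (z - r0 u) / r3 u) V); auto.
  - sms.
  - rewrite Derive_id; lra.
  - unfold V, d2. rewrite (is_derive_unique _ _ 1). lra.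
    evar_last. apply (is_derive_plus (V := R_NormedModule) (fun w => w)). apply is_derive_id.
    apply (is_derive_mult (fun w => w^2 + P 0)); [|apply (sm2_derive2 W); exact SW|intros; apply Rmult_comm]. auto_derive; auto.
    unfold plus, mult, one; simpl. rewrite P0. ring.
  - sms.
  - unfold r0, K. rewrite F0, P0. unfold Rdiv. ring.
  - unfold d2. rewrite (is_derive_unique _ _ (/ r3 0)). now apply Rinv_neq_0_compat. auto_derive; auto. field; auto.
  - assert (Nr : locally_2d (fun u _ => r3 u <> 0) 0 0) by (apply (neq0_near (fun u _ => r3 u)); auto).
    apply (locally_2d_mp3 _ _ _ _ _ _ FF EW Nr). intros u w X1 X2 X3. rewrite X1. unfold V.
    replace (g u w) with (r3 u * (3 * W u w + 3 * w * (W u w)^2 + (w^2 + P u) * (W u w)^3)) by lra. field. auto.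
Qed.

(** Translate v by the zero m(u) of F_vv. Then F_v(u, m(u) + y) is its value at y = 0 plus y^2 times a function
    without zeros, of the sign eps of F_vvv; with w = y times the square root of its absolute value, F_v is
    proportional to w^2 + P(u). *)
Theorem cubic_unfolding F : sm2 F 0 0 -> F 0 0 = 0 -> d2 F 0 0 = 0 -> d2 (d2 F) 0 0 = 0 -> d2 (d2 (d2 F)) 0 0 <> 0 ->
  exists m eps, sm1 m 0 /\ m 0 = 0 /\ locally 0 (fun u => d2 (d2 F) u (m u) = 0) /\
    (eps = 1 \/ eps = -1) /\ 0 < eps * d2 (d2 (d2 F)) 0 0 /\
    A_equivalent (corank1 F) (corank1 (fun u v => v ^ 3 + 3 * (eps * d2 F u (m u)) * v)).
Proof.
  intros SF F0 F1 F2 F3.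
  assert (S2 : sm2 (d2 (d2 F)) 0 0) by sms. assert (S3 : sm2 (d2 (d2 (d2 F))) 0 0) by sms.
  destruct (implicit_function (fun u _ z => d2 (d2 F) u z) 0 0 0) as (mm & Sm & m0 & Em & _); auto. sms.
  set (m := fun u => mm u 0). assert (Sm1 : sm1 m 0) by (unfold m; sms). assert (m0' : m 0 = 0) by exact m0.
  assert (Em' : locally 0 (fun u => d2 (d2 F) u (m u) = 0)) by apply (locally_2d_1d_const_y _ 0 0 Em).
  assert (eps : exists eps, (eps = 1 \/ eps = -1) /\ 0 < eps * d2 (d2 (d2 F)) 0 0).
  { destruct (Rtotal_order (d2 (d2 (d2 F)) 0 0) 0) as [H|[H|H]]; [exists (-1)|contradiction|exists 1]; split; auto; lra. }
  destruct eps as (eps & Heps & Hpos). exists m, eps. do 5 (split; auto).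
  assert (ee : eps * eps = 1) by (destruct Heps; subst; ring).
  set (la := fun u y => d2 F u (m u + y)). assert (Sla : sm2 la 0 0) by (unfold la; sms).
  assert (dla : locally_2d (fun u y => d2 la u y = d2 (d2 F) u (m u + y)) 0 0).
  { assert (N : locally_2d (fun u y => sm2 (d2 F) u (m u + y)) 0 0).
    { apply (locally_2d_pull (sm2 (d2 F)) (fun u _ => u) (fun u y => m u + y)); [sms|sms|]. rewrite m0', Rplus_0_r. apply sm2_near. sms. }
    apply (locally_2d_mp _ _ _ _ N). intros u y X. apply is_derive_unique. evar_last. apply (sm2_chain (d2 F) (fun _ => u) (fun y => m u + y) u (m u + y) 0 1 y); auto; auto_derive; auto. simpl; ring. }
  assert (ddla : d2 (d2 la) 0 0 = d2 (d2 (d2 F)) 0 0).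
  { destruct (d_ext _ _ _ _ dla) as [_ ->]. destruct (d_comp (d2 (d2 F)) (fun u _ => u) (fun u y => m u + y) 0 0 0 0) as [_ ->]; auto; try sms.
    rewrite (proj2 (d_fst 0 0)). replace (d2 (fun u y => m u + y) 0 0) with 1. ring. symmetry. apply is_derive_unique. auto_derive; auto. }
  destruct (hadamard_2 la (fun _ => 0) 0 0 Sla ltac:(sms) eq_refl) as (e & Se & Ee & e0). rewrite ddla in e0.
  assert (dla0 : locally 0 (fun u => d2 la u 0 = 0)).
  { pose proof (locally_2d_1d_const_y _ 0 0 dla) as X. apply (locally_mp2 _ _ _ _ X Em'). intros u Y1 Y2. now rewrite Y1, Rplus_0_r. }
  set (P := fun u => eps * d2 F u (m u)). assert (SP : sm1 P 0) by (unfold P; sms).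
  assert (P0 : P 0 = 0) by (unfold P; rewrite m0', F1; ring).
  assert (Ela : locally_2d (fun u y => la u y = eps * (P u + y^2 * (eps * e u y))) 0 0).
  { assert (X : locally_2d (fun u _ => d2 la u 0 = 0) 0 0) by (now apply locally_2d_fst).
    apply (locally_2d_mp2 _ _ _ _ _ Ee X). intros u y -> ->. unfold P, la. rewrite Rplus_0_r.
    replace (eps * (eps * d2 F u (m u) + y ^ 2 * (eps * e u y))) with ((eps*eps) * (d2 F u (m u) + y ^ 2 * (e u y))) by ring. rewrite ee. ring. }
  assert (ep : 0 < eps * e 0 0) by (rewrite e0; lra).
  set (s := fun u y => sqrt (eps * e u y)).
  assert (Ss : sm2 s 0 0).
  { apply (sm_comp1 sqrt (fun u y _ => eps * e u y)). now apply sm_sqrt_id. sms. }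
  assert (s0 : 0 < s 0 0) by (now apply sqrt_lt_R0).
  assert (Es : locally_2d (fun u y => s u y * s u y = eps * e u y) 0 0).
  { assert (N : near (fun u y z => eps * e 0 0 / 2 < eps * e u y) 0 0 0) by (apply (sm_pos_near (fun u y _ => eps * e u y)); [sms|auto]).
    apply (near_locally_2d _ _ _ 0). eapply near_imp; [|exact N]. intros u y z X. cbv beta in X. apply sqrt_sqrt. lra. }
  clearbody s.
  destruct (implicit_function (fun u w y => y * s u y - w) 0 0 0) as (phi & Sphi & phi0 & Ephi & _).
  { sms. } { ring. }
  { unfold D3. rewrite (is_derive_unique _ _ (s 0 0)). lra.
    eapply derive_eq; [apply (derive_sub (fun y => y * s 0 y) (fun _ => 0)); [apply (derive_mul (fun y => y) (fun y => s 0 y)); [apply derive_id|apply sm2_derive2; exact Ss]|apply derive_cst]|ring]. }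
  assert (dphi : d2 phi 0 0 * s 0 0 = 1).
  { destruct (d_ext _ _ _ _ Ephi) as [_ X]. assert (Z : d2 (fun _ _ => 0) 0 0 = 0) by exact (Derive_const 0 0). rewrite Z in X. clear Z.
    assert (Sc : sm2 (fun u w => s u (phi u w)) 0 0) by sms.
    assert (Y : is_derive (fun w => phi 0 w * s 0 (phi 0 w) - w) 0 (d2 phi 0 0 * s 0 0 - 1)).
    { eapply derive_eq; [apply (derive_sub (fun w => phi 0 w * s 0 (phi 0 w)) (fun w => w)); [apply (derive_mul (fun w => phi 0 w) (fun w => s 0 (phi 0 w))); [apply sm2_derive2; exact Sphi|apply (sm2_derive2 (fun u w => s u (phi u w))); exact Sc]|apply derive_id]|]. cbv beta. rewrite phi0. ring. }
    assert (Y' : d2 (fun x y => phi x y * s x (phi x y) - y) 0 0 = d2 phi 0 0 * s 0 0 - 1) by exact (is_derive_unique _ _ _ Y).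
    rewrite X in Y'. lra. }
  assert (dphi0 : d2 phi 0 0 <> 0) by (intros X; rewrite X in dphi; lra).
  set (F' := fun u w => F u (m u + phi u w)).
  assert (SF' : sm2 F' 0 0) by (unfold F'; sms).
  assert (F'0 : F' 0 0 = 0) by (unfold F'; rewrite m0', phi0, Rplus_0_r; auto).
  apply A_equivalent_trans with (corank1 F').
  - apply A_equivalent_sym; [now apply corank1_smooth|].
    apply (A_equivalent_source F' F (fun u w => m u + phi u w)).
    + sms. + rewrite m0', phi0; ring.
    + unfold d2. rewrite (is_derive_unique _ _ (d2 phi 0 0)); auto.
      eapply derive_eq; [apply (derive_add (fun _ => m 0) (fun w => phi 0 w)); [apply derive_cst|apply sm2_derive2; exact Sphi]|ring].
    + now apply locally_2d_forall.
  - apply (cubic_unfolding_prenormal F' P (fun u w => eps * d2 phi u w)); auto.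
    + sms.
    + intros X. apply Rmult_integral in X. destruct X; [destruct Heps; lra|auto].
    + assert (N1 : locally_2d (fun u w => la u (phi u w) = eps * (P u + (phi u w)^2 * (eps * e u (phi u w))) /\ s u (phi u w) * s u (phi u w) = eps * e u (phi u w)) 0 0).
      { apply (locally_2d_pull (fun u y => la u y = eps * (P u + y^2 * (eps * e u y)) /\ s u y * s u y = eps * e u y) (fun u _ => u) phi); [sms|auto|]. rewrite phi0. now apply locally_2d_and. }
      assert (N2 : locally_2d (fun u w => sm2 F u (m u + phi u w)) 0 0).
      { apply (locally_2d_pull (sm2 F) (fun u _ => u) (fun u w => m u + phi u w)); [sms|sms|]. rewrite m0', phi0, Rplus_0_r. now apply sm2_near. }
      apply (locally_2d_mp4 _ _ _ _ _ _ _ N1 N2 Ephi (sm2_near _ _ _ Sphi)). intros u w [X1 X2] X3 X4 X5.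
      assert (Y : d2 F' u w = la u (phi u w) * d2 phi u w).
      { unfold F', la. apply is_derive_unique. evar_last. apply (sm2_chain F (fun _ => u) (fun w => m u + phi u w) u (m u + phi u w) 0 (d2 phi u w) w); auto.
        auto_derive; auto. eapply derive_eq; [apply (derive_add (fun _ => m u) (fun w => phi u w)); [apply derive_cst|apply sm2_derive2; exact X5]|ring]. simpl; ring. }
      rewrite Y, X1, <- X2. replace (w^2) with ((phi u w * s u (phi u w))^2) by (f_equal; lra). ring.
Qed.

(** * Orders of vanishing of functions of one variable *)

(** Orders of vanishing at 0 of arbitrary functions of one variable; the bounds are only needed for natural exponents. *)
Definition bigO (n : nat) (h : R -> R) : Prop := exists C, locally 0 (fun t => Rabs (h t) <= C * Rabs t ^ n).

Lemma locally_all (P : R -> Prop) x : (forall t, P t) -> locally x P.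
Proof. intros H. exists (mkposreal 1 Rlt_0_1). auto. Qed.

Lemma bigO_pos n h : bigO n h -> exists C, 0 < C /\ locally 0 (fun t => Rabs (h t) <= C * Rabs t ^ n).
Proof.
  intros [C H]. exists (Rmax C 1). split. apply Rlt_le_trans with 1; [lra|apply Rmax_r].
  apply (locally_mp _ _ _ H). intros t Ht. eapply Rle_trans; [exact Ht|]. apply Rmult_le_compat_r; [apply pow_le, Rabs_pos|apply Rmax_l].
Qed.

Lemma bigO_ext n f g : locally 0 (fun t => f t = g t) -> bigO n f -> bigO n g.
Proof. intros E [C H]. exists C. apply (locally_mp2 _ _ _ _ E H). intros t -> K. exact K. Qed.

Lemma bigO_add n f g : bigO n f -> bigO n g -> bigO n (fun t => f t + g t).
Proof.
  intros [C H] [D K]. exists (C + D). apply (locally_mp2 _ _ _ _ H K). intros t A B.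
  eapply Rle_trans; [apply Rabs_triang|]. lra.
Qed.

Lemma bigO_opp n f : bigO n f -> bigO n (fun t => - f t).
Proof. intros [C H]. exists C. apply (locally_mp _ _ _ H). intros t A. now rewrite Rabs_Ropp. Qed.

Lemma bigO_sub n f g : bigO n f -> bigO n g -> bigO n (fun t => f t - g t).
Proof. intros Hf Hg. apply (bigO_add n f (fun t => - g t)); auto. now apply bigO_opp. Qed.

Lemma bigO_mul n m f g : bigO n f -> bigO m g -> bigO (n + m) (fun t => f t * g t).
Proof.
  intros Hf Hg. destruct (bigO_pos _ _ Hf) as (C & HC & H). destruct (bigO_pos _ _ Hg) as (D & HD & K).
  exists (C * D). apply (locally_mp2 _ _ _ _ H K). intros t A B. rewrite Rabs_mult, pow_add.
  replace (C * D * (Rabs t ^ n * Rabs t ^ m)) with ((C * Rabs t ^ n) * (D * Rabs t ^ m)) by ring.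
  apply Rmult_le_compat; auto; apply Rabs_pos.
Qed.

Lemma locally_lt1 : locally 0 (fun t => Rabs t < 1).
Proof. exists (mkposreal 1 Rlt_0_1). intros t Ht. change (Rabs (t - 0) < 1) in Ht. now rewrite Rminus_0_r in Ht. Qed.

Lemma bigO_le n m f : (m <= n)%nat -> bigO n f -> bigO m f.
Proof.
  intros Hm Hf. destruct (bigO_pos _ _ Hf) as (C & HC & H). exists C. apply (locally_mp2 _ _ _ _ H locally_lt1). intros t A B.
  eapply Rle_trans; [exact A|]. apply Rmult_le_compat_l; [lra|].
  replace n with (m + (n - m))%nat by lia. rewrite pow_add. rewrite <- (Rmult_1_r (Rabs t ^ m)) at 2.
  pose proof (Rabs_pos t). apply Rmult_le_compat_l; [now apply pow_le|]. rewrite <- (pow1 (n - m)). apply pow_incr. lra.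
Qed.

Lemma bigO_continuous h : sm1 h 0 -> bigO 0 h.
Proof.
  intros S. exists (Rabs (h 0) + 1). pose proof (sm_cont _ _ _ _ S 1 Rlt_0_1) as N.
  apply (near_locally (fun x => Rabs (h x - h 0) < 1) 0 0 0) in N. apply (locally_mp _ _ _ N). intros t A. simpl. rewrite Rmult_1_r.
  replace (h t) with ((h t - h 0) + h 0) by ring. eapply Rle_trans; [apply Rabs_triang|]. lra.
Qed.

Lemma bigO_const c : bigO 0 (fun _ => c).
Proof. apply bigO_continuous. sms. Qed.

Lemma bigO_id : bigO 1 (fun t => t).
Proof. exists 1. apply locally_all. intros t. simpl. lra. Qed.

Lemma bigO_pow n : bigO n (fun t => t ^ n).
Proof. exists 1. apply locally_all. intros t. rewrite RPow_abs. lra. Qed.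

Lemma bigO_powmul n g : bigO 0 g -> bigO n (fun t => t ^ n * g t).
Proof. intros H. rewrite <- (Nat.add_0_r n) at 1. apply bigO_mul; [apply bigO_pow|exact H]. Qed.

Lemma bigO_powfun n m f : bigO n f -> bigO (m * n) (fun t => f t ^ m).
Proof.
  intros H. induction m as [|m IH]; simpl. apply bigO_const. now apply bigO_mul.
Qed.

Lemma bigO_scal n c f : bigO n f -> bigO n (fun t => c * f t).
Proof. intros H. apply (bigO_mul 0 n (fun _ => c) f); auto. apply bigO_const. Qed.

Lemma bigO_vanish h : sm1 h 0 -> h 0 = 0 -> bigO 1 h.
Proof.
  intros S E. destruct (hadamard_1 h 0 S) as (g & Sg & Eg & _). apply bigO_ext with (fun t => t ^ 1 * g t).
  - apply (locally_mp _ _ _ Eg). intros t ->. rewrite E. ring.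
  - apply bigO_powmul. now apply bigO_continuous.
Qed.

Lemma bigO_linear h : sm1 h 0 -> h 0 = 0 -> bigO 2 (fun t => h t - Derive h 0 * t).
Proof.
  intros S E. destruct (hadamard_1 h 0 S) as (g & Sg & Eg & Dg). destruct (hadamard_1 g 0 Sg) as (k & Sk & Ek & _).
  apply bigO_ext with (fun t => t ^ 2 * k t).
  - apply (locally_mp2 _ _ _ _ Eg Ek). intros t -> ->. rewrite E, Dg. ring.
  - apply bigO_powmul. now apply bigO_continuous.
Qed.

Lemma bigO_comp n m f g : (1 <= m)%nat -> bigO n f -> bigO m g -> bigO (m * n) (fun t => f (g t)).
Proof.
  intros Hm Hf Hg. destruct (bigO_pos _ _ Hf) as (C & HC & H). destruct (bigO_pos _ _ Hg) as (D & HD & K).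
  exists (C * D ^ n). destruct H as [d H].
  assert (L : locally 0 (fun t => Rabs t < d / D)).
  { assert (Hp : 0 < d / D) by (apply Rdiv_lt_0_compat; auto; apply cond_pos). exists (mkposreal _ Hp). intros t Ht. change (Rabs (t - 0) < d/D) in Ht. now rewrite Rminus_0_r in Ht. }
  apply (locally_mp3 _ _ _ _ _ K L locally_lt1). intros t A B B1. pose proof (Rabs_pos t).
  assert (P : Rabs t ^ m <= Rabs t). { destruct m as [|m]; [lia|]. simpl. rewrite <- (Rmult_1_r (Rabs t)) at 3. apply Rmult_le_compat_l; auto. rewrite <- (pow1 m). apply pow_incr; lra. }
  eapply Rle_trans. apply H. change (Rabs (g t - 0) < d). rewrite Rminus_0_r. eapply Rle_lt_trans; [exact A|].
  apply Rle_lt_trans with (D * Rabs t). apply Rmult_le_compat_l; lra. replace (pos d) with (D * (d / D)) by (field; lra). now apply Rmult_lt_compat_l.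
  rewrite Rmult_assoc. apply Rmult_le_compat_l; [lra|]. rewrite pow_mult, <- Rpow_mult_distr. apply pow_incr. split; [apply Rabs_pos|exact A].
Qed.

(** The contradiction that ends the necessity proofs: a function of order n has no lower bound of order m < n. *)
Lemma bigO_lower n m c h : bigO n h -> (m < n)%nat -> 0 < c -> locally 0 (fun t => c * Rabs t ^ m <= Rabs (h t)) -> False.
Proof.
  intros Hf Hm Hc L. destruct (bigO_pos _ _ (bigO_le n (S m) h ltac:(lia) Hf)) as (C & HC & H).
  destruct (filter_and _ _ L H) as [d K].
  set (t := Rmin (d/2) (c / (2 * C))). assert (Ht : 0 < t). { unfold t. apply Rmin_pos. pose proof (cond_pos d); lra. apply Rdiv_lt_0_compat; lra. }
  assert (Htd : t <= d/2) by apply Rmin_l. assert (Htc : t <= c / (2*C)) by apply Rmin_r. pose proof (cond_pos d) as Hd.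
  destruct (K t) as [A B]. { change (Rabs (t - 0) < d). rewrite Rminus_0_r, Rabs_pos_eq; lra. }
  rewrite (Rabs_pos_eq t) in * by lra. simpl in B. pose proof (pow_lt t m Ht) as P.
  assert (c * t ^ m <= (C * t) * t ^ m) by lra. assert (c <= C * t) by (apply Rmult_le_reg_r with (t^m); auto).
  assert (C * t <= C * (c / (2*C))) by (apply Rmult_le_compat_l; lra). replace (C * (c / (2*C))) with (c/2) in H2 by (field; lra). lra.
Qed.

Lemma bigO_coeff n c : bigO (S n) (fun t => c * t ^ n) -> c = 0.
Proof.
  intros H. destruct (Req_dec c 0) as [E|E]; auto. exfalso.
  apply (bigO_lower _ n (Rabs c) _ H ltac:(lia)). now apply Rabs_pos_lt. apply locally_all. intros t. rewrite Rabs_mult, RPow_abs. lra.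
Qed.

Lemma bigO_at_0 n f : bigO (S n) f -> f 0 = 0.
Proof.
  intros [C H]. apply locally_singleton in H. rewrite Rabs_R0, pow_i in H by lia. rewrite Rmult_0_r in H.
  pose proof (Rabs_pos (f 0)). apply Rabs_eq_0. lra.
Qed.

Lemma sm1_zero g : sm1 g 0 -> locally 0 (fun t => t <> 0 -> g t = 0) -> g 0 = 0.
Proof.
  intros S H. destruct (Req_dec (g 0) 0) as [E|E]; auto. exfalso.
  apply (bigO_lower 2 1 1 (fun t => t * 0) ltac:(apply bigO_ext with (fun t => t ^ 2 * 0); [apply locally_all; intros; ring|apply bigO_powmul, bigO_const]) ltac:(lia) Rlt_0_1).
  apply (locally_mp2 _ _ _ _ H (neq0_germ g S E)). intros t K N. destruct (Req_dec t 0) as [->|T]; [rewrite Rabs_R0, Rmult_0_r, Rabs_R0; simpl; lra|]. now apply K in T.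
Qed.

(** Hadamard's lemma divides by t once; the quotient has one order less, also at 0 by continuity. *)
Lemma bigO_divide k h : sm1 h 0 -> bigO k h -> exists e, sm1 e 0 /\ locally 0 (fun u => h u = u ^ k * e u).
Proof.
  revert h. induction k as [|k IH]; intros h S H.
  - exists h. split; auto. apply locally_all. intros; simpl; ring.
  - destruct (hadamard_1 h 0 S) as (g & Sg & Eg & _). rewrite (bigO_at_0 _ _ H) in Eg.
    assert (E : locally 0 (fun t => h t = t * g t)) by (apply (locally_mp _ _ _ Eg); intros t ->; ring). clear Eg.
    assert (Hg : bigO k g).
    { destruct k as [|k]; [now apply bigO_continuous|].
      assert (g0 : g 0 = 0).
      { destruct (Req_dec (g 0) 0) as [|N]; auto. exfalso. destruct (germ_lower_bound g Sg N) as (c & Hc & L).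
        apply (bigO_lower (Datatypes.S (Datatypes.S k)) 1 c h H ltac:(lia) Hc). apply (locally_mp2 _ _ _ _ E L). intros t -> K.
        rewrite pow_1, Rabs_mult, Rmult_comm. apply Rmult_le_compat_l; [apply Rabs_pos|exact K]. }
      destruct H as [C H]. exists C. apply (locally_mp2 _ _ _ _ E H). intros t Et K. destruct (Req_dec t 0) as [->|N].
      - rewrite g0, Rabs_R0, pow_i by lia. lra.
      - apply Rmult_le_reg_l with (Rabs t); [now apply Rabs_pos_lt|]. rewrite Et, Rabs_mult in K. simpl in *. lra. }
    destruct (IH g Sg Hg) as (e & Se & Ee). exists e. split; auto. apply (locally_mp2 _ _ _ _ E Ee). intros t -> ->. simpl. ring.
Qed.

Lemma bigO_leading k c h : sm1 h 0 -> bigO (S k) (fun t => h t - c * t ^ k) -> exists e, sm1 e 0 /\ e 0 = c /\ locally 0 (fun u => h u = u ^ k * e u).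
Proof.
  intros S H. destruct (bigO_divide (Datatypes.S k) (fun t => h t - c * t ^ k) ltac:(sms) H) as (e & Se & Ee).
  exists (fun t => c + t * e t). split; [sms|]. split; [ring|]. apply (locally_mp _ _ _ Ee). intros t X. simpl in X. replace (h t) with (c * t ^ k + t * t ^ k * e t) by lra. ring.
Qed.

(** Implicit function theorem for z^k = e(u) at the positive k-th root of e(0). *)
Lemma root_germ e k : (1 <= k)%nat -> sm1 e 0 -> 0 < e 0 -> exists rho, sm1 rho 0 /\ 0 < rho 0 /\ locally 0 (fun u => rho u ^ k = e u).
Proof.
  intros Hk S E. set (z := Rpower (e 0) (/ INR k)).
  assert (Hz : 0 < z) by apply exp_pos. assert (HI : 0 < INR k) by (apply lt_0_INR; lia).
  assert (Ez : z ^ k = e 0). { rewrite <- Rpower_pow by auto. unfold z. rewrite Rpower_mult, Rinv_l, Rpower_1; lra. }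
  destruct (implicit_function (fun u _ z => z ^ k - e u) 0 0 z) as (phi & Sphi & phi0 & Ephi & _).
  - sms.
  - rewrite Ez; ring.
  - unfold D3. rewrite (is_derive_unique _ _ (INR k * z ^ pred k)). apply Rmult_integral_contrapositive_currified. lra. apply pow_nonzero; lra. auto_derive; auto. ring.
  - exists (fun u => phi u 0). split; [sms|]. split; [now rewrite phi0|]. apply (locally_mp _ _ _ (locally_2d_1d_const_y _ 0 0 Ephi)). intros u X. lra.
Qed.

(** * Taylor expansion along curves *)

(** Lagrange's form of the remainder, with x and y of order 1 in t. *)
Lemma taylor_along f N x y : sm2 f 0 0 -> bigO 1 x -> bigO 1 y ->
  bigO (S N) (fun t => f (x t) (y t) - sum_f_R0 (fun p => sum_f_R0 (fun m => taylor_coeff f m (p - m) * x t ^ m * y t ^ (p - m)) p) N).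
Proof.
  intros S Hx Hy. assert (L : locally_2d (fun u v => ex_diff_n f (Datatypes.S N) u v) 0 0).
  { apply (locally_2d_mp _ _ _ _ (sm2_near _ _ _ S)). intros. now apply sm2_ex_diff_n. }
  destruct (Taylor_Lagrange_2d f N 0 0 L) as [D [d H]].
  destruct (bigO_pos _ _ Hx) as (C1 & HC1 & K1). destruct (bigO_pos _ _ Hy) as (C2 & HC2 & K2).
  set (C := C1 + C2). exists (Rabs D * C ^ Datatypes.S N).
  assert (Ld : locally 0 (fun t => Rabs t < d / C)).
  { assert (Hp : 0 < d / C) by (apply Rdiv_lt_0_compat; [apply cond_pos|unfold C; lra]). exists (mkposreal _ Hp). intros t Ht. change (Rabs (t - 0) < d/C) in Ht. now rewrite Rminus_0_r in Ht. }
  apply (locally_mp3 _ _ _ _ _ K1 K2 Ld). intros t A1 A2 A3. simpl pow in A1, A2. rewrite Rmult_1_r in A1, A2. pose proof (Rabs_pos t) as Pt.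
  assert (CT : C * Rabs t < d). { replace (pos d) with (C * (d / C)) by (field; unfold C; lra). apply Rmult_lt_compat_l; auto. unfold C; lra. }
  assert (B1 : Rabs (x t) <= C * Rabs t) by (unfold C; nra). assert (B2 : Rabs (y t) <= C * Rabs t) by (unfold C; nra).
  specialize (H (x t) (y t)). rewrite !Rminus_0_r in H. specialize (H ltac:(lra) ltac:(lra)).
  replace (sum_f_R0 (fun p => sum_f_R0 (fun m => taylor_coeff f m (p - m) * x t ^ m * y t ^ (p - m)) p) N) with (DL_pol N f 0 0 (x t) (y t)).
  - eapply Rle_trans; [exact H|]. apply Rle_trans with (Rabs D * Rmax (Rabs (x t)) (Rabs (y t)) ^ Datatypes.S N).
    + apply Rmult_le_compat_r; [|apply Rle_abs]. apply pow_le. eapply Rle_trans; [apply Rabs_pos|apply Rmax_l].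
    + rewrite Rmult_assoc. apply Rmult_le_compat_l; [apply Rabs_pos|]. rewrite <- Rpow_mult_distr. apply pow_incr. split; [eapply Rle_trans; [apply Rabs_pos|apply Rmax_l]|]. now apply Rmax_lub.
  - unfold DL_pol. apply sum_eq. intros p Hp. unfold differential, Rdiv. rewrite Rmult_comm, scal_sum. apply sum_eq. intros m Hm.
    unfold taylor_coeff, C, Binomial.C. pose proof (INR_fact_neq_0 p). pose proof (INR_fact_neq_0 m). pose proof (INR_fact_neq_0 (p - m)). field. auto.
Qed.

(** Reduces the Taylor coefficients of f_x to those of f, in which the data are given. *)
Lemma partial_derive_d1 f i j : sm2 f 0 0 -> partial_derive i j (d1 f) 0 0 = partial_derive (S i) j f 0 0.
Proof.
  intros S. unfold partial_derive.
  rewrite (Derive_n_ext_loc _ (Derive (fun t => Derive_n (fun z => f t z) j 0))).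
  - change (Derive (fun t => Derive_n (fun z => f t z) j 0)) with (Derive_n (fun t => Derive_n (fun z => f t z) j 0) 1).
    rewrite Derive_n_comp. now rewrite Nat.add_1_r.
  - apply (locally_mp _ _ _ (locally_2d_1d_const_y _ 0 0 (sm2_near _ _ _ S))). intros t St.
    assert (L : locally_2d (ex_diff_n f (Datatypes.S j)) t 0).
    { apply (locally_2d_mp _ _ _ _ (sm2_near _ _ _ St)). intros. now apply sm2_ex_diff_n. }
    pose proof (Derive_partial_derive_aux1 j f t 0 L) as E. symmetry. exact E.
Qed.

(** * Invariants of A-equivalence *)

Lemma locally_2d_locally_2d P x y : locally_2d P x y -> locally_2d (locally_2d P) x y.
Proof.
  intros H. apply (near_locally_2d _ _ _ 0). apply (near_locally_2d _ _ _ 0) in H. apply near_near in H. eapply near_imp; [|exact H].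
  intros u v w K. now apply near_locally_2d in K.
Qed.

(** The determinants of the differentials of both sides of phi2 o g1 = g2 o phi1, with the common terms cancelled: the
    Jacobians of equivalent germs are proportional in corresponding points. *)
Lemma jacobian_relation F F0 a b c d : sm2 F 0 0 -> sm2 F0 0 0 -> F 0 0 = 0 ->
  sm2 a 0 0 -> sm2 b 0 0 -> a 0 0 = 0 -> b 0 0 = 0 -> sm2 c 0 0 -> sm2 d 0 0 ->
  locally_2d (fun u v => c u (F u v) = a u v /\ d u (F u v) = F0 (a u v) (b u v)) 0 0 ->
  locally_2d (fun u v => (d1 a u v * d2 b u v - d2 a u v * d1 b u v) * d2 F0 (a u v) (b u v) =
    (d1 c u (F u v) * d2 d u (F u v) - d2 c u (F u v) * d1 d u (F u v)) * d2 F u v) 0 0.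
Proof.
  intros SF SF0 F00 Sa Sb a0 b0 Sc Sd L.
  assert (N1 : locally_2d (fun u v => sm2 c u (F u v) /\ sm2 d u (F u v)) 0 0).
  { apply (locally_2d_pull (fun u z => sm2 c u z /\ sm2 d u z) (fun u _ => u) F); [sms|auto|]. rewrite F00. apply locally_2d_and; now apply sm2_near. }
  assert (N2 : locally_2d (fun u v => sm2 F0 (a u v) (b u v)) 0 0).
  { apply (locally_2d_pull (sm2 F0) a b); auto. rewrite a0, b0. now apply sm2_near. }
  apply (locally_2d_mp4 _ _ _ _ _ _ _ (locally_2d_and _ _ _ _ N1 N2) (locally_2d_and _ _ _ _ (sm2_near _ _ _ Sa) (sm2_near _ _ _ Sb)) (sm2_near _ _ _ SF) (locally_2d_locally_2d _ _ _ L)).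
  intros u v [[Hc Hd] HF0] [Ha Hb] HF K.
  assert (K1 : locally_2d (fun u v => c u (F u v) = a u v) u v) by (apply (locally_2d_mp _ _ _ _ K); tauto).
  assert (K2 : locally_2d (fun u v => d u (F u v) = F0 (a u v) (b u v)) u v) by (apply (locally_2d_mp _ _ _ _ K); tauto).
  destruct (d_ext _ _ _ _ K1) as [X1 X2]. destruct (d_ext _ _ _ _ K2) as [X3 X4].
  assert (Su : sm2 (fun u _ : R => u) u v) by sms.
  destruct (d_comp c (fun u _ => u) F u v u (F u v) Hc eq_refl eq_refl Su HF) as [Y1 Y2].
  destruct (d_comp d (fun u _ => u) F u v u (F u v) Hd eq_refl eq_refl Su HF) as [Y3 Y4].
  destruct (d_comp F0 a b u v (a u v) (b u v) HF0 eq_refl eq_refl Ha Hb) as [Z1 Z2].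
  destruct (d_fst u v) as [f1 f2]. rewrite f1 in Y1, Y3. rewrite f2 in Y2, Y4. rewrite Y1 in X1. rewrite Y2 in X2. rewrite Y3, Z1 in X3. rewrite Y4, Z2 in X4.
  rewrite <- X1, <- X2 in *.
  set (p := d1 c u (F u v)) in *. set (q := d2 c u (F u v)) in *. set (r := d1 d u (F u v)) in *. set (s := d2 d u (F u v)) in *.
  set (x := d1 F0 (a u v) (b u v)) in *. set (y := d2 F0 (a u v) (b u v)) in *. set (bu := d1 b u v) in *. set (bv := d2 b u v) in *.
  set (fu := d1 F u v) in *. set (fv := d2 F u v) in *.
  replace (((p * 1 + q * fu) * bv - (p * 0 + q * fv) * bu) * y) with ((p + q * fu) * (y * bv) - q * fv * (y * bu)) by ring.
  replace (y * bv) with (s * fv - x * (q * fv)) by lra. replace (y * bu) with (r + s * fu - x * (p + q * fu)) by lra. ring.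
Qed.

Lemma locally_2d_along P x y : sm1 x 0 -> sm1 y 0 -> x 0 = 0 -> y 0 = 0 -> locally_2d P 0 0 -> locally 0 (fun t => P (x t) (y t)).
Proof. intros Sx Sy x0 y0 H. apply locally_2d_pull1; auto. now rewrite x0, y0. Qed.

Lemma bigO_along F x y : sm2 F 0 0 -> sm1 x 0 -> sm1 y 0 -> x 0 = 0 -> y 0 = 0 -> bigO 0 (fun t => F (x t) (y t)).
Proof. intros. apply bigO_continuous. sms. Qed.

Lemma curve_image a b x y : sm2 a 0 0 -> sm2 b 0 0 -> a 0 0 = 0 -> b 0 0 = 0 -> d1 a 0 0 * d2 b 0 0 - d2 a 0 0 * d1 b 0 0 <> 0 ->
  sm1 x 0 -> sm1 y 0 -> x 0 = 0 -> y 0 = 0 -> (Derive x 0 <> 0 \/ Derive y 0 <> 0) ->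
  sm1 (fun t => a (x t) (y t)) 0 /\ sm1 (fun t => b (x t) (y t)) 0 /\ a (x 0) (y 0) = 0 /\ b (x 0) (y 0) = 0 /\
  (Derive (fun t => a (x t) (y t)) 0 <> 0 \/ Derive (fun t => b (x t) (y t)) 0 <> 0).
Proof.
  intros Sa Sb a0 b0 J Sx Sy x0 y0 I. split; [sms|]. split; [sms|]. rewrite x0, y0. split; auto. split; auto.
  assert (D1 : Derive (fun t => a (x t) (y t)) 0 = d1 a 0 0 * Derive x 0 + d2 a 0 0 * Derive y 0)
    by exact (is_derive_unique _ _ _ (sm2_chain a x y 0 0 _ _ 0 Sa x0 y0 (sm1_derive _ _ Sx) (sm1_derive _ _ Sy))).
  assert (D2 : Derive (fun t => b (x t) (y t)) 0 = d1 b 0 0 * Derive x 0 + d2 b 0 0 * Derive y 0)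
    by exact (is_derive_unique _ _ _ (sm2_chain b x y 0 0 _ _ 0 Sb x0 y0 (sm1_derive _ _ Sx) (sm1_derive _ _ Sy))).
  rewrite D1, D2. clear D1 D2.
  set (p := d1 a 0 0) in *. set (q := d2 a 0 0) in *. set (r := d1 b 0 0) in *. set (s := d2 b 0 0) in *. set (m := Derive x 0) in *. set (n := Derive y 0) in *.
  destruct (Req_dec (p * m + q * n) 0) as [E1|]; auto. destruct (Req_dec (r * m + s * n) 0) as [E2|]; auto. exfalso.
  assert (M : (p * s - q * r) * m = 0) by (replace ((p * s - q * r) * m) with (s * (p * m + q * n) - q * (r * m + s * n)) by ring; rewrite E1, E2; ring).
  assert (N : (p * s - q * r) * n = 0) by (replace ((p * s - q * r) * n) with (p * (r * m + s * n) - r * (p * m + q * n)) by ring; rewrite E1, E2; ring).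
  apply Rmult_integral in M. apply Rmult_integral in N. tauto.
Qed.

(** The Jacobians satisfy lambda0(phi1) = rho lambda with rho smooth. Differentiating, the derivatives of lambda0 are
    combinations of lambda and of its derivatives, so that their orders along the curve do not decrease. *)
Lemma jacobian_order_transfer F F0 n x y : sm2 F 0 0 -> sm2 F0 0 0 -> F 0 0 = 0 -> A_equivalent (corank1 F) (corank1 F0) ->
  sm1 x 0 -> sm1 y 0 -> x 0 = 0 -> y 0 = 0 -> (Derive x 0 <> 0 \/ Derive y 0 <> 0) ->
  bigO n (fun t => d2 F (x t) (y t)) -> bigO n (fun t => d1 (d2 F) (x t) (y t)) -> bigO n (fun t => d2 (d2 F) (x t) (y t)) ->
  exists X Y, sm1 X 0 /\ sm1 Y 0 /\ X 0 = 0 /\ Y 0 = 0 /\ (Derive X 0 <> 0 \/ Derive Y 0 <> 0) /\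
    bigO n (fun t => d1 (d2 F0) (X t) (Y t)) /\ bigO n (fun t => d2 (d2 F0) (X t) (Y t)).
Proof.
  intros SF SF0 F00 HA Sx Sy x0 y0 I B0 B1 B2.
  destruct (A_equivalent_data F F0 HA) as (a & b & c & d & Sa & Sb & a0 & b0 & J & _ & Sc & Sd & c0 & d0 & _ & L).
  exists (fun t => a (x t) (y t)), (fun t => b (x t) (y t)).
  destruct (curve_image a b x y Sa Sb a0 b0 J Sx Sy x0 y0 I) as (C1 & C2 & C3 & C4 & C5). do 5 (split; [assumption|]).
  pose proof (jacobian_relation F F0 a b c d SF SF0 F00 Sa Sb a0 b0 Sc Sd L) as R.
  set (J1 := fun u v => d1 a u v * d2 b u v - d2 a u v * d1 b u v).
  assert (SJ1 : sm2 J1 0 0) by (unfold J1; sms).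
  set (rho := fun u v => (d1 c u (F u v) * d2 d u (F u v) - d2 c u (F u v) * d1 d u (F u v)) / J1 u v).
  assert (Srho : sm2 rho 0 0) by (unfold rho; sms).
  pose proof (neq0_near J1 0 0 SJ1 J) as NJ.
  assert (R' : locally_2d (fun u v => d2 F0 (a u v) (b u v) = rho u v * d2 F u v) 0 0).
  { apply (locally_2d_mp2 _ _ _ _ _ R NJ). intros u v E N. unfold rho. fold (J1 u v) in E. apply Rmult_eq_reg_l with (J1 u v); auto. rewrite E. field. auto. }
  assert (N2 : locally_2d (fun u v => sm2 (d2 F0) (a u v) (b u v)) 0 0).
  { apply (locally_2d_pull (sm2 (d2 F0)) a b); auto. rewrite a0, b0. apply sm2_near. sms. }
  assert (E : locally_2d (fun u v => J1 u v <> 0 /\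
     d1 (d2 F0) (a u v) (b u v) * d1 a u v + d2 (d2 F0) (a u v) (b u v) * d1 b u v = d1 rho u v * d2 F u v + rho u v * d1 (d2 F) u v /\
     d1 (d2 F0) (a u v) (b u v) * d2 a u v + d2 (d2 F0) (a u v) (b u v) * d2 b u v = d2 rho u v * d2 F u v + rho u v * d2 (d2 F) u v) 0 0).
  { assert (SdF : sm2 (d2 F) 0 0) by sms.
    apply (locally_2d_mp4 _ _ _ _ _ _ _ (locally_2d_locally_2d _ _ _ R') (locally_2d_and _ _ _ _ N2 NJ) (locally_2d_and _ _ _ _ (sm2_near _ _ _ Sa) (sm2_near _ _ _ Sb)) (locally_2d_and _ _ _ _ (sm2_near _ _ _ Srho) (sm2_near _ _ _ SdF))).
    intros u v K [HF0 HJ] [Ha Hb] [Hr HF]. split; auto. destruct (d_ext _ _ _ _ K) as [X1 X2].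
    destruct (d_comp (d2 F0) a b u v _ _ HF0 eq_refl eq_refl Ha Hb) as [Y1 Y2]. rewrite Y1 in X1. rewrite Y2 in X2. rewrite X1, X2.
    split; apply is_derive_unique.
    - apply (derive_mul (fun u => rho u v) (fun u => d2 F u v)); now apply sm2_derive1.
    - apply (derive_mul (fun v => rho u v) (fun v => d2 F u v)); now apply sm2_derive2. }
  pose proof (locally_2d_along _ x y Sx Sy x0 y0 E) as Et. cbv beta in Et.
  assert (Q1 : bigO n (fun t => d1 rho (x t) (y t) * d2 F (x t) (y t) + rho (x t) (y t) * d1 (d2 F) (x t) (y t))).
  { apply bigO_add; apply (bigO_mul 0 n); auto; apply (bigO_along _ x y); auto; sms. }
  assert (Q2 : bigO n (fun t => d2 rho (x t) (y t) * d2 F (x t) (y t) + rho (x t) (y t) * d2 (d2 F) (x t) (y t))).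
  { apply bigO_add; apply (bigO_mul 0 n); auto; apply (bigO_along _ x y); auto; sms. }
  assert (Sb1 : sm2 (fun u v => d2 b u v / J1 u v) 0 0) by sms. assert (Sb2 : sm2 (fun u v => d1 b u v / J1 u v) 0 0) by sms.
  assert (Sa1 : sm2 (fun u v => d2 a u v / J1 u v) 0 0) by sms. assert (Sa2 : sm2 (fun u v => d1 a u v / J1 u v) 0 0) by sms.
  split.
  - eapply bigO_ext; [|apply bigO_sub; [apply (bigO_mul 0 n _ _ (bigO_along _ x y Sb1 Sx Sy x0 y0) Q1)|apply (bigO_mul 0 n _ _ (bigO_along _ x y Sb2 Sx Sy x0 y0) Q2)]].
    apply (locally_mp _ _ _ Et). intros t (NJt & X1 & X2). rewrite <- X1, <- X2. unfold J1 in *. field. exact NJt.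
  - eapply bigO_ext; [|apply bigO_sub; [apply (bigO_mul 0 n _ _ (bigO_along _ x y Sa2 Sx Sy x0 y0) Q2)|apply (bigO_mul 0 n _ _ (bigO_along _ x y Sa1 Sx Sy x0 y0) Q1)]].
    apply (locally_mp _ _ _ Et). intros t (NJt & X1 & X2). rewrite <- X1, <- X2. unfold J1 in *. field. exact NJt.
Qed.

(** In the target, a function of order n remains of order n; F0 restricted to the image of the line u = 0, which is
    tangent to that line to order n, differs from F0 on the line by the same order. *)
Lemma multiplicity_transfer F F0 n : sm2 F 0 0 -> sm2 F0 0 0 -> F 0 0 = 0 -> A_equivalent (corank1 F) (corank1 F0) -> (2 <= n)%nat ->
  bigO n (fun v => F 0 v) -> exists Y, sm1 Y 0 /\ Y 0 = 0 /\ Derive Y 0 <> 0 /\ bigO n (fun v => F0 0 (Y v)).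
Proof.
  intros SF SF0 F00 HA Hn B.
  destruct (A_equivalent_data F F0 HA) as (a & b & c & d & Sa & Sb & a0 & b0 & J & _ & Sc & Sd & c0 & d0 & _ & L).
  pose proof (curve_image a b (fun _ => 0) (fun t => t) Sa Sb a0 b0 J ltac:(sms) ltac:(sms) eq_refl eq_refl ltac:(right; rewrite Derive_id; lra)) as (C1 & C2 & C3 & C4 & C5).
  assert (Lt : locally 0 (fun v => c 0 (F 0 v) = a 0 v /\ d 0 (F 0 v) = F0 (a 0 v) (b 0 v))).
  { apply (locally_2d_along _ (fun _ => 0) (fun t => t)) in L; auto; sms. }
  assert (Bc : forall h, sm2 h 0 0 -> h 0 0 = 0 -> bigO n (fun v => h 0 (F 0 v))).
  { intros h Sh h0. rewrite <- (Nat.mul_1_r n). apply (bigO_comp 1 n (h 0) (fun v => F 0 v)); auto; [lia|]. apply bigO_vanish; auto. sms. }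
  assert (BX : bigO n (fun v => a 0 v)) by (eapply bigO_ext; [|apply (Bc c Sc c0)]; apply (locally_mp _ _ _ Lt); tauto).
  assert (BF : bigO n (fun v => F0 (a 0 v) (b 0 v))) by (eapply bigO_ext; [|apply (Bc d Sd d0)]; apply (locally_mp _ _ _ Lt); tauto).
  exists (fun v => b 0 v). split; [exact C2|]. split; [exact C4|]. split.
  - destruct C5 as [C5|C5]; auto. exfalso. apply C5.
    apply (bigO_coeff 1). pose proof (bigO_linear (fun v => a 0 v) C1 a0) as Lin.
    apply bigO_ext with (fun t => a 0 t - (a 0 t - Derive (fun t => a 0 t) 0 * t)). apply locally_all; intros; simpl; ring.
    apply bigO_sub; auto. now apply bigO_le with n.
  - destruct (hadamard_fst F0 (fun _ => 0) 0 0 SF0 ltac:(sms) eq_refl) as (g & Sg & Eg & _).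
    apply bigO_ext with (fun v => F0 (a 0 v) (b 0 v) - a 0 v * g (a 0 v) (b 0 v)).
    + pose proof (locally_2d_along _ (fun v => a 0 v) (fun v => b 0 v) C1 C2 a0 b0 Eg) as K. apply (locally_mp _ _ _ K). intros v ->. ring.
    + apply bigO_sub; auto. rewrite <- (Nat.add_0_r n). apply bigO_mul; auto. apply (bigO_along g); auto.
Qed.

(** A curve with nonzero velocity has exact order 1, so that Y^m e(Y) has exact order m. *)
Lemma bigO_immersed_pow Y m n e : sm1 Y 0 -> Y 0 = 0 -> Derive Y 0 <> 0 -> sm1 e 0 -> e 0 <> 0 -> (m < n)%nat ->
  bigO n (fun t => Y t ^ m * e (Y t)) -> False.
Proof.
  intros S Y0 D Se e0 Hm B. destruct (hadamard_1 Y 0 S) as (g & Sg & Eg & g0). rewrite Y0 in Eg.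
  set (h := fun t => g t ^ m * e (Y t)). assert (Sh : sm1 h 0) by (unfold h; sms).
  assert (h0 : h 0 <> 0) by (unfold h; rewrite g0, Y0; apply Rmult_integral_contrapositive_currified; auto; now apply pow_nonzero).
  destruct (germ_lower_bound h Sh h0) as (c & Hc & L). apply (bigO_lower n m c _ B Hm Hc).
  apply (locally_mp2 _ _ _ _ Eg L). intros t E K. replace (Y t ^ m) with (t ^ m * g t ^ m) by (rewrite E, <- Rpow_mult_distr; f_equal; ring).
  rewrite Rmult_assoc, Rabs_mult, RPow_abs, Rmult_comm. apply Rmult_le_compat_l; [apply Rabs_pos|exact K].
Qed.

(** * Beaks, lips, goose and ugly goose *)

(** The unfolding v^3 + al(u) v, to which the beaks, the lips, the goose and the ugly goose belong. *)
Definition cubic (al : R -> R) : R -> R -> R := fun u v => v ^ 3 + al u * v.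

Lemma cubic_sm al : sm1 al 0 -> sm2 (cubic al) 0 0 /\ cubic al 0 0 = 0.
Proof. intros S. split; [unfold cubic; sms|unfold cubic; ring]. Qed.

Lemma A_equivalent_cubic al be h : sm1 h 0 -> h 0 = 0 -> Derive h 0 <> 0 ->
  locally 0 (fun u => al u = be (h u)) -> A_equivalent (corank1 (cubic al)) (corank1 (cubic be)).
Proof.
  intros Sh h0 Dh E.
  assert (D : d2 (fun _ v => v) 0 0 <> 0) by (unfold d2; rewrite Derive_id; lra).
  apply (A_equivalent_fibred (cubic al) (cubic be) h (fun _ z => z) (fun _ v => v)); auto; try sms.
  assert (L : locally_2d (fun u _ => al u = be (h u)) 0 0) by (now apply locally_2d_fst).
  apply (locally_2d_mp _ _ _ _ L). intros u v K. unfold cubic. now rewrite K.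
Qed.

Lemma Derive_mul_id g : sm1 g 0 -> Derive (fun u => u * g u) 0 = g 0.
Proof.
  intros S. apply is_derive_unique. eapply derive_eq; [apply (derive_mul (fun u => u) g); [apply derive_id|apply sm1_derive; exact S]|ring].
Qed.

(** If al = u^k e with s e(0) > 0, then u times the k-th root of s e is a coordinate in which al is s u^k. *)
Lemma cubic_monomial al e k s : (1 <= k)%nat -> sm1 e 0 -> locally 0 (fun u => al u = u ^ k * e u) -> s * s = 1 -> 0 < s * e 0 ->
  A_equivalent (corank1 (cubic al)) (corank1 (cubic (fun u => s * u ^ k))).
Proof.
  intros Hk Se E Hs H0.
  destruct (root_germ (fun u => s * e u) k Hk ltac:(sms) H0) as (rho & Sr & r0 & Er).
  apply (A_equivalent_cubic _ _ (fun u => u * rho u)).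
  - sms.
  - ring.
  - rewrite Derive_mul_id by auto. lra.
  - apply (locally_mp2 _ _ _ _ E Er). intros u -> K. rewrite Rpow_mult_distr, K.
    replace (s * (u ^ k * (s * e u))) with ((s * s) * (u ^ k * e u)) by ring. rewrite Hs. ring.
Qed.

(** Replace u by s u. *)
Lemma cubic_sign_odd s : s * s = 1 -> A_equivalent (corank1 (cubic (fun u => s * u ^ 3))) (corank1 (cubic (fun u => 1 * u ^ 3))).
Proof.
  intros Hs. apply (A_equivalent_cubic _ _ (fun u => s * u)).
  - sms.
  - ring.
  - rewrite (is_derive_unique _ _ s). intros ->; lra. auto_derive; auto. ring.
  - apply locally_all. intros u. replace (1 * (s * u) ^ 3) with ((s * s) * (s * u ^ 3)) by ring. rewrite Hs. ring.
Qed.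

Lemma cubic_d al u v : d2 (cubic al) u v = 3 * v ^ 2 + al u.
Proof. unfold cubic, d2. apply is_derive_unique. auto_derive; auto. ring. Qed.

Lemma cubic_dd al u v : sm1 al u -> d1 (d2 (cubic al)) u v = Derive al u /\ d2 (d2 (cubic al)) u v = 6 * v.
Proof.
  intros S. unfold d1 at 1, d2 at 2.
  rewrite (Derive_ext (fun t => d2 (cubic al) t v) (fun t => 3 * v ^ 2 + al t)) by (intros; apply cubic_d).
  rewrite (Derive_ext (fun t => d2 (cubic al) u t) (fun t => 3 * t ^ 2 + al u)) by (intros; apply cubic_d).
  split; apply is_derive_unique.
  - eapply derive_eq; [apply (derive_add (fun _ => 3 * v^2) al); [apply derive_cst|apply sm1_derive; exact S]|ring].
  - auto_derive; auto. ring.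
Qed.

(** Along the curve (t, 0) the Jacobian 3 v^2 + al and its derivatives vanish to order k - 1. For the curve (X, Y)
    with the same property in the other germ, the derivative 6 Y in v forces Y to have order at least 2, hence X is
    immersed, and the derivative s l X^(l-1) in u has exact order l - 1 < k - 1. *)
Lemma cubic_order_invariant al k s l : sm1 al 0 -> bigO k al -> s <> 0 -> (2 <= l)%nat -> (l < k)%nat ->
  A_equivalent (corank1 (cubic al)) (corank1 (cubic (fun u => s * u ^ l))) -> False.
Proof.
  intros Sal B Hs Hl Hk HA. destruct (cubic_sm al Sal) as [S1 E1].
  assert (Sbe : sm1 (fun u => s * u ^ l) 0) by sms. destruct (cubic_sm _ Sbe) as [S2 _].
  assert (Dal : bigO (k - 1) (Derive al)).
  { destruct (bigO_divide k al Sal B) as (e & Se & Ee). apply bigO_ext with (fun u => u ^ (k - 1) * (INR k * e u + u * Derive e u)).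
    - assert (N : locally 0 (fun u => locally u (fun t => al t = t ^ k * e t) /\ sm1 e u)) by (apply filter_and; [now apply locally_locally|now apply sm1_near]).
      apply (locally_mp _ _ _ N). intros u [K Su]. rewrite (Derive_ext_loc _ _ _ K). symmetry. apply is_derive_unique.
      assert (X : is_derive (fun t => t ^ k) u (INR k * u ^ pred k)) by (auto_derive; auto; ring).
      eapply derive_eq; [exact (derive_mul _ e u _ _ X (sm1_derive _ _ Su))|].
      destruct k as [|k]; [lia|]. replace (Datatypes.S k - 1)%nat with k by lia. rewrite Nat.pred_succ, <- tech_pow_Rmult. ring.
    - apply bigO_powmul. apply bigO_continuous. sms. }
  destruct (jacobian_order_transfer _ _ (k - 1) (fun t => t) (fun _ => 0) S1 S2 E1 HA) as (X & Y & SX & SY & X0 & Y0 & I & B1 & B2); auto; try sms.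
  - left. rewrite Derive_id. lra.
  - apply bigO_ext with al. apply locally_all. intros t. rewrite cubic_d. ring. apply bigO_le with k; auto; lia.
  - apply bigO_ext with (Derive al); auto. apply (locally_mp _ _ _ (sm1_near _ _ Sal)). intros t St. now rewrite (proj1 (cubic_dd al t 0 St)).
  - apply bigO_ext with (fun _ => 0). apply (locally_mp _ _ _ (sm1_near _ _ Sal)). intros t St. rewrite (proj2 (cubic_dd al t 0 St)). ring.
    exists 0. apply locally_all. intros. rewrite Rabs_R0. lra.
  - assert (SX' : locally 0 (fun t => sm1 (fun u => s * u ^ l) (X t))) by (apply locally_all; intros; clear; sms).
    assert (B2' : bigO 2 Y).
    { apply bigO_le with (k - 1)%nat; [lia|]. apply bigO_ext with (fun t => / 6 * d2 (d2 (cubic (fun u => s * u ^ l))) (X t) (Y t)); [|now apply bigO_scal].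
      apply (locally_mp _ _ _ SX'). intros t St. rewrite (proj2 (cubic_dd _ _ (Y t) St)). field. }
    assert (DY : Derive Y 0 = 0).
    { apply (bigO_coeff 1). apply bigO_ext with (fun t => Y t - (Y t - Derive Y 0 * t)). apply locally_all; intros; simpl; ring. apply bigO_sub; auto. now apply bigO_linear. }
    assert (DX : Derive X 0 <> 0) by (destruct I; auto; contradiction).
    apply (bigO_immersed_pow X (l - 1) (k - 1) (fun _ => s * INR l) SX X0 DX); [sms| |lia|].
    + apply Rmult_integral_contrapositive_currified; auto. apply not_0_INR. lia.
    + apply bigO_ext with (fun t => d1 (d2 (cubic (fun u => s * u ^ l))) (X t) (Y t)); auto.
      apply (locally_mp _ _ _ SX'). intros t St. rewrite (proj1 (cubic_dd _ _ (Y t) St)). apply is_derive_unique. auto_derive; auto.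
      replace (pred l) with (l - 1)%nat by lia. ring.
Qed.

(** The Jacobian 3 q^2 + p^2 of the lips vanishes at the origin only, that of the beaks on the lines u = sqrt 3 v and
    u = - sqrt 3 v; a diffeomorphism germ is injective. *)
Lemma beaks_not_lips : A_equivalent (corank1 (cubic (fun u => -1 * u ^ 2))) (corank1 (cubic (fun u => 1 * u ^ 2))) -> False.
Proof.
  intros HA. set (F := cubic (fun u => -1 * u ^ 2)) in *. set (F0 := cubic (fun u => 1 * u ^ 2)) in *.
  assert (SF : sm2 F 0 0 /\ F 0 0 = 0) by (apply cubic_sm; sms). assert (SF0 : sm2 F0 0 0 /\ F0 0 0 = 0) by (apply cubic_sm; sms).
  destruct SF as [SF EF]. destruct SF0 as [SF0 _].
  destruct (A_equivalent_data F F0 HA) as (a & b & c & d & Sa & Sb & a0 & b0 & J & Inj & Sc & Sd & c0 & d0 & _ & L).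
  pose proof (jacobian_relation F F0 a b c d SF SF0 EF Sa Sb a0 b0 Sc Sd L) as R.
  assert (SJ : sm2 (fun u v => d1 a u v * d2 b u v - d2 a u v * d1 b u v) 0 0) by sms.
  pose proof (neq0_near _ 0 0 SJ J) as NJ.
  destruct (locally_2d_and _ _ _ _ Inj (locally_2d_and _ _ _ _ R NJ)) as [e K].
  pose proof (cond_pos e) as He.
  set (t := e / 4). assert (Ht : 0 < t) by (unfold t; lra).
  assert (s3 : 0 < sqrt 3 < 2). { split. apply sqrt_lt_R0; lra. rewrite <- (sqrt_square 2) by lra. apply sqrt_lt_1; lra. }
  destruct (K (sqrt 3 * t) t) as (I & R' & N).
  { rewrite Rminus_0_r, Rabs_pos_eq by nra. unfold t. nra. } { rewrite Rminus_0_r, Rabs_pos_eq by lra. unfold t. lra. }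
  unfold F, F0 in R'. rewrite !cubic_d in R'. fold F in R'.
  replace (3 * t ^ 2 + -1 * (sqrt 3 * t) ^ 2) with 0 in R' by (rewrite Rpow_mult_distr, pow2_sqrt by lra; ring). rewrite Rmult_0_r in R'.
  apply Rmult_integral in R'. destruct R' as [R'|R']; [contradiction|].
  set (p := a (sqrt 3 * t) t) in *. set (q := b (sqrt 3 * t) t) in *.
  assert (p = 0 /\ q = 0) as [P Q]. { pose proof (pow2_ge_0 p). pose proof (pow2_ge_0 q). split; apply Rsqr_0_uniq; unfold Rsqr; lra. }
  destruct (I P Q). lra.
Qed.

(** The conditions on the Taylor coefficients, as values of partial derivatives. *)
Lemma monge_facts a f : parabolic_monge_form a f -> sm2 f 0 0 /\ f 0 0 = 0 /\
  (forall i j, (3 <= i + j)%nat -> partial_derive i j f 0 0 = a i j) /\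
  partial_derive 1 0 f 0 0 = 0 /\ partial_derive 0 1 f 0 0 = 0 /\ partial_derive 2 0 f 0 0 = 0 /\ partial_derive 1 1 f 0 0 = 0.
Proof.
  intros (S & _ & H). split; [now apply smooth_germ_sm2|].
  assert (Z : forall i j, monge_coeff a i j = 0 -> partial_derive i j f 0 0 = 0).
  { intros i j E. specialize (H i j). rewrite E in H. unfold taylor_coeff in H. pose proof (INR_fact_neq_0 i). pose proof (INR_fact_neq_0 j).
    replace (partial_derive i j f 0 0) with (partial_derive i j f 0 0 / (INR (fact i) * INR (fact j)) * (INR (fact i) * INR (fact j))) by (field; auto). rewrite H. ring. }
  split; [exact (Z 0%nat 0%nat eq_refl)|]. split.
  - intros i j Hij. specialize (H i j). unfold monge_coeff in H. rewrite (proj2 (Nat.leb_le 3 (i+j)) Hij) in H. unfold taylor_coeff in H.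
    pose proof (INR_fact_neq_0 i). pose proof (INR_fact_neq_0 j).
    apply Rmult_eq_reg_r with (/ (INR (fact i) * INR (fact j))); [exact H|]. apply Rinv_neq_0_compat. now apply Rmult_integral_contrapositive_currified.
  - repeat split; now apply Z.
Qed.

Lemma INR_fact_values : INR (fact 0) = 1 /\ INR (fact 1) = 1 /\ INR (fact 2) = 2 /\ INR (fact 3) = 6 /\ INR (fact 4) = 24 /\ INR (fact 5) = 120 /\ INR (fact 6) = 720 /\ INR (fact 7) = 5040.
Proof. repeat split; rewrite INR_IZR_INZ; reflexivity. Qed.

(** The curve X = k1 u + k2 u^2 satisfies f_xx(X, u) = O(u^3), and the exact solution m of f_xx(m, u) = 0 therefore
    differs from it by O(u^3). As m is a critical point of f_x(., u), the values of f_x differ by the square of this,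
    and the Taylor polynomial along X is exact to order 5. The k1 and k2 come from solving f_xx(X, u) = 0 order by
    order. *)
Lemma critical_value_expansion a f m : parabolic_monge_form a f -> a 3%nat 0%nat <> 0 -> sm1 m 0 -> m 0 = 0 ->
  locally 0 (fun u => d1 (d1 f) (m u) u = 0) ->
  bigO 5 (fun u => d1 f (m u) u - (- Q_D4 a / (2 * a 3%nat 0%nat) * u ^ 2 + Q_E7 a / (6 * a 3%nat 0%nat ^ 3) * u ^ 3
     + Q_Estar a / (24 * a 3%nat 0%nat ^ 5) * u ^ 4)).
Proof.
  intros hf Ha Sm m0 Em. destruct (monge_facts a f hf) as (Sf & f0 & pd & p10 & p01 & p20 & p11).
  assert (Sl : sm2 (d1 f) 0 0) by sms. assert (Sll : sm2 (d1 (d1 f)) 0 0) by sms.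
  set (k1 := - a 2%nat 1%nat / a 3%nat 0%nat).
  set (k2 := - (a 4%nat 0%nat * k1 ^ 2 + 2 * a 3%nat 1%nat * k1 + a 2%nat 2%nat) / (2 * a 3%nat 0%nat)).
  set (X := fun u => k1 * u + k2 * u ^ 2).
  assert (SX : sm1 X 0) by (unfold X; sms). assert (X0 : X 0 = 0) by (unfold X; ring).
  destruct INR_fact_values as (F0 & F1 & F2 & F3 & F4 & _).
  (* the approximate critical point is accurate to third order *)
  assert (B2 : bigO 3 (fun u => d1 (d1 f) (X u) u)).
  { pose proof (taylor_along (d1 (d1 f)) 2 X (fun u => u) Sll (bigO_vanish X SX X0) bigO_id) as T.
    (* Q is the part of order at least 3 of the Taylor polynomial along X *)
    set (Q := fun u => u ^ 3 * ((k2 * a 3%nat 1%nat + k1 * k2 * a 4%nat 0%nat) + u * (k2^2 * a 4%nat 0%nat / 2))).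
    assert (BQ : bigO 3 Q) by (apply bigO_powmul, bigO_continuous; sms).
    eapply bigO_ext; [|apply (bigO_add 3 _ _ T BQ)]. apply locally_all. intros u. cbv beta.
    cbn [sum_f_R0 Nat.sub]. unfold taylor_coeff. rewrite !partial_derive_d1 by sms. rewrite p20, !pd by lia. rewrite F0, F1, F2.
    unfold Q, X, k2, k1. field. auto. }
  assert (B4 : bigO 5 (fun u => d1 f (X u) u - (- Q_D4 a / (2 * a 3%nat 0%nat) * u ^ 2 + Q_E7 a / (6 * a 3%nat 0%nat ^ 3) * u ^ 3
     + Q_Estar a / (24 * a 3%nat 0%nat ^ 5) * u ^ 4))).
  { pose proof (taylor_along (d1 f) 4 X (fun u => u) Sl (bigO_vanish X SX X0) bigO_id) as T.
    set (l21 := a 3%nat 1%nat / 2). set (l30 := a 4%nat 0%nat / 6). set (l13 := a 2%nat 3%nat / 6). set (l22 := a 3%nat 2%nat / 4). set (l31 := a 4%nat 1%nat / 6). set (l40 := a 5%nat 0%nat / 24).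
    set (Q := fun u => u ^ 5 * ((k2^2*l21 + 3*k1*k2^2*l30 + k2*l13 + 2*k1*k2*l22 + 3*k1^2*k2*l31 + 4*k1^3*k2*l40) + u * ((k2^3*l30 + k2^2*l22 + 3*k1*k2^2*l31 + 6*k1^2*k2^2*l40) + u * ((k2^3*l31 + 4*k1*k2^3*l40) + u * (k2^4*l40))))).
    assert (BQ : bigO 5 Q) by (apply bigO_powmul, bigO_continuous; sms).
    eapply bigO_ext; [|apply (bigO_add 5 _ _ T BQ)]. apply locally_all. intros u. cbv beta.
    cbn [sum_f_R0 Nat.sub]. unfold taylor_coeff. rewrite !partial_derive_d1 by sms. rewrite p20, p10, p11, !pd by lia. rewrite F0, F1, F2, F3, F4.
    unfold Q, X, k2, l21, l30, l13, l22, l31, l40, k1, Q_D4, Q_E7, Q_Estar. field. auto. }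
  (* so that the critical value is accurate to sixth order *)
  destruct (hadamard_2 (fun y x => d1 f x y) m 0 0 ltac:(sms) Sm m0) as (g & Sg & Eg & _).
  destruct (hadamard (fun y x => d1 (d1 f) x y) m 0 0 ltac:(sms) Sm m0) as (h & Sh & Eh & Dh).
  assert (h0 : h 0 0 <> 0).
  { pose proof (Dh 0) as D. rewrite m0 in D. rewrite D. change (partial_derive 3 0 f 0 0 <> 0). now rewrite pd by lia. }
  assert (Eg' := locally_2d_along _ (fun u => u) X ltac:(sms) SX eq_refl X0 Eg). assert (Eh' := locally_2d_along _ (fun u => u) X ltac:(sms) SX eq_refl X0 Eh).
  assert (Nh := locally_2d_along _ (fun u => u) X ltac:(sms) SX eq_refl X0 (neq0_near h 0 0 Sh h0)). cbv beta in Eg', Eh', Nh.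
  assert (B3 : bigO 3 (fun u => X u - m u)).
  { apply bigO_ext with (fun u => d1 (d1 f) (X u) u * / h u (X u)).
    - apply (locally_mp3 _ _ _ _ _ Eh' Nh Em). intros u K1 K2 K3. rewrite K3 in K1. rewrite K1. field. auto.
    - apply (bigO_mul 3 0); auto. apply bigO_continuous. sms. }
  assert (B6 : bigO 5 (fun u => (X u - m u) ^ 2 * g u (X u))).
  { apply bigO_le with 6%nat; [lia|]. apply (bigO_mul 6 0). apply (bigO_powfun 3 2); auto. apply bigO_continuous. sms. }
  eapply bigO_ext; [|apply (bigO_sub 5 _ _ B4 B6)]. apply (locally_mp2 _ _ _ _ Eg' Em). intros u K1 K2. cbv beta.
  rewrite K1. change (d2 (fun y x => d1 f x y) u (m u)) with (d1 (d1 f) (m u) u). rewrite K2. ring.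
Qed.

(** The constant K = 3 eps has the sign of a30, which makes K Q_D4 / a30 have the sign of Q_D4. *)
Lemma projection_cubic a f : parabolic_monge_form a f -> a 3%nat 0%nat <> 0 -> exists al K, sm1 al 0 /\ 0 < K * a 3%nat 0%nat /\
  A_equivalent (corank1 (fun u v => f v u)) (corank1 (cubic al)) /\
  bigO 5 (fun u => al u - K * (- Q_D4 a / (2 * a 3%nat 0%nat) * u ^ 2 + Q_E7 a / (6 * a 3%nat 0%nat ^ 3) * u ^ 3 + Q_Estar a / (24 * a 3%nat 0%nat ^ 5) * u ^ 4)).
Proof.
  intros hf Ha. destruct (monge_facts a f hf) as (Sf & f0 & pd & p10 & p01 & p20 & p11).
  assert (p30 : d1 (d1 (d1 f)) 0 0 = a 3%nat 0%nat) by (rewrite <- pd by lia; reflexivity).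
  destruct (cubic_unfolding (fun u v => f v u)) as (m & eps & Sm & m0 & Em & He & Hp & HA).
  - sms.
  - exact f0.
  - exact p10.
  - exact p20.
  - change (d1 (d1 (d1 f)) 0 0 <> 0). now rewrite p30.
  - change (0 < eps * d1 (d1 (d1 f)) 0 0) in Hp. rewrite p30 in Hp.
    exists (fun u => 3 * (eps * d1 f (m u) u)), (3 * eps). split; [sms|]. split; [lra|]. split; [exact HA|].
    pose proof (critical_value_expansion a f m hf Ha Sm m0 Em) as B.
    eapply bigO_ext; [|apply (bigO_scal 5 (3 * eps) _ B)]. apply locally_all. intros u. cbv beta. ring.
Qed.

Lemma cubic_leading al k c : sm1 al 0 -> (1 <= k)%nat -> bigO (S k) (fun u => al u - c * u ^ k) -> forall s, s * s = 1 -> 0 < s * c ->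
  A_equivalent (corank1 (cubic al)) (corank1 (cubic (fun u => s * u ^ k))).
Proof.
  intros S Hk B s Hs Hc. destruct (bigO_leading k c al S B) as (e & Se & e0 & E). apply (cubic_monomial al e k s); auto. now rewrite e0.
Qed.

Lemma sign_exists c : c <> 0 -> exists s, s * s = 1 /\ 0 < s * c.
Proof. intros H. destruct (Rlt_dec 0 c). exists 1; lra. exists (-1); lra. Qed.

Lemma cubic_truncate al p2 p3 p4 : bigO 5 (fun u => al u - (p2 * u ^ 2 + p3 * u ^ 3 + p4 * u ^ 4)) ->
  bigO 3 (fun u => al u - p2 * u ^ 2) /\ (p2 = 0 -> bigO 4 (fun u => al u - p3 * u ^ 3)) /\ (p2 = 0 -> p3 = 0 -> bigO 5 (fun u => al u - p4 * u ^ 4)).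
Proof.
  intros B. split; [|split].
  - eapply bigO_ext; [|apply (bigO_add 3 _ (fun u => u ^ 3 * (p3 + p4 * u)) (bigO_le 5 3 _ ltac:(lia) B))]. apply locally_all; intros; cbv beta; ring. apply bigO_powmul, bigO_continuous; sms.
  - intros ->. eapply bigO_ext; [|apply (bigO_add 4 _ (fun u => u ^ 4 * p4) (bigO_le 5 4 _ ltac:(lia) B))]. apply locally_all; intros; cbv beta; ring. apply bigO_powmul, bigO_const.
  - intros -> ->. eapply bigO_ext; [|exact B]. apply locally_all; intros; cbv beta; ring.
Qed.

(** The last case bounds the order of al from below and serves to exclude degenerate projections in the converse
    direction. *)
Lemma projection_cubic_cases a f : parabolic_monge_form a f -> a 3%nat 0%nat <> 0 -> let F := fun u v => f v u in
  (0 < Q_D4 a -> A_equivalent (corank1 F) (corank1 (cubic (fun u => -1 * u ^ 2)))) /\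
  (Q_D4 a < 0 -> A_equivalent (corank1 F) (corank1 (cubic (fun u => 1 * u ^ 2)))) /\
  (Q_D4 a = 0 -> Q_E7 a <> 0 -> A_equivalent (corank1 F) (corank1 (cubic (fun u => 1 * u ^ 3)))) /\
  (Q_D4 a = 0 -> Q_E7 a = 0 -> Q_Estar a <> 0 -> exists s, s * s = 1 /\ A_equivalent (corank1 F) (corank1 (cubic (fun u => s * u ^ 4)))) /\
  (Q_D4 a = 0 -> Q_E7 a = 0 -> Q_Estar a = 0 -> exists al, sm1 al 0 /\ bigO 5 al /\ A_equivalent (corank1 F) (corank1 (cubic al))).
Proof.
  intros hf Ha F. destruct (projection_cubic a f hf Ha) as (al & K & Sal & HK & HA & B). fold F in HA.
  set (A := a 3%nat 0%nat) in *.
  assert (B' : bigO 5 (fun u => al u - (K * (- Q_D4 a / (2 * A)) * u ^ 2 + K * (Q_E7 a / (6 * A ^ 3)) * u ^ 3 + K * (Q_Estar a / (24 * A ^ 5)) * u ^ 4))).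
  { eapply bigO_ext; [|exact B]. apply locally_all; intros; cbv beta; ring. }
  destruct (cubic_truncate _ _ _ _ B') as (T2 & T3 & T4).
  assert (K0 : K <> 0) by (intros ->; lra).
  assert (KA : 0 < K / A). { assert (Z : 0 < A * A) by nra. replace (K / A) with (K * A / (A * A)) by (field; auto). now apply Rdiv_lt_0_compat. }
  assert (E2 : K * (- Q_D4 a / (2 * A)) = - (K / A) * Q_D4 a / 2) by (field; auto).
  split; [|split; [|split; [|split]]].
  - intros H. apply A_equivalent_trans with (corank1 (cubic al)); auto. apply (cubic_leading al 2 _ Sal ltac:(lia) T2 (-1)); [ring|]. rewrite E2. pose proof (Rmult_lt_0_compat _ _ KA H). lra.
  - intros H. apply A_equivalent_trans with (corank1 (cubic al)); auto. apply (cubic_leading al 2 _ Sal ltac:(lia) T2 1); [ring|]. rewrite E2. pose proof (Rmult_lt_0_compat _ (- Q_D4 a) KA ltac:(lra)). lra.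
  - intros H1 H2. specialize (T3 ltac:(rewrite E2, H1; lra)).
    destruct (sign_exists (K * (Q_E7 a / (6 * A ^ 3)))) as (s & Hs & Hc).
    { apply Rmult_integral_contrapositive_currified; auto. apply Rmult_integral_contrapositive_currified; auto. apply Rinv_neq_0_compat. apply Rmult_integral_contrapositive_currified; [lra|now apply pow_nonzero]. }
    apply A_equivalent_trans with (corank1 (cubic al)); auto. apply A_equivalent_trans with (corank1 (cubic (fun u => s * u ^ 3))); [|now apply cubic_sign_odd].
    apply (cubic_leading al 3 _ Sal ltac:(lia) T3 s); auto.
  - intros H1 H2 H3. specialize (T4 ltac:(rewrite E2, H1; lra) ltac:(rewrite H2; unfold Rdiv; ring)).
    destruct (sign_exists (K * (Q_Estar a / (24 * A ^ 5)))) as (s & Hs & Hc).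
    { apply Rmult_integral_contrapositive_currified; auto. apply Rmult_integral_contrapositive_currified; auto. apply Rinv_neq_0_compat. apply Rmult_integral_contrapositive_currified; [lra|now apply pow_nonzero]. }
    exists s. split; auto. apply A_equivalent_trans with (corank1 (cubic al)); auto. apply (cubic_leading al 4 _ Sal ltac:(lia) T4 s); auto.
  - intros H1 H2 H3. exists al. split; auto. split; auto. eapply bigO_ext; [|exact B']. apply locally_all; intros; cbv beta. rewrite H1, H2, H3. unfold Rdiv; ring.
Qed.

(** The cubic has multiplicity 3 on the line u = 0, whereas a30 = 0 would give multiplicity at least 4. *)
Lemma cubic_a30 a f be : parabolic_monge_form a f -> sm1 be 0 -> be 0 = 0 -> A_equivalent (corank1 (fun u v => f v u)) (corank1 (cubic be)) -> a 3%nat 0%nat <> 0.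
Proof.
  intros hf Sbe be0 HA Ha. destruct (monge_facts a f hf) as (Sf & f0 & pd & p10 & p01 & p20 & p11).
  assert (B : bigO 4 (fun v => f v 0)).
  { pose proof (taylor_along f 3 (fun t => t) (fun _ => 0) Sf bigO_id (bigO_scal 1 0 _ bigO_id)) as T ||
    pose proof (taylor_along f 3 (fun t => t) (fun t => 0 * t) Sf bigO_id (bigO_scal 1 0 _ bigO_id)) as T.
    eapply bigO_ext; [|exact T]. apply locally_all. intros t. cbv beta. cbn [sum_f_R0 Nat.sub]. unfold taylor_coeff.
    change (partial_derive 0 0 f 0 0) with (f 0 0). rewrite f0, p10, p01, p20, p11. rewrite (pd 3%nat 0%nat), Ha by lia.
    rewrite !Rmult_0_l. unfold Rdiv. simpl. ring. }
  assert (SF : sm2 (fun u v => f v u) 0 0) by sms.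
  destruct (multiplicity_transfer (fun u v => f v u) (cubic be) 4 SF (proj1 (cubic_sm be Sbe)) f0 HA ltac:(lia) B) as (Y & SY & Y0 & DY & BY).
  apply (bigO_immersed_pow Y 3 4 (fun _ => 1) SY Y0 DY); [sms|lra|lia|].
  apply bigO_ext with (fun v => cubic be 0 (Y v)); auto. apply locally_all. intros v. unfold cubic. rewrite be0. ring.
Qed.

Lemma cubic_power_equiv_sym k l s r : s <> 0 -> r <> 0 -> (2 <= k)%nat -> (2 <= l)%nat ->
  A_equivalent (corank1 (cubic (fun u => s * u ^ k))) (corank1 (cubic (fun u => r * u ^ l))) -> k = l.
Proof.
  intros Hs Hr Hk Hl HA. destruct (Nat.lt_trichotomy k l) as [H|[H|H]]; auto; exfalso.
  - apply A_equivalent_sym in HA; [|apply corank1_smooth; apply cubic_sm; sms].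
    apply (cubic_order_invariant (fun u => r * u ^ l) l s k) in HA; auto. sms. apply bigO_scal, bigO_pow.
  - apply (cubic_order_invariant (fun u => s * u ^ k) k r l) in HA; auto. sms. apply bigO_scal, bigO_pow.
Qed.

(** The values of Q_D4, Q_E7 and Q_E* decide to which v^3 + s' u^k v the projection is equivalent, and k and, for k =
    2, the sign are invariants. *)
Lemma projection_cubic_order a f l s : parabolic_monge_form a f -> (2 <= l <= 4)%nat -> s * s = 1 ->
  A_equivalent (corank1 (fun u v => f v u)) (corank1 (cubic (fun u => s * u ^ l))) -> a 3%nat 0%nat <> 0 /\
  (l = 2%nat -> 0 < - s * Q_D4 a) /\ (l = 3%nat -> Q_D4 a = 0 /\ Q_E7 a <> 0) /\ (l = 4%nat -> Q_D4 a = 0 /\ Q_E7 a = 0 /\ Q_Estar a <> 0).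
Proof.
  intros hf Hl Hs HA. assert (s0 : s <> 0) by (intros ->; lra).
  assert (Ha : a 3%nat 0%nat <> 0). { eapply cubic_a30; eauto. sms. simpl. destruct l; [lia|]. simpl; ring. }
  split; auto. destruct (monge_facts a f hf) as (Sf & f0 & _).
  assert (SF : smooth_map_germ (corank1 (fun u v => f v u))) by (apply corank1_smooth; auto; sms).
  destruct (projection_cubic_cases a f hf Ha) as (C1 & C2 & C3 & C4 & C5). set (F := fun u v => f v u) in *.
  assert (back : forall be, A_equivalent (corank1 F) (corank1 (cubic be)) -> A_equivalent (corank1 (cubic be)) (corank1 (cubic (fun u => s * u ^ l)))).
  { intros be K. apply A_equivalent_trans with (corank1 F); auto. now apply A_equivalent_sym. }
  assert (E2 : Q_D4 a <> 0 -> l = 2%nat /\ 0 < - s * Q_D4 a).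
  { intros H. assert (s = 1 \/ s = -1) as Hs1. { assert ((s - 1) * (s + 1) = 0) as Z by lra. apply Rmult_integral in Z. destruct Z; [left|right]; lra. }
    destruct (Rlt_dec 0 (Q_D4 a)) as [P|P].
    - pose proof (back _ (C1 P)) as K. assert (2%nat = l) as <- by (eapply cubic_power_equiv_sym; [| | | |exact K]; auto; lra || lia). split; auto.
      destruct Hs1 as [-> | ->]; [|lra]. exfalso. now apply beaks_not_lips.
    - assert (P' : Q_D4 a < 0) by lra. pose proof (back _ (C2 P')) as K. assert (2%nat = l) as <- by (eapply cubic_power_equiv_sym; [| | | |exact K]; auto; lra || lia). split; auto.
      destruct Hs1 as [-> | ->]; [lra|]. exfalso. apply beaks_not_lips. apply A_equivalent_sym; auto. apply corank1_smooth; apply cubic_sm; sms. }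
  assert (E3 : Q_D4 a = 0 -> Q_E7 a <> 0 -> l = 3%nat).
  { intros H1 H2. symmetry. eapply cubic_power_equiv_sym; [| | | |exact (back _ (C3 H1 H2))]; auto; lra || lia. }
  assert (E4 : Q_D4 a = 0 -> Q_E7 a = 0 -> Q_Estar a <> 0 -> l = 4%nat).
  { intros H1 H2 H3. destruct (C4 H1 H2 H3) as (r & Hr & K). symmetry. eapply cubic_power_equiv_sym; [| | | |exact (back _ K)]; auto; try lia. intros ->; lra. }
  assert (E5 : Q_D4 a = 0 -> Q_E7 a = 0 -> Q_Estar a = 0 -> False).
  { intros H1 H2 H3. destruct (C5 H1 H2 H3) as (al & Sal & Bal & K). apply (cubic_order_invariant al 5 s l Sal Bal s0); try lia. auto. }
  destruct (Req_dec (Q_D4 a) 0) as [H1|H1]; [|destruct (E2 H1); repeat split; intros; subst; try lia; auto].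
  destruct (Req_dec (Q_E7 a) 0) as [H2|H2]; [|rewrite (E3 H1 H2) in *; repeat split; intros; try lia; auto].
  destruct (Req_dec (Q_Estar a) 0) as [H3|H3]; [exfalso; auto|]. rewrite (E4 H1 H2 H3) in *; repeat split; intros; try lia; auto.
Qed.

(** * Maps with prescribed critical values along a parabola *)

(** Identities that are first obtained after division by a power of t extend to t = 0 by continuity. *)
Lemma locally_neq0_zero g : sm1 g 0 -> locally 0 (fun t => t <> 0 -> g t = 0) -> locally 0 (fun t => g t = 0).
Proof.
  intros S H. pose proof (sm1_zero g S H) as Z. apply (locally_mp _ _ _ H). intros t K. destruct (Req_dec t 0) as [->|]; auto.
Qed.

(** The difference h = F - F0 vanishes on s = 0 together with h_s, and on u = s^2 together with h_s as well, so that h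
    = D^2 g for D = s (u - s^2). Moving s by D W changes F0 by D^2 (e0 W + k W^2), by the Taylor formula for F0 with
    remainder k, and e0(0) <> 0 allows to solve for W. *)
Lemma equivalent_same_critical_values F F0 e e0 k :
  sm2 F 0 0 -> sm2 F0 0 0 -> F 0 0 = 0 -> sm2 e0 0 0 -> e0 0 0 <> 0 ->
  locally_2d (fun u s => d2 F u s = s * (u - s ^ 2) * e u s) 0 0 ->
  (forall u s, d2 F0 u s = s * (u - s ^ 2) * e0 u s) ->
  locally 0 (fun u => F u 0 = F0 u 0) -> locally 0 (fun s => F (s ^ 2) s = F0 (s ^ 2) s) ->
  sm k 0 0 0 -> k 0 0 0 = 0 ->
  (forall u s d, F0 u (s + d) = F0 u s + d2 F0 u s * d + d ^ 2 * k u s d) ->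
  A_equivalent (corank1 F) (corank1 F0).
Proof.
  intros SF SF0 F00 Se0 e00 DF DF0 EF ES Sk k0 Tay.
  set (h := fun u s => F u s - F0 u s). assert (Sh : sm2 h 0 0) by (unfold h; sms).
  assert (Dh : locally_2d (fun u s => d2 h u s = s * (u - s^2) * (e u s - e0 u s)) 0 0).
  { apply (locally_2d_mp3 _ _ _ _ _ _ DF (sm2_near _ _ _ SF) (sm2_near _ _ _ SF0)). intros u s X S1 S2. apply is_derive_unique.
    eapply derive_eq; [apply (derive_sub (fun t => F u t) (fun t => F0 u t)); apply sm2_derive2; auto|]. rewrite X, DF0. ring. }
  assert (sq : sm1 (fun s => s^2) 0) by sms. assert (sq0 : 0^2 = 0) by ring.
  destruct (hadamard_2 h (fun _ => 0) 0 0 Sh ltac:(sms) eq_refl) as (h1 & Sh1 & E1 & _).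
  assert (H1 : locally_2d (fun u s => h u s = s^2 * h1 u s) 0 0).
  { assert (X : locally_2d (fun u _ => h u 0 = 0 /\ d2 h u 0 = 0) 0 0).
    { apply (locally_2d_fst (fun u => h u 0 = 0 /\ d2 h u 0 = 0)), filter_and.
      - apply (locally_mp _ _ _ EF). intros u K. unfold h. lra.
      - apply (locally_mp _ _ _ (locally_2d_1d_const_y _ 0 0 Dh)). intros u ->. ring. }
    apply (locally_2d_mp2 _ _ _ _ _ E1 X). intros u s -> [-> ->]. ring. }
  assert (H1s : locally 0 (fun s => h1 (s^2) s = 0)).
  { apply (locally_neq0_zero (fun s => h1 (s^2) s)). sms.
    assert (Y := locally_2d_along _ (fun s => s^2) (fun s => s) sq ltac:(sms) sq0 eq_refl H1). cbv beta in Y.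
    apply (locally_mp2 _ _ _ _ Y ES). intros s K1 K2 Hs. unfold h in K1. rewrite K2, Rminus_diag in K1.
    symmetry in K1. apply Rmult_integral in K1. destruct K1 as [K1|K1]; auto. exfalso. apply (pow_nonzero s 2 Hs). exact K1. }
  destruct (hadamard_fst h1 (fun s => s^2) 0 0 Sh1 sq sq0) as (h2 & Sh2 & E2 & _).
  assert (H2 : locally_2d (fun u s => h u s = s^2 * ((u - s^2) * h2 u s)) 0 0).
  { assert (X : locally_2d (fun _ s => h1 (s^2) s = 0) 0 0) by (now apply locally_2d_snd).
    apply (locally_2d_mp3 _ _ _ _ _ _ H1 E2 X). intros u s -> -> ->. ring. }
  assert (H2s : locally 0 (fun s => h2 (s^2) s = 0)).
  { apply (locally_neq0_zero (fun s => h2 (s^2) s)). sms.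
    assert (Y := locally_2d_along _ (fun s => s^2) (fun s => s) sq ltac:(sms) sq0 eq_refl (locally_2d_and _ _ _ _ (locally_2d_and _ _ _ _ (locally_2d_locally_2d _ _ _ H2) Dh) (sm2_near _ _ _ Sh2))). cbv beta in Y.
    apply (locally_mp _ _ _ Y). intros s [[K1 K2] K3] Hs. destruct (d_ext _ _ _ _ K1) as [_ K4]. rewrite K2, Rminus_diag, Rmult_0_r, Rmult_0_l in K4.
    assert (Z : d2 (fun u s => s^2 * ((u - s^2) * h2 u s)) (s^2) s = - (2 * s^3 * h2 (s^2) s)).
    { apply is_derive_unique. pose proof (sm2_derive2 _ _ _ K3) as D.
      assert (D1 : is_derive (fun t => s^2 - t^2) s (- (2 * s))) by (auto_derive; auto; ring). assert (D2 : is_derive (fun t => t^2) s (2 * s)) by (auto_derive; auto; ring).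
      eapply derive_eq; [exact (derive_mul _ _ s _ _ D2 (derive_mul _ _ s _ _ D1 D))|]. cbv beta. ring. }
    rewrite Z in K4. assert (W : s^3 * h2 (s^2) s = 0) by lra. apply Rmult_integral in W. destruct W as [W|W]; auto. exfalso. now apply (pow_nonzero s 3 Hs). }
  destruct (hadamard_fst h2 (fun s => s^2) 0 0 Sh2 sq sq0) as (g & Sg & E3 & _).
  set (D := fun u s : R => s * (u - s^2)).
  assert (H3 : locally_2d (fun u s => F u s = F0 u s + (D u s)^2 * g u s) 0 0).
  { assert (X : locally_2d (fun _ s => h2 (s^2) s = 0) 0 0) by (now apply locally_2d_snd).
    apply (locally_2d_mp3 _ _ _ _ _ _ H2 E3 X). intros u s K1 K2 K3. rewrite K2, K3 in K1. unfold h in K1. unfold D.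
    replace (F u s) with (F0 u s + (F u s - F0 u s)) by ring. rewrite K1. ring. }
  clear H1 H1s H2 H2s E1 E2 E3 Dh Sh1 Sh2 h1 h2.
  assert (SD : sm2 D 0 0) by (unfold D; sms). assert (D0 : D 0 0 = 0) by (unfold D; ring).
  set (W0 := g 0 0 / e0 0 0).
  assert (Sk' : sm (fun u s W => k u s (D u s * W)) 0 0 W0).
  { apply (sm_comp k (fun u _ _ => u) (fun _ s _ => s) (fun u s W => D u s * W)); sms. }
  destruct (implicit_function (fun u s W => e0 u s * W + W^2 * k u s (D u s * W) - g u s) 0 0 W0) as (W & SW & W00 & EW & _).
  { apply (sm_sub (fun u s W => e0 u s * W + W^2 * k u s (D u s * W)) (fun u s W => g u s)); [|sms].
    apply (sm_add (fun u s W => e0 u s * W) (fun u s W => W^2 * k u s (D u s * W))); [sms|].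
    apply (sm_mul (fun u s W => W^2) (fun u s W => k u s (D u s * W))); [sms|exact Sk']. }
  { rewrite D0, Rmult_0_l, k0. unfold W0. field. auto. }
  { assert (X : is_derive (fun W => e0 0 0 * W + W ^ 2 * k 0 0 (D 0 0 * W) - g 0 0) W0 (e0 0 0)).
    { apply is_derive_ext with (fun W => e0 0 0 * W - g 0 0). { intros t. rewrite D0, Rmult_0_l, k0. req. ring. } auto_derive; auto; ring. }
    intros Z. apply e00. rewrite <- (is_derive_unique _ _ _ X). exact Z. }
  set (V := fun u s => s + D u s * W u s).
  apply (A_equivalent_source F F0 V).
  - unfold V; sms.
  - unfold V. rewrite D0. ring.
  - assert (DD : is_derive (fun s => D 0 s) 0 0) by (unfold D; auto_derive; auto; ring).
    assert (X : is_derive (fun s => V 0 s) 0 1).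
    { unfold V. eapply derive_eq; [apply (derive_add (fun s => s) (fun s => D 0 s * W 0 s)); [apply derive_id|apply (derive_mul _ _ 0 _ _ DD (sm2_derive2 _ _ _ SW))]|]. cbv beta. rewrite D0. ring. }
    intros Z. apply is_derive_unique in X. unfold d2 in Z. assert (Z' : 0 = 1) by (rewrite <- X; symmetry; exact Z). lra.
  - apply (locally_2d_mp2 _ _ _ _ _ H3 EW). intros u s K1 K2. unfold V. rewrite Tay, DF0, K1. fold (D u s).
    replace (g u s) with (e0 u s * W u s + (W u s)^2 * k u s (D u s * W u s)) by lra. ring.
Qed.

(** The polynomial with derivative s (u - s^2) (4 + 15/2 s) in s; the last factor is chosen such that the critical
    values at (s^2, s) are s^4 + s^5. *)
Definition gull1 u s := 2 * u * s ^ 2 - s ^ 4 + 5 / 2 * u * s ^ 3 - 3 / 2 * s ^ 5.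
(** Likewise with the factor 4 + 35/2 s^3 and the critical values s^4 + s^7. *)
Definition gull3 u s := 2 * u * s ^ 2 - s ^ 4 + 7 / 2 * u * s ^ 5 - 5 / 2 * s ^ 7.

Lemma gull_d u s : d2 gull1 u s = s * (u - s ^ 2) * (4 + 15 / 2 * s) /\ d2 gull3 u s = s * (u - s ^ 2) * (4 + 35 / 2 * s ^ 3).
Proof. split; apply is_derive_unique; unfold gull1, gull3; auto_derive; auto; field. Qed.

(** The function k in the Taylor formula for the model is its expansion in d after two terms, in Horner form. *)
Lemma gull1_model F e : sm2 F 0 0 -> locally_2d (fun u s => d2 F u s = s * (u - s ^ 2) * e u s) 0 0 ->
  locally 0 (fun u => F u 0 = 0) -> locally 0 (fun s => F (s ^ 2) s = s ^ 4 * (1 + s ^ 1)) -> A_equivalent (corank1 F) (corank1 gull1).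
Proof.
  intros SF DF EF ES.
  apply (equivalent_same_critical_values F gull1 e (fun _ s => 4 + 15 / 2 * s)
   (fun u s d => (2*u + (-6)*s^2 + (15/2)*s*u + (-15)*s^3) + d * (((-4)*s + (5/2)*u + (-15)*s^2) + d * (((-1) + (-(15/2))*s) + d * ((-(3/2))))))); auto.
  - unfold gull1; sms.
  - apply (locally_singleton _ _ EF).
  - sms.
  - lra.
  - intros; apply gull_d.
  - apply (locally_mp _ _ _ EF). intros u ->. unfold gull1. ring.
  - apply (locally_mp _ _ _ ES). intros s ->. unfold gull1. field.
  - sms.
  - ring.
  - intros u s d. rewrite (proj1 (gull_d u s)). unfold gull1. field.
Qed.

Lemma gull3_model F e : sm2 F 0 0 -> locally_2d (fun u s => d2 F u s = s * (u - s ^ 2) * e u s) 0 0 ->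
  locally 0 (fun u => F u 0 = 0) -> locally 0 (fun s => F (s ^ 2) s = s ^ 4 * (1 + s ^ 3)) -> A_equivalent (corank1 F) (corank1 gull3).
Proof.
  intros SF DF EF ES.
  apply (equivalent_same_critical_values F gull3 e (fun _ s => 4 + 35 / 2 * s ^ 3)
   (fun u s d => (2*u + (-6)*s^2 + 35*s^3*u + (-(105/2))*s^5) + d * (((-4)*s + 35*s^2*u + (-(175/2))*s^4) + d * (((-1) + (35/2)*s*u + (-(175/2))*s^3) + d * (((7/2)*u + (-(105/2))*s^2) + d * (((-(35/2))*s) + d * ((-(5/2))))))))); auto.
  - unfold gull3; sms.
  - apply (locally_singleton _ _ EF).
  - sms.
  - lra.
  - intros; apply gull_d.
  - apply (locally_mp _ _ _ EF). intros u ->. unfold gull3. ring.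
  - apply (locally_mp _ _ _ ES). intros s ->. unfold gull3. field.
  - sms.
  - ring.
  - intros u s d. rewrite (proj2 (gull_d u s)). unfold gull3. field.
Qed.

(** For S = s be(u) and U = u be(u)^2 the parabola is preserved, and s b(s^2) = s^(2q+1) be^(2q+1) becomes S^(2q+1). *)
Lemma gull_rescale F e b be q : sm2 F 0 0 -> sm1 be 0 -> be 0 <> 0 -> F 0 0 = 0 ->
  locally_2d (fun u s => d2 F u s = s * (u - s ^ 2) * e u s) 0 0 -> locally 0 (fun u => F u 0 = 0) ->
  locally 0 (fun s => F (s ^ 2) s = s ^ 4 * (1 + s * b (s ^ 2))) -> locally 0 (fun x => b x = x ^ q * be x ^ (2 * q + 1)) ->
  exists F' e', A_equivalent (corank1 F) (corank1 F') /\ sm2 F' 0 0 /\ locally_2d (fun u s => d2 F' u s = s * (u - s ^ 2) * e' u s) 0 0 /\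
    locally 0 (fun u => F' u 0 = 0) /\ locally 0 (fun s => F' (s ^ 2) s = s ^ 4 * (1 + s ^ (2 * q + 1))).
Proof.
  intros SF Sbe be0 F00 DF EF ES Eb.
  set (h := fun u => u * (be u) ^ 2). assert (Sh : sm1 h 0) by (unfold h; sms). assert (h0 : h 0 = 0) by (unfold h; ring).
  assert (Dh : Derive h 0 <> 0).
  { assert (X : Derive h 0 = (be 0)^2) by (apply (Derive_mul_id (fun u => be u ^ 2)); sms). rewrite X. now apply pow_nonzero. }
  destruct (inverse_germ h Sh h0 Dh) as (k & Sk & k0 & L1 & L2).
  assert (bk : be (k 0) <> 0) by now rewrite k0.
  set (T := fun U S => S / be (k U)). assert (ST : sm2 T 0 0) by (unfold T; sms). assert (T0 : T 0 0 = 0) by (unfold T, Rdiv; ring).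
  set (F' := fun U S => be (k U) ^ 4 * F (k U) (T U S)). assert (SF' : sm2 F' 0 0) by (unfold F'; sms).
  pose proof (neq0_germ be Sbe be0) as Nb.
  assert (Nbk : locally 0 (fun U => be (k U) <> 0)) by (apply (neq0_germ (fun U => be (k U))); [sms|auto]).
  exists F', (fun U S => e (k U) (T U S)). split; [|split; [exact SF'|split; [|split]]].
  - apply (A_equivalent_fibred F F' h (fun u z => be u ^ 4 * z) (fun u s => s * be u)); auto; try solve [unfold h; sms].
    + unfold d2. rewrite (is_derive_unique _ _ (be 0)); auto. auto_derive; auto; ring.
    + unfold d2. rewrite (is_derive_unique _ _ (be 0 ^ 4)). now apply pow_nonzero. auto_derive; auto; ring.
    + apply (locally_2d_mp2 _ _ _ _ _ (locally_2d_fst _ 0 0 L2) (locally_2d_fst _ 0 0 Nb)). intros u s K1 K2. unfold F', T. rewrite K1. f_equal. f_equal. field. auto.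
  - assert (X : locally_2d (fun U S => d2 F (k U) (T U S) = T U S * (k U - T U S ^ 2) * e (k U) (T U S) /\ sm2 F (k U) (T U S)) 0 0).
    { apply (locally_2d_pull (fun u s => d2 F u s = s * (u - s ^ 2) * e u s /\ sm2 F u s) (fun U _ => k U) T); [sms|auto|]. rewrite k0, T0. apply locally_2d_and; auto. now apply sm2_near. }
    apply (locally_2d_mp3 _ _ _ _ _ _ X (locally_2d_fst _ 0 0 L1) (locally_2d_fst _ 0 0 Nbk)). intros U S [K1 K2] K3 K4.
    assert (Y : d2 F' U S = be (k U) ^ 4 * (d2 F (k U) (T U S) * / be (k U))).
    { unfold F'. apply is_derive_unique. apply is_derive_scal. eapply derive_eq; [apply (sm2_chain F (fun _ => k U) (fun S => T U S) (k U) (T U S) 0 (/ be (k U)) S); auto|].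
      apply derive_cst. unfold T. auto_derive; auto; field; auto. ring. }
    rewrite Y, K1. unfold T. unfold h in K3. replace (U - S ^ 2) with (k U * be (k U) ^ 2 - S ^ 2) by (now rewrite K3). field. auto.
  - pose proof (locally_pull1 (fun u => F u 0 = 0) k 0 Sk ltac:(rewrite k0; exact EF)) as X. apply (locally_mp _ _ _ X). intros U K. unfold F', T. unfold Rdiv. rewrite Rmult_0_l, K. ring.
  - set (t := fun S => T (S ^ 2) S). assert (St : sm1 t 0) by (unfold t; sms). assert (t0 : t 0 = 0) by (unfold t, T, Rdiv; ring).
    pose proof (locally_pull1 (fun s => F (s ^ 2) s = s ^ 4 * (1 + s * b (s ^ 2))) t 0 St ltac:(rewrite t0; exact ES)) as X1. cbv beta in X1.
    assert (X2 : locally 0 (fun S => h (k (S^2)) = S^2 /\ be (k (S^2)) <> 0 /\ b (k (S^2)) = k (S^2) ^ q * be (k (S^2)) ^ (2 * q + 1))).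
    { apply (locally_pull1 (fun U => h (k U) = U /\ be (k U) <> 0 /\ b (k U) = k U ^ q * be (k U) ^ (2 * q + 1)) (fun S => S^2)); [sms|]. rewrite pow_i by lia.
      repeat apply filter_and; auto. apply (locally_pull1 (fun x => b x = x ^ q * be x ^ (2 * q + 1)) k); auto. now rewrite k0. }
    apply (locally_mp2 _ _ _ _ X1 X2). intros S K1 (K2 & K3 & K4). unfold F'. fold (t S).
    assert (K5 : t S * be (k (S^2)) = S) by (unfold t, T; field; auto).
    assert (K6 : k (S^2) = t S ^ 2). { unfold h in K2. apply Rmult_eq_reg_r with (be (k (S^2)) ^ 2); [|now apply pow_nonzero]. rewrite K2, <- Rpow_mult_distr, K5. reflexivity. }
    rewrite <- K6 in K1. rewrite K1, K4. clear K1 K2 K4.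
    replace (k (S^2) ^ q) with ((t S ^ 2) ^ q) by (now rewrite <- K6).
    set (B := be (k (S^2))) in *. set (x := t S) in *. rewrite <- K5. rewrite !(Rpow_mult_distr x B), <- pow_mult.
    replace (2 * q + 1)%nat with (Datatypes.S (2 * q)) by lia. rewrite <- !tech_pow_Rmult. ring.
Qed.

(** The Jacobian has no terms u, v, v^2, so that its Newton polygon lies above the points u^2, u v and v^3. *)
Lemma jacobian_form la T : sm2 la 0 0 -> la 0 0 = 0 -> d2 la 0 0 = 0 -> d1 la 0 0 = 0 ->
  sm1 T 0 -> locally 0 (fun y => la 0 y = y ^ 3 * T y) ->
  exists A B C, sm1 A 0 /\ sm1 B 0 /\ sm2 C 0 0 /\ B 0 = d1 (d2 la) 0 0 /\ d2 (d2 la) 0 0 = 0 /\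
    locally_2d (fun u v => la u v = u ^ 2 * A u + u * B u * v + v ^ 2 * C u v) 0 0 /\
    locally 0 (fun v => C 0 v - v * T v = 0).
Proof.
  intros Sla l00 lv lu ST ET. set (p := d1 (d2 la) 0 0).
  destruct (hadamard_2 la (fun _ => 0) 0 0 Sla ltac:(sms) eq_refl) as (C & SC & EC & C2).
  assert (Sl0 : sm1 (fun u => la u 0) 0) by sms.
  assert (Dl0 : Derive (fun u => la u 0) 0 = 0) by exact lu.
  destruct (bigO_divide 2 (fun u => la u 0) Sl0) as (A & SA & EA).
  { pose proof (bigO_linear (fun u => la u 0) Sl0 l00) as B. rewrite Dl0 in B. eapply bigO_ext; [|exact B]. apply locally_all; intros; cbv beta; ring. }
  assert (Sl1 : sm1 (fun u => d2 la u 0) 0) by sms.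
  destruct (hadamard_1 (fun u => d2 la u 0) 0 Sl1) as (B & SB & EB & B0). rewrite lv in EB. change (B 0 = p) in B0.
  assert (EL : locally_2d (fun u v => la u v = u^2 * A u + u * B u * v + v^2 * C u v) 0 0).
  { apply (locally_2d_mp3 _ _ _ _ _ _ EC (locally_2d_fst _ 0 0 EA) (locally_2d_fst _ 0 0 EB)). intros u v -> -> ->. ring. }
  assert (C0 : locally 0 (fun v => C 0 v - v * T v = 0)).
  { apply (locally_neq0_zero (fun v => C 0 v - v * T v)); [sms|]. apply (locally_mp2 _ _ _ _ (locally_2d_1d_const_x _ 0 0 EL) ET). intros v K1 K2 Hv. rewrite K2 in K1.
    apply Rmult_eq_reg_l with (v^2); [|now apply pow_nonzero]. simpl in *. lra. }
  assert (C00 : C 0 0 = 0) by (pose proof (locally_singleton _ _ C0) as K; cbv beta in K; lra).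
  exists A, B, C. repeat (split; [assumption|]). split; [lra|]. split; assumption.
Qed.

(** The Newton polygon of the Jacobian gives two branches: v = c(u) from the edge between u^2 and u v, and a curve
    tangent to the v-axis from the edge between u v and v^3, whose leading coefficient is kap. The first is moved to
    the axis v = 0, where F is made to vanish; the second becomes u = q(y) with q of exact order 2, and the square
    root of q / kap is the coordinate s. X(s) is the ordinate of the second branch over u = kap s^2. *)
Lemma gull_reduction F T : sm2 F 0 0 -> F 0 0 = 0 -> d2 F 0 0 = 0 -> d2 (d2 F) 0 0 = 0 -> d1 (d2 F) 0 0 = 0 ->
  d1 (d2 (d2 F)) 0 0 <> 0 -> sm1 T 0 -> T 0 <> 0 -> locally 0 (fun y => d2 F 0 y = y ^ 3 * T y) ->
  exists X F3 e, let kap := - T 0 / d1 (d2 (d2 F)) 0 0 in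
    sm1 X 0 /\ X 0 = 0 /\ Derive X 0 = 1 /\ locally 0 (fun s => d2 F (kap * s ^ 2) (X s) = 0) /\
    sm2 F3 0 0 /\ sm2 e 0 0 /\ e 0 0 <> 0 /\ A_equivalent (corank1 F) (corank1 F3) /\
    locally 0 (fun u => F3 u 0 = 0) /\ locally_2d (fun u s => d2 F3 u s = s * (u - s ^ 2) * e u s) 0 0 /\
    locally 0 (fun s => F (kap * s ^ 2) (X s) - F (kap * s ^ 2) (X (- s)) = F3 (s ^ 2) s - F3 (s ^ 2) (- s)).
Proof.
  intros SF F00 l00 lv lu Hp ST T0 ET.
  set (p := d1 (d2 (d2 F)) 0 0) in *. set (la := d2 F) in *. assert (Sla : sm2 la 0 0) by (unfold la; sms).
  (* first branch: v = u xi, where xi solves the equation divided by u^2 *)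
  destruct (jacobian_form la T Sla l00 lv lu ST ET) as (A & B & C & SA & SB & SC & B0 & lvv & EL & C0). fold p in B0.
  assert (C00 : C 0 0 = 0) by (pose proof (locally_singleton _ _ C0) as K; cbv beta in K; lra).
  destruct (implicit_function (fun u _ x => A u + x * B u + x^2 * C u (u * x)) 0 0 (- A 0 / B 0)) as (xi & Sxi & xi0 & Exi & _).
  { sms. }
  { rewrite Rmult_0_l, C00, B0. field. auto. }
  { assert (X : is_derive (fun x => A 0 + x * B 0 + x^2 * C 0 (0 * x)) (- A 0 / B 0) p).
    { apply is_derive_ext with (fun x => A 0 + x * B 0). { intros x. rewrite Rmult_0_l, C00. req. ring. } auto_derive; auto. rewrite B0; ring. }
    intros Z. apply Hp. rewrite <- (is_derive_unique _ _ _ X). exact Z. }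
  set (c := fun u => u * xi u 0). assert (Sc : sm1 c 0) by (unfold c; sms). assert (c0 : c 0 = 0) by (unfold c; ring).
  assert (Ec : locally 0 (fun u => la u (c u) = 0)).
  { assert (Y := locally_2d_along _ (fun u => u) c ltac:(sms) Sc eq_refl c0 EL). cbv beta in Y.
    apply (locally_mp2 _ _ _ _ Y (locally_2d_1d_const_y _ 0 0 Exi)). intros u -> K. unfold c.
    replace (u^2 * A u + u * B u * (u * xi u 0) + (u * xi u 0)^2 * C u (u * xi u 0)) with (u^2 * (A u + xi u 0 * B u + xi u 0^2 * C u (u * xi u 0))) by ring. rewrite K. ring. }
  (* second branch: translate the first one to y = 0 and divide by y *)
  set (l := fun u y => la u (c u + y)). assert (Sl : sm2 l 0 0) by (unfold l; sms).
  destruct (hadamard l (fun _ => 0) 0 0 Sl ltac:(sms) eq_refl) as (mu & Smu & Emu & Dmu).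
  assert (Emu' : locally_2d (fun u y => l u y = y * mu u y) 0 0).
  { apply (locally_2d_mp2 _ _ _ _ _ Emu (locally_2d_fst _ 0 0 Ec)). intros u y -> K. unfold l at 1. rewrite Rplus_0_r, K. ring. }
  assert (dl : locally 0 (fun u => d2 l u 0 = d2 la u (c u))).
  { assert (N : locally 0 (fun u => sm2 la u (c u))) by (apply (locally_2d_along _ (fun u => u) c); auto; [sms|now apply sm2_near]).
    apply (locally_mp _ _ _ N). intros u Su. unfold l. apply is_derive_unique. eapply derive_eq; [apply (sm2_chain la (fun _ => u) (fun y => c u + y) u (c u) 0 1 0); auto|]; [ring|apply derive_cst|auto_derive; auto; ring|ring]. }
  assert (mu00 : mu 0 0 = 0).
  { pose proof (Dmu 0) as D. pose proof (locally_singleton _ _ dl) as K. cbv beta in D, K. rewrite D, K, c0. exact lv. }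
  assert (dmu : d1 mu 0 0 = p).
  { unfold d1. rewrite (Derive_ext_loc _ (fun u => d2 la u (c u))).
    - apply is_derive_unique. assert (Slv : sm2 (d2 la) 0 0) by sms.
      eapply derive_eq; [apply (sm2_chain (d2 la) (fun u => u) c 0 0 1 (Derive c 0) 0 Slv eq_refl c0)|]; [apply derive_id|now apply sm1_derive|].
      rewrite lvv. change (d1 (d2 la) 0 0) with p. ring.
    - apply (locally_mp _ _ _ dl). intros u K. rewrite (Dmu u). exact K. }
  destruct (implicit_function (fun y _ u => mu u y) 0 0 0) as (qq & Sqq & qq0 & Eqq & _).
  { sms. } { exact mu00. } { intros Z. apply Hp. rewrite <- dmu. exact Z. }
  set (q := fun y => qq y 0). assert (Sq : sm1 q 0) by (unfold q; sms). assert (q0 : q 0 = 0) by exact qq0.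
  assert (Eq : locally 0 (fun y => mu (q y) y = 0)) by exact (locally_2d_1d_const_y _ 0 0 Eqq).
  destruct (hadamard_fst mu q 0 0 Smu Sq q0) as (nu & Snu & Enu & Dnu).
  assert (nu00 : nu 0 0 = p). { pose proof (Dnu 0) as D. cbv beta in D. rewrite q0 in D. now rewrite D. }
  assert (Enu' : locally_2d (fun u y => l u y = y * ((u - q y) * nu u y)) 0 0).
  { apply (locally_2d_mp3 _ _ _ _ _ _ Emu' Enu (locally_2d_snd _ 0 0 Eq)). intros u y -> -> ->. ring. }
  (* the second branch is a parabola in a suitable coordinate s *)
  set (kap := - T 0 / p).
  assert (Hkap : kap <> 0) by (unfold kap; apply Rmult_integral_contrapositive_currified; [lra|now apply Rinv_neq_0_compat]).
  assert (Snu0 : sm1 (fun y => nu 0 y) 0) by sms.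
  assert (nu0 : (fun y => nu 0 y) 0 <> 0) by (cbv beta; now rewrite nu00).
  set (w := fun y => - T y / nu 0 y / kap). assert (Sw : sm1 w 0) by (unfold w; sms; now rewrite nu00).
  assert (w0 : w 0 = 1) by (unfold w, kap; rewrite nu00; field; auto).
  assert (Ew : locally 0 (fun y => q y = kap * (y^2 * w y))).
  { assert (Z : locally 0 (fun y => q y - kap * (y^2 * w y) = 0)).
    { apply (locally_neq0_zero (fun y => q y - kap * (y^2 * w y))); [sms|].
      apply (locally_mp3 _ _ _ _ _ (locally_2d_1d_const_x _ 0 0 Enu') ET (neq0_germ _ Snu0 nu0)). intros y K1 K2 K3 Hy.
      unfold l in K1. rewrite c0, Rplus_0_l, K2 in K1. unfold w.
      replace (kap * (y ^ 2 * (- T y / nu 0 y / kap))) with (- (y^2 * T y) / nu 0 y) by (field; auto).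
      apply Rmult_eq_reg_l with (y * nu 0 y); [|now apply Rmult_integral_contrapositive_currified].
      replace (y * nu 0 y * (q y - - (y ^ 2 * T y) / nu 0 y)) with (y * nu 0 y * q y + y ^ 3 * T y) by (field; auto). rewrite K1. ring. }
    apply (locally_mp _ _ _ Z). intros; lra. }
  destruct (root_germ w 2 ltac:(lia) Sw ltac:(rewrite w0; lra)) as (rho & Srho & rho0 & Erho).
  assert (rho1 : rho 0 = 1). { pose proof (locally_singleton _ _ Erho) as K. cbv beta in K. rewrite w0 in K. nra. }
  assert (Syr : sm1 (fun y => y * rho y) 0) by sms.
  assert (Dyr : Derive (fun y => y * rho y) 0 = 1) by (rewrite Derive_mul_id; auto).
  destruct (inverse_germ (fun y => y * rho y) Syr (Rmult_0_l (rho 0)) ltac:(rewrite Dyr; lra)) as (psi & Spsi & psi0 & L1 & _).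
  destruct (hadamard_1 psi 0 Spsi) as (psi1 & Spsi1 & Epsi1 & psi10). rewrite psi0 in Epsi1.
  assert (Dpsi : psi1 0 = 1).
  { assert (X : locally 0 (fun s => psi1 s * rho (psi s) - 1 = 0)).
    { apply (locally_neq0_zero (fun s => psi1 s * rho (psi s) - 1)); [sms|]. apply (locally_mp2 _ _ _ _ L1 Epsi1). intros s K1 K2 Hs.
      apply Rmult_eq_reg_l with s; auto. rewrite K2 in K1 at 1. replace (s * (psi1 s * rho (psi s) - 1)) with ((0 + (s - 0) * psi1 s) * rho (psi s) - s) by ring. rewrite K1. ring. }
    pose proof (locally_singleton _ _ X) as K. cbv beta in K. rewrite psi0, rho1 in K. lra. }
  assert (Dpsi' : Derive psi 0 = 1) by now rewrite <- psi10.
  assert (Eqpsi : locally 0 (fun s => q (psi s) = kap * s^2)).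
  { assert (X := locally_pull1 (fun y => q y = kap * (y^2 * w y) /\ rho y ^ 2 = w y) psi 0 Spsi ltac:(rewrite psi0; now apply filter_and)).
    apply (locally_mp2 _ _ _ _ X L1). intros s [K1 K2] K3. cbv beta in K3. rewrite K1, <- K2, <- Rpow_mult_distr, K3. reflexivity. }
  set (F3 := fun u s => F (kap * u) (c (kap * u) + psi s) - F (kap * u) (c (kap * u))).
  assert (SF3 : sm2 F3 0 0) by (unfold F3; sms).
  set (e := fun u s => kap * psi1 s * nu (kap * u) (psi s) * Derive psi s).
  assert (Se : sm2 e 0 0) by (unfold e; sms).
  set (X := fun s => c (kap * s^2) + psi s). assert (SX : sm1 X 0) by (unfold X; sms).
  assert (SL : sm2 (fun u s => l (kap * u) (psi s)) 0 0) by sms.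
  assert (EL3 : locally_2d (fun u s => l (kap * u) (psi s) = psi s * ((kap * u - q (psi s)) * nu (kap * u) (psi s))) 0 0).
  { apply (locally_2d_pull (fun u y => l u y = y * ((u - q y) * nu u y)) (fun u _ => kap * u) (fun _ s => psi s)); [sms|sms|]. rewrite psi0, Rmult_0_r. exact Enu'. }
  exists X, F3, e. cbv zeta. fold kap. split; [exact SX|]. split; [unfold X; rewrite psi0, pow_i, Rmult_0_r, c0 by lia; ring|]. split.
  { unfold X. apply is_derive_unique. assert (Sc2 : sm1 (fun s => c (kap * s^2)) 0) by sms.
    assert (D : is_derive (fun s => c (kap * s^2)) 0 (Derive c 0 * (kap * 0))).
    { eapply derive_eq; [apply (sm2_chain (fun u _ => c u) (fun s => kap * s^2) (fun _ => 0) 0 0 (kap * 0) 0 0)|]; [sms|ring|reflexivity|auto_derive; auto; ring|apply derive_cst|]. unfold d1. ring. }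
    eapply derive_eq; [exact (derive_add _ _ 0 _ _ D (sm1_derive _ _ Spsi))|]. rewrite Dpsi'. ring. }
  split.
  { assert (Y := locally_2d_along _ (fun s => s^2) (fun s => s) ltac:(sms) ltac:(sms) ltac:(simpl; ring) eq_refl EL3). cbv beta in Y.
    apply (locally_mp2 _ _ _ _ Y Eqpsi). intros s K1 K2. unfold l in K1. unfold X. rewrite K1, K2. ring. }
  split; [exact SF3|]. split; [exact Se|]. split.
  { unfold e. rewrite psi0, Rmult_0_r, Dpsi, Dpsi', nu00, !Rmult_1_r. now apply Rmult_integral_contrapositive_currified. }
  split.
  { apply A_equivalent_sym. { apply corank1_smooth; auto. unfold F3. rewrite psi0, Rplus_0_r. ring. }
    apply (A_equivalent_fibred F3 F (fun u => kap * u) (fun u z => z + F (kap * u) (c (kap * u))) (fun u s => c (kap * u) + psi s)).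
    - sms.
    - ring.
    - rewrite (is_derive_unique _ _ kap); auto. auto_derive; auto; ring.
    - sms.
    - rewrite psi0, Rmult_0_r, c0. ring.
    - unfold d2. rewrite (is_derive_unique _ _ 1). lra. eapply derive_eq; [apply (derive_add (fun _ => c (kap * 0)) psi); [apply derive_cst|now apply sm1_derive]|]. rewrite Dpsi'. ring.
    - sms.
    - rewrite Rmult_0_r, c0, F00. ring.
    - unfold d2. rewrite (is_derive_unique _ _ 1). lra. auto_derive; auto; ring.
    - apply locally_2d_forall. intros u s. unfold F3. ring. }
  split.
  { apply locally_all. intros u. unfold F3. rewrite psi0, Rplus_0_r. ring. }
  split.
  { assert (N : locally_2d (fun u s => sm2 F (kap * u) (c (kap * u) + psi s)) 0 0).
    { apply (locally_2d_pull (sm2 F) (fun u _ => kap * u) (fun u s => c (kap * u) + psi s)); [sms|sms|]. rewrite psi0, Rmult_0_r, c0, Rplus_0_r. now apply sm2_near. }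
    assert (N2 : locally_2d (fun _ s => q (psi s) = kap * s^2 /\ psi s = 0 + (s - 0) * psi1 s /\ sm1 psi s) 0 0).
    { apply (locally_2d_snd (fun s => q (psi s) = kap * s^2 /\ psi s = 0 + (s - 0) * psi1 s /\ sm1 psi s)). repeat apply filter_and; auto. now apply sm1_near. }
    apply (locally_2d_mp3 _ _ _ _ _ _ N EL3 N2). intros u s K1 K2 (K3 & K4 & K5).
    assert (Y : d2 F3 u s = l (kap * u) (psi s) * Derive psi s).
    { unfold F3, l. apply is_derive_unique. eapply derive_eq; [apply (derive_sub (fun s => F (kap * u) (c (kap * u) + psi s)) (fun _ => F (kap * u) (c (kap * u)))); [|apply derive_cst]|].
      - apply (sm2_chain F (fun _ => kap * u) (fun s => c (kap * u) + psi s) (kap * u) (c (kap * u) + psi s) 0 (0 + Derive psi s) s); auto. apply derive_cst.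
        apply (derive_add (fun _ => c (kap * u)) psi); [apply derive_cst|now apply sm1_derive].
      - fold la. ring. }
    rewrite Y, K2, K3. unfold e. rewrite K4 at 1. ring. }
  { apply locally_all. intros s. unfold F3, X. replace ((- s)^2) with (s^2) by ring. ring. }
Qed.

(** The critical value over (s^2, s) is the integral of F_s, that is, s^4 times the smooth function obtained by
    scaling; its even and odd parts are separated by Whitney's theorem. The value A(0) = e(0) / 4 comes from the
    integral of t (1 - t^2). *)
(** * The critical values along the parabola *)

Lemma gull_values F e : sm2 F 0 0 -> sm2 e 0 0 -> e 0 0 <> 0 -> locally 0 (fun u => F u 0 = 0) ->
  locally_2d (fun u s => d2 F u s = s * (u - s ^ 2) * e u s) 0 0 ->
  exists A B, sm1 A 0 /\ sm1 B 0 /\ A 0 <> 0 /\ locally 0 (fun s => F (s ^ 2) s = s ^ 4 * (A (s ^ 2) + s * B (s ^ 2))).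
Proof.
  intros SF Se e0 EF DF.
  destruct (locally_2d_square _ (locally_2d_and _ _ _ _ (sm2_near _ _ _ SF) (locally_2d_and _ _ _ _ (sm2_near _ _ _ Se) DF))) as (r & Hr & K).
  set (z := fun s => RInt (fun t => t * (1 - t^2) * e (s^2) (t * s)) 0 1).
  assert (Sz : sm1 z 0).
  { assert (X : sm2 (fun s _ => z s) 0 0).
    { apply (sm2_RInt (fun s _ t => t * (1 - t^2) * e (s^2) (t * s))). intros t Ht. sms. }
    sms. }
  assert (z0 : z 0 = e 0 0 / 4).
  { unfold z. rewrite (RInt_ext _ (fun t => e 0 0 * (t - t^3))).
    - rewrite (RInt_FTC (fun t => e 0 0 * (t^2/2 - t^4/4)) (fun t => e 0 0 * (t - t^3))). req. field.
      intros t _. auto_derive; auto; field. intros t _. apply (cont3_cont_3 (fun _ _ t => e 0 0 * (t - t^3)) 0 0). apply sm_cont. clear; sms.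
    - intros t _. rewrite pow_i, Rmult_0_r by lia. req. ring. }
  destruct (whitney_1 z Sz) as (A & B & SA & SB & EZ). exists A, B. split; auto. split; auto. split.
  { pose proof (locally_singleton _ _ EZ) as X. cbv beta in X. rewrite pow_i, Rmult_0_l, Rplus_0_r in X by lia. rewrite <- X, z0. lra. }
  assert (EF' : locally 0 (fun s => F (s^2) 0 = 0)).
  { apply (locally_pull1 (fun u => F u 0 = 0) (fun s => s^2)); [sms|]. rewrite pow_i by lia. exact EF. }
  assert (Ls : locally 0 (fun s => Rabs s < Rmin r 1)).
  { assert (Hm : 0 < Rmin r 1) by (apply Rmin_pos; lra). exists (mkposreal _ Hm). intros s Hs. change (Rabs (s - 0) < Rmin r 1) in Hs. now rewrite Rminus_0_r in Hs. }
  apply (locally_mp3 _ _ _ _ _ EZ EF' Ls). intros s E1 E2 E3. cbv beta in E1. rewrite <- E1.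
  pose proof (Rmin_l r 1). pose proof (Rmin_r r 1). pose proof (Rabs_pos s).
  assert (H2 : Rabs (s^2) < r). { rewrite <- RPow_abs. simpl. nra. }
  assert (St : forall t, 0 <= t <= 1 -> Rabs (0 + t * (s - 0)) < r) by (intros; apply abs_scale; auto; lra).
  rewrite (hquot_eq (fun _ => 0) F (s^2) s) by (intros; apply K; auto). rewrite E2, Rplus_0_l, Rminus_0_r.
  unfold hquot. rewrite (RInt_ext _ (fun t => s^3 * (t * (1 - t^2) * e (s^2) (t * s)))).
  - assert (RS : RInt (fun t => s^3 * (t * (1 - t^2) * e (s^2) (t * s))) 0 1 = s^3 * z s).
    { apply (RInt_scal (V := R_CompleteNormedModule) (fun t => t * (1 - t^2) * e (s^2) (t * s)) 0 1 (s^3)).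
      apply (ex_RInt_cont (fun _ _ t => t * (1 - t^2) * e (s^2) (t * s)) 0 0). intros t Ht. apply sm_cont.
      destruct (K (s^2) (0 + t * (s - 0)) H2 (St t Ht)) as (_ & Se' & _). replace (0 + t * (s - 0)) with (t * s) in Se' by ring. sms. }
    rewrite RS. ring.
  - intros t Ht. rewrite Rmin_left, Rmax_right in Ht by lra. destruct (K (s^2) (0 + t * (s - 0)) H2 (St t ltac:(lra))) as (_ & _ & ->).
    replace (0 + t * (s - 0)) with (t * s) by ring. req. ring.
Qed.

(** Divide F by A(u). *)
Lemma gull_normalize F e A B : sm2 F 0 0 -> F 0 0 = 0 -> sm1 A 0 -> sm1 B 0 -> A 0 <> 0 -> locally 0 (fun u => F u 0 = 0) ->
  locally_2d (fun u s => d2 F u s = s * (u - s ^ 2) * e u s) 0 0 ->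
  locally 0 (fun s => F (s ^ 2) s = s ^ 4 * (A (s ^ 2) + s * B (s ^ 2))) ->
  exists F' e', A_equivalent (corank1 F) (corank1 F') /\ sm2 F' 0 0 /\ F' 0 0 = 0 /\ locally 0 (fun u => F' u 0 = 0) /\
    locally_2d (fun u s => d2 F' u s = s * (u - s ^ 2) * e' u s) 0 0 /\
    locally 0 (fun s => F' (s ^ 2) s = s ^ 4 * (1 + s * (B (s ^ 2) / A (s ^ 2)))).
Proof.
  intros SF F00 SA SB A0 EF DF ES. pose proof (neq0_germ A SA A0) as NA.
  exists (fun u s => F u s / A u), (fun u s => e u s / A u).
  assert (D : d2 (fun _ v => v) 0 0 <> 0) by (rewrite (proj2 (d_snd 0 0)); lra).
  split; [|split; [sms|split; [|split; [|split]]]].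
  - apply (A_equivalent_fibred _ _ (fun u => u) (fun u z => z / A u) (fun _ s => s)); auto; try sms.
    + unfold d2. rewrite (is_derive_unique _ _ (/ A 0)). now apply Rinv_neq_0_compat. auto_derive; auto. field; auto.
    + now apply locally_2d_forall.
  - rewrite F00. unfold Rdiv; ring.
  - apply (locally_mp _ _ _ EF). intros u ->. unfold Rdiv; ring.
  - apply (locally_2d_mp3 _ _ _ _ _ _ DF (sm2_near _ _ _ SF) (locally_2d_fst _ 0 0 NA)). intros u s K1 K2 K3. apply is_derive_unique.
    apply is_derive_ext with (fun s => / A u * F u s). { intros t. req. field. auto. }
    eapply derive_eq; [apply is_derive_scal, sm2_derive2; exact K2|]. rewrite K1. field. auto.
  - assert (NA2 : locally 0 (fun s => A (s^2) <> 0)) by (apply (locally_pull1 (fun u => A u <> 0) (fun s => s^2)); [sms|now rewrite pow_i by lia]).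
    apply (locally_mp2 _ _ _ _ ES NA2). intros s K1 K2. rewrite K1. field. auto.
Qed.

(** Put v = s w: after division by s^3, the equation of the second branch becomes M(s, w) = 0 with a simple solution w
    = w0(s) near 1. If w1 = 1 + tau s satisfies it up to s^2, then w1 - w0 = O(s^2), and F changes between the two by
    the integral of its derivative, of size s^4 times (w1 - w0)^2. *)
Lemma approximate_critical_value F T X tau : sm2 F 0 0 -> d2 F 0 0 = 0 -> d2 (d2 F) 0 0 = 0 -> d1 (d2 F) 0 0 = 0 ->
  d1 (d2 (d2 F)) 0 0 <> 0 -> sm1 T 0 -> T 0 <> 0 -> locally 0 (fun y => d2 F 0 y = y ^ 3 * T y) ->
  let kap := - T 0 / d1 (d2 (d2 F)) 0 0 in
  sm1 X 0 -> X 0 = 0 -> Derive X 0 = 1 -> locally 0 (fun s => d2 F (kap * s ^ 2) (X s) = 0) ->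
  bigO 5 (fun s => d2 F (kap * s ^ 2) (s + tau * s ^ 2)) ->
  bigO 8 (fun s => F (kap * s ^ 2) (s + tau * s ^ 2) - F (kap * s ^ 2) (X s)).
Proof.
  intros SF l00 lv lu Hp ST T0 ET kap SX X0 DX EX BT.
  assert (Sla : sm2 (d2 F) 0 0) by sms.
  destruct (jacobian_form (d2 F) T Sla l00 lv lu ST ET) as (A & B & C & SA & SB & SC & B0 & _ & EL & C0).
  set (p := d1 (d2 (d2 F)) 0 0) in *.
  destruct (hadamard_fst C (fun _ => 0) 0 0 SC ltac:(sms) eq_refl) as (C' & SC' & EC' & _).
  assert (EL' : locally_2d (fun u v => d2 F u v = u ^ 2 * A u + u * B u * v + v ^ 3 * T v + u * v ^ 2 * C' u v) 0 0).
  { assert (X1 : locally_2d (fun _ v => C 0 v - v * T v = 0) 0 0) by (now apply locally_2d_snd).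
    apply (locally_2d_mp3 _ _ _ _ _ _ EL EC' X1). intros u v -> -> K. replace (C 0 v) with (v * T v) by lra. ring. }
  set (M := fun s w => kap^2 * s * A (kap * s^2) + kap * w * B (kap * s^2) + w^3 * T (s * w) + kap * s * w^2 * C' (kap * s^2) (s * w)).
  assert (k0 : kap * 0^2 = 0) by ring.
  assert (SM : sm2 M 0 1) by (unfold M; sms).
  assert (Ss : sm2 (fun s _ : R => kap * s^2) 0 1) by sms. assert (Sw : sm2 (fun s w : R => s * w) 0 1) by sms.
  assert (EM : locally_2d (fun s w => d2 F (kap * s^2) (s * w) = s^3 * M s w /\ sm2 F (kap * s^2) (s * w)) 0 1).
  { assert (Y : locally_2d (fun s w => d2 F (kap * s^2) (s * w) = (kap * s^2) ^ 2 * A (kap * s^2) + (kap * s^2) * B (kap * s^2) * (s * w) + (s * w) ^ 3 * T (s * w) + (kap * s^2) * (s * w) ^ 2 * C' (kap * s^2) (s * w) /\ sm2 F (kap * s^2) (s * w)) 0 1).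
    { apply (locally_2d_pull (fun u v => d2 F u v = u ^ 2 * A u + u * B u * v + v ^ 3 * T v + u * v ^ 2 * C' u v /\ sm2 F u v) (fun s _ => kap * s^2) (fun s w => s * w) 0 1 Ss Sw).
      rewrite k0, Rmult_0_l. apply locally_2d_and; auto. now apply sm2_near. }
    apply (locally_2d_mp _ _ _ _ Y). intros s w [-> K]. split; auto. unfold M. ring. }
  destruct (hadamard_1 X 0 SX) as (w0 & Sw0 & Ew0 & w00). rewrite X0 in Ew0. rewrite DX in w00.
  set (w1 := fun s => 1 + tau * s). assert (Sw1 : sm1 w1 0) by (unfold w1; sms). assert (w10 : w1 0 = 1) by (unfold w1; ring).
  assert (at1 : forall w, sm1 w 0 -> w 0 = 1 -> locally 0 (fun s => d2 F (kap * s^2) (s * w s) = s^3 * M s (w s))).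
  { intros w Sw' w'0. assert (Y : locally 0 (fun s => d2 F (kap * s^2) (s * w s) = s^3 * M s (w s) /\ sm2 F (kap * s^2) (s * w s))).
    { apply (locally_2d_pull1 (fun s w => d2 F (kap * s^2) (s * w) = s^3 * M s w /\ sm2 F (kap * s^2) (s * w)) (fun s => s) w); [sms|auto|]. now rewrite w'0. }
    apply (locally_mp _ _ _ Y). tauto. }
  assert (SM1 : forall w, sm1 w 0 -> w 0 = 1 -> sm1 (fun s => M s (w s)) 0) by (intros w Sw' w'0; sms).
  assert (M0 : locally 0 (fun s => M s (w0 s) = 0)).
  { apply (locally_neq0_zero (fun s => M s (w0 s)) (SM1 w0 Sw0 w00)). apply (locally_mp3 _ _ _ _ _ (at1 w0 Sw0 w00) Ew0 EX). intros s K1 K2 K3 Hs.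
    replace (X s) with (s * w0 s) in K3 by (rewrite K2; ring). rewrite K3 in K1. symmetry in K1. apply Rmult_integral in K1. destruct K1 as [K1|K1]; auto. exfalso. now apply (pow_nonzero s 3 Hs). }
  assert (BM : bigO 2 (fun s => M s (w1 s))).
  { assert (S5 : sm1 (fun s => d2 F (kap * s ^ 2) (s + tau * s ^ 2)) 0) by sms.
    destruct (bigO_divide 5 _ S5 BT) as (g & Sg & Eg). apply bigO_ext with (fun s => s^2 * g s); [|apply bigO_powmul; now apply bigO_continuous].
    assert (Z : locally 0 (fun s => M s (w1 s) - s^2 * g s = 0)).
    { pose proof (SM1 w1 Sw1 w10) as SM1'. apply (locally_neq0_zero (fun s => M s (w1 s) - s^2 * g s)).
      apply (sm_sub (fun s _ _ => M s (w1 s)) (fun s _ _ => s^2 * g s)); [exact SM1'|sms].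
      apply (locally_mp2 _ _ _ _ (at1 w1 Sw1 w10) Eg). intros s K1 K2 Hs. replace (s * w1 s) with (s + tau * s^2) in K1 by (unfold w1; ring). rewrite K2 in K1.
      apply Rmult_eq_reg_l with (s^3); [|now apply pow_nonzero]. replace (s^3 * (M s (w1 s) - s^2 * g s)) with (s^3 * M s (w1 s) - s^5 * g s) by ring. rewrite <- K1. ring. }
    apply (locally_mp _ _ _ Z). intros; lra. }
  destruct (hadamard M w0 0 1 SM Sw0 w00) as (G & SG & EG & DG).
  assert (G01 : G 0 1 <> 0).
  { pose proof (DG 0) as D. rewrite w00 in D. rewrite D.
    (* M 0 w is T 0 times w^3 - w, as kap B 0 = - T 0 *)
    assert (Y : is_derive (fun w => M 0 w) 1 (2 * T 0)).
    { apply is_derive_ext with (fun w => kap * w * B 0 + w^3 * T 0).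
      { intros w. unfold M. req. rewrite k0, !Rmult_0_l, !Rmult_0_r. ring. }
      auto_derive; auto. rewrite B0. unfold kap. field. auto. }
    intros Z. assert (Z' : 2 * T 0 = 0) by (rewrite <- (is_derive_unique _ _ _ Y); exact Z). lra. }
  assert (EG' : locally_2d (fun s w => M s w = (w - w0 s) * G s w) 0 1).
  { assert (Y : locally_2d (fun s _ => M s (w0 s) = 0) 0 1) by (now apply locally_2d_fst).
    apply (locally_2d_mp2 _ _ _ _ _ EG Y). intros s w -> ->. ring. }
  assert (Bw : bigO 2 (fun s => w1 s - w0 s)).
  { assert (SG1 : sm1 (fun s => G s (w1 s)) 0) by sms. assert (G1 : (fun s => G s (w1 s)) 0 <> 0) by (cbv beta; now rewrite w10).
    apply bigO_ext with (fun s => M s (w1 s) * / G s (w1 s)).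
    - assert (Y : locally 0 (fun s => M s (w1 s) = (w1 s - w0 s) * G s (w1 s))).
      { apply (locally_2d_pull1 (fun s w => M s w = (w - w0 s) * G s w) (fun s => s) w1); [sms|auto|now rewrite w10]. }
      apply (locally_mp2 _ _ _ _ Y (neq0_germ _ SG1 G1)). intros s -> K. field. exact K.
    - apply (bigO_mul 2 0); auto. apply bigO_continuous. apply (sm_inv (fun s _ _ => G s (w1 s))); auto. }
  (* the derivative of F (kap s^2) (s w) in w is s^4 (w - w0) G *)
  assert (BG : locally_2d (fun s w => Rabs (G s w) <= Rabs (G 0 1) + 1) 0 1).
  { apply (locally_2d_mp _ _ _ _ (sm2_continuity _ _ _ SG (mkposreal 1 Rlt_0_1))). intros s w K. simpl in K.
    replace (G s w) with ((G s w - G 0 1) + G 0 1) by ring. eapply Rle_trans; [apply Rabs_triang|]. lra. }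
  destruct (locally_2d_and _ _ _ _ EM (locally_2d_and _ _ _ _ EG' BG)) as [r K].
  destruct (bigO_pos _ _ Bw) as (D & HD & LD). set (Gm := Rabs (G 0 1) + 1) in *. assert (HGm : 0 < Gm) by (unfold Gm; pose proof (Rabs_pos (G 0 1)); lra).
  assert (near1 : forall w, sm1 w 0 -> w 0 = 1 -> locally 0 (fun s => Rabs (w s - 1) < r)).
  { intros w Sw' w'0. apply (locally_pull1 (fun x => Rabs (x - 1) < r) w); auto. rewrite w'0. exists r. auto. }
  assert (near0 : locally 0 (fun s => Rabs (s - 0) < r)) by (exists r; auto).
  exists (Gm * D^2). apply (locally_mp3 _ _ _ _ _ (filter_and _ _ (near1 w0 Sw0 w00) (near1 w1 Sw1 w10)) (filter_and _ _ near0 Ew0) LD).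
  intros s [N0 N1] [Ns Ew] Ld.
  destruct (mvt (fun w => F (kap * s^2) (s * w)) (fun w => s * d2 F (kap * s^2) (s * w)) (w0 s) (w1 s)) as [w [Hw Ew']].
  { intros t Ht. destruct (K s t Ns (between_ball _ _ _ _ _ Ht N0 N1)) as [[_ S1] _].
    eapply derive_eq; [apply (sm2_chain F (fun _ => kap * s^2) (fun w => s * w) (kap * s^2) (s * t) 0 s t); auto|]. apply derive_cst. auto_derive; auto; ring. ring. }
  destruct (K s w Ns (between_ball _ _ _ _ _ Hw N0 N1)) as [[K1 _] [K2 K3]]. cbv beta in Ew'.
  replace (s + tau * s^2) with (s * w1 s) by (unfold w1; ring). replace (X s) with (s * w0 s) by (rewrite Ew; ring).
  rewrite Ew', K1, K2. set (dd := w1 s - w0 s) in *.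
  assert (Hdd : Rabs (w - w0 s) <= Rabs dd).
  { unfold dd. unfold Rmin, Rmax in Hw. destruct (Rle_dec (w0 s) (w1 s)). rewrite !Rabs_pos_eq; lra. rewrite !Rabs_left1; lra. }
  replace (s * (s^3 * ((w - w0 s) * G s w)) * dd) with (s^4 * ((w - w0 s) * dd) * G s w) by ring.
  rewrite !Rabs_mult. rewrite <- RPow_abs. set (a := Rabs s) in *. assert (Ha : 0 <= a) by apply Rabs_pos.
  pose proof (Rabs_pos dd). pose proof (Rabs_pos (w - w0 s)). pose proof (Rabs_pos (G s w)).
  assert (P2 : Rabs (w - w0 s) * Rabs dd <= (D * a^2) * (D * a^2)) by (apply Rmult_le_compat; auto; lra).
  replace (Gm * D^2 * a^8) with (a^4 * ((D * a^2) * (D * a^2)) * Gm) by ring.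
  assert (0 <= a^4) by (now apply pow_le).
  apply Rmult_le_compat; auto. apply Rmult_le_pos; auto. now apply Rmult_le_pos. now apply Rmult_le_compat_l.
Qed.

(** The two points of the parabola over u = kap s^2 are (s^2, s) and (s^2, -s); half the difference of their critical
    values is s^5 B(s^2), and it agrees up to order 8 with the one along the test curve. Hence B(0) = g5, and B'(0) =
    g7 if g5 vanishes. *)
Lemma gull_structure F T tau g5 g7 : sm2 F 0 0 -> F 0 0 = 0 -> d2 F 0 0 = 0 -> d2 (d2 F) 0 0 = 0 -> d1 (d2 F) 0 0 = 0 ->
  d1 (d2 (d2 F)) 0 0 <> 0 -> sm1 T 0 -> T 0 <> 0 -> locally 0 (fun y => d2 F 0 y = y ^ 3 * T y) ->
  let kap := - T 0 / d1 (d2 (d2 F)) 0 0 in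
  bigO 5 (fun s => d2 F (kap * s ^ 2) (s + tau * s ^ 2)) ->
  bigO 8 (fun s => F (kap * s ^ 2) (s + tau * s ^ 2) - F (kap * s ^ 2) (- s + tau * s ^ 2) - 2 * (g5 * s ^ 5 + g7 * s ^ 7)) ->
  exists F' e' b A, A_equivalent (corank1 F) (corank1 F') /\ sm2 F' 0 0 /\ F' 0 0 = 0 /\ locally 0 (fun u => F' u 0 = 0) /\
    locally_2d (fun u s => d2 F' u s = s * (u - s ^ 2) * e' u s) 0 0 /\ sm1 b 0 /\
    locally 0 (fun s => F' (s ^ 2) s = s ^ 4 * (1 + s * b (s ^ 2))) /\ A <> 0 /\ b 0 = g5 / A /\
    (g5 = 0 -> exists b1, sm1 b1 0 /\ b1 0 = g7 / A /\ locally 0 (fun x => b x = x * b1 x)).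
Proof.
  intros SF F00 l00 lv lu Hp ST T0 ET kap B5 B8.
  destruct (gull_reduction F T SF F00 l00 lv lu Hp ST T0 ET) as (X & F3 & e & SX & X0 & DX & EX & SF3 & Se & e0 & HA & EF3 & DF3 & odd). fold kap in EX, odd.
  destruct (gull_values F3 e SF3 Se e0 EF3 DF3) as (A & B & SA & SB & A0 & EV).
  destruct (gull_normalize F3 e A B SF3 (locally_singleton _ _ EF3) SA SB A0 EF3 DF3 EV) as (F4 & e4 & HA4 & SF4 & F40 & EF4 & DF4 & ES4).
  exists F4, e4, (fun x => B x / A x), (A 0).
  assert (main : bigO 8 (fun s => s^5 * B (s^2) - (g5 * s^5 + g7 * s^7))).
  { pose proof (approximate_critical_value F T X tau SF l00 lv lu Hp ST T0 ET SX X0 DX EX B5) as P. fold kap in P.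
    assert (Pm : bigO 8 (fun s => F (kap * s ^ 2) (- s + tau * s ^ 2) - F (kap * s ^ 2) (X (- s)))).
    { pose proof (bigO_comp 8 1 _ (fun s => - s) ltac:(lia) P (bigO_opp 1 _ bigO_id)) as Q. simpl Nat.mul in Q. eapply bigO_ext; [|exact Q].
      apply locally_all. intros s. cbv beta. replace ((- s)^2) with (s^2) by ring. reflexivity. }
    assert (EVm : locally 0 (fun s => F3 (s^2) (- s) = s^4 * (A (s^2) - s * B (s^2)))).
    { assert (Y : locally 0 (fun s => F3 ((- s)^2) (- s) = (- s)^4 * (A ((- s)^2) + (- s) * B ((- s)^2)))).
      { apply (locally_pull1 (fun s => F3 (s ^ 2) s = s ^ 4 * (A (s ^ 2) + s * B (s ^ 2))) (fun s => - s)); [sms|]. now rewrite Ropp_0. }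
      apply (locally_mp _ _ _ Y). intros s K. replace ((- s)^2) with (s^2) in K by ring. rewrite K. ring. }
    eapply bigO_ext; [|apply (bigO_scal 8 (/2) _ (bigO_add 8 _ _ B8 (bigO_sub 8 _ _ Pm P)))].
    apply (locally_mp3 _ _ _ _ _ odd EV EVm). intros s K1 K2 K3. cbv beta. rewrite K2, K3 in K1.
    replace (F (kap * s ^ 2) (s + tau * s ^ 2) - F (kap * s ^ 2) (- s + tau * s ^ 2) - 2 * (g5 * s ^ 5 + g7 * s ^ 7) +
      (F (kap * s ^ 2) (- s + tau * s ^ 2) - F (kap * s ^ 2) (X (- s)) - (F (kap * s ^ 2) (s + tau * s ^ 2) - F (kap * s ^ 2) (X s))))
     with ((F (kap * s ^ 2) (X s) - F (kap * s ^ 2) (X (- s))) - 2 * (g5 * s ^ 5 + g7 * s ^ 7)) by ring.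
    rewrite K1. field. }
  assert (SB2 : sm1 (fun s => B (s^2)) 0) by sms.
  assert (Bg5 : B 0 = g5).
  { destruct (hadamard_1 B 0 SB) as (B1 & SB1 & EB1 & _).
    assert (EB1' : locally 0 (fun s => B (s^2) = B 0 + (s^2 - 0) * B1 (s^2))).
    { apply (locally_pull1 (fun x => B x = B 0 + (x - 0) * B1 x) (fun s => s^2)); [sms|]. now rewrite pow_i by lia. }
    cut (B 0 - g5 = 0); [lra|]. apply (bigO_coeff 5).
    eapply bigO_ext; [|apply (bigO_add 6 _ (fun s => s^6 * (s * (g7 - B1 (s^2)))) (bigO_le 8 6 _ ltac:(lia) main)); apply bigO_powmul, bigO_continuous; sms].
    apply (locally_mp _ _ _ EB1'). intros s ->. ring. }
  split; [now apply A_equivalent_trans with (corank1 F3)|]. split; [exact SF4|]. split; [exact F40|]. split; [exact EF4|]. split; [exact DF4|].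
  split; [sms|]. split; [exact ES4|]. split; [exact A0|]. split; [now rewrite Bg5|].
  intros Hg. destruct (hadamard_1 B 0 SB) as (B1 & SB1 & EB1 & _). exists (fun x => B1 x / A x).
  rewrite Bg5, Hg in EB1.
  split; [sms|]. split.
  - f_equal. cut (B1 0 - g7 = 0); [lra|]. apply (bigO_coeff 7).
    assert (EB1' : locally 0 (fun s => B (s^2) = 0 + (s^2 - 0) * B1 (s^2))).
    { apply (locally_pull1 (fun x => B x = 0 + (x - 0) * B1 x) (fun s => s^2)); [sms|]. now rewrite pow_i by lia. }
    destruct (hadamard_1 B1 0 SB1) as (B2 & SB2' & EB2 & _).
    assert (EB2' : locally 0 (fun s => B1 (s^2) = B1 0 + (s^2 - 0) * B2 (s^2))).
    { apply (locally_pull1 (fun x => B1 x = B1 0 + (x - 0) * B2 x) (fun s => s^2)); [sms|]. now rewrite pow_i by lia. }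
    eapply bigO_ext; [|apply (bigO_add 8 _ (fun s => s^8 * (- (s * B2 (s^2)))) main); apply bigO_powmul, bigO_continuous; sms].
    apply (locally_mp2 _ _ _ _ EB1' EB2'). intros s -> ->. rewrite Hg. ring.
  - apply (locally_mp2 _ _ _ _ EB1 (neq0_germ A SA A0)). intros x -> K. field. auto.
Qed.

(** An equivalence maps the parabola to the parabola of the other germ, (s^2, s) to (tau(s)^2, tau(s)) with tau'(0) <>
    0. Both components of the image of the critical value are smooth functions of s^2 and of the critical value z(s);
    hence tau(s)^2 - tau(-s)^2 and the corresponding difference of tau^4 (1 + tau^(2q+1)) are multiples of z(s) -
    z(-s) = 2 s^5 b(s^2). As tau^4 - tau'^4 is a multiple of tau^2 - tau'^2, so is tau(s)^(2q+5) - tau(-s)^(2q+5), and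
    this has exact order 2q + 5 because the exponent is odd. *)
(** * Invariance of the order of the critical values *)

Lemma gull_invariant F e b F0 e0 q : sm2 F 0 0 -> sm2 F0 0 0 -> F 0 0 = 0 -> sm2 e0 0 0 -> e0 0 0 <> 0 -> sm1 b 0 ->
  locally_2d (fun u s => d2 F u s = s * (u - s ^ 2) * e u s) 0 0 ->
  locally_2d (fun u s => d2 F0 u s = s * (u - s ^ 2) * e0 u s) 0 0 ->
  locally 0 (fun s => F (s ^ 2) s = s ^ 4 * (1 + s * b (s ^ 2))) ->
  locally 0 (fun s => F0 (s ^ 2) s = s ^ 4 * (1 + s ^ (2 * q + 1))) ->
  A_equivalent (corank1 F) (corank1 F0) ->
  exists c, 0 < c /\ locally 0 (fun s => c * Rabs s ^ (2 * q + 5) <= Rabs (s ^ 5 * b (s ^ 2))).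
Proof.
  intros SF SF0 F00 Se0 e00 Sb DF DF0 ES ES0 HA.
  destruct (A_equivalent_data F F0 HA) as (a & be & c & d & Sa & Sbe & a0 & be0 & J & _ & Sc & Sd & c0 & d0 & _ & L).
  pose proof (jacobian_relation F F0 a be c d SF SF0 F00 Sa Sbe a0 be0 Sc Sd L) as JR.
  set (J1 := fun u v => d1 a u v * d2 be u v - d2 a u v * d1 be u v) in *.
  assert (SJ1 : sm2 J1 0 0) by (unfold J1; sms).
  assert (lam0 : d2 F 0 0 = 0). { pose proof (locally_2d_singleton _ _ _ DF) as K. cbv beta in K. rewrite K. ring. }
  assert (av : d2 a 0 0 = 0).
  { assert (L1 : locally_2d (fun u v => c u (F u v) = a u v) 0 0) by (apply (locally_2d_mp _ _ _ _ L); tauto).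
    destruct (d_ext _ _ _ _ L1) as [_ <-]. assert (Su : sm2 (fun u _ : R => u) 0 0) by sms.
    destruct (d_comp c (fun u _ => u) F 0 0 0 0 Sc eq_refl F00 Su SF) as [_ ->]. rewrite (proj2 (d_fst 0 0)), lam0. ring. }
  assert (bv : d2 be 0 0 <> 0) by (intros Z; apply J; rewrite av, Z; ring).
  assert (sq : sm1 (fun s => s ^ 2) 0) by sms. assert (sq0 : 0 ^ 2 = 0) by ring. assert (Sid : sm1 (fun s => s) 0) by sms.
  set (tau := fun s => be (s ^ 2) s). assert (Stau : sm1 tau 0) by (unfold tau; sms). assert (tau0 : tau 0 = 0) by (unfold tau; now rewrite sq0).
  assert (Dtau : Derive tau 0 = d2 be 0 0).
  { apply is_derive_unique. unfold tau. eapply derive_eq; [apply (sm2_chain be (fun s => s ^ 2) (fun s => s) 0 0 0 1 0); auto|]; [auto_derive; auto; ring|apply derive_id|ring]. }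
  destruct (hadamard_1 tau 0 Stau) as (th & Sth & Eth & th0). rewrite Dtau in th0. rewrite tau0 in Eth.
  assert (th0' : th 0 <> 0) by now rewrite th0.
  (* the singular parabola is sent to the singular parabola *)
  assert (along : forall P, locally_2d P 0 0 -> locally 0 (fun s => P (s ^ 2) s)) by (intros P HP; apply (locally_2d_along P (fun s => s ^ 2) (fun s => s)); auto).
  assert (Ea : locally 0 (fun s => a (s ^ 2) s = tau s ^ 2)).
  { assert (Z : locally 0 (fun s => a (s ^ 2) s - tau s ^ 2 = 0)).
    { apply (locally_neq0_zero (fun s => a (s ^ 2) s - tau s ^ 2)); [sms|].
      assert (T1 : locally_2d (fun u v => d2 F0 (a u v) (be u v) = be u v * (a u v - be u v ^ 2) * e0 (a u v) (be u v) /\ e0 (a u v) (be u v) <> 0) 0 0).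
      { apply (locally_2d_pull (fun u s => d2 F0 u s = s * (u - s ^ 2) * e0 u s /\ e0 u s <> 0) a be); auto. rewrite a0, be0. apply locally_2d_and; auto. now apply neq0_near. }
      apply (locally_mp3 _ _ _ _ _ (filter_and _ _ (along _ JR) (along _ DF)) (filter_and _ _ (along _ T1) (along _ (neq0_near J1 0 0 SJ1 J))) (filter_and _ _ Eth (neq0_germ th Sth th0'))).
      intros s [K1 K2] [[K3 K4] K5] [K6 K7] Hs. rewrite K2 in K1. change (J1 (s^2) s * d2 F0 (a (s^2) s) (be (s^2) s) =
         (d1 c (s^2) (F (s^2) s) * d2 d (s^2) (F (s^2) s) - d2 c (s^2) (F (s^2) s) * d1 d (s^2) (F (s^2) s)) * (s * (s ^ 2 - s ^ 2) * e (s^2) s)) in K1.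
      rewrite Rminus_diag, Rmult_0_r, Rmult_0_l, Rmult_0_r in K1. apply Rmult_integral in K1. destruct K1 as [K1|K1]; [contradiction|].
      rewrite K3 in K1. apply Rmult_integral in K1. destruct K1 as [K1|K1]; [|contradiction]. apply Rmult_integral in K1. destruct K1 as [K1|K1]; [|exact K1].
      exfalso. change (tau s = 0) in K1. rewrite K1 in K6. rewrite Rminus_0_r, Rplus_0_l in K6. symmetry in K6. apply Rmult_integral in K6. tauto. }
    apply (locally_mp _ _ _ Z). intros; lra. }
  set (z := fun s => F (s ^ 2) s). assert (Sz : sm1 z 0) by (unfold z; sms). assert (z0 : z 0 = 0) by (unfold z; now rewrite sq0).
  assert (Ec : locally 0 (fun s => c (s ^ 2) (z s) = tau s ^ 2)).
  { apply (locally_mp2 _ _ _ _ (along _ L) Ea). intros s [K1 _] K2. unfold z. now rewrite K1. }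
  assert (Ed : locally 0 (fun s => d (s ^ 2) (z s) = tau s ^ 4 * (1 + tau s ^ (2 * q + 1)))).
  { assert (T1 : locally 0 (fun s => F0 (tau s ^ 2) (tau s) = tau s ^ 4 * (1 + tau s ^ (2 * q + 1)))) by (apply (locally_pull1 (fun s => F0 (s ^ 2) s = s ^ 4 * (1 + s ^ (2 * q + 1))) tau); [exact Stau|now rewrite tau0]).
    apply (locally_mp3 _ _ _ _ _ (along _ L) Ea T1). intros s [_ K1] K2 K3. unfold z. rewrite K1, K2. exact K3. }
  assert (opp : forall P : R -> Prop, locally 0 P -> locally 0 (fun s => P (- s))) by (intros P HP; apply (locally_pull1 P (fun s => - s)); [sms|now rewrite Ropp_0]).
  (* (s^2, s) and (s^2, - s) lie over the same u, and their critical values differ by 2 s^5 b *)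
  assert (lip : forall h, sm2 h 0 0 -> exists g, sm1 g 0 /\ locally 0 (fun s => h (s ^ 2) (z s) - h (s ^ 2) (z (- s)) = (z s - z (- s)) * g s)).
  { intros h Sh. destruct (hadamard (fun s y => h (s ^ 2) y) (fun s => z (- s)) 0 0) as (g & Sg & Eg & _).
    - sms.
    - clear - Sz. apply (sm_comp1 z (fun s _ _ => - s)); [rewrite Ropp_0; exact Sz|sms].
    - now rewrite Ropp_0.
    - exists (fun s => g s (z s)). split; [sms|]. apply (locally_mp _ _ _ (locally_2d_along _ (fun s => s) z Sid Sz eq_refl z0 Eg)). intros s ->. ring. }
  destruct (lip c Sc) as (g1 & Sg1 & Eg1). destruct (lip d Sd) as (g2 & Sg2 & Eg2).
  assert (Stm : sm1 (fun s => tau (- s)) 0) by (apply (sm_comp1 tau (fun s _ _ => - s)); [rewrite Ropp_0; exact Stau|sms]).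
  assert (Sthm : sm1 (fun s => th (- s)) 0) by (apply (sm_comp1 th (fun s _ _ => - s)); [rewrite Ropp_0; exact Sth|sms]).
  set (H := fun s => 2 * (g2 s - g1 s * (tau s ^ 2 + tau (- s) ^ 2))). assert (SH : sm1 H 0) by (unfold H; sms).
  set (n := (2 * q + 5)%nat). set (Th := fun s => th s ^ n + th (- s) ^ n).
  assert (STh : sm1 Th 0) by (unfold Th; sms).
  assert (Th0 : Th 0 <> 0). { unfold Th. rewrite Ropp_0. pose proof (pow_nonzero (th 0) n th0'). lra. }
  assert (main : locally 0 (fun s => s ^ n * Th s = s ^ 5 * b (s ^ 2) * H s)).
  { apply (locally_mp3 _ _ _ _ _ (filter_and _ _ (filter_and _ _ Ec (opp _ Ec)) (filter_and _ _ Ed (opp _ Ed))) (filter_and _ _ (filter_and _ _ Eg1 Eg2) (filter_and _ _ ES (opp _ ES))) (filter_and _ _ Eth (opp _ Eth))).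
    intros s [[C1 C2] [C3 C4]] [[C5 C6] [C7 C8]] [C9 C10]. replace ((- s) ^ 2) with (s ^ 2) in * by ring.
    assert (Ez : z s - z (- s) = 2 * (s ^ 5 * b (s ^ 2))). { unfold z. replace ((- s) ^ 2) with (s ^ 2) by ring. rewrite C7, C8. ring. }
    rewrite C1, C2, Ez in C5. rewrite C3, C4, Ez in C6.
    assert (En : s ^ n * Th s = tau s ^ n - tau (- s) ^ n).
    { rewrite C9, C10. unfold Th. rewrite !Rminus_0_r, !Rplus_0_l, !Rpow_mult_distr.
      replace ((- s) ^ n) with (- s ^ n). ring. unfold n. replace (2 * q + 5)%nat with (Datatypes.S (2 * (q + 2))) by lia. rewrite <- !tech_pow_Rmult, !pow_mult. replace ((- s) ^ 2) with (s ^ 2) by ring. ring. }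
    rewrite En. unfold n, H. replace (2 * q + 5)%nat with (4 + (2 * q + 1))%nat by lia. rewrite !pow_add.
    replace (s ^ 5 * b (s ^ 2) * (2 * (g2 s - g1 s * (tau s ^ 2 + tau (- s) ^ 2)))) with (2 * (s ^ 5 * b (s ^ 2)) * g2 s - 2 * (s ^ 5 * b (s ^ 2)) * g1 s * (tau s ^ 2 + tau (- s) ^ 2)) by ring.
    rewrite <- C5, <- C6, !pow_add. ring. }
  destruct (germ_lower_bound Th STh Th0) as (k & Hk & Lk). destruct (bigO_pos _ _ (bigO_continuous H SH)) as (M & HM & LM).
  exists (k / M). split; [now apply Rdiv_lt_0_compat|]. apply (locally_mp3 _ _ _ _ _ main Lk LM). intros s K1 K2 K3. simpl in K3. rewrite Rmult_1_r in K3.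
  apply (f_equal Rabs) in K1. rewrite (Rabs_mult (s ^ n)), (Rabs_mult _ (H s)), <- RPow_abs in K1. pose proof (pow_le _ n (Rabs_pos s)).
  pose proof (Rabs_pos (s ^ 5 * b (s ^ 2))). apply Rmult_le_reg_r with M; auto. fold n.
  replace (k / M * Rabs s ^ n * M) with (Rabs s ^ n * k) by (field; lra).
  apply Rle_trans with (Rabs s ^ n * Rabs (Th s)). now apply Rmult_le_compat_l. rewrite K1. now apply Rmult_le_compat_l.
Qed.

(** * The criterion for gulls and ugly gulls, and the normal forms *)

Lemma gull_smooth : sm2 gull1 0 0 /\ sm2 gull3 0 0 /\ gull1 0 0 = 0 /\ gull3 0 0 = 0.
Proof. unfold gull1, gull3. split; [sms|]. split; [sms|]. split; ring. Qed.

Lemma gull1_of_leading F e b : sm2 F 0 0 -> F 0 0 = 0 -> locally 0 (fun u => F u 0 = 0) ->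
  locally_2d (fun u s => d2 F u s = s * (u - s ^ 2) * e u s) 0 0 -> sm1 b 0 ->
  locally 0 (fun s => F (s ^ 2) s = s ^ 4 * (1 + s * b (s ^ 2))) -> b 0 <> 0 -> A_equivalent (corank1 F) (corank1 gull1).
Proof.
  intros SF F00 EF DF Sb ES b0.
  destruct (gull_rescale F e b b 0 SF Sb b0 F00 DF EF ES) as (F' & e' & HA & SF' & DF' & EF' & ES').
  - apply locally_all. intros x. simpl. ring.
  - apply A_equivalent_trans with (corank1 F'); auto. apply (gull1_model F' e'); auto.
Qed.

(** Odd roots exist for both signs. *)
Lemma cube_root_germ g : sm1 g 0 -> g 0 <> 0 -> exists r, sm1 r 0 /\ r 0 <> 0 /\ locally 0 (fun x => r x ^ 3 = g x).
Proof.
  intros S g0. destruct (Rlt_dec 0 (g 0)) as [P|P].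
  - destruct (root_germ g 3 ltac:(lia) S P) as (r & Sr & r0 & E). exists r. split; auto. split; auto. lra.
  - destruct (root_germ (fun x => - g x) 3 ltac:(lia) ltac:(sms) ltac:(lra)) as (r & Sr & r0 & E). exists (fun x => - r x). split; [sms|]. split; [lra|].
    apply (locally_mp _ _ _ E). intros x K. replace ((- r x) ^ 3) with (- r x ^ 3) by ring. rewrite K. ring.
Qed.

Lemma gull3_of_leading F e b b1 : sm2 F 0 0 -> F 0 0 = 0 -> locally 0 (fun u => F u 0 = 0) ->
  locally_2d (fun u s => d2 F u s = s * (u - s ^ 2) * e u s) 0 0 ->
  locally 0 (fun s => F (s ^ 2) s = s ^ 4 * (1 + s * b (s ^ 2))) -> sm1 b1 0 -> b1 0 <> 0 -> locally 0 (fun x => b x = x * b1 x) -> A_equivalent (corank1 F) (corank1 gull3).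
Proof.
  intros SF F00 EF DF ES Sb1 b10 Eb. destruct (cube_root_germ b1 Sb1 b10) as (r & Sr & r0 & Er).
  destruct (gull_rescale F e b r 1 SF Sr r0 F00 DF EF ES) as (F' & e' & HA & SF' & DF' & EF' & ES').
  - apply (locally_mp2 _ _ _ _ Eb Er). intros x -> <-. simpl. ring.
  - apply A_equivalent_trans with (corank1 F'); auto. apply (gull3_model F' e'); auto.
Qed.

Lemma bigO_square_comp n b : bigO n b -> bigO (2 * n) (fun s => b (s ^ 2)).
Proof. intros B. apply (bigO_comp n 2 b (fun s => s ^ 2)); auto. apply bigO_pow. Qed.

(** The number n bounds the order of b from below, and the invariant bounds it from above by 0, respectively 1. *)
Lemma gull_order_bound F e b n : sm2 F 0 0 -> F 0 0 = 0 -> locally_2d (fun u s => d2 F u s = s * (u - s ^ 2) * e u s) 0 0 -> sm1 b 0 ->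
  locally 0 (fun s => F (s ^ 2) s = s ^ 4 * (1 + s * b (s ^ 2))) -> bigO n b ->
  (A_equivalent (corank1 F) (corank1 gull1) -> n = 0%nat) /\ (A_equivalent (corank1 F) (corank1 gull3) -> (n <= 1)%nat).
Proof.
  intros SF F00 DF Sb ES B. destruct gull_smooth as (S1 & S3 & _).
  assert (B5 : bigO (5 + 2 * n) (fun s => s ^ 5 * b (s ^ 2))) by (apply bigO_mul; [apply bigO_pow|now apply bigO_square_comp]).
  split; intros HA.
  - destruct (gull_invariant F e b gull1 (fun _ s => 4 + 15 / 2 * s) 0) as (c & Hc & L); auto.
    + clear; sms.
    + lra.
    + apply locally_2d_forall. apply gull_d.
    + apply locally_all. intros s. unfold gull1. simpl. field.
    + destruct n as [|n]; auto. exfalso. apply (bigO_lower (5 + 2 * Datatypes.S n) (2 * 0 + 5) c _ B5); auto. lia.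
  - destruct (gull_invariant F e b gull3 (fun _ s => 4 + 35 / 2 * s ^ 3) 1) as (c & Hc & L); auto.
    + clear; sms.
    + lra.
    + apply locally_2d_forall. apply gull_d.
    + apply locally_all. intros s. unfold gull3. simpl. field.
    + destruct n as [|[|n]]; auto. exfalso. apply (bigO_lower (5 + 2 * Datatypes.S (Datatypes.S n)) (2 * 1 + 5) c _ B5); auto. lia.
Qed.

Lemma gull3_not_gull1 : ~ A_equivalent (corank1 gull3) (corank1 gull1).
Proof.
  intros HA. destruct gull_smooth as (S1 & S3 & E1 & E3).
  destruct (gull_order_bound gull3 (fun _ s => 4 + 35 / 2 * s ^ 3) (fun x => x) 1 S3 E3) as [K _].
  - apply locally_2d_forall. apply gull_d.
  - sms.
  - apply locally_all. intros s. unfold gull3. field.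
  - apply bigO_id.
  - discriminate (K HA).
Qed.

(** The criterion is stated for general germs, because it is applied to the normal forms as well as to the projection. *)
Lemma gull_criterion F T tau g5 g7 : sm2 F 0 0 -> F 0 0 = 0 -> d2 F 0 0 = 0 -> d2 (d2 F) 0 0 = 0 -> d1 (d2 F) 0 0 = 0 ->
  d1 (d2 (d2 F)) 0 0 <> 0 -> sm1 T 0 -> T 0 <> 0 -> locally 0 (fun y => d2 F 0 y = y ^ 3 * T y) ->
  let kap := - T 0 / d1 (d2 (d2 F)) 0 0 in
  bigO 5 (fun s => d2 F (kap * s ^ 2) (s + tau * s ^ 2)) ->
  bigO 8 (fun s => F (kap * s ^ 2) (s + tau * s ^ 2) - F (kap * s ^ 2) (- s + tau * s ^ 2) - 2 * (g5 * s ^ 5 + g7 * s ^ 7)) ->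
  (g5 <> 0 <-> A_equivalent (corank1 F) (corank1 gull1)) /\ (g5 = 0 /\ g7 <> 0 <-> A_equivalent (corank1 F) (corank1 gull3)).
Proof.
  intros SF F00 l00 lv lu Hp ST T0 ET kap B5 B8. destruct gull_smooth as (S1 & S3 & E1 & E3).
  destruct (gull_structure F T tau g5 g7 SF F00 l00 lv lu Hp ST T0 ET B5 B8) as (F' & e & b & A & HA & SF' & F'00 & EF' & DF' & Sb & ES & A0 & b0 & Hb).
  assert (HA' : A_equivalent (corank1 F') (corank1 F)) by (apply A_equivalent_sym; auto; now apply corank1_smooth).
  assert (nz : forall x, x <> 0 -> x / A <> 0) by (intros x Hx; apply Rmult_integral_contrapositive_currified; auto; now apply Rinv_neq_0_compat).
  assert (suff1 : g5 <> 0 -> A_equivalent (corank1 F) (corank1 gull1)).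
  { intros H. apply A_equivalent_trans with (corank1 F'); auto. apply (gull1_of_leading F' e b); auto. rewrite b0. auto. }
  assert (O1 : g5 = 0 -> bigO 1 b) by (intros H; apply bigO_vanish; auto; rewrite b0, H; unfold Rdiv; ring).
  split; split.
  - exact suff1.
  - intros H Z. destruct (gull_order_bound F' e b 1) as [K _]; auto. discriminate (K (A_equivalent_trans _ _ _ HA' H)).
  - intros [Z H]. destruct (Hb Z) as (b1 & Sb1 & b10 & Eb). apply A_equivalent_trans with (corank1 F'); auto. apply (gull3_of_leading F' e b b1); auto. rewrite b10. auto.
  - intros H. assert (Z : g5 = 0).
    { destruct (Req_dec g5 0) as [Z|Z]; auto. exfalso. apply gull3_not_gull1. apply A_equivalent_trans with (corank1 F); auto. apply A_equivalent_sym; auto. now apply corank1_smooth. }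
    split; auto. intros Z7. destruct (Hb Z) as (b1 & Sb1 & b10 & Eb).
    destruct (gull_order_bound F' e b 2) as [_ K]; auto.
    + apply bigO_ext with (fun x => x * b1 x). now apply (locally_mp _ _ _ Eb). apply (bigO_mul 1 1). apply bigO_id. apply bigO_vanish; auto. rewrite b10, Z7. unfold Rdiv; ring.
    + pose proof (K (A_equivalent_trans _ _ _ HA' H)). lia.
Qed.

(** Here kap = - 2, and tau = - 5/8 removes the term of order 4 of F_v along the test curve; the odd part of F is s^5
    + 375/128 s^7 + O(s^9). *)
Lemma gulls_normal_form : A_equivalent (corank1 (fun u v => u * v ^ 2 + v ^ 4 + v ^ 5)) (corank1 gull1).
Proof.
  assert (D : forall u v, d2 (fun u v => u * v ^ 2 + v ^ 4 + v ^ 5) u v = 2 * u * v + 4 * v ^ 3 + 5 * v ^ 4) by (intros; apply is_derive_unique; auto_derive; auto; ring).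
  assert (D2 : forall u v, d2 (d2 (fun u v => u * v ^ 2 + v ^ 4 + v ^ 5)) u v = 2 * u + 12 * v ^ 2 + 20 * v ^ 3).
  { intros u v. apply is_derive_unique. apply is_derive_ext with (fun v => 2 * u * v + 4 * v ^ 3 + 5 * v ^ 4); [intros; now rewrite D|]. auto_derive; auto; ring. }
  assert (D12 : d1 (d2 (fun u v => u * v ^ 2 + v ^ 4 + v ^ 5)) 0 0 = 0).
  { apply is_derive_unique. apply is_derive_ext with (fun u => 2 * u * 0 + 4 * 0 ^ 3 + 5 * 0 ^ 4); [intros; now rewrite D|]. auto_derive; auto; ring. }
  assert (D122 : d1 (d2 (d2 (fun u v => u * v ^ 2 + v ^ 4 + v ^ 5))) 0 0 = 2).
  { apply is_derive_unique. apply is_derive_ext with (fun u => 2 * u + 12 * 0 ^ 2 + 20 * 0 ^ 3); [intros; now rewrite D2|]. auto_derive; auto; ring. }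
  destruct (gull_criterion (fun u v => u * v ^ 2 + v ^ 4 + v ^ 5) (fun y => 4 + 5 * y) (-5/8) 1 (375/128)) as [[K _] _].
  - sms.
  - ring.
  - rewrite D; ring.
  - rewrite D2; ring.
  - exact D12.
  - rewrite D122; lra.
  - sms.
  - lra.
  - apply locally_all. intros y. rewrite D. ring.
  - rewrite D122. apply bigO_ext with (fun s => s ^ 5 * (- (125/16) + s * (1375/128 + s * (- (625/128) + s * (3125/4096))))).
    + apply locally_all. intros s. rewrite D. field.
    + apply bigO_powmul, bigO_continuous; sms.
  - rewrite D122. apply bigO_ext with (fun s => s ^ 8 * (2 * (3125/4096) * s)).
    + apply locally_all. intros s. field.
    + apply bigO_powmul, bigO_continuous; sms.
  - apply K. lra.
Qed.

(** Here kap = - 2 and tau = 0, as F_v has no terms of order 4 along (- 2 s^2, s); the odd part of F is s^7. *)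
Lemma ugly_gulls_normal_form : A_equivalent (corank1 (fun u v => u * v ^ 2 + v ^ 4 + v ^ 7)) (corank1 gull3).
Proof.
  assert (D : forall u v, d2 (fun u v => u * v ^ 2 + v ^ 4 + v ^ 7) u v = 2 * u * v + 4 * v ^ 3 + 7 * v ^ 6) by (intros; apply is_derive_unique; auto_derive; auto; ring).
  assert (D2 : forall u v, d2 (d2 (fun u v => u * v ^ 2 + v ^ 4 + v ^ 7)) u v = 2 * u + 12 * v ^ 2 + 42 * v ^ 5).
  { intros u v. apply is_derive_unique. apply is_derive_ext with (fun v => 2 * u * v + 4 * v ^ 3 + 7 * v ^ 6); [intros; now rewrite D|]. auto_derive; auto; ring. }
  assert (D12 : d1 (d2 (fun u v => u * v ^ 2 + v ^ 4 + v ^ 7)) 0 0 = 0).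
  { apply is_derive_unique. apply is_derive_ext with (fun u => 2 * u * 0 + 4 * 0 ^ 3 + 7 * 0 ^ 6); [intros; now rewrite D|]. auto_derive; auto; ring. }
  assert (D122 : d1 (d2 (d2 (fun u v => u * v ^ 2 + v ^ 4 + v ^ 7))) 0 0 = 2).
  { apply is_derive_unique. apply is_derive_ext with (fun u => 2 * u + 12 * 0 ^ 2 + 42 * 0 ^ 5); [intros; now rewrite D2|]. auto_derive; auto; ring. }
  destruct (gull_criterion (fun u v => u * v ^ 2 + v ^ 4 + v ^ 7) (fun y => 4 + 7 * y ^ 3) 0 0 1) as [_ [K _]].
  - sms.
  - ring.
  - rewrite D; ring.
  - rewrite D2; ring.
  - exact D12.
  - rewrite D122; lra.
  - sms.
  - lra.
  - apply locally_all. intros y. rewrite D. ring.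
  - rewrite D122. apply bigO_ext with (fun s => s ^ 5 * (7 * s)).
    + apply locally_all. intros s. rewrite D. field.
    + apply bigO_powmul, bigO_continuous; sms.
  - rewrite D122. apply bigO_ext with (fun s => s ^ 8 * 0).
    + apply locally_all. intros s. field.
    + apply bigO_powmul, bigO_const.
  - apply K. lra.
Qed.

(** The two equations make the terms of order 3 and 4 of f_x vanish along the test curve. The coefficients of s^5 and
    s^7 are the odd part of the Taylor polynomial of f; the even terms, those in y alone among them, cancel. *)
(** * Gulls among the projections of surfaces *)

Lemma gull_test_curve a f kap tau : parabolic_monge_form a f -> a 3%nat 0%nat = 0 ->
  a 2%nat 1%nat * kap + a 4%nat 0%nat / 6 = 0 ->
  a 1%nat 2%nat * kap ^ 2 / 2 + a 3%nat 1%nat * kap / 2 + a 5%nat 0%nat / 24 + tau * a 4%nat 0%nat / 3 = 0 ->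
  bigO 5 (fun s => d1 f (s + tau * s ^ 2) (kap * s ^ 2)) /\
  bigO 8 (fun s => f (s + tau * s ^ 2) (kap * s ^ 2) - f (- s + tau * s ^ 2) (kap * s ^ 2) - 2 *
   ((a 1%nat 2%nat * kap ^ 2 / 2 + a 2%nat 1%nat * kap * tau + a 3%nat 1%nat * kap / 6 + a 4%nat 0%nat * tau / 6 + a 5%nat 0%nat / 120) * s ^ 5 +
    (a 1%nat 3%nat * kap ^ 3 / 6 + a 2%nat 2%nat * kap ^ 2 * tau / 2 + a 3%nat 1%nat * kap * tau ^ 2 / 2 + a 4%nat 0%nat * tau ^ 3 / 6 + a 3%nat 2%nat * kap ^ 2 / 12
     + a 4%nat 1%nat * kap * tau / 6 + a 5%nat 0%nat * tau ^ 2 / 12 + a 5%nat 1%nat * kap / 120 + a 6%nat 0%nat * tau / 120 + a 7%nat 0%nat / 5040) * s ^ 7)).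
Proof.
  intros hf a30 H3 H4. destruct (monge_facts a f hf) as (Sf & f0 & pd & p10 & p01 & p20 & p11).
  assert (Sl : sm2 (d1 f) 0 0) by sms.
  destruct INR_fact_values as (F0 & F1 & F2 & F3 & F4 & F5 & F6 & F7).
  assert (By : bigO 1 (fun s => kap * s ^ 2)) by (apply bigO_vanish; [sms|ring]).
  assert (Bx : forall e, bigO 1 (fun s => e * s + tau * s ^ 2)) by (intros; apply bigO_vanish; [sms|ring]).
  set (a12 := a 1%nat 2%nat) in *. set (a13 := a 1%nat 3%nat) in *. set (a14 := a 1%nat 4%nat) in *. set (a15 := a 1%nat 5%nat) in *. set (a16 := a 1%nat 6%nat) in *. set (a21 := a 2%nat 1%nat) in *. set (a22 := a 2%nat 2%nat) in *. set (a23 := a 2%nat 3%nat) in *. set (a24 := a 2%nat 4%nat) in *. set (a25 := a 2%nat 5%nat) in *. set (a31 := a 3%nat 1%nat) in *. set (a32 := a 3%nat 2%nat) in *. set (a33 := a 3%nat 3%nat) in *. set (a34 := a 3%nat 4%nat) in *. set (a40 := a 4%nat 0%nat) in *. set (a41 := a 4%nat 1%nat) in *. set (a42 := a 4%nat 2%nat) in *. set (a43 := a 4%nat 3%nat) in *. set (a50 := a 5%nat 0%nat) in *. set (a51 := a 5%nat 1%nat) in *. set (a52 := a 5%nat 2%nat) in *. set (a60 := a 6%nat 0%nat) in *. set (a61 := a 6%nat 1%nat) in *. set (a70 := a 7%nat 0%nat) in *.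
  split.
  - pose proof (taylor_along (d1 f) 4 _ _ Sl (Bx 1) By) as T.
    assert (BQ : bigO 5 (fun s => s ^ 5 * (((1/2)*a22*kap^2 + a31*kap*tau + (1/2)*a40*tau^2 + (1/6)*a41*kap + (1/6)*a50*tau) + s * (((1/6)*a13*kap^3 + (1/2)*a22*kap^2*tau + (1/2)*a31*kap*tau^2 + (1/6)*a40*tau^3 + (1/4)*a32*kap^2 + (1/2)*a41*kap*tau + (1/4)*a50*tau^2) + s * (((1/6)*a23*kap^3 + (1/2)*a32*kap^2*tau + (1/2)*a41*kap*tau^2 + (1/6)*a50*tau^3) + s * ((1/24)*a14*kap^4 + (1/6)*a23*kap^3*tau + (1/4)*a32*kap^2*tau^2 + (1/6)*a41*kap*tau^3 + (1/24)*a50*tau^4)))))) by (apply bigO_powmul, bigO_continuous; sms).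
    eapply bigO_ext; [|exact (bigO_add 5 _ _ T BQ)]. apply locally_all. intros s. cbv beta.
    cbn [sum_f_R0 Nat.sub]. unfold taylor_coeff. rewrite !partial_derive_d1 by (clear - Sf; sms). rewrite p10, p20, p11, !pd by lia. rewrite F0, F1, F2, F3, F4.
    rewrite a30. fold a12 a13 a14 a15 a16 a21 a22 a23 a24 a25 a31 a32 a33 a34 a40 a41 a42 a43 a50 a51 a52 a60 a61 a70. rewrite Rmult_1_l.
    transitivity (d1 f (s + tau * s ^ 2) (kap * s ^ 2) - s ^ 3 * (a21 * kap + a40 / 6) - s ^ 4 * (a12 * kap ^ 2 / 2 + a31 * kap / 2 + a50 / 24 + tau * a40 / 3 + tau * (a21 * kap + a40 / 6))).
    + field.
    + rewrite H3, H4. ring.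
  - pose proof (taylor_along f 7 _ _ Sf (Bx 1) By) as T1. pose proof (taylor_along f 7 _ _ Sf (Bx (-1)) By) as T2.
    assert (BQ : bigO 8 (fun s => s ^ 8 * (s * (((1/12)*a14*kap^4 + (1/3)*a23*kap^3*tau + (1/2)*a32*kap^2*tau^2 + (1/3)*a41*kap*tau^3 + (1/12)*a50*tau^4 + (1/18)*a33*kap^3 + (1/6)*a42*kap^2*tau + (1/6)*a51*kap*tau^2 + (1/18)*a60*tau^3 + (1/120)*a52*kap^2 + (1/60)*a61*kap*tau + (1/120)*a70*tau^2) + s ^ 2 * (((1/60)*a15*kap^5 + (1/12)*a24*kap^4*tau + (1/6)*a33*kap^3*tau^2 + (1/6)*a42*kap^2*tau^3 + (1/12)*a51*kap*tau^4 + (1/60)*a60*tau^5 + (1/72)*a34*kap^4 + (1/18)*a43*kap^3*tau + (1/12)*a52*kap^2*tau^2 + (1/18)*a61*kap*tau^3 + (1/72)*a70*tau^4) + s ^ 2 * ((1/360)*a16*kap^6 + (1/60)*a25*kap^5*tau + (1/24)*a34*kap^4*tau^2 + (1/18)*a43*kap^3*tau^3 + (1/24)*a52*kap^2*tau^4 + (1/60)*a61*kap*tau^5 + (1/360)*a70*tau^6)))))) by (apply bigO_powmul, bigO_continuous; sms).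
    eapply bigO_ext; [|exact (bigO_add 8 _ _ (bigO_sub 8 _ _ T1 T2) BQ)]. apply locally_all. intros s. cbv beta.
    cbn [sum_f_R0 Nat.sub]. unfold taylor_coeff. rewrite p10, p20, p01, p11. set (p00 := partial_derive 0 0 f 0 0). set (p02 := partial_derive 0 2 f 0 0).
    rewrite !pd by lia. rewrite F0, F1, F2, F3, F4, F5, F6, F7. rewrite a30. fold a12 a13 a14 a15 a16 a21 a22 a23 a24 a25 a31 a32 a33 a34 a40 a41 a42 a43 a50 a51 a52 a60 a61 a70. rewrite Rmult_1_l.
    replace (-1 * s) with (- s) by ring. field.
Qed.

(** Solving the equations for kap and tau and substituting gives R_A4 / (360 a21^2) for the coefficient of s^5; where
    it vanishes, eliminating a12 gives R_A6 / (1134000 a21^3 a40^2) for that of s^7. *)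
Lemma projection_gull a f : parabolic_monge_form a f -> a 3%nat 0%nat = 0 -> a 2%nat 1%nat <> 0 -> a 4%nat 0%nat <> 0 ->
  (R_A4 a <> 0 <-> A_equivalent (corank1 (fun u v => f v u)) (corank1 gull1)) /\
  (R_A4 a = 0 /\ R_A6 a <> 0 <-> A_equivalent (corank1 (fun u v => f v u)) (corank1 gull3)).
Proof.
  intros hf a30 a21 a40. destruct (monge_facts a f hf) as (Sf & f0 & pd & p10 & p01 & p20 & p11).
  destruct INR_fact_values as (F0 & F1 & F2 & F3 & _).
  set (F := fun u v => f v u). assert (SF : sm2 F 0 0) by (unfold F; sms).
  assert (Sl : sm2 (d1 f) 0 0) by sms. assert (Sll : sm2 (d1 (d1 f)) 0 0) by sms.
  assert (S0 : sm1 (fun y => d1 f y 0) 0) by sms.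
  destruct (bigO_leading 3 (a 4%nat 0%nat / 6) (fun y => d1 f y 0) S0) as (T & ST & T0 & ET).
  { pose proof (taylor_along (d1 f) 3 (fun y => y) (fun _ => 0) Sl bigO_id) as B. eapply bigO_ext; [|apply B].
    - apply locally_all. intros y. cbv beta. cbn [sum_f_R0 Nat.sub]. unfold taylor_coeff. rewrite !partial_derive_d1 by (clear - Sf; sms).
      rewrite p10, p20, p11, !pd, a30, F0, F1, F2, F3 by lia. field.
    - apply bigO_vanish; [clear; sms|reflexivity]. }
  assert (T0' : T 0 <> 0) by lra.
  assert (lu : d1 (d2 F) 0 0 = 0).
  { change (partial_derive 0 1 (d1 f) 0 0 = 0). now rewrite partial_derive_d1. }
  assert (p : d1 (d2 (d2 F)) 0 0 = a 2%nat 1%nat).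
  { change (partial_derive 0 1 (d1 (d1 f)) 0 0 = a 2%nat 1%nat). rewrite !partial_derive_d1 by auto. now apply pd. }
  set (kap := - T 0 / d1 (d2 (d2 F)) 0 0).
  assert (Ek : kap = - a 4%nat 0%nat / (6 * a 2%nat 1%nat)) by (unfold kap; rewrite p, T0; field; auto).
  set (tau := - 3 / a 4%nat 0%nat * (a 1%nat 2%nat * kap ^ 2 / 2 + a 3%nat 1%nat * kap / 2 + a 5%nat 0%nat / 24)).
  destruct (gull_test_curve a f kap tau hf a30) as [B5 B8].
  { rewrite Ek. field. auto. }
  { unfold tau. field. auto. }
  match type of B8 with bigO 8 (fun s => _ - 2 * (?x * _ + ?y * _)) => set (g5 := x) in B8; set (g7 := y) in B8 end.
  destruct (gull_criterion F T tau g5 g7 SF f0) as [C1 C3]; auto.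
  { now rewrite p. }
  assert (E5 : g5 = R_A4 a * / (360 * a 2%nat 1%nat ^ 2)) by (unfold g5, tau; rewrite Ek; unfold R_A4; field; auto).
  assert (E7 : R_A4 a = 0 -> g7 = R_A6 a * / (1134000 * a 2%nat 1%nat ^ 3 * a 4%nat 0%nat ^ 2)).
  { intros Z. assert (E12 : a 1%nat 2%nat = (10 * a 2%nat 1%nat * a 3%nat 1%nat * a 4%nat 0%nat - 3 * a 2%nat 1%nat ^ 2 * a 5%nat 0%nat) / (5 * a 4%nat 0%nat ^ 2)).
    { unfold R_A4 in Z. apply Rmult_eq_reg_r with (5 * a 4%nat 0%nat ^ 2). field_simplify; auto. lra. apply Rmult_integral_contrapositive_currified; [lra|now apply pow_nonzero]. }
    unfold g7, tau. rewrite E12, Ek. unfold R_A6. field. auto. }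
  assert (N5 : / (360 * a 2%nat 1%nat ^ 2) <> 0) by (apply Rinv_neq_0_compat, Rmult_integral_contrapositive_currified; [lra|now apply pow_nonzero]).
  assert (N7 : / (1134000 * a 2%nat 1%nat ^ 3 * a 4%nat 0%nat ^ 2) <> 0).
  { apply Rinv_neq_0_compat. repeat apply Rmult_integral_contrapositive_currified; try lra; auto. }
  assert (Z5 : g5 = 0 <-> R_A4 a = 0).
  { rewrite E5. split; intros Z; [apply Rmult_integral in Z; tauto|rewrite Z; ring]. }
  split.
  - rewrite <- C1, Z5. tauto.
  - rewrite <- C3, Z5. split; intros [H1 H2]; split; auto; intros Z; apply H2.
    + rewrite (E7 H1) in Z. apply Rmult_integral in Z. tauto.
    + rewrite (E7 H1), Z. ring.
Qed.

Lemma not_immersed_of_order_2 X : sm1 X 0 -> X 0 = 0 -> bigO 2 X -> Derive X 0 = 0.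
Proof.
  intros S E B. apply (bigO_coeff 1). apply bigO_ext with (fun t => X t - (X t - Derive X 0 * t)). apply locally_all; intros; simpl; ring.
  apply bigO_sub; auto. now apply bigO_linear.
Qed.

Lemma bigO_2_of_vanishing h : sm1 h 0 -> h 0 = 0 -> Derive h 0 = 0 -> bigO 2 h.
Proof.
  intros S E D. eapply bigO_ext; [|exact (bigO_linear h S E)]. apply locally_all. intros t. cbv beta. rewrite D. ring.
Qed.

(** The germ G has multiplicity exactly 4 on u = 0: it is not equivalent to a cubic, which excludes a30 <> 0, and a40
    = 0 would make the multiplicity at least 5. If a21 were 0, the Jacobian and its derivatives would vanish to order
    2 along the v-axis; but the derivatives of s (u - s^2) eps(s) vanish to order 2 along no immersed curve. *)
Lemma gull_necessary_conditions a f G eps w : parabolic_monge_form a f -> sm2 G 0 0 ->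
  (forall u s, d2 G u s = s * (u - s ^ 2) * eps s) -> (forall s, sm1 eps s) -> eps 0 <> 0 ->
  (forall y, G 0 y = y ^ 4 * w y) -> sm1 w 0 -> w 0 <> 0 -> A_equivalent (corank1 (fun u v => f v u)) (corank1 G) ->
  a 3%nat 0%nat = 0 /\ a 2%nat 1%nat * a 4%nat 0%nat <> 0.
Proof.
  intros hf SG DG Seps e0 EG Sw w0 HA. destruct (monge_facts a f hf) as (Sf & f0 & pd & p10 & p01 & p20 & p11).
  set (F := fun u v => f v u) in *. assert (SF : sm2 F 0 0) by (unfold F; sms).
  assert (G0 : G 0 0 = 0) by (rewrite EG; ring).
  assert (HA' : A_equivalent (corank1 G) (corank1 F)) by (apply A_equivalent_sym; auto; now apply corank1_smooth).
  assert (a30 : a 3%nat 0%nat = 0).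
  { destruct (Req_dec (a 3%nat 0%nat) 0) as [|N]; auto. exfalso. destruct (projection_cubic a f hf N) as (al & K & Sal & _ & HC & Bal).
    destruct (cubic_sm al Sal) as [SC _].
    assert (al0 : al 0 = 0). { apply bigO_at_0 in Bal. cbv beta in Bal. rewrite !pow_i in Bal by lia. lra. }
    destruct (multiplicity_transfer G (cubic al) 4 SG SC G0 (A_equivalent_trans _ _ _ HA' HC)) as (Y & SY & Y0 & DY & B); [lia| |].
    - apply bigO_ext with (fun v => v ^ 4 * w v). apply locally_all; intros; now rewrite EG. apply bigO_powmul. now apply bigO_continuous.
    - apply (bigO_immersed_pow Y 3 4 (fun _ => 1) SY Y0 DY); [sms|lra|lia|]. eapply bigO_ext; [|exact B]. apply locally_all. intros t. cbv beta. unfold cubic. rewrite al0. ring. }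
  split; [exact a30|]. apply Rmult_integral_contrapositive_currified; intros Z.
  - assert (Sl : sm2 (d1 f) 0 0) by sms.
    destruct (jacobian_order_transfer F G 2 (fun _ => 0) (fun t => t) SF SG f0 HA) as (X & Y & SX & SY & X0 & Y0 & I & B1 & B2); auto; try sms.
    + right. rewrite Derive_id. lra.
    + apply (bigO_2_of_vanishing (fun t => d1 f t 0)); [sms|exact p10|exact p20].
    + apply (bigO_2_of_vanishing (fun t => d2 (d1 f) t 0)); [sms| |].
      * change (partial_derive 0 1 (d1 f) 0 0 = 0). now rewrite partial_derive_d1.
      * change (partial_derive 1 1 (d1 f) 0 0 = 0). rewrite partial_derive_d1 by auto. now rewrite pd by lia.
    + apply (bigO_2_of_vanishing (fun t => d1 (d1 f) t 0)); [sms|exact p20|]. change (partial_derive 3 0 f 0 0 = 0). now rewrite pd by lia.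
    + assert (D1 : forall u s, d1 (d2 G) u s = s * eps s).
      { intros u s. apply is_derive_unique. apply is_derive_ext with (fun u => s * (u - s ^ 2) * eps s); [intros; now rewrite DG|]. auto_derive; auto; ring. }
      assert (D2 : forall u s, d2 (d2 G) u s = (u - 3 * s ^ 2) * eps s + s * (u - s ^ 2) * Derive eps s).
      { intros u s. apply is_derive_unique. apply is_derive_ext with (fun s => s * (u - s ^ 2) * eps s); [intros; now rewrite DG|].
        assert (P : is_derive (fun s => s * (u - s ^ 2)) s (u - 3 * s ^ 2)) by (auto_derive; auto; ring).
        exact (derive_mul _ eps s _ _ P (sm1_derive _ _ (Seps s))). }
      assert (DY : Derive Y 0 = 0).
      { destruct (Req_dec (Derive Y 0) 0) as [|N]; auto. exfalso. apply (bigO_immersed_pow Y 1 2 eps SY Y0 N (Seps 0) e0); [lia|].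
        eapply bigO_ext; [|exact B1]. apply locally_all. intros t. cbv beta. rewrite D1. ring. }
      assert (BY : bigO 2 Y) by now apply bigO_2_of_vanishing.
      destruct I as [I|I]; [|contradiction]. apply I. apply not_immersed_of_order_2; auto.
      assert (SeY : sm1 (fun t => eps (Y t)) 0) by (pose proof (Seps 0); clear - H SY Y0; sms).
      assert (SdY : sm1 (fun t => Derive eps (Y t)) 0) by (pose proof (Seps 0); clear - H SY Y0; sms).
      assert (eY : (fun t => eps (Y t)) 0 <> 0) by (cbv beta; now rewrite Y0).
      apply bigO_ext with (fun t => (d2 (d2 G) (X t) (Y t) - Y t * ((X t - Y t ^ 2) * Derive eps (Y t) - 3 * Y t * eps (Y t))) * / eps (Y t)).
      * apply (locally_mp _ _ _ (neq0_germ _ SeY eY)). intros t N. rewrite D2. field. exact N.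
      * apply (bigO_mul 2 0). apply bigO_sub; auto. apply (bigO_mul 2 0); auto. apply bigO_continuous. sms. apply bigO_continuous. apply (sm_inv (fun s _ _ => eps (Y s))); auto.
  - destruct (multiplicity_transfer F G 5 SF SG f0 HA) as (Y & SY & Y0 & DY & B); [lia| |].
    + pose proof (taylor_along f 4 (fun y => y) (fun _ => 0) Sf bigO_id) as B. eapply bigO_ext; [|apply B; apply bigO_vanish; [clear; sms|reflexivity]].
      apply locally_all. intros y. cbv beta. cbn [sum_f_R0 Nat.sub]. unfold taylor_coeff, F. change (partial_derive 0 0 f 0 0) with (f 0 0). set (p02 := partial_derive 0 2 f 0 0).
      rewrite f0, p10, p20, p11, p01, !pd, a30, Z by lia. unfold Rdiv; ring.
    + apply (bigO_immersed_pow Y 4 5 w SY Y0 DY Sw w0); [lia|]. eapply bigO_ext; [|exact B]. apply locally_all. intros t. cbv beta. now rewrite EG.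
Qed.

Lemma gull_conditions a f : parabolic_monge_form a f ->
  (A_equivalent (corank1 (fun u v => f v u)) (corank1 gull1) \/ A_equivalent (corank1 (fun u v => f v u)) (corank1 gull3)) ->
  a 3%nat 0%nat = 0 /\ a 2%nat 1%nat * a 4%nat 0%nat <> 0.
Proof.
  intros hf. destruct gull_smooth as (S1 & S3 & _). intros [HA|HA].
  - apply (gull_necessary_conditions a f gull1 (fun s => 4 + 15 / 2 * s) (fun s => - 1 - 3 / 2 * s)); auto.
    + apply gull_d.
    + intros s. sms.
    + lra.
    + intros y. unfold gull1. field.
    + sms.
    + lra.
  - apply (gull_necessary_conditions a f gull3 (fun s => 4 + 35 / 2 * s ^ 3) (fun s => - 1 - 5 / 2 * s ^ 3)); auto.
    + apply gull_d.
    + intros s. sms.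
    + lra.
    + intros y. unfold gull3. field.
    + sms.
    + lra.
Qed.

(** * The classification *)

Theorem theorem4p5 (f : R -> R -> R) (a : nat -> nat -> R)
    (hf : parabolic_monge_form a f) :
  let a30 := a 3%nat 0%nat in
  let a21 := a 2%nat 1%nat in
  let a40 := a 4%nat 0%nat in
  let phi := asymptotic_projection f in
  (a30 <> 0 /\ Q_D4 a > 0 <-> is_beaks phi) /\
  (a30 <> 0 /\ Q_D4 a < 0 <-> is_lips phi) /\
  (a30 <> 0 /\ Q_D4 a = 0 /\ Q_E7 a <> 0 <-> is_goose phi) /\
  (a30 = 0 /\ a21 * a40 <> 0 /\ R_A4 a <> 0 <-> is_gulls phi) /\
  (a30 <> 0 /\ Q_D4 a = 0 /\ Q_E7 a = 0 /\ Q_Estar a <> 0 <->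
     is_positive_ugly_goose phi \/ is_negative_ugly_goose phi) /\
  (a30 = 0 /\ a21 * a40 <> 0 /\ R_A4 a = 0 /\ R_A6 a <> 0 <->
     is_ugly_gulls phi).
Proof.
  intros a30 a21 a40 phi. subst a30 a21 a40. destruct (monge_facts a f hf) as (Sf & f0 & _).
  set (F := fun u v => f v u). assert (SF : sm2 F 0 0) by (unfold F; sms).
  assert (Sphi : smooth_map_germ phi).
  { apply smooth_map_germ_iff. split; [unfold phi; simpl; now rewrite f0|]. split; unfold c1, c2, phi; simpl; sms. }
  assert (HF : forall g h, (forall u v, g u v = h u v) -> A_equivalent phi (corank1 g) <-> A_equivalent (corank1 F) (corank1 h)).
  { intros g h E. pose proof (asymptotic_projection_corank1 f) as H. split; intros K.
    - apply A_equivalent_trans with phi; [now apply A_equivalent_sym|]. apply A_equivalent_trans with (corank1 g); auto. now apply A_equivalent_eq, locally_2d_forall.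
    - apply A_equivalent_trans with (corank1 F); auto. apply A_equivalent_trans with (corank1 h); auto. now apply A_equivalent_eq, locally_2d_forall. }
  assert (HG : forall g h, A_equivalent (corank1 g) (corank1 h) -> sm2 g 0 0 -> g 0 0 = 0 -> A_equivalent phi (corank1 g) <-> A_equivalent (corank1 F) (corank1 h)).
  { intros g h E Sg g0. rewrite (HF g g) by auto. split; intros K; eapply A_equivalent_trans; eauto. apply A_equivalent_sym; auto. now apply corank1_smooth. }
  assert (beaks : is_beaks phi <-> A_equivalent (corank1 F) (corank1 (cubic (fun u => -1 * u ^ 2)))) by (apply HF; intros; unfold cubic; ring).
  assert (lips : is_lips phi <-> A_equivalent (corank1 F) (corank1 (cubic (fun u => 1 * u ^ 2)))) by (apply HF; intros; unfold cubic; ring).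
  assert (goose : is_goose phi <-> A_equivalent (corank1 F) (corank1 (cubic (fun u => 1 * u ^ 3)))) by (apply HF; intros; unfold cubic; ring).
  assert (ugly_p : is_positive_ugly_goose phi <-> A_equivalent (corank1 F) (corank1 (cubic (fun u => 1 * u ^ 4)))) by (apply HF; intros; unfold cubic; ring).
  assert (ugly_n : is_negative_ugly_goose phi <-> A_equivalent (corank1 F) (corank1 (cubic (fun u => -1 * u ^ 4)))) by (apply HF; intros; unfold cubic; ring).
  assert (gulls : is_gulls phi <-> A_equivalent (corank1 F) (corank1 gull1)) by (apply HG; [apply gulls_normal_form|sms|ring]).
  assert (ugly_gulls : is_ugly_gulls phi <-> A_equivalent (corank1 F) (corank1 gull3)) by (apply HG; [apply ugly_gulls_normal_form|sms|ring]).
  assert (ord := fun l s => projection_cubic_order a f l s hf). assert (cases := projection_cubic_cases a f hf). cbv zeta in cases.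
  rewrite beaks, lips, goose, ugly_p, ugly_n, gulls, ugly_gulls. clear beaks lips goose ugly_p ugly_n gulls ugly_gulls HF HG.
  split; [|split; [|split; [|split; [|split]]]].
  - split.
    + intros [H Q]. now apply cases.
    + intros K. destruct (ord 2%nat (-1) ltac:(lia) ltac:(lra) K) as (H & Q & _). split; auto. specialize (Q eq_refl). lra.
  - split.
    + intros [H Q]. now apply cases.
    + intros K. destruct (ord 2%nat 1 ltac:(lia) ltac:(lra) K) as (H & Q & _). split; auto. specialize (Q eq_refl). lra.
  - split.
    + intros (H & Q & Q'). now apply cases.
    + intros K. destruct (ord 3%nat 1 ltac:(lia) ltac:(lra) K) as (H & _ & Q & _). split; auto.
  - split.
    + intros (H & H' & Q). apply projection_gull with a; auto; intros Z; apply H'; rewrite Z; ring.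
    + intros K. destruct (gull_conditions a f hf (or_introl K)) as [H H']. split; auto. split; auto.
      apply (projection_gull a f hf); auto; intros Z; apply H'; rewrite Z; ring.
  - split.
    + intros (H & Q & Q' & Q''). destruct (cases H) as (_ & _ & _ & C & _). destruct (C Q Q' Q'') as (s & Hs & K).
      assert (Z : (s - 1) * (s + 1) = 0) by lra. apply Rmult_integral in Z. destruct Z as [Z|Z].
      * left. replace 1 with s by lra. exact K.
      * right. replace (-1) with s by lra. exact K.
    + intros [K|K].
      * destruct (ord 4%nat 1 ltac:(lia) ltac:(lra) K) as (H & _ & _ & Q). split; auto.
      * destruct (ord 4%nat (-1) ltac:(lia) ltac:(lra) K) as (H & _ & _ & Q). split; auto.
  - split.
    + intros (H & H' & Q). apply projection_gull with a; auto; intros Z; apply H'; rewrite Z; ring.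
    + intros K. destruct (gull_conditions a f hf (or_intror K)) as [H H']. split; auto. split; auto.
      apply (projection_gull a f hf); auto; intros Z; apply H'; rewrite Z; ring.
Qed.
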